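(* Let $X_t$ be a strictly stable Lévy process with stability index $\alpha\in(0,2]$, positivity parameter $\varrho\in(0,1)$ and scale parameter $k>0$, and let $X^{\uparrow}_t=\sup\{X_s:s\in[0,t]\}$, $X^{\downarrow}_t=\inf\{X_s:s\in[0,t]\}$. Then for $t,\xi>0$, $$\mathbf{E}\exp(-\xi X^{\uparrow}_t)=\frac{\alpha}{\pi}\int_0^\infty\frac{u^{-(2-\alpha)\varrho}\sin(\varrho\pi)}{1+2u\cos(\varrho\pi)+u^2}\exp\left(I(u)+J(u)-\frac{k^\alpha t\,\xi^\alpha u^\alpha}{\cos((2\varrho-1)\frac{\alpha\pi}{2})}\right)du,$$ where $$I(u)=\frac1\pi\int_0^\infty\frac{\sin(\varrho\pi)}{1+2v\cos(\varrho\pi)+v^2}\,\log\frac{(v-u)\sqrt{u^2-2uv\cos(2\varrho\pi)+v^2}}{v^\alpha-u^\alpha}\,dv,$$ $$J(u)=\frac1\pi\int_0^\infty\frac{1+v\cos(\varrho\pi)}{1+2v\cos(\varrho\pi)+v^2}\,\frac1v\,\operatorname{Arg}\bigl(u-v\cos(2\varrho\pi)+iv\sin(2\varrho\pi)\bigr)\,dv.$$ A similar formula for $\mathbf{E}\exp(\xi X^{\downarrow}_t)$ is obtained by replacing $\varrho$ by $1-\varrho$ throughout.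
   Context: $\operatorname{Arg}$ is the principal argument. A strictly stable Lévy process with stability index $\alpha\in(0,2]$, positivity parameter $\varrho=\mathbf{P}(X_t>0)\in(0,1)$ and scale parameter $k>0$ is the Lévy process with $\mathbf{E}e^{i\xi X_t}=e^{-t\Psi(\xi)}$, where $\Psi(\xi)=a\xi^\alpha$ for $\xi>0$, $\Psi(\xi)=\bar a(-\xi)^\alpha$ for $\xi<0$, and $$a=k^\alpha\left(1-i\tan\bigl((2\varrho-1)\tfrac{\alpha\pi}{2}\bigr)\right).$$ The admissible range of $\varrho$ here is $\varrho\in(0,1)$ if $\alpha\in(0,1]$ and $\varrho\in[1-\frac1\alpha,\frac1\alpha]$ if $\alpha\in(1,2]$. *)

(* Defs.v *)
From HB Require Import structures.
From mathcomp Require Import all_boot all_order all_algebra.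
From mathcomp Require Import complex.
From mathcomp Require Import all_classical all_reals all_analysis.

Set Implicit Arguments.
Unset Strict Implicit.
Unset Printing Implicit Defensive.

Import Order.TTheory GRing.Theory Num.Theory.
Import numFieldNormedType.Exports.

Local Open Scope classical_set_scope.
Local Open Scope complex_scope.
Local Open Scope ring_scope.

Section ComplexFunctions.
Variable R : realType.

Definition cexp (z : R[i]) : R[i] :=
  (expR (complex.Re z) * cos (complex.Im z)) +i*
  (expR (complex.Re z) * sin (complex.Im z)).

(* The value at 0 is the junk value pi / 2; see [cArg_itv] and [cArg_polar]. *)
Definition cArg (z : R[i]) : R :=
  let: x +i* y := z in
  let theta := acos (x / Num.sqrt (x ^+ 2 + y ^+ 2)) in
  if 0 <= y then theta else - theta.

Lemma cArg_aux (x y : R) : x +i* y != 0 ->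
  let r := Num.sqrt (x ^+ 2 + y ^+ 2) in
  [/\ 0 < r, -1 <= x / r <= 1 & (y != 0 -> x / r < 1) /\ (y != 0 -> -1 < x / r)].
Proof.
move=> z0 r.
have xy0 : 0 < x ^+ 2 + y ^+ 2.
  rewrite lt_neqAle addr_ge0 ?sqr_ge0// andbT eq_sym paddr_eq0 ?sqr_ge0//.
  by rewrite !sqrf_eq0; apply: contra z0 => /andP[/eqP-> /eqP->].
have r0 : 0 < r by rewrite sqrtr_gt0.
have r2 : r ^+ 2 = x ^+ 2 + y ^+ 2 by rewrite sqr_sqrtr// ltW.
have xr : `|x| <= r.
  by rewrite -(@ler_pXn2r _ 2%N) ?nnegrE ?(ltW r0)// r2 real_normK ?num_real// lerDl sqr_ge0.
have xr' : y != 0 -> `|x| < r.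
  move=> y0; rewrite -(@ltr_pXn2r _ 2%N) ?nnegrE ?(ltW r0)// r2 real_normK ?num_real//.
  by rewrite ltrDl lt_neqAle sqr_ge0 andbT eq_sym sqrf_eq0.
split => //; first by rewrite ler_pdivlMr// ler_pdivrMr// mulN1r mul1r -ler_norml.
split => /xr'; rewrite ltr_norml => /andP[h1 h2].
  by rewrite ltr_pdivrMr// mul1r.
by rewrite ltr_pdivlMr// mulN1r.
Qed.

Lemma cArg_itv (z : R[i]) : z != 0 -> - pi < cArg z <= pi.
Proof.
case: z => x y z0; rewrite /cArg.
have [r0 h [h1 h2]] := cArg_aux z0.
have pi0 := @pi_gt0 R.
case: (leP 0 y) => y0.
  by rewrite acos_lepi// andbT (lt_le_trans _ (acos_ge0 h))// oppr_lt0.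
have {}y0 : y != 0 by rewrite lt_eqF.
rewrite ltrN2 acos_ltpi ?h2//=; last by case/andP: h.
by rewrite (le_trans _ (ltW pi0))// oppr_le0 acos_ge0.
Qed.

Lemma cArg_polar (z : R[i]) : z != 0 -> z = `|z| * cexp ('i%C * (cArg z)%:C).
Proof.
case: z => x y z0.
have [r0 h _] := cArg_aux z0.
set r := Num.sqrt _ in r0 h.
have r2 : r ^+ 2 = x ^+ 2 + y ^+ 2.
  by rewrite sqr_sqrtr// addr_ge0 ?sqr_ge0.
have rsin : r * sin (acos (x / r)) = `|y|.
  rewrite sin_acos// -{1}(ger0_norm (ltW r0)) -sqrtr_sqr -sqrtrM ?sqr_ge0//.
  rewrite -[RHS]sqrtr_sqr; congr Num.sqrt.
  rewrite mulrBr mulr1 expr_div_n mulrCA divff ?mulr1 ?expf_neq0 ?gt_eqF//.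
  by rewrite r2 addrAC subrr add0r.
have rcos : r * cos (acos (x / r)) = x.
  by rewrite acosK// mulrCA divff ?mulr1// gt_eqF.
rewrite normc_def /cexp /= -/r !(mul0r, mul1r, mulr0, add0r, addr0, subr0, oppr0).
rewrite expR0 !mul1r; simpc.
case: (leP 0 y) => y0; first by rewrite rcos rsin ger0_norm.
by rewrite cosN sinN mulrN rcos rsin ltr0_norm// opprK.
Qed.

End ComplexFunctions.

Section Levy.
Context d (T : measurableType d) (R : realType) (P : probability T R).

(* Meaningful when the real and imaginary parts of Z are P-integrable. *)
Definition cexpectation (Z : T -> R[i]) : R[i] :=
  fine ('E_P[fun w => complex.Re (Z w)])%E +i*
  fine ('E_P[fun w => complex.Im (Z w)])%E.

(* Taking some A i equal to setT gives the product rule for subfamilies. *)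
Definition mutually_independent n (Y : 'I_n -> T -> R) : Prop :=
  forall A : 'I_n -> set R, (forall i, measurable (A i)) ->
    P (\bigcap_(i in [set: 'I_n]) (Y i @^-1` A i)) =
    (\prod_(i < n) P (Y i @^-1` A i))%E.

Definition cadlag (f : R -> R) : Prop :=
  (forall t : R, 0 <= t -> f s @[s --> t^'+] --> f t) /\
  (forall t : R, 0 < t -> cvg (f s @[s --> t^'-])).

(* Only the variables X t with 0 <= t are constrained.  Continuity in
   probability follows from right-continuity and stationarity. *)
Record levy_process (X : R -> {RV P >-> R}) : Prop := LevyProcess {
  levy_start : {ae P, forall w, X 0 w = 0};
  levy_independent : forall (n : nat) (s : nat -> R),
    0 <= s 0%N -> (forall i, s i <= s i.+1) ->
    mutually_independent (fun (i : 'I_n) w => X (s i.+1) w - X (s i) w);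
  levy_stationary : forall s t : R, 0 <= s -> 0 <= t ->
    forall A : set R, measurable A ->
    P ((fun w => X (s + t) w - X s w) @^-1` A) = P (X t @^-1` A);
  levy_cadlag : {ae P, forall w, cadlag (fun t => X t w)} }.

Definition stable_admissible (alpha rho : R) : Prop :=
  [/\ 0 < alpha <= 2, 0 < rho < 1 &
      (1 < alpha -> 1 - alpha^-1 <= rho <= alpha^-1)].

Definition stable_coef (alpha rho k : R) : R[i] :=
  (k `^ alpha)%:C *
  (1 - 'i%C * (tan ((2 * rho - 1) * (alpha * pi / 2)))%:C).

Definition stable_exponent (alpha rho k xi : R) : R[i] :=
  if 0 < xi then stable_coef alpha rho k * (xi `^ alpha)%:C
  else if xi < 0 then conjc (stable_coef alpha rho k) * ((- xi) `^ alpha)%:C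
  else 0.

Record strictly_stable (alpha rho k : R) (X : R -> {RV P >-> R}) : Prop :=
  StrictlyStable {
  stable_levy : levy_process X;
  stable_range : stable_admissible alpha rho;
  stable_scale : 0 < k;
  stable_positivity : forall t : R, 0 < t -> P [set w | 0 < X t w] = rho%:E;
  stable_charfun : forall t xi : R, 0 <= t ->
    cexpectation (fun w => cexp ('i%C * xi%:C * (X t w)%:C)) =
    cexp (- (t%:C * stable_exponent alpha rho k xi)) }.

(* [sup] and [inf] are those of real sets; cadlag paths are bounded on [0, t]. *)
Definition running_sup (X : R -> {RV P >-> R}) (t : R) (w : T) : R :=
  sup [set X s w | s in `[0, t]].

Definition running_inf (X : R -> {RV P >-> R}) (t : R) (w : T) : R :=
  inf [set X s w | s in `[0, t]].

End Levy.

Section Formula.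
Variable R : realType.
Implicit Types alpha rho k t xi u v : R.

Notation mu := (@lebesgue_measure R).

Definition I_integrand alpha rho u v : R :=
  sin (rho * pi) / (1 + 2 * v * cos (rho * pi) + v ^+ 2) *
  ln ((v - u) * Num.sqrt (u ^+ 2 - 2 * u * v * cos (2 * rho * pi) + v ^+ 2) /
      (v `^ alpha - u `^ alpha)).

Definition I_term alpha rho u : R :=
  pi^-1 * \int[mu]_(v in `]0, +oo[) I_integrand alpha rho u v.

Definition J_integrand rho u v : R :=
  (1 + v * cos (rho * pi)) / (1 + 2 * v * cos (rho * pi) + v ^+ 2) * v^-1 *
  cArg ((u - v * cos (2 * rho * pi)) +i* (v * sin (2 * rho * pi))).

Definition J_term rho u : R :=
  pi^-1 * \int[mu]_(v in `]0, +oo[) J_integrand rho u v.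

Definition sup_integrand alpha rho k t xi u : R :=
  u `^ (- ((2 - alpha) * rho)) * sin (rho * pi) /
    (1 + 2 * u * cos (rho * pi) + u ^+ 2) *
  expR (I_term alpha rho u + J_term rho u -
        k `^ alpha * t * xi `^ alpha * u `^ alpha /
        cos ((2 * rho - 1) * (alpha * pi / 2))).

Definition sup_formula alpha rho k t xi : R :=
  alpha / pi * \int[mu]_(u in `]0, +oo[) sup_integrand alpha rho k t xi u.

(* [Rintegral] is total, so the existence of the integrals occurring in
   [sup_formula] has to be stated separately. *)
Definition sup_formula_converges alpha rho k t xi : Prop :=
  [/\ forall u, 0 < u ->
        mu.-integrable `]0, +oo[ (EFin \o I_integrand alpha rho u),
      forall u, 0 < u ->
        mu.-integrable `]0, +oo[ (EFin \o J_integrand rho u) &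
      mu.-integrable `]0, +oo[ (EFin \o sup_integrand alpha rho k t xi)].

End Formula.

(* Main.v *)
From HB Require Import structures.
Require Import Defs.
From mathcomp Require Import all_boot all_order all_algebra.
From mathcomp Require Import complex.
From mathcomp Require Import all_classical all_reals all_analysis.
From mathcomp Require Import measurable_realfun.
From mathcomp Require Import ring lra zify.
Set Implicit Arguments.
Unset Strict Implicit.
Unset Printing Implicit Defensive.
Import Order.TTheory GRing.Theory Num.Theory.
Import numFieldNormedType.Exports.
Local Open Scope classical_set_scope.
Local Open Scope ring_scope.

(* Write [M] for the supremum of [xi X] over [[0, t]].  Applied to the random
   walks [X (k t / 2^N)], Spitzer's identity gives the Laplace transform of
   [t |-> E exp (- M)] as
     [q int_0^oo exp (- q t) E exp (- M) dt
        = exp (- (1/pi) int_0^oo w(v) ln (1 + v^alpha / Q) dv)],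
   where [w(v) = sin (rho pi) / (1 + 2 v cos (rho pi) + v^2)], [Q = q / c] and
   [c = k^alpha xi^alpha / cos ((2 rho - 1) alpha pi / 2)], once
   [E (1 - exp (- (xi X_s)^+))] has been expressed through [w] by rotating the
   ray of integration in a Fourier integral.  The right-hand side extends
   holomorphically in [Q] to the plane cut along the negative axis; a Cauchy
   integral shows that it is a Stieltjes transform, that is, the Laplace
   transform of a mixture of the functions [exp (- c t u^alpha)], with a density
   given by its boundary values on the cut.  Another rotation turns the phase of
   these boundary values into [J].  Uniqueness of Laplace transforms concludes;
   the infimum is minus the supremum of [- X], for which [rho] becomes
   [1 - rho]. *)

(** * Differentiation and integration *)

(** Spitzer's identity involves only one-dimensional laws, so the process enters through E (1 - exp
    (- (xi X_s)^+)) alone; dyadic meshes make the discrete maxima monotone in the mesh. What is then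
    known in continuous time is the Laplace transform of a monotone limit, compared at a fixed time
    with a continuous mixture. Contour arguments are carried out on real functions: a function of r
    e^(iy) is a pair of real functions satisfying the polar Cauchy-Riemann equations, and the mean
    value theorem in y replaces Cauchy's theorem on a sector. The obstacle is that the target rays
    carry singularities, logarithmic or polar. Rotations stop short of them, and the limit is taken
    by dominated convergence, with inverse square roots as majorants of logarithms. The first
    rotation goes to the angle beta = (rho - 1/2) pi, where the exponent of the process is real. The
    pole i of the Fourier kernel is then seen from the ray at angle (1 - rho) pi, which is how rho
    enters w. In the Cauchy integral the pole at Q is cancelled by a multiple of z^(1/2), which
    vanishes at 0 and contributes an arctangent integral on the cut. *)

Section derivation_rules.
Context {R : realType}.
Implicit Types (f g : R -> R) (x a b c : R).

(* A plain constant, so that [apply] does not trigger the type-class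
   resolution attached to [is_derive]. *)
Definition isder x f a : Prop := is_derive x 1 f a.

Lemma der_eq f x a b : isder x f a -> a = b -> is_derive x 1 f b.
Proof. by move=> h <-. Qed.

Lemma isder_in f x a : is_derive x 1 f a -> isder x f a.
Proof. by []. Qed.

Lemma der_cst c x : isder x (fun=> c) 0.
Proof. exact: is_derive_cst. Qed.

Lemma der_id x : isder x (fun y => y) 1.
Proof. exact: is_derive_id. Qed.

Lemma derD f g x a b : isder x f a -> isder x g b -> isder x (fun y => f y + g y) (a + b).
Proof. by move=> h k; exact: (is_deriveD h k). Qed.

Lemma derN f x a : isder x f a -> isder x (fun y => - f y) (- a).
Proof. by move=> h; exact: (is_deriveN h). Qed.

Lemma derM f g x a b : isder x f a -> isder x g b ->
  isder x (fun y => f y * g y) (a * g x + f x * b).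
Proof.
move=> h k; apply: (der_eq (is_deriveM h k)).
by rewrite /GRing.scale/= addrC mulrC (mulrC a).
Qed.

Lemma derX f n x a : isder x f a -> isder x (fun y => f y ^+ n) (n%:R * f x ^+ n.-1 * a).
Proof.
move=> h; elim: n => [|n IH].
  by apply: (der_eq (der_cst 1 x)); rewrite !mul0r.
rewrite /isder; under eq_fun do rewrite exprS.
apply: (der_eq (derM h IH)) => /=.
case: n {IH} => [|n /=]; first by rewrite expr0; lra.
by rewrite !exprS -[n.+2%:R]natr1; ring.
Qed.

Lemma derV f x a : f x != 0 -> isder x f a -> isder x (fun y => (f y)^-1) (- a / f x ^+ 2).
Proof.
move=> f0 h; apply: (der_eq (is_deriveV f0 h)).
by rewrite /GRing.scale/= mulNr mulrC mulNr mulrC -mulNr.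
Qed.

Lemma der_comp f g x a b : is_derive (g x) 1 f a -> isder x g b ->
  isder x (fun y => f (g y)) (a * b).
Proof. exact: is_derive1_comp. Qed.

Lemma der_ln f x a : 0 < f x -> isder x f a -> isder x (fun y => ln (f y)) (a / f x).
Proof. by move=> f0 h; apply: (der_eq (der_comp (is_derive1_ln f0) h)); rewrite mulrC. Qed.

Lemma der_exp f x a : isder x f a -> isder x (fun y => expR (f y)) (expR (f x) * a).
Proof. by move=> h; exact: (der_comp (is_derive_expR _) h). Qed.

Lemma der_sin f x a : isder x f a -> isder x (fun y => sin (f y)) (cos (f x) * a).
Proof. by move=> h; exact: (der_comp (is_derive_sin _) h). Qed.

Lemma der_cos f x a : isder x f a -> isder x (fun y => cos (f y)) (- sin (f x) * a).
Proof. by move=> h; exact: (der_comp (is_derive_cos _) h). Qed.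

Lemma der_atan f x a : isder x f a -> isder x (fun y => atan (f y)) (a / (1 + f x ^+ 2)).
Proof. by move=> h; apply: (der_eq (der_comp (is_derive1_atan _) h)); rewrite mulrC. Qed.

Lemma der_sqrt f x a : 0 < f x -> isder x f a ->
  isder x (fun y => Num.sqrt (f y)) (a / (2 * Num.sqrt (f x))).
Proof. by move=> f0 h; apply: (der_eq (der_comp (is_derive1_sqrt f0) h)); rewrite mulrC. Qed.

Lemma der_pow f p x a : 0 < f x -> isder x f a ->
  isder x (fun y => f y `^ p) (p * f x `^ (p - 1) * a).
Proof. by move=> f0 h; exact: (der_comp (is_derive1_powR p f0) h). Qed.

Lemma der_cont f x a : isder x f a -> {for x, continuous f}.
Proof. by move=> h; apply: differentiable_continuous; apply/derivable1_diffP; case: h. Qed.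

Lemma cont_at_left f x a : {for x, continuous f} -> f x = a -> f y @[y --> x^'-] --> a.
Proof. by move=> fx <-; exact: cvg_at_left_filter. Qed.

Lemma cont_at_right f x a : {for x, continuous f} -> f x = a -> f y @[y --> x^'+] --> a.
Proof. by move=> fx <-; exact: cvg_at_right_filter. Qed.

End derivation_rules.

(** Syntax-directed differentiation. The derivative is an existential variable built along the way,
    so that [der] leaves the side conditions and one identity between the computed and the announced
    derivative. *)
Ltac der0 := lazymatch goal with
  | |- isder _ (fun y => y) _ => apply der_id
  | |- isder _ (fun _ => ?c) _ => apply (der_cst c)
  | |- isder _ (fun y => _ + _) _ => eapply derD
  | |- isder _ (fun y => - _) _ => eapply derN
  | |- isder _ (fun y => _ * _) _ => eapply derM
  | |- isder _ (fun y => _ ^+ _) _ => eapply derX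
  | |- isder _ (fun y => _ ^-1) _ => eapply derV
  | |- isder _ (fun y => ln _) _ => eapply der_ln
  | |- isder _ (fun y => expR _) _ => eapply der_exp
  | |- isder _ (fun y => sin _) _ => eapply der_sin
  | |- isder _ (fun y => cos _) _ => eapply der_cos
  | |- isder _ (fun y => atan _) _ => eapply der_atan
  | |- isder _ (fun y => Num.sqrt _) _ => eapply der_sqrt
  | |- isder _ (fun y => _ `^ _) _ => eapply der_pow
  end.
(* Unification may leave eta-contracted functions such as [*%R c]. *)
Ltac der1 := first [ der0 | lazymatch goal with
  | |- isder _ (fun _ => _) _ => fail
  | |- isder ?x ?f ?a => change (isder x (fun y => f y) a); der0
  end ].
Ltac der := eapply der_eq; [repeat der1|]; cbv beta.

(** Continuity is read off from differentiability: only the positivity and nonvanishing conditions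
    remain. *)
Ltac dcont := eapply der_cont; repeat der1; cbv beta.

Section measurability.
Context {R : realType} d (T : measurableType d).
Implicit Types (D : set T) (f g : T -> R).

Lemma measurable_invr : measurable_fun setT (fun x : R => x^-1).
Proof.
rewrite (_ : (fun x : R => x^-1) =
    fun x => if 0 <= x then x `^ (-1) else - ((- x) `^ (-1))); last first.
  apply/funext => x; case: (leP 0 x) => x0; first by rewrite powR_inv1.
  by rewrite powR_inv1 ?invrN ?opprK// oppr_ge0 ltW.
apply: measurable_fun_ifT; first exact: measurable_fun_ler.
  exact: measurable_powR.
apply: measurable_funN; apply: (measurableT_comp (measurable_powR _)).
exact: measurable_funN.
Qed.

Lemma mfunV D f : measurable_fun D f -> measurable_fun D (fun x => (f x)^-1).
Proof. exact: measurableT_comp measurable_invr. Qed.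

Lemma mfun_ln D f : measurable_fun D f -> measurable_fun D (fun x => ln (f x)).
Proof. exact: measurableT_comp (@measurable_ln R). Qed.

Lemma mfun_expR D f : measurable_fun D f -> measurable_fun D (fun x => expR (f x)).
Proof. exact: measurableT_comp (@measurable_expR R). Qed.

Lemma mfun_powR D f p : measurable_fun D f -> measurable_fun D (fun x => f x `^ p).
Proof. exact: measurableT_comp (measurable_powR p). Qed.

Lemma mfun_cont D f (h : R -> R) : continuous h -> measurable_fun D f ->
  measurable_fun D (fun x => h (f x)).
Proof. by move=> ch; apply: measurableT_comp; exact: continuous_measurable_fun. Qed.

Lemma mfun_sin D f : measurable_fun D f -> measurable_fun D (fun x => sin (f x)).
Proof. exact: mfun_cont (@continuous_sin R). Qed.

Lemma mfun_cos D f : measurable_fun D f -> measurable_fun D (fun x => cos (f x)).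
Proof. exact: mfun_cont (@continuous_cos R). Qed.

Lemma mfun_atan D f : measurable_fun D f -> measurable_fun D (fun x => atan (f x)).
Proof. exact: mfun_cont (@continuous_atan R). Qed.

Lemma mfun_sqrt D f : measurable_fun D f -> measurable_fun D (fun x => Num.sqrt (f x)).
Proof. exact: mfun_cont (@sqrt_continuous R). Qed.

Lemma mfun_norm D f : measurable_fun D f -> measurable_fun D (fun x => `|f x|).
Proof. exact: mfun_cont (@norm_continuous R _). Qed.

End measurability.

Ltac meas0 := lazymatch goal with
  | |- measurable_fun _ (fun _ => _ + _) => apply: measurable_funD
  | |- measurable_fun _ (fun _ => - _) => apply: measurable_funN
  | |- measurable_fun _ (fun _ => _ * _) => apply: measurable_funM
  | |- measurable_fun _ (fun _ => _ ^+ _) => apply: measurable_funX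
  | |- measurable_fun _ (fun _ => _ ^-1) => apply: mfunV
  | |- measurable_fun _ (fun _ => ln _) => apply: mfun_ln
  | |- measurable_fun _ (fun _ => expR _) => apply: mfun_expR
  | |- measurable_fun _ (fun _ => _ `^ _) => apply: mfun_powR
  | |- measurable_fun _ (fun _ => sin _) => apply: mfun_sin
  | |- measurable_fun _ (fun _ => cos _) => apply: mfun_cos
  | |- measurable_fun _ (fun _ => atan _) => apply: mfun_atan
  | |- measurable_fun _ (fun _ => Num.sqrt _) => apply: mfun_sqrt
  | |- measurable_fun _ (fun _ => `|_|) => apply: mfun_norm
  end.
Ltac meas1 := first [ meas0 | by [] | eassumption | lazymatch goal with
  | |- measurable_fun _ (fun _ => _) => fail
  | |- measurable_fun ?D ?f => change (measurable_fun D (fun x => f x)); meas0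
  end ].
Ltac meas := repeat meas1.

Section integration.
Context {R : realType}.
Notation mu := (@lebesgue_measure R).

Lemma Rdominated_cvg d (T : measurableType d) (m : {measure set T -> \bar R})
    (D : set T) (f_ : nat -> T -> R) (f g : T -> R) :
  measurable D -> (forall n, measurable_fun D (f_ n)) ->
  (forall x, D x -> f_ ^~ x @ \oo --> f x) ->
  m.-integrable D (EFin \o g) ->
  (forall n x, D x -> `|f_ n x| <= g x) ->
  m.-integrable D (EFin \o f) /\
  (\int[m]_(x in D) f_ n x) @[n --> \oo] --> \int[m]_(x in D) f x.
Proof.
move=> mD mf ff ig fg.
have mf' : measurable_fun D f by exact: (measurable_fun_cvg mf ff).
have [] := @dominated_convergence _ _ _ m D mD (fun n x => (f_ n x)%:E) (EFin \o f)
  (EFin \o g).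
- by move=> n; exact/measurable_EFinP.
- exact/measurable_EFinP.
- by apply: aeW => x Dx; apply: cvg_EFin; [exact: nearW|exact: ff].
- by [].
- by apply: aeW => x n Dx; rewrite lee_fin fg.
move=> intf _ h; split=> //.
apply: fine_cvg; rewrite fineK; last exact: integrable_fin_num.
exact: h.
Qed.

Lemma le_Rintegrable d (T : measurableType d) (m : {measure set T -> \bar R})
    (D : set T) (f g : T -> R) :
  measurable D -> measurable_fun D f -> (forall x, D x -> `|f x| <= g x) ->
  m.-integrable D (EFin \o g) -> m.-integrable D (EFin \o f).
Proof.
move=> mD mf fg; apply: le_integrable => //; first exact/measurable_EFinP.
by move=> x Dx; rewrite /= lee_fin (le_trans (fg x Dx)) // ler_norm.
Qed.

Lemma integrableM_cst d (T : measurableType d) (m : {measure set T -> \bar R})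
    (D : set T) (c : R) (f : T -> R) : measurable D ->
  m.-integrable D (EFin \o f) -> m.-integrable D (EFin \o (fun x => c * f x)).
Proof. by move=> mD h; have := integrableZl mD c h; apply: eq_integrable. Qed.

Lemma integrableDr d (T : measurableType d) (m : {measure set T -> \bar R})
    (D : set T) (f g : T -> R) : measurable D ->
  m.-integrable D (EFin \o f) -> m.-integrable D (EFin \o g) ->
  m.-integrable D (EFin \o (fun x => f x + g x)).
Proof. by move=> mD h k; have := integrableD mD h k; apply: eq_integrable. Qed.

Lemma integrableBr d (T : measurableType d) (m : {measure set T -> \bar R})
    (D : set T) (f g : T -> R) : measurable D ->
  m.-integrable D (EFin \o f) -> m.-integrable D (EFin \o g) ->
  m.-integrable D (EFin \o (fun x => f x - g x)).
Proof. by move=> mD h k; have := integrableB mD h k; apply: eq_integrable. Qed.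

Lemma integrable_mfun d (T : measurableType d) (m : {measure set T -> \bar R})
    (D : set T) (f : T -> R) :
  m.-integrable D (EFin \o f) -> measurable_fun D f.
Proof. by move=> /integrableP[/measurable_EFinP]. Qed.

Lemma eq_integrable_fun d (T : measurableType d) (m : {measure set T -> \bar R})
    (D : set T) (f g : T -> R) : measurable D -> (forall x, D x -> f x = g x) ->
  m.-integrable D (EFin \o f) -> m.-integrable D (EFin \o g).
Proof. by move=> mD fg; apply: eq_integrable => // x /set_mem/fg/= ->. Qed.

Lemma eq_Rint d (T : measurableType d) (m : {measure set T -> \bar R})
    (D : set T) (f g : T -> R) : (forall x, D x -> f x = g x) ->
  \int[m]_(x in D) f x = \int[m]_(x in D) g x.
Proof. by move=> fg; apply: eq_Rintegral => x /set_mem/fg. Qed.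

Lemma open_cont_mfun (D : set R) (f : R -> R) : open D ->
  (forall x, D x -> {for x, continuous f}) -> measurable_fun D f.
Proof. by move=> oD h; apply: open_continuous_measurable_fun => // x /set_mem/h. Qed.

(** Monotone convergence along compact intervals: for a nonnegative derivative, finite limits of the
    primitive give integrability and the value together. *)
Lemma ge0_FTC_exhaustion (D : set R) (s e : nat -> R) (f F : R -> R) (l0 l1 : R) :
  D = \bigcup_n `[s n, e n]%classic ->
  (forall n m, (n <= m)%N -> s m <= s n /\ e n <= e m) ->
  (forall n, s n < e n) ->
  open D ->
  (forall x, D x -> {for x, continuous f}) ->
  (forall x, D x -> isder x F (f x)) ->
  (forall x, D x -> 0 <= f x) ->
  F (s n) @[n --> \oo] --> l0 -> F (e n) @[n --> \oo] --> l1 ->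
  mu.-integrable D (EFin \o f) /\ \int[mu]_(x in D) f x = l1 - l0.
Proof.
move=> DE se slte oD cf dF f0 Fs Fe.
have mD : measurable D by exact: open_measurable.
have mf : measurable_fun D f by exact: open_cont_mfun.
have sub n : `[s n, e n]%classic `<=` D by rewrite DE => x h; exists n.
have int_n n : (\int[mu]_(x in `[s n, e n]) (f x)%:E = (F (e n) - F (s n))%:E)%E.
  rewrite EFinB; apply: continuous_FTC2 => //.
  - apply: continuous_in_subspaceT => x /set_mem/= xI; apply: cf; exact: (sub n).
  - have dI x : x \in `[s n, e n] -> isder x F (f x).
      by move=> xI; apply: dF; exact: (sub n).
    split.
    + by move=> x xI; case: (dI x (subset_itv_oo_cc xI)).
    + apply: cvg_at_right_filter; apply: (@der_cont _ _ _ (f (s n))).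
      by apply: dI; rewrite in_itv/= lexx ltW.
    + apply: cvg_at_left_filter; apply: (@der_cont _ _ _ (f (e n))).
      by apply: dI; rewrite in_itv/= lexx ltW.
  - move=> x xI; rewrite derive1E; apply: derive_val.
    by apply: dF; apply: (sub n); exact: (subset_itv_oo_cc xI).
have h : ((\int[mu]_(x in `[s n, e n]) (f x)%:E)%E @[n --> \oo] -->
    \int[mu]_(x in D) (f x)%:E)%E.
  rewrite DE; apply: ge0_nondecreasing_set_cvg_integral => //.
  - move=> n m nm; apply/subsetPset => x /=; rewrite !in_itv/= => /andP[a b].
    have [sm em] := se _ _ nm.
    by rewrite (le_trans sm a) (le_trans b em).
  - by move=> n; apply/measurable_EFinP; apply: measurable_funS mf => //; exact: sub.
  - by move=> n x xI; rewrite lee_fin; apply: f0; exact: (sub n).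
have intE : (\int[mu]_(x in D) (f x)%:E = (l1 - l0)%:E)%E.
  move: h; under eq_fun do rewrite int_n.
  move=> h; apply: (cvg_unique _ h) => //.
  by apply: cvg_EFin; [exact: nearW|exact: cvgB].
split; last by rewrite /Rintegral intE.
apply/integrableP; split; first exact/measurable_EFinP.
under eq_integral => x /set_mem/f0 fx do rewrite /= ger0_norm//.
by rewrite intE ltry.
Qed.

Lemma ge0_FTC_oo (a b l0 l1 : R) (f F : R -> R) : a < b ->
  (forall x, a < x < b -> {for x, continuous f}) ->
  (forall x, a < x < b -> isder x F (f x)) ->
  (forall x, a < x < b -> 0 <= f x) ->
  F x @[x --> a^'+] --> l0 -> F x @[x --> b^'-] --> l1 ->
  mu.-integrable `]a, b[ (EFin \o f) /\ \int[mu]_(x in `]a, b[) f x = l1 - l0.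
Proof.
move=> ab cf dF f0 Fa Fb.
(* Starting the denominators at 3 keeps the intervals from [a + d n] to [b - d n] nondegenerate for
   every [n]. *)
pose d n : R := (b - a) / n.+3%:R.
have ba0 : 0 < b - a by rewrite subr_gt0.
have d0 n : 0 < d n by rewrite divr_gt0.
have d3 n : d n <= (b - a) / 3.
  by rewrite ler_pM2l// lef_pV2 ?posrE// ler_nat.
have dmono n m : (n <= m)%N -> d m <= d n.
  by move=> nm; rewrite ler_pM2l// lef_pV2 ?posrE// ler_nat !ltnS.
have dcvg : d n @[n --> \oo] --> (0 : R).
  rewrite -(mulr0 (b - a)); apply: cvgM; first exact: cvg_cst.
  have := @cvg_harmonic R; rewrite -(cvg_shiftn 2).
  by under eq_fun do rewrite /harmonic addn2.
apply: (@ge0_FTC_exhaustion _ (fun n => a + d n) (fun n => b - d n) _ F) => //.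
- apply/seteqP; split=> x /=.
    rewrite in_itv/= => /andP[ax xb].
    have m0 : 0 < Num.min (x - a) (b - x) by rewrite lt_min !subr_gt0 ax.
    have /cvgrPdist_lt/(_ _ m0)[n _ /(_ n (leqnn n))] := dcvg.
    rewrite sub0r normrN gtr0_norm// lt_min => /andP[h1 h2].
    by exists n => //=; rewrite in_itv/=; apply/andP; split; lra.
  move=> [n _ /=]; rewrite !in_itv/= => /andP[h1 h2].
  by have := d0 n; apply: contraTT => h; apply: contraNN h => h; apply/andP; split; lra.
- by move=> n m /dmono ?; split; lra.
- by move=> n; have := d3 n; lra.
- move: Fa => /cvg_at_rightP; apply; split.
    by move=> n; rewrite ltrDl.
  by rewrite -[X in _ --> X]addr0; apply: cvgD => //; exact: cvg_cst.
- move: Fb => /cvg_at_leftP; apply; split.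
    by move=> n; rewrite gtrBl.
  by rewrite -[X in _ --> X]subr0; apply: cvgB => //; exact: cvg_cst.
Qed.

Lemma ge0_FTC_oy (a l0 l1 : R) (f F : R -> R) :
  (forall x, a < x -> {for x, continuous f}) ->
  (forall x, a < x -> isder x F (f x)) ->
  (forall x, a < x -> 0 <= f x) ->
  F x @[x --> a^'+] --> l0 -> F x @[x --> +oo] --> l1 ->
  mu.-integrable `]a, +oo[ (EFin \o f) /\ \int[mu]_(x in `]a, +oo[) f x = l1 - l0.
Proof.
move=> cf dF f0 Fa Fb.
pose d n : R := n.+1%:R^-1.
have d0 n : 0 < d n by rewrite invr_gt0.
have d1 n : d n <= 1 by rewrite invf_le1// ler1n.
have dcvg : d n @[n --> \oo] --> (0 : R) by exact: cvg_harmonic.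
apply: (@ge0_FTC_exhaustion _ (fun n => a + d n) (fun n => a + n.+2%:R) _ F) => //.
- apply/seteqP; split=> x /=.
    rewrite in_itv/= andbT => ax.
    have m0 : 0 < x - a by rewrite subr_gt0.
    have /cvgrPdist_lt/(_ _ m0)[n _ nP] := dcvg.
    have [k xk] : exists k : nat, x - a < k%:R.
      by exists (Num.truncn (x - a)).+1; rewrite truncnS_gt.
    exists (maxn n k) => //=; rewrite in_itv/=; apply/andP; split.
      have := nP (maxn n k) (leq_maxl _ _).
      by rewrite /= sub0r normrN gtr0_norm//; lra.
    have : k%:R <= (maxn n k).+2%:R :> R by rewrite ler_nat; lia.
    by move=> kk; lra.
  by move=> [n _ /=]; rewrite !in_itv/= andbT => /andP[h1 h2]; have := d0 n; lra.
- move=> n m nm; split.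
    by rewrite lerD2l lef_pV2 ?posrE// ler_nat.
  by rewrite lerD2l ler_nat !ltnS.
- move=> n; rewrite ltrD2l; apply: (le_lt_trans (d1 n)).
  by rewrite ltr1n.
- by move=> x /=; rewrite in_itv/= andbT => /cf.
- by move=> x /=; rewrite in_itv/= andbT => /dF.
- by move=> x /=; rewrite in_itv/= andbT => /f0.
- move: Fa => /cvg_at_rightP; apply; split.
    by move=> n; rewrite ltrDl.
  by rewrite -[X in _ --> X]addr0; apply: cvgD => //; exact: cvg_cst.
- move: Fb => /cvg_pinftyP; apply.
  apply/cvgryPge => A; near=> n.
  have h : A - a <= n%:R by near: n; exact: nbhs_infty_ger.
  by apply: (@le_trans _ _ (a + n%:R)); [lra|rewrite lerD2l ler_nat; lia].
Unshelve. all: by end_near. Qed.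

Lemma integrable_setUr d (T : measurableType d) (m : {measure set T -> \bar R})
    (A B : set T) (f : T -> R) : measurable A -> measurable B ->
  m.-integrable A (EFin \o f) -> m.-integrable B (EFin \o f) ->
  m.-integrable (A `|` B) (EFin \o f).
Proof.
move=> mA mB iA iB.
have mf : measurable_fun (A `|` B) (EFin \o f).
  by apply/(measurable_funU _ mA mB); split; [exact: measurable_int iA|exact: measurable_int iB].
apply/integrableP; split=> //.
have -> : A `|` B = A `|` (B `\` A) by rewrite setDE setUIr setUCr setIT.
have mBA : measurable (B `\` A) by exact: measurableD.
have iBA : m.-integrable (B `\` A) (EFin \o f) by apply: integrableS iB => //; exact: subDsetl.
rewrite ge0_integral_setU//=.
- by apply: lte_add_pinfty; [case/integrableP: iA|case/integrableP: iBA].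
- apply/(measurable_funU _ mA mBA); split; apply/measurable_EFinP; apply: measurableT_comp => //.
    exact: integrable_mfun iA.
  exact: integrable_mfun iBA.
- by apply/disj_setPS => x [Ax [_]].
Qed.

Lemma Rintegral_sum d (T : measurableType d) (m : {measure set T -> \bar R})
    (D : set T) (I : Type) (s : seq I) (f : I -> T -> R) : measurable D ->
  (forall i, m.-integrable D (EFin \o f i)) ->
  m.-integrable D (EFin \o (fun x => \sum_(i <- s) f i x)) /\
  \int[m]_(x in D) (\sum_(i <- s) f i x) = \sum_(i <- s) \int[m]_(x in D) f i x.
Proof.
move=> mD fi; elim: s => [|i s [IH1 IH2]].
  split; last first.
    rewrite big_nil; under eq_Rintegral do rewrite big_nil.
    by rewrite Rintegral_cst// mul0r.
  by under eq_fun do rewrite big_nil; exact: (integrable0 m D).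
have E x : \sum_(j <- i :: s) f j x = f i x + \sum_(j <- s) f j x by rewrite big_cons.
split.
  by apply: (eq_integrable_fun mD _ (integrableDr mD (fi i) IH1)) => x _; rewrite E.
under eq_Rintegral do rewrite E.
by rewrite RintegralD// IH2 big_cons.
Qed.

Lemma le_Lint (g : R -> R) (D : set R) (f : R -> R) :
  measurable D -> measurable_fun D f -> (forall x, D x -> `|f x| <= g x) ->
  mu.-integrable D (EFin \o g) -> mu.-integrable D (EFin \o f).
Proof. by move=> mD mf fg ig; exact: (@le_Rintegrable _ _ mu D f g mD mf fg ig). Qed.

Lemma eq_Lint (D : set R) (f g : R -> R) : measurable D ->
  (forall x, D x -> f x = g x) ->
  mu.-integrable D (EFin \o f) -> mu.-integrable D (EFin \o g).
Proof. by move=> mD fg fi; exact: (@eq_integrable_fun _ _ mu D f g mD fg fi). Qed.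

Lemma LintD (D : set R) (f g : R -> R) : measurable D ->
  mu.-integrable D (EFin \o f) -> mu.-integrable D (EFin \o g) ->
  mu.-integrable D (EFin \o (fun x => f x + g x)).
Proof. by move=> mD fi gi; exact: (@integrableDr _ _ mu D f g mD fi gi). Qed.

Lemma LintB (D : set R) (f g : R -> R) : measurable D ->
  mu.-integrable D (EFin \o f) -> mu.-integrable D (EFin \o g) ->
  mu.-integrable D (EFin \o (fun x => f x - g x)).
Proof. by move=> mD fi gi; exact: (@integrableBr _ _ mu D f g mD fi gi). Qed.

Lemma LintZ (D : set R) (c : R) (f : R -> R) : measurable D ->
  mu.-integrable D (EFin \o f) -> mu.-integrable D (EFin \o (fun x => c * f x)).
Proof. by move=> mD fi; exact: (@integrableM_cst _ _ mu D c f mD fi). Qed.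

Lemma eq_Lintegral (D : set R) (f g : R -> R) : (forall x, D x -> f x = g x) ->
  \int[mu]_(x in D) f x = \int[mu]_(x in D) g x.
Proof. exact: (@eq_Rint _ _ mu D f g). Qed.

Lemma LintegralD (D : set R) (f g : R -> R) : measurable D ->
  mu.-integrable D (EFin \o f) -> mu.-integrable D (EFin \o g) ->
  \int[mu]_(x in D) (f x + g x) = \int[mu]_(x in D) f x + \int[mu]_(x in D) g x.
Proof. by move=> mD fi gi; exact: (@RintegralD _ _ _ mu D f g mD fi gi). Qed.

Lemma LintegralB (D : set R) (f g : R -> R) : measurable D ->
  mu.-integrable D (EFin \o f) -> mu.-integrable D (EFin \o g) ->
  \int[mu]_(x in D) (f x - g x) = \int[mu]_(x in D) f x - \int[mu]_(x in D) g x.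
Proof. by move=> mD fi gi; exact: (@RintegralB _ _ _ mu D f g mD fi gi). Qed.

Lemma LintegralZ (D : set R) (c : R) (f : R -> R) : measurable D ->
  mu.-integrable D (EFin \o f) ->
  \int[mu]_(x in D) (c * f x) = c * \int[mu]_(x in D) f x.
Proof. by move=> mD fi; exact: (@RintegralZl _ _ _ mu D f c mD fi). Qed.

Lemma mfunS (D : set R) (f : R -> R) : measurable_fun setT f -> measurable_fun D f.
Proof. exact: measurable_funS measurableT (subsetT _). Qed.

Lemma ler_Lint (D : set R) (f g : R -> R) : measurable D ->
  mu.-integrable D (EFin \o f) -> mu.-integrable D (EFin \o g) ->
  (forall x, D x -> f x <= g x) -> \int[mu]_(x in D) f x <= \int[mu]_(x in D) g x.
Proof. by move=> mD fi gi fg; exact: (@le_Rintegral _ _ _ mu D f g mD fi gi fg). Qed.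

Lemma Ldominated_cvg (g : R -> R) (D : set R) (f_ : nat -> R -> R) (f : R -> R) :
  measurable D -> (forall n, measurable_fun D (f_ n)) ->
  (forall x, D x -> f_ ^~ x @ \oo --> f x) ->
  mu.-integrable D (EFin \o g) ->
  (forall n x, D x -> `|f_ n x| <= g x) ->
  mu.-integrable D (EFin \o f) /\
  (\int[mu]_(x in D) f_ n x) @[n --> \oo] --> \int[mu]_(x in D) f x.
Proof.
by move=> mD mf ff ig fg; exact: (@Rdominated_cvg _ _ mu D f_ f g mD mf ff ig fg).
Qed.

Lemma integrable_restr (I D : set R) (f : R -> R) : measurable I -> measurable D ->
  I `<=` D -> mu.-integrable I (EFin \o f) ->
  mu.-integrable D (EFin \o (f \_ I)) /\
  \int[mu]_(x in D) (f \_ I) x = \int[mu]_(x in I) f x.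
Proof.
move=> mI mD ID fi; split.
  rewrite -restrict_EFin; apply/(integrable_restrict mu mI) => //.
  by rewrite (setIidr ID).
by rewrite -[in RHS](setIidr ID) Rintegral_mkcondr.
Qed.

End integration.

Section fubini_real.
Context {R : realType} d1 d2 {T1 : measurableType d1} {T2 : measurableType d2}.
Variables (m1 : {sigma_finite_measure set T1 -> \bar R})
  (m2 : {sigma_finite_measure set T2 -> \bar R}).

(** The bound [b] on the inner integrals of [|f|] gives, by Tonelli applied to the extension of [f]
    by zero, integrability on the product; Fubini then applies to that extension. *)
Lemma Rfubini (D1 : set T1) (D2 : set T2) (f : T1 -> T2 -> R) (b : T2 -> R) :
  measurable D1 -> measurable D2 ->
  measurable_fun (D1 `*` D2) (fun p => f p.1 p.2) ->
  (forall x, D1 x -> m2.-integrable D2 (EFin \o f x)) ->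
  (forall y, D2 y -> m1.-integrable D1 (EFin \o f ^~ y)) ->
  (forall y, D2 y -> \int[m1]_(x in D1) `|f x y| <= b y) ->
  m2.-integrable D2 (EFin \o b) ->
  [/\ m1.-integrable D1 (EFin \o (fun x => \int[m2]_(y in D2) f x y)),
      m2.-integrable D2 (EFin \o (fun y => \int[m1]_(x in D1) f x y)) &
   \int[m1]_(x in D1) \int[m2]_(y in D2) f x y =
   \int[m2]_(y in D2) \int[m1]_(x in D1) f x y].
Proof.
move=> mD1 mD2 mf i2 i1 fb ib.
pose g : T1 * T2 -> \bar R := EFin \o ((fun p => f p.1 p.2) \_ (D1 `*` D2)).
have mD12 : measurable (D1 `*` D2) by exact: measurableX.
have mg : measurable_fun setT g.
  by apply/measurable_EFinP; apply/(measurable_restrictT _ mD12).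
have gE x y : (g (x, y) = ((fun y => (f x y)%:E) \_ D2) y * (\1_D1 x)%:E)%E.
  rewrite /g /= !patchE in_setX/= indicE.
  by case: (x \in D1); case: (y \in D2); rewrite ?mule1 ?mule0.
have gE' x y : (g (x, y) = ((fun x => (f x y)%:E) \_ D1) x * (\1_D2 y)%:E)%E.
  rewrite /g /= !patchE in_setX/= indicE.
  by case: (x \in D1); case: (y \in D2); rewrite ?mule1 ?mule0.
pose I2 x := \int[m2]_(y in D2) f x y; pose I1 y := \int[m1]_(x in D1) f x y.
have inner2 x : (\int[m2]_y g (x, y) = (EFin \o (I2 \_ D1)) x)%E.
  rewrite /= patchE; case: ifPn => xD1.
    rewrite fineK; last by apply: integrable_fin_num => //; apply: i2; exact: set_mem.
    rewrite [RHS]integral_mkcond; apply: eq_integral => y _.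
    by rewrite gE indicE xD1 mule1.
  by apply: integral0_eq => y _; rewrite gE indicE (negPf xD1) mule0.
have inner1 y : (\int[m1]_x g (x, y) = (EFin \o (I1 \_ D2)) y)%E.
  rewrite /= patchE; case: ifPn => yD2.
    rewrite fineK; last by apply: integrable_fin_num => //; apply: i1; exact: set_mem.
    rewrite [RHS]integral_mkcond; apply: eq_integral => x _.
    by rewrite gE' indicE yD2 mule1.
  by apply: integral0_eq => x _; rewrite gE' indicE (negPf yD2) mule0.
have ig : (m1 \x m2)%E.-integrable setT g.
  apply/(integrable21ltyP m1 m2 mg).
  apply: (@le_lt_trans _ _ (\int[m2]_(y in D2) (b y)%:E)%E); last first.
    have /integrable_lty := ib.
    by apply.
  rewrite [leRHS]integral_mkcond.
  apply: ge0_le_integral => //.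
  - by move=> y _; apply: integral_ge0.
  - apply: (@measurable_fun_fubini_tonelli_G _ _ _ _ _ m1 (fun p => `|g p|%E)) => //.
    by apply: measurableT_comp.
  - by move: (ib) => /(integrable_mfun (D := D2)) mb; apply/(measurable_restrictT _ mD2);
      exact/measurable_EFinP.
  - move=> y _; rewrite patchE; case: ifPn => yD2.
      rewrite [leLHS](_ : _ = (\int[m1]_(x in D1) `|f x y|)%:E) ?lee_fin; first by apply: fb; exact: set_mem.
      rewrite fineK; last first.
        by apply: integrable_fin_num => //; apply: integrable_norm; apply: i1; exact: set_mem.
      rewrite [RHS]integral_mkcond; apply: eq_integral => x _.
      by rewrite gE' indicE yD2 mule1 !patchE; case: ifPn => //; rewrite abse0.
    by rewrite integral0_eq// => x _; rewrite gE' indicE (negPf yD2) mule0 abse0.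
split.
- apply/(integrable_mkcond _ mD1).
  have := integrable_fubini_F ig.
  rewrite /fubini_F; under eq_fun do rewrite inner2.
  by rewrite restrict_EFin.
- have mI1 : measurable_fun D2 I1.
    have := measurable_fubini_G ig.
    rewrite /fubini_G; under eq_fun do rewrite inner1.
    by move=> /measurable_EFinP/(measurable_restrictT _ mD2).
  apply: (le_Rintegrable mD2 mI1 _ ib) => y Dy.
  apply: le_trans (fb y Dy); apply: le_normr_Rintegral => //; exact: i1.
- have := Fubini ig.
  under eq_integral do rewrite inner2; under [in RHS]eq_integral do rewrite inner1.
  move=> h; rewrite (Rintegral_mkcond m1) (Rintegral_mkcond m2) /Rintegral.
  by congr fine.
Qed.

End fubini_real.

(** * Powers as majorants *)

Section power_domination.
Context {R : realType}.
Notation mu := (@lebesgue_measure R).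

Lemma cont_powR (p x : R) : 0 < x -> {for x, continuous (fun y : R => y `^ p)}.
Proof. by move=> x0; exact: (der_cont (is_derive1_powR p x0)). Qed.

Lemma integrable_powR01 (a : R) : 0 < a ->
  mu.-integrable `]0, 1[ (EFin \o (fun v : R => v `^ (a - 1))).
Proof.
move=> a0.
suff [] : mu.-integrable `]0, 1[ (EFin \o (fun v : R => v `^ (a - 1))) /\
   \int[mu]_(v in `]0, 1[) v `^ (a - 1) = a^-1 - 0 by [].
apply: (@ge0_FTC_oo _ 0 1 0 a^-1 _ (fun v => v `^ a / a)) => //.
- by move=> x /andP[x0 _]; exact: cont_powR.
- move=> x /andP[x0 _]; der => //.
  by rewrite mulr0 addr0 mulr1 mulrC mulKf ?gt_eqF.
- by move=> x _; exact: powR_ge0.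
- rewrite -[X in _ --> X](mul0r a^-1); apply: cvgM; last exact: cvg_cst.
  exact: powR_cvg0.
- apply: cont_at_left; last by rewrite powR1 mul1r.
  by dcont.
Qed.

Lemma cvgy_powRN (b : R) : 0 < b -> x `^ (- b) @[x --> +oo] --> (0 : R).
Proof.
move=> b0; apply/cvgr0Pnorm_le => e e0; near=> v.
pose A := e `^ (- b^-1).
have A0 : 0 < A by exact: powR_gt0.
have Av : A <= v by near: v; apply: nbhs_pinfty_ge; exact: num_real.
have v0 : 0 < v by exact: lt_le_trans Av.
rewrite ger0_norm ?powR_ge0// powRN invf_ple ?posrE ?powR_gt0//.
have -> : e^-1 = A `^ b.
  by rewrite /A -powRrM mulNr mulVf ?gt_eqF// powRN powRr1 ?ltW.
by rewrite ge0_ler_powR// ?nnegrE ltW// (lt_le_trans A0).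
Unshelve. all: by end_near. Qed.

Lemma integrable_powR1y (b : R) : 0 < b ->
  mu.-integrable `]1, +oo[ (EFin \o (fun v : R => v `^ (- b - 1))).
Proof.
move=> b0.
suff [] : mu.-integrable `]1, +oo[ (EFin \o (fun v : R => v `^ (- b - 1))) /\
   \int[mu]_(v in `]1, +oo[) v `^ (- b - 1) = 0 - (- b^-1) by [].
have x0 x : 1 < x -> (0 : R) < x by move=> /(lt_trans ltr01).
apply: (@ge0_FTC_oy _ 1 (- b^-1) 0 _ (fun v => v `^ (- b) * - b^-1)) => //.
- by move=> x /x0 ?; exact: cont_powR.
- move=> x /x0 ?; der => //.
  by rewrite mulr0 addr0 mulr1; field; rewrite gt_eqF.
- by move=> x _; exact: powR_ge0.
- apply: cont_at_right; last by rewrite powR1 mul1r.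
  by dcont.
- rewrite -[X in _ --> X](mul0r (- b^-1)); apply: cvgM; last exact: cvg_cst.
  exact: cvgy_powRN.
Qed.

Lemma integrable_cby (a : R) (f : R -> R) : mu.-integrable `]a, +oo[ (EFin \o f) ->
  mu.-integrable `[a, +oo[ (EFin \o f).
Proof.
move=> h; have -> : `[a, +oo[%classic = [set a] `|` `]a, +oo[%classic by rewrite setU1itv.
apply: integrable_setUr => //; apply/integrableP; split.
  exact: measurable_fun_set1.
by rewrite integral_set1.
Qed.

(** A majorant with independent behaviour at the two ends: against dv / v it is [v^a] near 0 and
    [v^-b] near infinity. *)
Definition bump (a b v : R) := if v < 1 then v `^ (a - 1) else v `^ (- b - 1).

Lemma bump_ge0 a b v : 0 <= bump a b v.
Proof. by rewrite /bump; case: ifP; rewrite powR_ge0. Qed.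

Lemma integrable_bump (a b : R) : 0 < a -> 0 < b ->
  mu.-integrable `]0, +oo[ (EFin \o bump a b).
Proof.
move=> a0 b0.
have E : `]0, +oo[%classic = `]0, 1[%classic `|` `[1, +oo[%classic :> set R.
  by rewrite -itv_bndbnd_setU// bnd_simp.
rewrite E; apply: integrable_setUr => //.
  apply: (eq_integrable_fun _ _ (integrable_powR01 a0)) => // v.
  by rewrite /= in_itv/= /bump => /andP[_ ->].
apply/integrable_cby.
apply: (eq_integrable_fun _ _ (integrable_powR1y b0)) => // v.
by rewrite /= in_itv/= andbT /bump => v1; rewrite ltNge (ltW v1).
Qed.
End power_domination.

(** * Uniqueness of Laplace transforms *)

Section laplace_uniqueness.
Context {R : realType}.
Notation mu := (@lebesgue_measure R).

Lemma integrable_expN (c : R) : 0 < c ->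
  mu.-integrable `]0, +oo[ (EFin \o (fun t : R => expR (- (c * t)))) /\
  \int[mu]_(t in `]0, +oo[) expR (- (c * t)) = c^-1.
Proof.
move=> c0; rewrite -[X in _ /\ _ = X]add0r -[X in _ /\ _ = _ + X]opprK.
have d (x : R) : isder x (fun t => - c^-1 * expR (- (c * t))) (expR (- (c * x))).
  by der; field; rewrite gt_eqF.
apply: (@ge0_FTC_oy _ 0 (- c^-1) 0 _ (fun t => - c^-1 * expR (- (c * t)))) => //.
- move=> x _; dcont.
- apply: cont_at_right (der_cont (d 0)) _.
  by rewrite mulr0 oppr0 expR0 mulr1.
- rewrite -[X in _ --> X](mulr0 (- c^-1)); apply: cvgM; first exact: cvg_cst.
  apply/cvgr0Pnorm_le => e e0; near=> x.
  rewrite ger0_norm ?expR_ge0// -[leRHS]lnK ?posrE// ler_expR lerNl -ler_pdivrMl//.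
Unshelve. all: by end_near. Qed.

(** The extra factor [expR (- t)] raises every exponent of the polynomial to at least 1, so that
    each monomial falls under the hypothesis. *)
Lemma laplace_poly (D : R -> R) (M : R) (p : {poly R}) :
  measurable_fun (`]0, +oo[%classic : set R) D ->
  (forall t, 0 < t -> `|D t| <= M) ->
  (forall n, \int[mu]_(t in `]0, +oo[) (D t * expR (- (n.+1%:R * t))) = 0) ->
  \int[mu]_(t in `]0, +oo[) (D t * (p.[expR (- t)] * expR (- t))) = 0.
Proof.
move=> mD DM D0.
have intD n : mu.-integrable `]0, +oo[ (EFin \o (fun t => D t * expR (- (n.+1%:R * t)))).
  have [i _] := @integrable_expN n.+1%:R (ltr0Sn _ _).
  apply: (@le_Lint _ (fun t => M * expR (- (n.+1%:R * t)))) => //.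
  - by apply: measurable_funM => //; exact: integrable_mfun i.
  - move=> x; rewrite /= in_itv/= andbT => x0.
    by rewrite normrM (ger0_norm (expR_ge0 _)) ler_pM2r ?expR_gt0// DM.
  - exact: integrableM_cst.
have E t : D t * (p.[expR (- t)] * expR (- t)) =
    \sum_(i < size p) p`_i * (D t * expR (- (i.+1%:R * t))).
  rewrite horner_coef mulr_suml mulr_sumr; apply: eq_bigr => i _.
  by rewrite -mulrN expRM_natl exprS; ring.
under eq_Rintegral do rewrite E.
have iM (i : 'I_(size p)) : mu.-integrable `]0, +oo[
    (EFin \o (fun t => p`_i * (D t * expR (- (i.+1%:R * t))))).
  by apply: integrableM_cst.
have [_ ->] := @Rintegral_sum _ _ _ mu _ _ (index_enum 'I_(size p))
  (fun i t => p`_i * (D t * expR (- (i.+1%:R * t)))) (measurable_itv `]0, +oo[) iM.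
by apply: big1 => i _; rewrite RintegralZl// D0 mulr0.
Qed.

Let lin_lower1 (M D k q : R) : 0 <= M -> - M <= D -> 0 <= k -> k <= q ->
  - (M * q) <= D * k.
Proof. by move=> *; nra. Qed.

Let lin_lower2 (e D k q m : R) : 0 < e -> e <= D -> 0 <= q -> q <= k -> 0 <= m ->
  e * q - m <= D * k.
Proof. by move=> *; nra. Qed.

(* Landau kernel: with [x = expR (- t)] and [x0] inside the interval, the
   polynomials [(1 - (x - x0) ^+ 2) ^+ N] concentrate at [x0]. *)
Lemma laplace_no_interval (D : R -> R) (M eps a b : R) :
  measurable_fun (`]0, +oo[%classic : set R) D ->
  (forall t, 0 < t -> `|D t| <= M) ->
  (forall n, \int[mu]_(t in `]0, +oo[) (D t * expR (- (n.+1%:R * t))) = 0) ->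
  0 <= a -> a < b -> 0 < eps -> (forall t, a < t < b -> eps <= D t) -> False.
Proof.
move=> mD DM D0 a0 ab eps0 De.
pose x0 : R := expR (- ((a + b) / 2)).
have h1 : 0 < x0 by exact: expR_gt0.
have h2 : expR (- b) < x0 by rewrite ltr_expR; lra.
have h3 : x0 < expR (- a) by rewrite ltr_expR; lra.
have h4 : expR (- a) <= 1 by rewrite -expR0 ler_expR; lra.
have h5 : 0 < expR (- b) by exact: expR_gt0.
(* In the variable exp (- t), the complement of the interval from [a] to [b] is at distance at least
   [dl] from [x0], while the interval from [a'] to [b'] below is the part within [dl / 2]. *)
pose dl := Num.min (expR (- a) - x0) (x0 - expR (- b)).
have dl0 : 0 < dl by rewrite lt_min !subr_gt0 h3.
have dl1 : dl <= expR (- a) - x0 by rewrite ge_min lexx.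
have dl2 : dl <= x0 - expR (- b) by rewrite ge_min lexx orbT.
clearbody dl; clearbody x0.
have p1 : 0 < x0 - dl / 2 by lra.
have p2 : 0 < x0 + dl / 2 by lra.
have [a' a'E] : exists a' : R, expR (- a') = x0 + dl / 2.
  by exists (- ln (x0 + dl / 2)); rewrite opprK lnK.
have [b' b'E] : exists b' : R, expR (- b') = x0 - dl / 2.
  by exists (- ln (x0 - dl / 2)); rewrite opprK lnK.
have a'b' : a' < b' by rewrite -ltrN2 -ltr_expR a'E b'E; lra.
have aa' : a < a' by rewrite -ltrN2 -ltr_expR a'E; lra.
have b'b : b' < b by rewrite -ltrN2 -ltr_expR b'E; lra.
(* The base of the kernel is at least [q1] on the inner interval and at most [q2] outside the outer
   one. Since [q2 < q1], the powers separate geometrically. *)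
have [q1 q1E] : exists q1 : R, q1 = 1 - (dl / 2) ^+ 2 by eexists.
have [q2 q2E] : exists q2 : R, q2 = 1 - dl ^+ 2 by eexists.
have q20 : 0 < q2 by rewrite q2E; nra.
have q12 : q2 < q1 by rewrite q1E q2E; nra.
have q10 := lt_trans q20 q12.
have x01 : x0 < 1 := lt_le_trans h3 h4.
have [i1 e1] := @integrable_expN 1 ltr01.
have mE : measurable_fun (`]0, +oo[%classic : set R) (fun t : R => expR (- t)).
  apply: measurable_funS (measurableT) (subsetT _) _.
  by apply: measurableT_comp => //.
have M0 : 0 <= M.
  by apply: le_trans (DM 1 ltr01).
have [c cE] : exists c : R, c = \int[mu]_(t in `]a', b'[) expR (- t) by eexists.
have p3 : 0 <= a' := le_trans a0 (ltW aa').
have [ic ec] : mu.-integrable `]a', b'[ (EFin \o (fun t : R => expR (- t))) /\ 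
    c = - expR (- b') - - expR (- a').
  have d (x : R) : isder x (fun t => - expR (- t)) (expR (- x)).
    by der; ring.
  rewrite cE; apply: (@ge0_FTC_oo _ a' b' (- expR (- a')) (- expR (- b')) _ (fun t => - expR (- t))) => //.
  - by move=> x _; dcont.
  - exact: cont_at_right (der_cont (d _)) _.
  - exact: cont_at_left (der_cont (d _)) _.
have c0 : 0 < c.
  have : expR (- b') < expR (- a') by rewrite ltr_expR ltrN2.
  by rewrite ec opprK addrC subr_gt0.
have key N : eps * q1 ^+ N * c <= M * q2 ^+ N.
  pose p : {poly R} := (1 - ('X - x0%:P) ^+ 2) ^+ N.
  have pE x : p.[x] = (1 - (x - x0) ^+ 2) ^+ N.
    by rewrite /p horner_exp !hornerE.
  have := laplace_poly p mD DM D0.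
  (* [h] bounds the integrand from below: a gain of order [q1 ^+ N] on the inner interval, and a
     loss of at most [M * q2 ^+ N] anywhere. *)
  pose h t := eps * q1 ^+ N * (expR (- t) * \1_(`]a', b'[%classic) t) - M * q2 ^+ N * expR (- (1 * t)).
  have sub : `]a', b'[%classic `<=` `]0, +oo[%classic.
    by move=> t /=; rewrite !in_itv/= andbT => /andP[t1 _]; exact: le_lt_trans t1.
  have iI : mu.-integrable `]0, +oo[ (EFin \o (fun t => expR (- t) * \1_(`]a', b'[%classic) t)).
    apply: (@le_Lint _ (fun t => expR (- (1 * t)))) => //.
      by apply: measurable_funM => //; exact: measurable_indic.
    move=> t _; rewrite mul1r ger0_norm ?mulr_ge0 ?expR_ge0// indicE ler_piMr ?expR_ge0//.
    by case: (_ \in _); rewrite ?ler01.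
  have eI : \int[mu]_(t in `]0, +oo[) (expR (- t) * \1_(`]a', b'[%classic) t) = c.
    rewrite cE -[in RHS](setIidr sub) Rintegral_mkcondr; apply: eq_Rint => t _.
    by rewrite patchE indicE; case: ifP => _; rewrite ?mulr1 ?mulr0.
  have ih : mu.-integrable `]0, +oo[ (EFin \o h).
    by apply: integrableBr => //; exact: integrableM_cst.
  have xin t : 0 < t -> 0 <= 1 - (expR (- t) - x0) ^+ 2 <= 1.
    move=> t0; have e0 := expR_gt0 (- t).
    have e2 : expR (- t) < 1 by rewrite -[ltRHS]expR0 ltr_expR oppr_lt0.
    have h7 : 0 <= (1 - (expR (- t) - x0)) * (1 + (expR (- t) - x0)) by apply: mulr_ge0; clear - h1 x01 e0 e2; lra.
    have h8 := sqr_ge0 (expR (- t) - x0).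
    have h9 : (1 - (expR (- t) - x0)) * (1 + (expR (- t) - x0)) = 1 - (expR (- t) - x0) ^+ 2 by ring.
    by rewrite -h9 h7/= h9 gerBl.
  have ip : mu.-integrable `]0, +oo[ (EFin \o (fun t => D t * (p.[expR (- t)] * expR (- t)))).
    apply: (@le_Lint _ (fun t => M * expR (- (1 * t)))) => //.
    - apply: measurable_funM => //; apply: measurable_funM => //.
      rewrite (_ : (fun x => p.[expR (- x)]) = fun x => (1 - (expR (- x) - x0) ^+ 2) ^+ N); last first.
        by apply/funext => x; rewrite pE.
      by apply: measurable_funX; apply: measurable_funB => //; apply: measurable_funX;
        apply: measurable_funB.
    - move=> t; rewrite /= in_itv/= andbT => t0.
      rewrite normrM ler_pM// ?DM// normrM mul1r (ger0_norm (expR_ge0 _)) ler_piMl ?expR_ge0//.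
      have /andP[k1 k2] := xin t t0.
      by rewrite pE normrX ger0_norm// exprn_ile1.
    - exact: integrableM_cst.
  move=> p0; have : \int[mu]_(t in `]0, +oo[) h t <= 0.
    rewrite -[leRHS]p0; apply: ler_Lint => // t; rewrite /= in_itv/= andbT => t0.
    have -> : h t = (eps * q1 ^+ N * \1_(`]a', b'[%classic) t - M * q2 ^+ N) * expR (- t).
      by rewrite /h mul1r; ring.
    rewrite mulrA ler_pM2r ?expR_gt0// indicE.
    have q1N : 0 <= q1 ^+ N := exprn_ge0 N (ltW q10).
    have q2N : 0 <= M * q2 ^+ N := mulr_ge0 M0 (exprn_ge0 N (ltW q20)).
    have /andP[k1 k2] := xin t t0.
    rewrite pE; case: (boolP (a < t < b)) => tab; last first.
      have -> : (t \in `]a', b'[%classic) = false.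
        apply: contraNF tab => /set_mem/=; rewrite in_itv/= => /andP[t1 t2].
        by rewrite (lt_trans aa' t1) (lt_trans t2 b'b).
      rewrite mulr0 sub0r; have /ler_normlP[DN _] := DM t t0.
      have : (1 - (expR (- t) - x0) ^+ 2) ^+ N <= q2 ^+ N.
        rewrite lerXn2r ?nnegrE ?(ltW q20)//.
        have : dl <= `|expR (- t) - x0|.
          move: tab; rewrite negb_and -!leNgt => /orP[ta|bt].
            have : expR (- a) <= expR (- t) by rewrite ler_expR lerN2.
            by move=> u; have v := ler_norm (expR (- t) - x0); clear - dl1 u v; lra.
          have : expR (- t) <= expR (- b) by rewrite ler_expR lerN2.
          by rewrite distrC => u; have v := ler_norm (x0 - expR (- t)); clear - dl2 u v; lra.
        move=> h6; rewrite q2E -[(expR _ - x0) ^+ 2]real_normK ?num_real//.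
        by rewrite lerD2l lerN2 lerXn2r ?nnegrE// ltW.
      apply: (lin_lower1 M0) => //; first by rewrite lerNl.
      by rewrite exprn_ge0.
    have Dt := De t tab.
    have kN : 0 <= (1 - (expR (- t) - x0) ^+ 2) ^+ N by rewrite exprn_ge0.
    case: (boolP (t \in _)) => [/set_mem/=|_]; last first.
      by have := lin_lower2 eps0 Dt (lexx 0) kN q2N; rewrite !mulr0.
    rewrite in_itv/= mulr1 => /andP[ta tb].
    have l1 : expR (- t) <= x0 + dl / 2.
      by rewrite -a'E ler_expR lerN2 ltW.
    have l2 : x0 - dl / 2 <= expR (- t).
      by rewrite -b'E ler_expR lerN2 ltW.
    have : q1 ^+ N <= (1 - (expR (- t) - x0) ^+ 2) ^+ N.
      rewrite lerXn2r ?nnegrE ?(ltW q10)//.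
      rewrite q1E lerD2l lerN2 -[leLHS]real_normK ?num_real//.
      rewrite lerXn2r ?nnegrE//; first by rewrite divr_ge0// ltW.
      by rewrite ler_norml; apply/andP; clear - l1 l2; split; lra.
    by move=> qk; exact: (lin_lower2 eps0 Dt q1N qk q2N).
  rewrite RintegralB//; try exact: integrableM_cst.
  by rewrite !RintegralZl// eI e1 invr1 mulr1 subr_le0.
have cv : M * (q2 / q1) ^+ N @[N --> \oo] --> (0 : R).
  rewrite -[X in _ --> X](mulr0 M); apply: cvgM; first exact: cvg_cst.
  by apply: cvg_expr; rewrite ger0_norm ?ltr_pdivrMr ?mul1r// divr_ge0 ?(ltW q10) ?(ltW q20).
have ec0 : 0 < eps * c by rewrite mulr_gt0.
have /cvgrPdist_lt/(_ _ ec0)[N _ /(_ N (leqnn N))] := cv.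
rewrite /= sub0r normrN expr_div_n mulrA ltNge => /negP; apply.
rewrite (le_trans _ (ler_norm _))// ler_pdivlMr ?exprn_gt0//.
by have := key N; rewrite mulrAC.
Qed.
End laplace_uniqueness.

(** * Rotation of the ray of integration *)

Section rotation.
Context {R : realType}.
Notation mu := (@lebesgue_measure R).

Lemma cvg_integral_exhaustion (f : R -> R) :
  mu.-integrable `]0, +oo[ (EFin \o f) ->
  \int[mu]_(r in `[n.+2%:R^-1, n.+2%:R]) f r @[n --> \oo] -->
  \int[mu]_(r in `]0, +oo[) f r.
Proof.
move=> fi.
pose I n : set R := `[n.+2%:R^-1, n.+2%:R]%classic.
have sub n : I n `<=` `]0, +oo[%classic.
  by move=> x /=; rewrite /I /= !in_itv/= andbT => /andP[x0 _]; apply: lt_le_trans x0.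
have -> : (fun n => \int[mu]_(r in `[n.+2%:R^-1, n.+2%:R]) f r) =
    (fun n => \int[mu]_(r in `]0, +oo[) (f r * \1_(I n) r)).
  apply/funext => n; rewrite -[X in Rintegral _ X](setIidr (sub n)) Rintegral_mkcondr.
  by apply: eq_Rint => t _; rewrite patchE indicE; case: ifP => _; rewrite ?mulr1 ?mulr0.
have mf : measurable_fun (`]0, +oo[%classic : set R) f by exact: (integrable_mfun fi).
apply: (@Ldominated_cvg _ (fun r => `|f r|) _ _ f _ _ _ _ _).2 => //.
- by move=> n; apply: measurable_funM => //; apply: measurable_indic; exact: measurable_itv.
- move=> x /=; rewrite in_itv/= andbT => x0.
  apply: cvg_near_cst; near=> n.
  rewrite indicE mem_set ?mulr1// /I /= in_itv/=; apply/andP; split.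
    rewrite invf_ple ?posrE//; apply: (@le_trans _ _ n%:R); last by rewrite ler_nat; lia.
    by near: n; exact: nbhs_infty_ger.
  apply: (@le_trans _ _ n%:R); last by rewrite ler_nat; lia.
  by near: n; exact: nbhs_infty_ger.
- exact: (integrable_norm fi).
- move=> n x _; rewrite normrM ler_piMr// indicE.
  by case: (_ \in _); rewrite ?normr1 ?normr0.
Unshelve. all: by end_near. Qed.

Lemma der_under_integral (D : set R) (G : R -> R) (f g : R -> R -> R) (l u y : R) :
  measurable D -> l < y < u ->
  (forall z, l < z < u -> mu.-integrable D (EFin \o f z)) ->
  (forall z r, l < z < u -> D r -> isder z (f ^~ r) (g z r)) ->
  mu.-integrable D (EFin \o G) ->
  (forall z r, l < z < u -> D r -> `|g z r| <= G r) ->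
  isder y (fun z => \int[mu]_(r in D) f z r) (\int[mu]_(r in D) g y r).
Proof.
move=> mD yI fi fg Gi gG.
pose I : set R := `]l, u[%classic.
have yI' : I y by rewrite /I /= in_itv.
have p1 z r : l < z < u -> D r -> partial1of2 f z r = g z r.
  by move=> zI rI; rewrite partial1of2E; apply: (@derive_val _ _ _ _ _ _ _ (fg z r zI rI)).
have h1 z : I z -> mu.-integrable D (EFin \o f z).
  by rewrite /I /= in_itv/=; exact: fi.
have h2 z r : I z -> D r -> derivable (f ^~ r) z 1.
  by rewrite /I /= in_itv/= => zI rI; case: (fg z r zI rI).
have h3 z r : I z -> D r -> `|partial1of2 f z r| <= `|G r|.
  rewrite /I /= in_itv/= => zI rI; rewrite p1// (le_trans (gG z r zI rI))//.
  exact: ler_norm.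
have G0 r : 0 <= `|G r| by [].
have Gi' : mu.-integrable D (EFin \o (fun r => `|G r|)) by exact: integrable_norm.
have dF := @derivable_under_integral R _ _ mu f D mD y l u yI' h1 h2 (fun r => `|G r|) G0 Gi' h3.
have E := @differentiation_under_integral R _ _ mu f D mD y l u yI' h1 h2 (fun r => `|G r|) G0 Gi' h3.
apply: DeriveDef; first exact: dF.
rewrite -derive1E E; apply: eq_Rint => r Dr; exact: p1.
Qed.

(** Differentiating [U r z / r] in the angle gives [V r z], which is the radial derivative of [W];
    the integral over the radius is then a difference of boundary values. *)
Lemma is_derive_integral_itv (U V W : R -> R -> R) (l u a b y M : R) :
  0 < a -> a < b -> l < y < u ->
  (forall r z, a <= r <= b -> l < z < u -> isder z (U r) (r * V r z)) ->
  (forall r z, a <= r <= b -> l < z < u -> isder r (W ^~ z) (V r z)) ->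
  (forall r z, a <= r <= b -> l < z < u -> {for r, continuous (U ^~ z)}) ->
  (forall r z, a <= r <= b -> l < z < u -> {for r, continuous (V ^~ z)}) ->
  (forall r z, a <= r <= b -> l < z < u -> `|V r z| <= M) ->
  is_derive y 1 (fun z => \int[mu]_(r in `[a, b]) (U r z / r)) (W b y - W a y).
Proof.
move=> a0 ab yI dU dW cU cV VM.
pose f z r := U r z / r.
have rpos r : a <= r <= b -> 0 < r by move=> /andP[ar _]; exact: lt_le_trans ar.
have cont_int (g : R -> R) : (forall r, a <= r <= b -> {for r, continuous g}) ->
    mu.-integrable `[a, b] (EFin \o g).
  move=> cg; apply: continuous_compact_integrable; first exact: segment_compact.
  by apply: continuous_in_subspaceT => r /set_mem/=; rewrite in_itv/= => /cg.
have d1 z r : l < z < u -> a <= r <= b -> isder z (f ^~ r) (V r z).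
  move=> zI rI; rewrite /f; have := dU r z rI zI => dUz.
  apply: der_eq (derM dUz (der_cst r^-1 z)) _.
  by rewrite mulr0 addr0 mulrAC divff ?mul1r// gt_eqF// rpos.
have intf z : l < z < u -> mu.-integrable `[a, b] (EFin \o f z).
  move=> zI; apply: cont_int => r rI; apply: cvgM; first exact: cU.
  by apply: cvgV; [rewrite gt_eqF// rpos|exact: cvg_id].
have mI : measurable (`[a, b]%classic : set R) by exact: measurable_itv.
have intM : mu.-integrable `[a, b] (EFin \o (fun=> M)).
  by apply: cont_int => r rI; exact: cvg_cst.
have := @der_under_integral `[a, b]%classic (fun=> M) f (fun z r => V r z) l u y mI yI intf _ intM _.
move=> D; apply: (der_eq (D _ _)).
- by move=> z r zI; rewrite /= in_itv/= => rI; exact: d1.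
- by move=> z r zI; rewrite /= in_itv/= => rI; exact: VM.
rewrite /Rintegral (@continuous_FTC2 _ _ (W ^~ y) _ _ ab) //.
- by apply: continuous_in_subspaceT => r /set_mem/=; rewrite in_itv/= => rI; exact: cV.
- have cW r : a <= r <= b -> {for r, continuous (W ^~ y)}.
    by move=> rI; exact: der_cont (dW r y rI yI).
  split.
  + move=> r; rewrite in_itv/= => /andP[ar rb].
    have rI : a <= r <= b by rewrite !ltW.
    by case: (dW r y rI yI).
  + by apply: cvg_at_right_filter; apply: cW; rewrite lexx ltW.
  + by apply: cvg_at_left_filter; apply: cW; rewrite lexx ltW.
- move=> r; rewrite in_itv/= => /andP[ar rb].
  have rI : a <= r <= b by rewrite !ltW.
  by rewrite derive1E; have := dW r y rI yI; rewrite /isder => h; apply: derive_val.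
Qed.

(* Cauchy's theorem in polar coordinates.  With [U + iW'] holomorphic and
   [V = d_r W], the hypothesis [d_y U = r d_r W] is one of the two
   Cauchy-Riemann equations, and rotating the ray of integration of
   [U dr / r] only produces boundary terms. *)
Lemma rotate_ray (U V W : R -> R -> R) (l u y0 y1 w0 w1 : R) :
  l < y0 -> y0 < y1 -> y1 < u ->
  (forall r z, 0 < r -> l < z < u -> isder z (U r) (r * V r z)) ->
  (forall r z, 0 < r -> l < z < u -> isder r (W ^~ z) (V r z)) ->
  (forall r z, 0 < r -> l < z < u -> {for r, continuous (U ^~ z)}) ->
  (forall r z, 0 < r -> l < z < u -> {for r, continuous (V ^~ z)}) ->
  (forall a b, 0 < a -> exists M, forall r z, a <= r <= b -> l < z < u -> `|V r z| <= M) ->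
  (forall e, 0 < e -> exists2 d, 0 < d &
     forall r z, 0 < r < d -> l < z < u -> `|W r z - w0| <= e) ->
  (forall e, 0 < e -> exists d, forall r z, d < r -> l < z < u -> `|W r z - w1| <= e) ->
  mu.-integrable `]0, +oo[ (EFin \o (fun r => U r y0 / r)) ->
  mu.-integrable `]0, +oo[ (EFin \o (fun r => U r y1 / r)) ->
  \int[mu]_(r in `]0, +oo[) (U r y1 / r) - \int[mu]_(r in `]0, +oo[) (U r y0 / r) =
  (w1 - w0) * (y1 - y0).
Proof.
move=> ly0 y01 y1u dU dW cU cV VM W0 W1 i0 i1.
have c0 := cvg_integral_exhaustion i0.
have c1 := cvg_integral_exhaustion i1.
apply: (cvg_unique _ (cvgB c1 c0)) => //; apply/cvgrPdist_le => e e0.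
have y10 : 0 < y1 - y0 by rewrite subr_gt0.
pose e' := e / (2 * (y1 - y0)).
have e'0 : 0 < e' by rewrite divr_gt0// mulr_gt0.
have [d0 d0p W0d] := W0 _ e'0; have [d1 W1d] := W1 _ e'0.
near=> n.
pose a : R := n.+2%:R^-1; pose b : R := n.+2%:R.
change (`|(w1 - w0) * (y1 - y0) - (\int[mu]_(r in `[a, b]) (U r y1 / r) -
  \int[mu]_(r in `[a, b]) (U r y0 / r))| <= e).
have a0 : 0 < a by rewrite invr_gt0.
have ab : a < b.
  apply: (@lt_trans _ _ 1); last by rewrite ltr1n.
  by rewrite invf_lt1// ltr1n.
have [M Mb] := VM a b a0.
have rpos r : a <= r <= b -> 0 < r by move=> /andP[ar _]; exact: lt_le_trans ar.
have dPhi z : l < z < u ->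
  is_derive z 1 (fun z => \int[mu]_(r in `[a, b]) (U r z / r)) (W b z - W a z).
  move=> zI; apply: (@is_derive_integral_itv _ V _ l u _ _ _ M) => //.
  - by move=> r ? /rpos; exact: dU.
  - by move=> r ? /rpos; exact: dW.
  - by move=> r ? /rpos; exact: cU.
  - by move=> r ? /rpos; exact: cV.
have inlu z : y0 <= z <= y1 -> l < z < u.
  by move=> /andP[z0 z1]; rewrite (lt_le_trans ly0 z0) (le_lt_trans z1 y1u).
(* The mean value theorem in the angle expresses the difference through [W] at a single intermediate
   angle [c], so limits of [W] that are uniform in the angle are enough to conclude. *)
have [||c cI ->] := @MVT _ (fun z => \int[mu]_(r in `[a, b]) (U r z / r))
    (fun z => W b z - W a z) _ _ y01.
- by move=> z; rewrite in_itv/= => /andP[z0 z1]; apply: dPhi; apply: inlu; rewrite !ltW.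
- apply: continuous_in_subspaceT => z /set_mem/=; rewrite in_itv/= => zI.
  exact: (der_cont (isder_in (dPhi z (inlu z zI)))).
have cI' : l < c < u.
  by apply: inlu; move: cI; rewrite in_itv/= => /andP[? ?]; rewrite !ltW.
rewrite -mulrBl normrM (gtr0_norm y10) -ler_pdivlMr//.
have Wa : `|W a c - w0| <= e'.
  apply: W0d => //; rewrite a0/= /a invf_plt ?posrE//.
  apply: (@lt_le_trans _ _ n%:R); last by rewrite ler_nat -addn2 leq_addr.
  by near: n; exact: nbhs_infty_gtr.
have Wb : `|W b c - w1| <= e'.
  apply: W1d => //; rewrite /b.
  apply: (@lt_le_trans _ _ n%:R); last by rewrite ler_nat -addn2 leq_addr.
  by near: n; exact: nbhs_infty_gtr.
have -> : e / (y1 - y0) = e' + e' by rewrite /e'; field; rewrite gt_eqF.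
have -> : w1 - w0 - (W b c - W a c) = (w1 - W b c) + (W a c - w0) by ring.
by rewrite (le_trans (ler_normD _ _))// lerD// distrC.
Unshelve. all: by end_near. Qed.

End rotation.

(** * The logarithm of 1 + r e^(it) *)

Section log_arg.
Context {R : realType}.
Implicit Types r t v x y : R.

Definition nrm2 r t : R := 1 + 2 * r * cos t + r ^+ 2.

(* [La r t + i Th r t] is the principal logarithm of [1 + r e^(it)]. *)
Definition La r t : R := ln (nrm2 r t) / 2.
Definition Th r t : R :=
  t / 2 + atan ((r - 1) / (r + 1) * (sin (t / 2) / cos (t / 2))).

Lemma cos_half_gt0 t : - pi < t < pi -> 0 < cos (t / 2).
Proof.
move=> /andP[t1 t2]; apply: cos_gt0_pihalf; apply/andP; split; lra.
Qed.

(** The half-angle form makes positivity for |t| < pi visible and matches the denominators arising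
    from the derivative of [Th]. *)
Lemma nrm2E r t : nrm2 r t =
  (r + 1) ^+ 2 * cos (t / 2) ^+ 2 + (r - 1) ^+ 2 * sin (t / 2) ^+ 2.
Proof.
rewrite /nrm2; have := cos2Dsin2 (t / 2) => cs.
have -> : cos t = cos (t / 2) ^+ 2 - sin (t / 2) ^+ 2.
  by rewrite {1}(splitr t) cosD !expr2.
have -> : 1 + 2 * r * (cos (t / 2) ^+ 2 - sin (t / 2) ^+ 2) + r ^+ 2 =
  (1 + r ^+ 2) * (cos (t / 2) ^+ 2 + sin (t / 2) ^+ 2) +
  2 * r * (cos (t / 2) ^+ 2 - sin (t / 2) ^+ 2) by rewrite cs; ring.
by ring.
Qed.

Lemma nrm2_gt0 r t : 0 <= r -> - pi < t < pi -> 0 < nrm2 r t.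
Proof.
move=> r0 /cos_half_gt0 c0; rewrite nrm2E; apply: ltr_pwDl; last first.
  by rewrite mulr_ge0// sqr_ge0.
by rewrite mulr_gt0// exprn_gt0//; lra.
Qed.

Lemma nrm2_ge r t : 0 <= r -> (r - 1) ^+ 2 <= nrm2 r t.
Proof. by move=> r0; rewrite /nrm2; have := cos_geN1 t; nra. Qed.

Lemma nrm2_le r t : 0 <= r -> nrm2 r t <= (r + 1) ^+ 2.
Proof. by move=> r0; rewrite /nrm2; have := cos_le1 t; nra. Qed.

Lemma nrm2_sin r t : sin t ^+ 2 <= nrm2 r t.
Proof.
have := cos2Dsin2 t; rewrite /nrm2 => cs.
have -> : 1 + 2 * r * cos t + r ^+ 2 = sin t ^+ 2 + (r + cos t) ^+ 2.
  have -> : sin t ^+ 2 = 1 - cos t ^+ 2 by lra.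
  by ring.
by rewrite lerDl sqr_ge0.
Qed.

Lemma der_La_r r t : 0 <= r -> - pi < t < pi ->
  isder r (La ^~ t) ((cos t + r) / nrm2 r t).
Proof.
move=> r0 tpi; have := nrm2_gt0 r0 tpi; rewrite /nrm2 => n0.
rewrite /La /nrm2; der => //.
by field; rewrite gt_eqF.
Qed.

Lemma der_La_t r t : 0 <= r -> - pi < t < pi ->
  isder t (La r) (- (r * sin t) / nrm2 r t).
Proof.
move=> r0 tpi; have := nrm2_gt0 r0 tpi; rewrite /nrm2 => n0.
rewrite /La /nrm2; der => //.
by field; rewrite gt_eqF.
Qed.

Let sin_half t : sin t = 2 * (sin (t / 2) * cos (t / 2)).
Proof. by rewrite {1}(splitr t) sinD; ring. Qed.

Let cos_half t : cos t = cos (t / 2) ^+ 2 - sin (t / 2) ^+ 2.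
Proof. by rewrite {1}(splitr t) cosD !expr2. Qed.

Let den_neq0 r t : 0 <= r -> - pi < t < pi ->
  1 + ((r - 1) / (r + 1) * (sin (t / 2) / cos (t / 2))) ^+ 2 != 0.
Proof. by move=> *; rewrite gt_eqF// ltr_pwDl// sqr_ge0. Qed.

Lemma der_Th_r r t : 0 <= r -> - pi < t < pi ->
  isder r (Th ^~ t) (sin t / nrm2 r t).
Proof.
move=> r0 tpi; have n0 := nrm2_gt0 r0 tpi; have d0 := den_neq0 r0 tpi.
have c0 := cos_half_gt0 tpi.
rewrite /Th; der; first by rewrite gt_eqF//; lra.
rewrite nrm2E in n0 *; rewrite (sin_half t).
move: c0 d0 n0; set c := cos _; set s := sin _ => c0 d0 n0.
have r1 : r + 1 != 0 by rewrite gt_eqF//; lra.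
have c1 : c != 0 by rewrite gt_eqF.
by field; rewrite r1 c1/= !exprMn (gt_eqF n0).
Qed.

Lemma der_Th_t r t : 0 <= r -> - pi < t < pi ->
  isder t (Th r) ((r ^+ 2 + r * cos t) / nrm2 r t).
Proof.
move=> r0 tpi; have n0 := nrm2_gt0 r0 tpi; have d0 := den_neq0 r0 tpi.
have c0 := cos_half_gt0 tpi; have cs := cos2Dsin2 (t / 2).
rewrite /Th; der; first by rewrite gt_eqF.
have -> : r ^+ 2 + r * cos t = r ^+ 2 * (cos (t / 2) ^+ 2 + sin (t / 2) ^+ 2) +
    r * (cos (t / 2) ^+ 2 - sin (t / 2) ^+ 2).
  by rewrite cs mulr1 (cos_half t).
rewrite nrm2E in n0 *.
move: c0 d0 n0; set c := cos _; set s := sin _ => c0 d0 n0.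
have r1 : r + 1 != 0 by rewrite gt_eqF//; lra.
have c1 : c != 0 by rewrite gt_eqF.
by field; rewrite r1 c1/= !exprMn (gt_eqF n0).
Qed.

Lemma Th0 t : - pi < t < pi -> Th 0 t = 0.
Proof.
move=> /andP[t1 t2]; rewrite /Th sub0r add0r divr1 mulN1r atanN -/(tan (t / 2)) tanK ?subrr//.
by rewrite in_itv/=; apply/andP; split; lra.
Qed.

Lemma Th_r0 r : Th r 0 = 0.
Proof. by rewrite /Th !mul0r sin0 mul0r mulr0 atan0 addr0. Qed.

Lemma ThN r t : Th r (- t) = - Th r t.
Proof. by rewrite /Th !mulNr sinN cosN mulNr mulrN atanN; ring. Qed.

Lemma LaN r t : La r (- t) = La r t.
Proof. by rewrite /La /nrm2 cosN. Qed.

(** The ratio [(r - 1) / (r + 1)] lies between -1 and 1, so the arctangent in [Th] stays between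
    [- t / 2] and [t / 2]. The half-angle form thus follows the right branch even where 1 + r cos t
    changes sign. *)
Lemma Th_bound r t : 0 <= r -> 0 <= t < pi -> 0 <= Th r t <= t.
Proof.
move=> r0 /andP[t0 tpi].
have tI : - pi < t < pi by rewrite tpi andbT; have := @pi_gt0 R; lra.
have tI2 : t / 2 \in `](- (pi / 2)), (pi / 2)[.
  by rewrite in_itv/=; move: tI => /andP[? ?]; apply/andP; split; lra.
have c0 := cos_half_gt0 tI.
have T0 : 0 <= sin (t / 2) / cos (t / 2).
  by rewrite divr_ge0 ?(ltW c0)// sin_ge0_pi//; lra.
have E : t / 2 = atan (sin (t / 2) / cos (t / 2)) by rewrite -/(tan _) tanK.
have r1 : 0 < r + 1 by lra.
have q1 : - 1 <= (r - 1) / (r + 1) by rewrite ler_pdivlMr//; lra.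
have q2 : (r - 1) / (r + 1) <= 1 by rewrite ler_pdivrMr//; lra.
have a1 : atan ((r - 1) / (r + 1) * (sin (t / 2) / cos (t / 2))) <= t / 2.
  by rewrite [leRHS]E; apply: le_atan; nra.
have a2 : - (t / 2) <= atan ((r - 1) / (r + 1) * (sin (t / 2) / cos (t / 2))).
  by rewrite [in leLHS]E -atanN; apply: le_atan; nra.
by rewrite /Th; apply/andP; split; lra.
Qed.

Lemma Th_norm r t : 0 <= r -> - pi < t < pi -> `|Th r t| <= `|t|.
Proof.
move=> r0 /andP[t1 t2]; case: (leP 0 t) => t0.
  have /andP[h1 h2] : 0 <= Th r t <= t by apply: Th_bound => //; rewrite t0.
  by rewrite !ger0_norm.
have /andP[h1 h2] : 0 <= Th r (- t) <= - t.
  by apply: Th_bound => //; apply/andP; split; lra.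
by rewrite -normrN -ThN ger0_norm// (ltr0_norm t0).
Qed.

(** For r >= 1/2 this is the bound by pi. For r < 1/2 the radial derivative is at most 4, because
    [nrm2] is at least 1/4, and 4 <= 2 pi. *)
Lemma Th_lin r t : 0 <= r -> - pi < t < pi -> `|Th r t| <= 2 * pi * r.
Proof.
move=> r0 tI; have pi0 := @pi_gt0 R; have pi2 : 2 <= pi :> R by exact: pi_ge2.
have tpi : `|t| <= pi by rewrite ler_norml; move: tI => /andP[? ?]; rewrite !ltW.
case: (leP (1 / 2) r) => r2.
  rewrite (le_trans (Th_norm r0 tI))// (le_trans tpi)//; nra.
move: r0; rewrite le_eqVlt => /orP[/eqP <-|r0].
  by rewrite Th0// normr0 mulr0.
have d x : 0 <= x -> isder x (Th ^~ t) (sin t / nrm2 x t).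
  by move=> x0; exact: der_Th_r.
have [||c cI] := @MVT _ (Th ^~ t) (fun x => sin t / nrm2 x t) 0 r r0.
- by move=> x; rewrite in_itv/= => /andP[x0 _]; apply: d; exact: ltW.
- apply: continuous_in_subspaceT => x /set_mem/=; rewrite in_itv/= => /andP[x0 _].
  exact: (der_cont (d x x0)).
rewrite Th0// !subr0 => ->; rewrite normrM (gtr0_norm r0) ler_pM2r//.
move: cI; rewrite in_itv/= => /andP[c0 cr].
have n1 := nrm2_ge t (ltW c0).
have n2 : 1 / 4 <= nrm2 c t by apply: le_trans n1; nra.
have n0 : 0 < nrm2 c t by lra.
rewrite normrM normrV ?unitfE ?gt_eqF// (gtr0_norm n0) ler_pdivrMr//.
by apply: (@le_trans _ _ 1); [exact: sin_max|nra].
Qed.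

(** The modulus of 1 + r e^(it) lies between |1 - r| and 1 + r, so one majorant serves all angles at
    once. *)
Lemma La_norm r t : 0 <= r -> r != 1 -> `|La r t| <= `|ln `|1 - r| | + ln (1 + r).
Proof.
move=> r0 r1.
have p0 : 0 < `|1 - r| by rewrite normr_gt0 subr_eq0 eq_sym.
have n0 : 0 < nrm2 r t.
  apply: lt_le_trans (nrm2_ge t r0).
  by rewrite lt_neqAle sqr_ge0 andbT eq_sym sqrf_eq0 subr_eq0.
have lo : ln `|1 - r| <= La r t.
  rewrite /La ler_pdivlMr// mulr_natr -lnXn// ler_ln ?posrE ?exprn_gt0//.
  by rewrite real_normK ?num_real// -sqrrN opprB nrm2_ge.
have hi : La r t <= ln (1 + r).
  rewrite /La ler_pdivrMr// mulr_natr -lnXn//; last by lra.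
  by rewrite ler_ln ?posrE ?exprn_gt0 1?addrC ?nrm2_le//; lra.
have l0 : 0 <= ln (1 + r) by rewrite ln_ge0//; lra.
rewrite ler_norml; apply/andP; split.
  by have := ler_norm (- ln `|1 - r|); rewrite normrN; lra.
by have := normr_ge0 (ln `|1 - r|); lra.
Qed.

End log_arg.

(** * Integrable majorants of logarithms *)

Section log_domination.
Context {R : realType}.
Notation mu := (@lebesgue_measure R).
Implicit Types a v x K : R.

Lemma cvg_sqrtr (F : set_system R) {FF : Filter F} (f : R -> R) (l : R) :
  f x @[x --> F] --> l -> Num.sqrt (f x) @[x --> F] --> Num.sqrt l.
Proof. by move=> fl; exact: (continuous_cvg _ (@sqrt_continuous R l) fl). Qed.

(** The angle-free majorant of [La x]; its only singularity is at 1, where 1 + x e^(it) can vanish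
    in the limit t = pi. *)
Definition Ld x : R := `|ln `|1 - x| | + ln (1 + x).

(** Majorant of the logarithmic singularity at 1. The inverse square root has elementary primitives,
    and the factor [x] makes [phi x / x] harmless at 0; beyond 2 the logarithm has no negative
    part. *)
Definition phi x : R := if x < 2 then x / Num.sqrt `|1 - x| else 0.

Lemma phi_ge0 x : 0 <= x -> 0 <= phi x.
Proof. by move=> x0; rewrite /phi; case: ifP => // _; rewrite divr_ge0// sqrtr_ge0. Qed.

Lemma ln_le_sub1 x : 0 < x -> ln x <= x - 1.
Proof. move=> x0; have := @le_ln1Dx R (x - 1).
have -> : 1 + (x - 1) = x by ring.
by move=> h; apply: h; lra. Qed.

(** With s^2 = |1 - x|, the left side is 2 ln (1 / s), at most 2 (1 / s - 1), and 1 - s <= x. *)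
Lemma Nln_le_phi x : 0 <= x -> - ln `|1 - x| <= 2 * phi x.
Proof.
move=> x0; rewrite /phi; case: ifPn => [x2|]; last first.
  rewrite -leNgt => x2; rewrite mulr0 oppr_le0 ln_ge0// ler0_norm; lra.
have [->|x1] := eqVneq x 1; first by rewrite subrr normr0 ln0// sqrtr0 invr0 mulr0 mulr0 oppr0.
have p0 : 0 < `|1 - x| by rewrite normr_gt0 subr_eq0 eq_sym.
set s := Num.sqrt _; have s0 : 0 < s by rewrite sqrtr_gt0.
have s2 : s ^+ 2 = `|1 - x| by rewrite sqr_sqrtr.
have -> : - ln `|1 - x| = 2 * ln s^-1 by rewrite -s2 lnXn// lnV ?posrE//; ring.
rewrite ler_pM2l// (le_trans (ln_le_sub1 _)) ?invr_gt0//.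
rewrite ler_pdivlMr// mulrBl mulVf ?gt_eqF// mul1r.
have : (1 - s) * (1 + s) = 1 - `|1 - x| by rewrite -s2; ring.
case: (leP x 1) => xx.
  by rewrite ger0_norm; [nra|lra].
by rewrite ler0_norm; [nra|lra].
Qed.

Lemma Ld_le x : 0 <= x -> Ld x <= 2 * phi x + 2 * ln (1 + x).
Proof.
move=> x0; rewrite /Ld; have h1 := Nln_le_phi x0; have h2 := phi_ge0 x0.
have h3 : 0 <= ln (1 + x) by rewrite ln_ge0//; lra.
suff : `|ln `|1 - x| | <= 2 * phi x + ln (1 + x) by lra.
rewrite ler_norml; apply/andP; split; first by lra.
have [x1|x1] := eqVneq x 1; first by rewrite {1}x1 subrr normr0 ln0//; lra.
have p0 : 0 < `|1 - x| by rewrite normr_gt0 subr_eq0 eq_sym.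
apply: (@le_trans _ _ (ln (1 + x))); last by lra.
by rewrite ler_ln ?posrE//; [rewrite ler_norml; apply/andP; split; lra|lra].
Qed.

(** The integrand is the derivative of (2/a) sqrt |1 - v^a / K| up to sign, and each side of the
    singularity contributes 2/a. That the value does not depend on [K] later makes the bounds on
    [kap] uniform in the radius. *)
Lemma int_phi a K : 0 < a -> 0 < K ->
  mu.-integrable `]0, +oo[ (EFin \o (fun v => phi (v `^ a / K) / v)) /\
  \int[mu]_(v in `]0, +oo[) (phi (v `^ a / K) / v) = 4 / a.
Proof.
move=> a0 K0.
pose u := K `^ a^-1; pose u2 := (2 * K) `^ a^-1.
have u0 : 0 < u by exact: powR_gt0.
have ua : u `^ a = K by rewrite -powRrM mulVf ?gt_eqF// powRr1 ?ltW.
have u2a : u2 `^ a = 2 * K by rewrite -powRrM mulVf ?gt_eqF// powRr1// ltW// mulr_gt0.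
have uu2 : u < u2 by apply: gt0_ltr_powR; rewrite ?invr_gt0 ?nnegrE ?mulr_ge0 ?ltW// ltr_pMl// ltr1n.
have mono (x y : R) : 0 <= x -> x < y -> x `^ a < y `^ a.
  by move=> x0 xy; apply: gt0_ltr_powR; rewrite ?nnegrE ?(le_trans x0 (ltW xy)).
pose f1 (v : R) := v `^ a / K / Num.sqrt (1 - v `^ a / K) / v.
pose f2 (v : R) := v `^ a / K / Num.sqrt (v `^ a / K - 1) / v.
pose F1 (v : R) := - (2 / a) * Num.sqrt (1 - v `^ a / K).
pose F2 (v : R) := 2 / a * Num.sqrt (v `^ a / K - 1).
have cx (x : R) : 0 < x -> {for x, continuous (fun v : R => v `^ a / K)}.
  by move=> x0; dcont.
have P1 (v : R) : 0 < v < u -> 0 < 1 - v `^ a / K.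
  by move=> /andP[v0 vu]; rewrite subr_gt0 ltr_pdivrMr// mul1r -ua mono// ltW.
have P2 (v : R) : u < v -> 0 < v `^ a / K - 1.
  by move=> uv; rewrite subr_gt0 ltr_pdivlMr// mul1r -ua mono// ltW.
have pw (v : R) : 0 < v -> v `^ (a - 1) = v `^ a / v.
  by move=> v0; rewrite powRD ?(gt_eqF v0) ?implybT// powRN powRr1// ltW.
have [i1 e1] : mu.-integrable `]0, u[ (EFin \o f1) /\
    \int[mu]_(v in `]0, u[) f1 v = 0 - - (2 / a).
  apply: (@ge0_FTC_oo _ 0 u _ _ _ F1); first exact: u0.
  - move=> x xI; have x0 : 0 < x by case/andP: xI.
    have := P1 x xI => px.
    by rewrite /f1; dcont => //; rewrite gt_eqF// sqrtr_gt0.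
  - move=> x xI; have x0 : 0 < x by case/andP: xI.
    have := P1 x xI => px.
    rewrite /F1 /f1; der => //; rewrite pw//.
    by field; rewrite !gt_eqF// sqrtr_gt0.
  - move=> x xI; have x0 : 0 < x by case/andP: xI.
    by rewrite /f1 !mulr_ge0// ?powR_ge0// ?invr_ge0 ?sqrtr_ge0// ltW.
  - rewrite /F1 -[X in _ --> X]mulr1; apply: cvgM; first exact: cvg_cst.
    rewrite -[X in _ --> X]sqrtr1; apply: cvg_sqrtr.
    rewrite -[X in _ --> X]subr0; apply: cvgB; first exact: cvg_cst.
    rewrite -[X in _ --> X](mul0r K^-1); apply: cvgM; last exact: cvg_cst.
    exact: powR_cvg0.
  - rewrite /F1 -[X in _ --> X](mulr0 (- (2 / a))); apply: cvgM; first exact: cvg_cst.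
    rewrite -[X in _ --> X]sqrtr0; apply: cvg_sqrtr.
    rewrite -[X in _ --> X](subrr 1); apply: cvgB; first exact: cvg_cst.
    by apply: cont_at_left (cx _ u0) _; rewrite ua divff// gt_eqF.
have [i2 e2] : mu.-integrable `]u, u2[ (EFin \o f2) /\
    \int[mu]_(v in `]u, u2[) f2 v = 2 / a - 0.
  apply: (@ge0_FTC_oo _ u u2 _ _ _ F2); first exact: uu2.
  - move=> x /andP[ux _]; have x0 := lt_trans u0 ux.
    have := P2 x ux => px.
    by rewrite /f2; dcont => //; rewrite gt_eqF// sqrtr_gt0.
  - move=> x /andP[ux _]; have x0 := lt_trans u0 ux.
    have := P2 x ux => px.
    rewrite /F2 /f2; der => //; rewrite pw//.
    by field; rewrite !gt_eqF// sqrtr_gt0.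
  - move=> x /andP[ux _]; have x0 := lt_trans u0 ux.
    by rewrite /f2 !mulr_ge0// ?powR_ge0// ?invr_ge0 ?sqrtr_ge0// ltW.
  - rewrite /F2 -[X in _ --> X](mulr0 (2 / a)); apply: cvgM; first exact: cvg_cst.
    rewrite -[X in _ --> X]sqrtr0; apply: cvg_sqrtr.
    rewrite -[X in _ --> X](subrr 1); apply: cvgB; last exact: cvg_cst.
    by apply: cont_at_right (cx _ u0) _; rewrite ua divff// gt_eqF.
  - rewrite /F2 -[X in _ --> X]mulr1; apply: cvgM; first exact: cvg_cst.
    rewrite -[X in _ --> X]sqrtr1; apply: cvg_sqrtr.
    rewrite -[X in _ --> X](_ : 2 - 1 = 1); last by ring.
    apply: cvgB; last exact: cvg_cst.
    apply: cont_at_left (cx _ (lt_trans u0 uu2)) _.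
    by rewrite u2a mulfK// gt_eqF.
have m0y : measurable (`]0, +oo[%classic : set R) by exact: measurable_itv.
have [j1 E1] : mu.-integrable `]0, +oo[ (EFin \o (f1 \_ `]0, u[)) /\
    \int[mu]_(x in `]0, +oo[) (f1 \_ `]0, u[) x = 2 / a.
  have [|||//|j ->] := @integrable_restr _ `]0, u[%classic `]0, +oo[%classic f1.
  - exact: measurable_itv.
  - exact: measurable_itv.
  - by move=> x /=; rewrite !in_itv/= andbT => /andP[].
  by split=> //; rewrite e1 opprK add0r.
have [j2 E2] : mu.-integrable `]0, +oo[ (EFin \o (f2 \_ `]u, u2[)) /\
    \int[mu]_(x in `]0, +oo[) (f2 \_ `]u, u2[) x = 2 / a.
  have [|||//|j ->] := @integrable_restr _ `]u, u2[%classic `]0, +oo[%classic f2.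
  - exact: measurable_itv.
  - exact: measurable_itv.
  - by move=> x /=; rewrite !in_itv/= andbT => /andP[/(lt_trans u0)].
  by split=> //; rewrite e2 subr0.
have E (x : R) : (`]0, +oo[%classic : set R) x ->
    (f1 \_ `]0, u[) x + (f2 \_ `]u, u2[) x = phi (x `^ a / K) / x.
  rewrite /= in_itv/= andbT => x0; rewrite !patchE !mem_setE !in_itv/= x0/=.
  have [xu|ux|->] := ltgtP x u.
  - have px : 0 < 1 - x `^ a / K by apply: P1; rewrite x0.
    rewrite /= addr0 /phi ifT; last by rewrite (@lt_trans _ _ 1)// ?ltr1n// -subr_gt0.
    by rewrite (gtr0_norm px) /f1.
  - have px := P2 x ux; rewrite add0r /phi /=.
    case: ifPn => xu2.
      rewrite ifT; last by rewrite ltr_pdivrMr// -u2a mono// ltW.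
      by rewrite ltr0_norm ?opprB// -oppr_gt0 opprB.
    rewrite ifF ?mul0r//; apply/negbTE; move: xu2; rewrite -!leNgt => xu2.
    rewrite ler_pdivlMr// -u2a; move: xu2; rewrite le_eqVlt => /orP[/eqP -> //|/mono h].
    by apply: ltW; apply: h; rewrite ltW// (lt_trans u0).
  - by rewrite add0r ua divff ?gt_eqF// /phi subrr normr0 sqrtr0 invr0 mulr0 if_same mul0r.
split; first by apply: (eq_Lint m0y E); exact: LintD.
rewrite -(eq_Lintegral E) LintegralD// E1 E2; field.
by rewrite gt_eqF.
Qed.

Lemma measurable_Ld : measurable_fun setT Ld.
Proof.
by rewrite /Ld; meas.
Qed.

Lemma integrable_arctan : mu.-integrable `]0, +oo[ (EFin \o (fun v : R => (1 + v ^+ 2)^-1)) /\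
  \int[mu]_(v in `]0, +oo[) (1 + v ^+ 2)^-1 = pi / 2.
Proof.
rewrite -[X in _ /\ _ = X]subr0.
have p0 (x : R) : 0 < 1 + x ^+ 2 by rewrite ltr_pwDl// sqr_ge0.
apply: (@ge0_FTC_oy _ 0 0 (pi / 2) _ atan) => //.
- by move=> x _; dcont; rewrite gt_eqF.
- by move=> x _; exact: is_derive1_atan.
- by move=> x _; rewrite invr_ge0 ltW.
- by apply: cont_at_right (@continuous_atan _ _) _; rewrite atan0.
- exact: cvgy_atan.
Qed.

(** The singular part is absorbed by [phi], using 2 v <= 1 + v^2 to trade the weight for 1 / v; what
    remains grows logarithmically and is absorbed by a [bump]. *)
Lemma integrable_Ld a K : 0 < a <= 2 -> 0 < K ->
  mu.-integrable `]0, +oo[ (EFin \o (fun v => Ld (v `^ a / K) / (1 + v ^+ 2))).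
Proof.
move=> /andP[a0 a2] K0.
have m0y : measurable (`]0, +oo[%classic : set R) by exact: measurable_itv.
have [iphi _] := int_phi a0 K0.
pose C := ln (1 + K^-1) + 4.
have l0 : 0 <= ln (1 + K^-1) by rewrite ln_ge0// lerDl invr_ge0 ltW.
have ib := @integrable_bump R 1 (1 / 2) ltac:(lra) ltac:(lra).
apply: (@le_Lint _ (fun v => phi (v `^ a / K) / v + 2 * C * bump 1 (1 / 2) v)) => //.
- apply: mfunS.
  apply: measurable_funM; last by meas.
  by apply: (measurableT_comp measurable_Ld); meas.
- move=> v; rewrite /= in_itv/= andbT => v0.
  have p0 : 0 < 1 + v ^+ 2 by rewrite ltr_pwDl// sqr_ge0.
  have x0 : 0 <= v `^ a / K by rewrite divr_ge0 ?powR_ge0 ?ltW.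
  set x := v `^ a / K in x0 *.
  have L0 : 0 <= Ld x by rewrite addr_ge0// ln_ge0//; lra.
  rewrite normrM normfV (gtr0_norm p0) (ger0_norm L0).
  have h := Ld_le x0.
  apply: (@le_trans _ _ ((2 * phi x + 2 * ln (1 + x)) / (1 + v ^+ 2))).
    by rewrite ler_pM2r ?invr_gt0.
  rewrite mulrDl lerD//.
    rewrite ler_pdivrMr// mulrAC ler_pdivlMr//.
    have := phi_ge0 x0; have : 2 * v <= 1 + v ^+ 2 by have := sqr_ge0 (1 - v); nra.
    by nra.
  rewrite -2!mulrA ler_pM2l// ler_pdivrMr//.
  rewrite /bump; case: ifPn => [v1|].
    rewrite subrr powRr0 mulr1.
    have : ln (1 + x) <= ln (1 + K^-1).
      rewrite ler_ln ?posrE; [|lra|by rewrite ltr_pwDl// invr_ge0 ltW].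
      rewrite lerD2l -[leRHS]mul1r ler_pM2r ?invr_gt0//.
      apply: le_trans (ge0_ler_powR (ltW a0) _ _ (ltW v1)) _; rewrite ?nnegrE ?powR1//.
      exact: ltW.
    by rewrite /C; nra.
  rewrite -leNgt => v1.
  have vs : v = v `^ (1 / 2) ^+ 2.
    by rewrite -powR_mulrn ?powR_ge0// -powRrM mul1r mulVf// powRr1// ltW.
  set s := v `^ (1 / 2) in vs.
  have s1 : 1 <= s.
    have h2 : 0 <= 1 / 2 :> R by lra.
    by apply: le_trans _ (ge0_ler_powR h2 _ _ v1); rewrite ?nnegrE ?powR1// ltW.
  have -> : v `^ (- (1 / 2) - 1) = (s * v)^-1.
    by rewrite -opprD powRN powRD ?(gt_eqF v0) ?implybT// powRr1// ltW.
  (* Since a <= 2, 1 + x is at most (1 + 1/K) v^2 = (1 + 1/K) s^4, and ln s <= s. *)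
  have : ln (1 + x) <= ln (1 + K^-1) + 4 * s.
    have k0 : 0 < 1 + K^-1 by rewrite ltr_pwDl// invr_ge0 ltW.
    have -> : 4 * s = 4 * s + 0 by ring.
    have lns : ln s <= s by apply: le_trans (ln_le_sub1 _) _; lra.
    apply: (@le_trans _ _ (ln ((1 + K^-1) * s ^+ 4))).
      rewrite ler_ln ?posrE ?mulr_gt0 ?exprn_gt0//; try lra.
      have -> : s ^+ 4 = v ^+ 2 by rewrite [in RHS]vs; ring.
      have v2 : 1 <= v ^+ 2 by rewrite exprn_ege1.
      have : x <= v ^+ 2 / K.
        rewrite ler_pM2r ?invr_gt0// -powR_mulrn ?ler_powR// ltW//.
      have : 0 < K^-1 by rewrite invr_gt0.
      by nra.
    rewrite lnM ?posrE ?exprn_gt0//; last by lra.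
    by rewrite lnXn ?mulr_natl; [lra|lra].
  have sv : 0 < s * v by nra.
  rewrite -mulrA [_^-1 * _]mulrC mulrA ler_pdivlMr//.
  have sv3 : s * v = s ^+ 3 by rewrite [X in s * X]vs; ring.
  have v4 : v ^+ 2 = s ^+ 4 by rewrite [in LHS]vs; ring.
  have s3 : s ^+ 3 <= s ^+ 4 by rewrite [leRHS]exprS ler_peMl ?exprn_ge0//; lra.
  rewrite sv3 v4 /C => lnx.
  have s30 : 0 <= s ^+ 3 by rewrite exprn_ge0//; lra.
  apply: (le_trans (ler_wpM2r s30 lnx)).
  have := ler_wpM2l l0 s3.
  have -> : (ln (1 + K^-1) + 4 * s) * s ^+ 3 = ln (1 + K^-1) * s ^+ 3 + 4 * s ^+ 4 by ring.
  by lra.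
- apply: integrableDr => //; exact: integrableM_cst.
Qed.

(** A Poisson-type kernel: it is the derivative of [Th v (rho * pi)] in [v], hence has total mass
    [rho * pi] on the half-line. *)
Definition wk rho v : R := sin (rho * pi) / (1 + 2 * v * cos (rho * pi) + v ^+ 2).

Section wk.
Variable rho : R.
Hypothesis rho01 : 0 < rho < 1.

Let rp : 0 < rho * pi < pi.
Proof.
have := @pi_gt0 R; case/andP: rho01 => r0 r1 p0.
by rewrite mulr_gt0//= gtr_pMl.
Qed.

Lemma sin_rho_gt0 : 0 < sin (rho * pi).
Proof. exact: sin_gt0_pi. Qed.

Lemma cos_rho_lt1 : `|cos (rho * pi)| < 1.
Proof.
rewrite -(@ltr_pXn2r _ 2%N) ?nnegrE// real_normK ?num_real// expr1n.
by have := cos2Dsin2 (rho * pi); have := sin_rho_gt0; nra.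
Qed.

Definition wC : R := (1 - `|cos (rho * pi)|)^-1.

Lemma wC_gt0 : 0 < wC.
Proof. by rewrite invr_gt0 subr_gt0 cos_rho_lt1. Qed.

(* Uniform in the angles of [[- rho pi, rho pi]]. *)
Lemma nrm2_lower r t : 0 <= r -> cos (rho * pi) <= cos t -> 1 + r ^+ 2 <= wC * nrm2 r t.
Proof.
move=> r0 ct; have c1 := cos_rho_lt1.
rewrite /wC mulrC ler_pdivlMr ?subr_gt0// /nrm2.
have : - `|cos (rho * pi)| <= cos t.
  by have := ler_norm (- cos (rho * pi)); rewrite normrN; lra.
have : 0 <= `|cos (rho * pi)| by [].
set c := `|_| in c1 *; set d := cos t => ? ?.
have := sqr_ge0 (r - 1); nra.
Qed.

Lemma wk_ge0 v : 0 <= v -> 0 <= wk rho v.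
Proof.
move=> v0; rewrite divr_ge0// ?ltW// ?sin_rho_gt0//.
by apply: nrm2_gt0 => //; have ? := @pi_gt0 R; case/andP: rp => ? ?; apply/andP; split; lra.
Qed.

Lemma wk_le v : 0 <= v -> wk rho v <= wC / (1 + v ^+ 2).
Proof.
move=> v0; have n0 : 0 < nrm2 v (rho * pi).
  by apply: nrm2_gt0 => //; have ? := @pi_gt0 R; case/andP: rp => ? ?; apply/andP; split; lra.
have p0 : 0 < 1 + v ^+ 2 by rewrite ltr_pwDl// sqr_ge0.
rewrite /wk -/(nrm2 v (rho * pi)) ler_pdivlMr// mulrAC ler_pdivrMr//.
apply: le_trans (nrm2_lower v0 (lexx _)).
by rewrite ler_piMl ?sin_le1// ltW.
Qed.

Lemma measurable_wk : measurable_fun setT (wk rho).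
Proof.
by rewrite /wk; meas.
Qed.

Lemma integrable_wk : mu.-integrable `]0, +oo[ (EFin \o wk rho).
Proof.
apply: (@le_Lint _ (fun v => wC * (1 + v ^+ 2)^-1)) => //.
- exact: measurable_funS measurableT (subsetT _) measurable_wk.
- by move=> v; rewrite /= in_itv/= andbT => v0; rewrite ger0_norm ?wk_le ?wk_ge0 ?ltW.
- by apply: integrableM_cst => //; exact: integrable_arctan.1.
Qed.

End wk.
End log_domination.

Local Open Scope complex_scope.
Local Open Scope ring_scope.

(** * Holomorphic functions in polar coordinates *)

Section complex_lemmas.
Context {R : realType}.
Implicit Types z w : R[i].

Lemma ReM z w : complex.Re (z * w) = complex.Re z * complex.Re w - complex.Im z * complex.Im w.
Proof. by case: z w => [a b] [c d]. Qed.

Lemma ImM z w : complex.Im (z * w) = complex.Re z * complex.Im w + complex.Im z * complex.Re w.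
Proof. by case: z w => [a b] [c d] /=. Qed.

Lemma ReD z w : complex.Re (z + w) = complex.Re z + complex.Re w.
Proof. by case: z w => [a b] [c d]. Qed.

Lemma ImD z w : complex.Im (z + w) = complex.Im z + complex.Im w.
Proof. by case: z w => [a b] [c d]. Qed.

Lemma ReN z : complex.Re (- z) = - complex.Re z.
Proof. by case: z. Qed.

Lemma ImN z : complex.Im (- z) = - complex.Im z.
Proof. by case: z. Qed.

Definition cabs2 z : R := complex.Re z ^+ 2 + complex.Im z ^+ 2.

Lemma ReV z : complex.Re z^-1 = complex.Re z / cabs2 z.
Proof. by case: z => a b. Qed.

Lemma ImV z : complex.Im z^-1 = - complex.Im z / cabs2 z.
Proof. by case: z => a b; rewrite /= mulNr. Qed.

Lemma cabs2_ge0 z : 0 <= cabs2 z.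
Proof. by rewrite addr_ge0// sqr_ge0. Qed.

Lemma cabs2_gt0 z : z != 0 -> 0 < cabs2 z.
Proof.
move=> z0; rewrite lt_neqAle cabs2_ge0 andbT eq_sym paddr_eq0 ?sqr_ge0//.
by rewrite !sqrf_eq0; apply: contra z0; case: z => a b /= /andP[/eqP-> /eqP->].
Qed.

Definition cabs z : R := Num.sqrt (cabs2 z).

Lemma cabs_ge0 z : 0 <= cabs z.
Proof. exact: sqrtr_ge0. Qed.

Lemma cabsM z w : cabs (z * w) = cabs z * cabs w.
Proof.
rewrite /cabs -sqrtrM ?cabs2_ge0//; congr Num.sqrt.
by rewrite /cabs2 ReM ImM; ring.
Qed.

Lemma cabs_sqr z : cabs z ^+ 2 = cabs2 z.
Proof. by rewrite sqr_sqrtr// cabs2_ge0. Qed.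

Lemma cabs_gt0 z : z != 0 -> 0 < cabs z.
Proof. by move=> z0; rewrite sqrtr_gt0 cabs2_gt0. Qed.

Lemma cabs_ge_Re z : `|complex.Re z| <= cabs z.
Proof. by rewrite -sqrtr_sqr ler_sqrt ?cabs2_ge0// lerDl sqr_ge0. Qed.

Lemma cabs_ge_Im z : `|complex.Im z| <= cabs z.
Proof. by rewrite -sqrtr_sqr ler_sqrt ?cabs2_ge0// lerDr sqr_ge0. Qed.

Lemma cabs_le_ReIm z : cabs z <= `|complex.Re z| + `|complex.Im z|.
Proof.
rewrite -(@ler_pXn2r _ 2%N) ?nnegrE ?cabs_ge0 ?addr_ge0// cabs_sqr /cabs2.
rewrite -[complex.Re z ^+ 2]real_normK ?num_real// -[complex.Im z ^+ 2]real_normK ?num_real//.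
by have := mulr_ge0 (normr_ge0 (complex.Re z)) (normr_ge0 (complex.Im z)); nra.
Qed.

Lemma cabsD z w : cabs (z + w) <= cabs z + cabs w.
Proof.
rewrite -(@ler_pXn2r _ 2%N) ?nnegrE ?cabs_ge0 ?addr_ge0 ?cabs_ge0// sqrrD !cabs_sqr.
suff : complex.Re z * complex.Re w + complex.Im z * complex.Im w <= cabs z * cabs w.
  by rewrite /cabs2 ReD ImD; lra.
apply: le_trans (ler_norm _) _.
rewrite -(@ler_pXn2r _ 2%N) ?nnegrE ?mulr_ge0 ?cabs_ge0// exprMn !cabs_sqr real_normK ?num_real//.
have := sqr_ge0 (complex.Re z * complex.Im w - complex.Im z * complex.Re w).
by rewrite /cabs2; nra.
Qed.

Lemma cabsN z : cabs (- z) = cabs z.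
Proof. by rewrite /cabs /cabs2 ReN ImN !sqrrN. Qed.

Lemma cabsV z : cabs z^-1 = (cabs z)^-1.
Proof.
have [->|z0] := eqVneq z 0.
  by rewrite invr0 /cabs /cabs2 /= !expr0n addr0 sqrtr0 invr0.
have c0 := cabs_gt0 z0.
have cz : cabs z != 0 by rewrite gt_eqF.
apply: (mulfI cz).
rewrite -cabsM divff// divff ?gt_eqF//.
by rewrite /cabs /cabs2 /= expr1n expr0n addr0 sqrtr1.
Qed.

Lemma cabs_cexp z : cabs (cexp z) = expR (complex.Re z).
Proof.
case: z => a b; rewrite /cabs /cabs2 /cexp /= !exprMn -mulrDr cos2Dsin2 mulr1.
by rewrite sqrtr_sqr ger0_norm// expR_ge0.
Qed.

Lemma cabs_real (a : R) : cabs a%:C = `|a|.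
Proof. by rewrite /cabs /cabs2 /= expr0n addr0 sqrtr_sqr. Qed.

End complex_lemmas.

Section polar_holomorphic.
Context {R : realType}.
Implicit Types (F G : R -> R -> R[i]) (D E : R[i]) (r y : R).

(* The Cauchy-Riemann equations for a function of [r e^(iy)]; [D] is the
   partial derivative with respect to [r]. *)
Definition chol F D r y : Prop :=
  [/\ isder r (fun s => complex.Re (F s y)) (complex.Re D),
      isder r (fun s => complex.Im (F s y)) (complex.Im D),
      isder y (fun t => complex.Re (F r t)) (- (r * complex.Im D)) &
      isder y (fun t => complex.Im (F r t)) (r * complex.Re D)].

Lemma isder_eq (f : R -> R) x a b : isder x f a -> a = b -> isder x f b.
Proof. by move=> h <-. Qed.

Lemma isder_ext (f g : R -> R) x a : (forall z, f z = g z) -> isder x f a -> isder x g a.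
Proof. by move=> /funext ->. Qed.

Lemma chol_cst (c : R[i]) r y : chol (fun _ _ => c) 0 r y.
Proof.
split; rewrite /= ?mulr0 ?oppr0; exact: der_cst.
Qed.

Lemma cholD F G D E r y : chol F D r y -> chol G E r y ->
  chol (fun s t => F s t + G s t) (D + E) r y.
Proof.
move=> [f1 f2 f3 f4] [g1 g2 g3 g4]; split.
- by apply: isder_ext (isder_eq (derD f1 g1) _) => [z|]; rewrite ?ReD.
- by apply: isder_ext (isder_eq (derD f2 g2) _) => [z|]; rewrite ?ImD.
- by apply: isder_ext (isder_eq (derD f3 g3) _) => [z|]; rewrite ?ReD// ImD; ring.
- by apply: isder_ext (isder_eq (derD f4 g4) _) => [z|]; rewrite ?ImD// ReD; ring.
Qed.

Lemma cholN F D r y : chol F D r y -> chol (fun s t => - F s t) (- D) r y.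
Proof.
move=> [f1 f2 f3 f4]; split.
- by apply: isder_ext (isder_eq (derN f1) _) => [z|]; rewrite ?ReN.
- by apply: isder_ext (isder_eq (derN f2) _) => [z|]; rewrite ?ImN.
- by apply: isder_ext (isder_eq (derN f3) _) => [z|]; rewrite ?ReN// ImN; ring.
- by apply: isder_ext (isder_eq (derN f4) _) => [z|]; rewrite ?ImN// ReN; ring.
Qed.

Lemma cholM F G D E r y : chol F D r y -> chol G E r y ->
  chol (fun s t => F s t * G s t) (D * G r y + F r y * E) r y.
Proof.
move=> [f1 f2 f3 f4] [g1 g2 g3 g4]; split.
- apply: isder_ext (isder_eq (derD (derM f1 g1) (derN (derM f2 g2))) _) => [z|].
    by rewrite ReM.
  by rewrite ReD !ReM; ring.
- apply: isder_ext (isder_eq (derD (derM f1 g2) (derM f2 g1)) _) => [z|].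
    by rewrite ImM.
  by rewrite ImD !ImM; ring.
- apply: isder_ext (isder_eq (derD (derM f3 g3) (derN (derM f4 g4))) _) => [z|].
    by rewrite ReM.
  by rewrite ImD !ImM; ring.
- apply: isder_ext (isder_eq (derD (derM f3 g4) (derM f4 g3)) _) => [z|].
    by rewrite ImM.
  by rewrite ReD !ReM; ring.
Qed.

Lemma cholV F D r y : F r y != 0 -> chol F D r y ->
  chol (fun s t => (F s t)^-1) (- D / F r y ^+ 2) r y.
Proof.
move=> F0 [f1 f2 f3 f4]; have n0 := cabs2_gt0 F0.
have n1 : complex.Re (F r y) ^+ 2 + complex.Im (F r y) ^+ 2 != 0.
  by move: n0; rewrite /cabs2 => n0; rewrite gt_eqF.
have R1 : complex.Re (- D / F r y ^+ 2) = (- complex.Re D *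
   (complex.Re (F r y) ^+ 2 - complex.Im (F r y) ^+ 2)
   - 2 * complex.Im D * complex.Re (F r y) * complex.Im (F r y))
    / (complex.Re (F r y) ^+ 2 + complex.Im (F r y) ^+ 2) ^+ 2.
  rewrite -exprVn expr2 !(ReM, ImM, ReN, ImN, ReV, ImV) /cabs2; field.
  exact: n1.
have R2 : complex.Im (- D / F r y ^+ 2) = (- complex.Im D *
   (complex.Re (F r y) ^+ 2 - complex.Im (F r y) ^+ 2)
   + 2 * complex.Re D * complex.Re (F r y) * complex.Im (F r y))
    / (complex.Re (F r y) ^+ 2 + complex.Im (F r y) ^+ 2) ^+ 2.
  rewrite -exprVn expr2 !(ReM, ImM, ReN, ImN, ReV, ImV) /cabs2; field.
  exact: n1.
split.
- apply: isder_ext (isder_eq (derM f1 (derV _ (derD (derX 2 f1) (derX 2 f2)))) _) => [z||] /=.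
  + by rewrite ReV.
  + exact: n1.
  + by rewrite R1 /=; field.
- apply: isder_ext (isder_eq (derM (derN f2) (derV _ (derD (derX 2 f1) (derX 2 f2)))) _) => [z||] /=.
  + by rewrite ImV.
  + exact: n1.
  + by rewrite R2 /=; field.
- apply: isder_ext (isder_eq (derM f3 (derV _ (derD (derX 2 f3) (derX 2 f4)))) _) => [z||] /=.
  + by rewrite ReV.
  + exact: n1.
  + by rewrite R2 /=; field.
- apply: isder_ext (isder_eq (derM (derN f4) (derV _ (derD (derX 2 f3) (derX 2 f4)))) _) => [z||] /=.
  + by rewrite ImV.
  + exact: n1.
  + by rewrite R1 /=; field.
Qed.

Lemma Re_cexp (z : R[i]) : complex.Re (cexp z) = expR (complex.Re z) * cos (complex.Im z).
Proof. by []. Qed.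

Lemma Im_cexp (z : R[i]) : complex.Im (cexp z) = expR (complex.Re z) * sin (complex.Im z).
Proof. by []. Qed.

Lemma chol_cexp F D r y : chol F D r y ->
  chol (fun s t => cexp (F s t)) (cexp (F r y) * D) r y.
Proof.
move=> [f1 f2 f3 f4]; split.
- by apply: isder_ext (isder_eq (derM (der_exp f1) (der_cos f2)) _) => [z//|]; rewrite ReM Re_cexp Im_cexp; ring.
- by apply: isder_ext (isder_eq (derM (der_exp f1) (der_sin f2)) _) => [z//|]; rewrite ImM Re_cexp Im_cexp; ring.
- by apply: isder_ext (isder_eq (derM (der_exp f3) (der_cos f4)) _) => [z//|]; rewrite ImM Re_cexp Im_cexp; ring.
- by apply: isder_ext (isder_eq (derM (der_exp f3) (der_sin f4)) _) => [z//|]; rewrite ReM Re_cexp Im_cexp; ring.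
Qed.

(* The power [(r e^(iy))^a e^(ib)]. *)
Definition cpow (a b : R) r y : R[i] :=
  (r `^ a * cos (a * y + b)) +i* (r `^ a * sin (a * y + b)).

Lemma cabs_cpow a b r y : cabs (cpow a b r y) = r `^ a.
Proof.
rewrite /cabs /cabs2 /= !exprMn -mulrDr cos2Dsin2 mulr1 sqrtr_sqr ger0_norm//.
exact: powR_ge0.
Qed.

Lemma chol_cpow a b r y : 0 < r ->
  chol (cpow a b) ((a / r)%:C * cpow a b r y) r y.
Proof.
move=> r0; have r1 : r != 0 by rewrite gt_eqF.
have pw : r `^ (a - 1) = r `^ a / r.
  by rewrite powRD ?r1 ?implybT// powRN powRr1// ltW.
have d1 := derM (der_pow a r0 (der_id r)) (der_cst (cos (a * y + b)) r).
have d2 := derM (der_pow a r0 (der_id r)) (der_cst (sin (a * y + b)) r).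
have l := derD (derM (der_cst a y) (der_id y)) (der_cst b y).
have d3 := derM (der_cst (r `^ a) y) (der_cos l).
have d4 := derM (der_cst (r `^ a) y) (der_sin l).
split.
- by apply: (isder_eq d1); rewrite ReM/= pw; field.
- by apply: (isder_eq d2); rewrite ImM/= pw; field.
- by apply: (isder_eq d3); rewrite ImM/=; field.
- by apply: (isder_eq d4); rewrite ReM/=; field.
Qed.

(* [Log (1 + (r e^(iy) / K)^a)] along [y -> y + b]. *)
Definition clog1p (K b : R) r y : R[i] := La (r / K) (y + b) +i* Th (r / K) (y + b).

Lemma chol_clog1p K b r y : 0 < K -> 0 < r -> - pi < y + b < pi ->
  chol (clog1p K b)
   (((cos (y + b) + r / K) / (K * nrm2 (r / K) (y + b))) +i*
    (sin (y + b) / (K * nrm2 (r / K) (y + b)))) r y.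
Proof.
move=> K0 r0 yb; have x0 : 0 <= r / K by rewrite divr_ge0 ?ltW.
have K1 : K != 0 by rewrite gt_eqF.
have n0 : nrm2 (r / K) (y + b) != 0 by rewrite gt_eqF// nrm2_gt0.
have l : isder r (fun s => s / K) (1 / K).
  by apply: (isder_eq (derM (der_id r) (der_cst K^-1 r))); rewrite mulr0 addr0.
have m : isder y (fun t => t + b) (1 + 0) := derD (der_id y) (der_cst b y).
split=> /=.
- by apply: (isder_eq (@der_comp _ (fun x => La x (y + b)) (fun s => s / K) r _ _ (der_La_r x0 yb) l)); field; rewrite n0.
- by apply: (isder_eq (@der_comp _ (fun x => Th x (y + b)) (fun s => s / K) r _ _ (der_Th_r x0 yb) l)); field; rewrite n0.
- by apply: (isder_eq (@der_comp _ (La (r / K)) (fun t => t + b) y _ _ (der_La_t x0 yb) m)); field; rewrite n0.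
- by apply: (isder_eq (@der_comp _ (Th (r / K)) (fun t => t + b) y _ _ (der_Th_t x0 yb) m)); field; rewrite n0.
Qed.

Definition ccont (F : R -> R[i]) r : Prop :=
  {for r, continuous (fun s => complex.Re (F s))} /\
  {for r, continuous (fun s => complex.Im (F s))}.

Lemma chol_ccont F D r y : chol F D r y -> ccont (F ^~ y) r.
Proof. by move=> [f1 f2 _ _]; split; [exact: der_cont f1|exact: der_cont f2]. Qed.

Lemma ccont_ext (f g : R -> R[i]) r : (forall s, f s = g s) -> ccont f r -> ccont g r.
Proof. by move=> /funext ->. Qed.

Lemma ccont_cst (c : R[i]) r : ccont (fun=> c) r.
Proof. by split; exact: cvg_cst. Qed.

Lemma ccontD (f g : R -> R[i]) r : ccont f r -> ccont g r -> ccont (fun s => f s + g s) r.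
Proof.
move=> [f1 f2] [g1 g2]; split.
  rewrite (_ : (fun s => complex.Re (f s + g s)) =
     fun s => complex.Re (f s) + complex.Re (g s)); first exact: continuousD.
  by apply/funext => s; rewrite ReD.
rewrite (_ : (fun s => complex.Im (f s + g s)) =
   fun s => complex.Im (f s) + complex.Im (g s)); first exact: continuousD.
by apply/funext => s; rewrite ImD.
Qed.

Lemma ccontN (f : R -> R[i]) r : ccont f r -> ccont (fun s => - f s) r.
Proof.
move=> [f1 f2]; split.
  rewrite (_ : (fun s => complex.Re (- f s)) = fun s => - complex.Re (f s)); first exact: continuousN.
  by apply/funext => s; rewrite ReN.
rewrite (_ : (fun s => complex.Im (- f s)) = fun s => - complex.Im (f s)); first exact: continuousN.
by apply/funext => s; rewrite ImN.
Qed.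

Lemma ccontM (f g : R -> R[i]) r : ccont f r -> ccont g r -> ccont (fun s => f s * g s) r.
Proof.
move=> [f1 f2] [g1 g2]; split.
  rewrite (_ : (fun s => complex.Re (f s * g s)) =
     fun s => complex.Re (f s) * complex.Re (g s) - complex.Im (f s) * complex.Im (g s)).
    by apply: continuousB; exact: continuousM.
  by apply/funext => s; rewrite ReM.
rewrite (_ : (fun s => complex.Im (f s * g s)) =
   fun s => complex.Re (f s) * complex.Im (g s) + complex.Im (f s) * complex.Re (g s)).
  by apply: continuousD; exact: continuousM.
by apply/funext => s; rewrite ImM.
Qed.

Notation mu := (@lebesgue_measure R).

(** Here U is the imaginary part: its angular derivative is r times the radial derivative of the
    real part, so the boundary terms are limits of real parts. *)
Lemma rotate_Im (F D : R -> R -> R[i]) (l u y0 y1 w0 w1 : R) :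
  l < y0 -> y0 < y1 -> y1 < u ->
  (forall r y, 0 < r -> l < y < u -> chol F (D r y) r y) ->
  (forall r y, 0 < r -> l < y < u -> ccont (D ^~ y) r) ->
  (forall a b, 0 < a -> exists M, forall r y, a <= r <= b -> l < y < u -> cabs (D r y) <= M) ->
  (forall e, 0 < e -> exists2 d, 0 < d &
     forall r y, 0 < r < d -> l < y < u -> `|complex.Re (F r y) - w0| <= e) ->
  (forall e, 0 < e -> exists d, forall r y, d < r -> l < y < u -> `|complex.Re (F r y) - w1| <= e) ->
  mu.-integrable `]0, +oo[ (EFin \o (fun r => complex.Im (F r y0) / r)) ->
  mu.-integrable `]0, +oo[ (EFin \o (fun r => complex.Im (F r y1) / r)) ->
  \int[mu]_(r in `]0, +oo[) (complex.Im (F r y1) / r) -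
  \int[mu]_(r in `]0, +oo[) (complex.Im (F r y0) / r) = (w1 - w0) * (y1 - y0).
Proof.
move=> ly0 y01 y1u hF cD bD W0 W1 i0 i1.
apply: (@rotate_ray _ (fun r y => complex.Im (F r y)) (fun r y => complex.Re (D r y))
   (fun r y => complex.Re (F r y)) l u) => //.
- by move=> r z r0 zI; have [] := hF r z r0 zI.
- by move=> r z r0 zI; have [] := hF r z r0 zI.
- by move=> r z r0 zI; have [] := chol_ccont (hF r z r0 zI).
- by move=> r z r0 zI; have [] := cD r z r0 zI.
- move=> a b a0; have [M MP] := bD a b a0; exists M => r z rI zI.
  exact: le_trans (cabs_ge_Re _) (MP r z rI zI).
Qed.

(** The previous rotation for i F, with both boundary terms zero. The two angles come in either
    order because the sign of rho - 1/2 decides the direction of rotation. *)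
Lemma rotate_Re0 (F D : R -> R -> R[i]) (l u y0 y1 : R) :
  l < y0 < u -> l < y1 < u ->
  (forall r y, 0 < r -> l < y < u -> chol F (D r y) r y) ->
  (forall r y, 0 < r -> l < y < u -> ccont (D ^~ y) r) ->
  (forall a b, 0 < a -> exists M, forall r y, a <= r <= b -> l < y < u -> cabs (D r y) <= M) ->
  (forall e, 0 < e -> exists2 d, 0 < d &
     forall r y, 0 < r < d -> l < y < u -> cabs (F r y) <= e) ->
  (forall e, 0 < e -> exists d, forall r y, d < r -> l < y < u -> cabs (F r y) <= e) ->
  mu.-integrable `]0, +oo[ (EFin \o (fun r => complex.Re (F r y0) / r)) ->
  mu.-integrable `]0, +oo[ (EFin \o (fun r => complex.Re (F r y1) / r)) ->
  \int[mu]_(r in `]0, +oo[) (complex.Re (F r y1) / r) =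
  \int[mu]_(r in `]0, +oo[) (complex.Re (F r y0) / r).
Proof.
wlog: y0 y1 / y0 < y1 => [H ly0 ly1 hF cD bD W0 W1 i0 i1|y01].
  have [y01|y10|->//] := ltgtP y0 y1; first exact: H.
  by apply/esym; exact: H.
move=> /andP[ly0 _] /andP[_ y1u] hF cD bD W0 W1 i0 i1.
apply/eqP; rewrite -subr_eq0; apply/eqP; rewrite -[RHS](mul0r (y1 - y0)) -[X in X * _](subr0 0).
apply: (@rotate_ray _ (fun r y => complex.Re (F r y)) (fun r y => - complex.Im (D r y))
   (fun r y => - complex.Im (F r y)) l u) => //.
- by move=> r z r0 zI; have [_ _ + _] := hF r z r0 zI; rewrite mulrN.
- by move=> r z r0 zI; have [_ h _ _] := hF r z r0 zI; exact: derN.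
- by move=> r z r0 zI; have [] := chol_ccont (hF r z r0 zI).
- by move=> r z r0 zI; have [_ h] := cD r z r0 zI; exact: continuousN.
- move=> a b a0; have [M MP] := bD a b a0; exists M => r z rI zI.
  by rewrite normrN; exact: le_trans (cabs_ge_Im _) (MP r z rI zI).
- move=> e e0; have [d d0 dP] := W0 e e0; exists d => // r y rI yI.
  by rewrite subr0 normrN; exact: le_trans (cabs_ge_Im _) (dP r y rI yI).
- move=> e e0; have [d dP] := W1 e e0; exists d => r y rI yI.
  by rewrite subr0 normrN; exact: le_trans (cabs_ge_Im _) (dP r y rI yI).
Qed.

End polar_holomorphic.

Local Close Scope complex_scope.

(** * Signed integrands and exceptional points *)

Section integration_complements.
Context {R : realType}.
Notation mu := (@lebesgue_measure R).

(** Integrability is assumed instead of a sign: monotone convergence gives way to dominated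
    convergence. *)
Lemma Lintegral_FTC_oy (a l0 l1 : R) (f F : R -> R) :
  mu.-integrable `]a, +oo[ (EFin \o f) ->
  (forall x, a < x -> {for x, continuous f}) ->
  (forall x, a < x -> isder x F (f x)) ->
  F x @[x --> a^'+] --> l0 -> F x @[x --> +oo] --> l1 ->
  \int[mu]_(x in `]a, +oo[) f x = l1 - l0.
Proof.
move=> fi cf dF Fa Fy.
pose s n : R := a + n.+1%:R^-1; pose e n : R := a + n.+2%:R.
have as_ n : a < s n by rewrite ltrDl.
have se n : s n < e n.
  rewrite ltrD2l; apply: (@le_lt_trans _ _ 1); last by rewrite ltr1n.
  by rewrite invf_le1// ler1n.
have dcvg : s n @[n --> \oo] --> a.
  by rewrite -[X in _ --> X]addr0; apply: cvgD; [exact: cvg_cst|exact: cvg_harmonic].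
pose I n : set R := `[s n, e n]%classic.
have sub n : I n `<=` `]a, +oo[%classic.
  by move=> x /=; rewrite /I /= !in_itv/= andbT => /andP[sx _]; exact: lt_le_trans sx.
have mf : measurable_fun (`]a, +oo[%classic : set R) f by exact: (integrable_mfun fi).
have cv : (\int[mu]_(x in I n) f x) @[n --> \oo] --> \int[mu]_(x in `]a, +oo[) f x.
  have -> : (fun n => \int[mu]_(r in I n) f r) =
      (fun n => \int[mu]_(r in `]a, +oo[) (f r * \1_(I n) r)).
    apply/funext => n; rewrite -[X in Rintegral _ X](setIidr (sub n)) Rintegral_mkcondr.
    by apply: eq_Lintegral => t _; rewrite patchE indicE; case: ifP => _; rewrite ?mulr1 ?mulr0.
  apply: (@Ldominated_cvg _ (fun r => `|f r|) _ _ f _ _ _ _ _).2 => //.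
  - by move=> n; apply: measurable_funM => //; apply: measurable_indic; exact: measurable_itv.
  - move=> x /=; rewrite in_itv/= andbT => ax.
    apply: cvg_near_cst; near=> n.
    rewrite indicE mem_set ?mulr1// /I /= in_itv/=; apply/andP; split.
      by apply: ltW; near: n; exact: (cvgr_lt a dcvg).
    rewrite -lerBlDl; apply: (@le_trans _ _ n%:R); last by rewrite ler_nat -addn2 leq_addr.
    by near: n; exact: nbhs_infty_ger.
  - exact: (integrable_norm fi).
  - move=> n x _; rewrite normrM ler_piMr// indicE.
    by case: (_ \in _); rewrite ?normr1 ?normr0.
have E n : \int[mu]_(x in I n) f x = F (e n) - F (s n).
  have dI x : x \in `[s n, e n] -> isder x F (f x).
    by rewrite in_itv/= => /andP[sx _]; apply: dF; exact: lt_le_trans sx.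
  rewrite /Rintegral (@continuous_FTC2 _ _ F _ _ (se n)) //.
  - apply: continuous_in_subspaceT => x /set_mem/=; rewrite in_itv/= => /andP[sx _].
    by apply: cf; exact: lt_le_trans sx.
  - split.
    + by move=> x xI; case: (dI x (subset_itv_oo_cc xI)).
    + apply: cvg_at_right_filter; apply: (@der_cont _ _ _ (f (s n))).
      by apply: dI; rewrite in_itv/= lexx ltW.
    + apply: cvg_at_left_filter; apply: (@der_cont _ _ _ (f (e n))).
      by apply: dI; rewrite in_itv/= lexx ltW.
  - move=> x xI; rewrite derive1E; apply: (@derive_val _ _ _ _ _ _ _ _).
    exact: (dI x (subset_itv_oo_cc xI)).
move: cv; under eq_fun do rewrite E; move=> cv; apply: (cvg_unique _ cv) => //.
apply: cvgB.
  move: Fy => /cvg_pinftyP; apply.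
  apply/cvgryPge => A; near=> n.
  have h : A - a <= n%:R by near: n; exact: nbhs_infty_ger.
  apply: (@le_trans _ _ (a + n%:R)); first by rewrite -lerBlDl.
  by rewrite /e lerD2l ler_nat -addn2 leq_addr.
by move: Fa => /cvg_at_rightP; apply; split.
Unshelve. all: by end_near. Qed.

(** The point [u] is meant for the singularity of a logarithm, where the convention ln 0 = 0 breaks
    the pointwise estimates. *)
Lemma le_Lint_except (g : R -> R) (u : R) (D : set R) (f : R -> R) :
  measurable D -> measurable_fun D f ->
  (forall x, D x -> x != u -> `|f x| <= g x) ->
  mu.-integrable D (EFin \o g) -> mu.-integrable D (EFin \o f).
Proof.
move=> mD mf fg gi.
have m1 : measurable [set u] by exact: measurable_set1.
have mDu : measurable (D `\` [set u]) by exact: measurableD.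
have sub : D `\` [set u] `<=` D by exact: subDsetl.
have i1 : mu.-integrable (D `\` [set u]) (EFin \o f).
  apply: (@le_Lint _ g) => //.
  - exact: measurable_funS mf.
  - by move=> x [Dx xu]; apply: fg => //; apply/eqP.
  - exact: integrableS gi.
have mDI : measurable (D `&` [set u]) by exact: measurableI.
have i2 : mu.-integrable (D `&` [set u]) (EFin \o f).
  apply/integrableP; split; first by apply/measurable_EFinP; apply: measurable_funS mf.
  by rewrite (integral_Sset1 u).
have -> : D = (D `\` [set u]) `|` (D `&` [set u]) by rewrite setUC setUIDK.
exact: integrable_setUr.
Qed.

Lemma Lintegral_except (u : R) (D : set R) (f : R -> R) : measurable D ->
  measurable_fun D f ->
  \int[mu]_(x in D `\` [set u]) f x = \int[mu]_(x in D) f x.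
Proof.
move=> mD mf; congr fine; apply: integral_setD1.
  by apply: measurableD => //; exact: measurable_set1.
apply/measurable_EFinP; apply: measurable_funS mf => //; exact: subDsetl.
Qed.

Lemma Ldominated_cvg_except (g : R -> R) (u : R) (D : set R) (f_ : nat -> R -> R) (f : R -> R) :
  measurable D -> (forall n, measurable_fun D (f_ n)) -> measurable_fun D f ->
  (forall x, D x -> x != u -> f_ ^~ x @ \oo --> f x) ->
  mu.-integrable D (EFin \o g) ->
  (forall n x, D x -> x != u -> `|f_ n x| <= g x) ->
  mu.-integrable D (EFin \o f) /\
  (\int[mu]_(x in D) f_ n x) @[n --> \oo] --> \int[mu]_(x in D) f x.
Proof.
move=> mD mf_ mf ff gi fg.
have mDu : measurable (D `\` [set u]) by apply: measurableD => //; exact: measurable_set1.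
have sub : D `\` [set u] `<=` D by exact: subDsetl.
have [i1 c1] : mu.-integrable (D `\` [set u]) (EFin \o f) /\
  (\int[mu]_(x in D `\` [set u]) f_ n x) @[n --> \oo] --> \int[mu]_(x in D `\` [set u]) f x.
  apply: (@Ldominated_cvg _ g) => //.
  - by move=> n; apply: measurable_funS (mf_ n).
  - by move=> x [Dx xu]; apply: ff => //; apply/eqP.
  - exact: integrableS gi.
  - by move=> n x [Dx xu]; apply: fg => //; apply/eqP.
split.
  apply: (@le_Lint_except g u) => // x Dx xu.
  rewrite -(cvg_lim _ (cvg_norm (ff x Dx xu)))//; apply: limr_le.
    by apply: is_cvg_norm; apply/cvg_ex; exists (f x); exact: ff.
  by apply: nearW => n; exact: fg.
rewrite -(Lintegral_except u mD mf).
by under eq_fun do rewrite -(Lintegral_except u mD (mf_ _)).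
Qed.

(** A positive value would persist, by continuity, on an interval, which [laplace_no_interval]
    excludes; the same applies to [- D]. *)
Lemma laplace_zero (D : R -> R) (M : R) (t : R) :
  (forall t, 0 < t -> {for t, continuous D}) ->
  (forall t, 0 < t -> `|D t| <= M) ->
  (forall n, \int[mu]_(t in `]0, +oo[) (D t * expR (- (n.+1%:R * t))) = 0) ->
  0 < t -> D t = 0.
Proof.
have oI : open (`]0, +oo[%classic : set R) by exact: interval_open.
have key (E : R -> R) : (forall t, 0 < t -> {for t, continuous E}) ->
    (forall t, 0 < t -> `|E t| <= M) ->
    (forall n, \int[mu]_(t in `]0, +oo[) (E t * expR (- (n.+1%:R * t))) = 0) ->
    0 < t -> E t <= 0.
  move=> cE EM E0 t0; rewrite leNgt; apply/negP => Et.
  have mE : measurable_fun (`]0, +oo[%classic : set R) E.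
    by apply: open_cont_mfun => // x; rewrite /= in_itv/= andbT => /cE.
  have e0 : 0 < E t / 2 by rewrite divr_gt0.
  have /cvgrPdist_lt/(_ _ e0) := cE t t0.
  move=> /nbhs_ballP[d /= d0 dP].
  pose d' := Num.min (d / 2) t.
  have d'0 : 0 < d' by rewrite lt_min divr_gt0.
  have d't : d' <= t by rewrite ge_min lexx orbT.
  have d'd : d' <= d / 2 by rewrite ge_min lexx.
  apply: (@laplace_no_interval R E M (E t / 2) (t - d') (t + d')) => //.
  - by rewrite subr_ge0.
  - by rewrite ltrD2l gtrN.
  - move=> x /andP[x1 x2].
    have : `|E t - E x| < E t / 2.
      apply: dP; rewrite /ball/= ltr_norml; apply/andP; split; lra.
    by rewrite ltr_norml => /andP[_ h]; lra.
move=> cD DM D0 t0; apply/eqP; rewrite eq_le key//= -oppr_le0.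
apply: (key (fun t => - D t)) => //.
- by move=> x x0; apply: continuousN; exact: cD.
- by move=> x x0; rewrite normrN DM.
- move=> n; transitivity (-1 * \int[mu]_(t in `]0, +oo[) (D t * expR (- (n.+1%:R * t)))).
    rewrite -LintegralZ//; first by apply: eq_Lintegral => x _; ring.
  have [i _] := @integrable_expN R n.+1%:R (ltr0Sn _ _).
  apply: (@le_Lint _ (fun t => M * expR (- (n.+1%:R * t)))) => //.
  - apply: measurable_funM; last exact: (integrable_mfun i).
    by apply: open_cont_mfun => // x; rewrite /= in_itv/= andbT => /cD.
  - move=> x; rewrite /= in_itv/= andbT => x0.
    by rewrite normrM (ger0_norm (expR_ge0 _)) ler_pM2r ?expR_gt0// DM.
  - exact: LintZ.
by rewrite D0 mulr0.
Qed.

End integration_complements.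

Local Open Scope complex_scope.
Local Open Scope ring_scope.

(** * Boundedness over annular sectors *)

Section bounded_complex.
Context {R : realType}.
Implicit Types (Z : R -> R -> Prop) (F G : R -> R -> R[i]).

Definition cbd Z F : Prop := exists M, forall r y, Z r y -> cabs (F r y) <= M.

Lemma cbd_cst Z (c : R[i]) : cbd Z (fun _ _ => c).
Proof. by exists (cabs c). Qed.

Lemma cbdD Z F G : cbd Z F -> cbd Z G -> cbd Z (fun r y => F r y + G r y).
Proof.
move=> [M FM] [N GN]; exists (M + N) => r y ry.
by apply: le_trans (cabsD _ _) _; rewrite lerD ?FM ?GN.
Qed.

Lemma cbdN Z F : cbd Z F -> cbd Z (fun r y => - F r y).
Proof. by move=> [M FM]; exists M => r y ry; rewrite cabsN FM. Qed.

Lemma cbdM Z F G : cbd Z F -> cbd Z G -> cbd Z (fun r y => F r y * G r y).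
Proof.
move=> [M FM] [N GN]; exists (M * N) => r y ry.
by rewrite cabsM ler_pM ?cabs_ge0 ?FM ?GN.
Qed.

Lemma cbdV Z F m : 0 < m -> (forall r y, Z r y -> m <= cabs (F r y)) ->
  cbd Z (fun r y => (F r y)^-1).
Proof.
move=> m0 mF; exists m^-1 => r y ry; rewrite cabsV lef_pV2 ?mF// posrE//.
by rewrite (lt_le_trans m0)// mF.
Qed.

Lemma cbd_ReIm Z F M : (forall r y, Z r y ->
  `|complex.Re (F r y)| <= M /\ `|complex.Im (F r y)| <= M) -> cbd Z F.
Proof.
move=> h; exists (M + M) => r y /h[h1 h2].
by apply: le_trans (cabs_le_ReIm _) _; rewrite lerD.
Qed.

Lemma cbd_cpow a b (r1 r2 l u : R) : 0 < r1 ->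
  cbd (fun r y => r1 <= r <= r2 /\ l < y < u) (cpow a b).
Proof.
move=> r10; exists (r1 `^ a + r2 `^ a) => r y [/andP[h1 h2] _].
have r0 : 0 < r by exact: lt_le_trans h1.
have r20 : 0 < r2 by exact: lt_le_trans h2.
rewrite cabs_cpow; have p1 := powR_ge0 r1 a; have p2 := powR_ge0 r2 a.
case: (leP 0 a) => a0.
  suff : r `^ a <= r2 `^ a by lra.
  by apply: ge0_ler_powR => //; rewrite nnegrE ltW.
suff : r `^ a <= r1 `^ a by lra.
rewrite -[a]opprK powRN [leRHS]powRN lef_pV2 ?posrE ?powR_gt0//.
by apply: ge0_ler_powR => //; rewrite ?nnegrE ?oppr_ge0 ltW.
Qed.

(** [wC] is stated for an angle of the form rho pi, so [tau] enters as [tau / pi]. Every estimate in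
    a closed subsector of |t| < pi rests on this lower bound. *)
Lemma nrm2_lower_angle (r t tau : R) : 0 <= r -> 0 < tau < pi -> - tau < t < tau ->
  1 + r ^+ 2 <= wC (tau / pi) * nrm2 r t /\ 0 < wC (tau / pi).
Proof.
move=> r0 /andP[t0 tpi] /andP[h1 h2].
have pi0 := @pi_gt0 R.
have I : 0 < tau / pi < 1 by rewrite divr_gt0//= ltr_pdivrMr// mul1r.
split; last exact: wC_gt0.
apply: nrm2_lower => //; rewrite mulfVK ?gt_eqF// -(cos_norm t).
have ht : `|t| < tau by rewrite ltr_norml h1.
have tI : tau \in `[0, pi] by rewrite in_itv/= (ltW t0) (ltW tpi).
have aI : `|t| \in `[0, pi] by rewrite in_itv/= normr_ge0 (le_trans (ltW ht)) ?(ltW tpi).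
by apply: ltW; rewrite ltr_cos.
Qed.

Lemma cabs_1Dcpow (r y : R) : 0 <= r -> cabs (1 + cpow 1 0 r y) = Num.sqrt (nrm2 r y).
Proof.
move=> r0; rewrite /cabs /cabs2 ReD ImD /= !mul1r !addr0 add0r !powRr1//.
congr Num.sqrt; rewrite /nrm2.
have -> : r ^+ 2 = r ^+ 2 * (cos y ^+ 2 + sin y ^+ 2) by rewrite cos2Dsin2 mulr1.
ring.
Qed.

Lemma ln1p_sublinear (e K C : R) : 0 < e -> 0 < K ->
  exists2 d : R, 0 < d & forall r : R, d < r -> ln (1 + r / K) + C <= e * r.
Proof.
(* Dividing by [A] before applying ln x <= x - 1 leaves a linear term of slope e / 2, so that the
   other half of the slope absorbs the constants. *)
move=> e0 K0; pose A := 2 / (e * K).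
have A0 : 0 < A by rewrite divr_gt0// mulr_gt0.
pose B := `|e * K / 2 + ln A + C|.
have B0 : 0 <= B by exact: normr_ge0.
have d0 : 0 < 2 * B / e + 1.
  by rewrite ltr_wpDl// divr_ge0// ?(ltW e0)// mulr_ge0.
exists (2 * B / e + 1) => // r rd.
have r0 : 0 < r by exact: lt_trans rd.
have p0 : 0 < 1 + r / K by rewrite ltr_pwDl// divr_ge0// ltW.
have := @ln_le_sub1 R ((1 + r / K) / A) (divr_gt0 p0 A0).
rewrite ln_div ?posrE// => h.
have E : (1 + r / K) / A = e * K / 2 + e * r / 2 by rewrite /A; field; rewrite !gt_eqF.
have : 2 * B < e * r.
  rewrite [ltRHS]mulrC -ltr_pdivrMr//; lra.
have := ler_norm (e * K / 2 + ln A + C); rewrite -/B; rewrite E in h; lra.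
Qed.

End bounded_complex.

Local Close Scope complex_scope.

Section lebesgue_fubini.
Context {R : realType}.
Notation mu := (@lebesgue_measure R).

Lemma Lfubini (D1 D2 : set R) (f : R -> R -> R) (b : R -> R) :
  measurable D1 -> measurable D2 ->
  measurable_fun (D1 `*` D2) (fun p : R * R => f p.1 p.2) ->
  (forall x, D1 x -> mu.-integrable D2 (EFin \o f x)) ->
  (forall y, D2 y -> mu.-integrable D1 (EFin \o f ^~ y)) ->
  (forall y, D2 y -> \int[mu]_(x in D1) `|f x y| <= b y) ->
  mu.-integrable D2 (EFin \o b) ->
  [/\ mu.-integrable D1 (EFin \o (fun x => \int[mu]_(y in D2) f x y)),
      mu.-integrable D2 (EFin \o (fun y => \int[mu]_(x in D1) f x y)) &
   \int[mu]_(x in D1) \int[mu]_(y in D2) f x y =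
   \int[mu]_(y in D2) \int[mu]_(x in D1) f x y].
Proof. by move=> m1 m2 mf; exact: (@Rfubini _ _ _ _ _ mu mu D1 D2 f b m1 m2 mf). Qed.

Lemma RLfubini d (T : measurableType d) (P : {sigma_finite_measure set T -> \bar R})
    (D1 : set T) (D2 : set R) (f : T -> R -> R) (b : R -> R) :
  measurable D1 -> measurable D2 ->
  measurable_fun (D1 `*` D2) (fun p : T * R => f p.1 p.2) ->
  (forall x, D1 x -> mu.-integrable D2 (EFin \o f x)) ->
  (forall y, D2 y -> P.-integrable D1 (EFin \o f ^~ y)) ->
  (forall y, D2 y -> \int[P]_(x in D1) `|f x y| <= b y) ->
  mu.-integrable D2 (EFin \o b) ->
  [/\ P.-integrable D1 (EFin \o (fun x => \int[mu]_(y in D2) f x y)),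
      mu.-integrable D2 (EFin \o (fun y => \int[P]_(x in D1) f x y)) &
   \int[P]_(x in D1) \int[mu]_(y in D2) f x y =
   \int[mu]_(y in D2) \int[P]_(x in D1) f x y].
Proof. by move=> m1 m2 mf; exact: (@Rfubini _ _ _ _ _ P mu D1 D2 f b m1 m2 mf). Qed.

End lebesgue_fubini.

(** * The expectation of 1 - exp(-Y^+) *)

Section kernel.
Context {R : realType}.
Notation mu := (@lebesgue_measure R).
Implicit Types (x th e p : R) (n : nat).

Lemma norm_sin_le (z : R) : `|sin z| <= `|z|.
Proof.
wlog z0 : z / 0 <= z => [H|].
  case: (leP 0 z) => [|z0]; first exact: H.
  by rewrite -normrN -sinN -(normrN z) H// oppr_ge0 ltW.
rewrite (ger0_norm z0); move: z0; rewrite le_eqVlt => /orP[/eqP <-|z0]; first by rewrite sin0 normr0.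
have [|c _] := @MVT R sin cos 0 z z0.
  by apply: continuous_in_subspaceT => x _; exact: continuous_sin.
rewrite sin0 !subr0 => ->; rewrite normrM (gtr0_norm z0) ler_piMl ?(ltW z0)//.
by rewrite ler_norml cos_geN1 cos_le1.
Qed.

(** For [e = 1] this is the real part of (1 - e^(i th x)) / (th (th - i)). The sign [e] separates
    the two halves of the line: reflecting [x] changes only the sine term. *)
Definition kf e x th : R :=
  (1 - cos (th * x)) / (1 + th ^+ 2) + e * (sin (th * x) / (th * (1 + th ^+ 2))).

Lemma kf_le e x th : 0 < th -> `|kf e x th| <= (2 + `|e| * `|x|) * (1 + th ^+ 2)^-1.
Proof.
move=> t0; have p0 : 0 < 1 + th ^+ 2 by rewrite ltr_pwDl// sqr_ge0.
have q0 : 0 < (1 + th ^+ 2)^-1 by rewrite invr_gt0.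
have c1 := cos_le1 (th * x); have c2 := cos_geN1 (th * x).
rewrite mulrDl; apply: le_trans (ler_normD _ _) _; apply: lerD.
  by rewrite normrM [X in _ * X]gtr0_norm// ler_pM2r// ger0_norm; lra.
rewrite normrM -mulrA ler_wpM2l// invfM mulrA normrM [X in _ * X]gtr0_norm// ler_pM2r//.
rewrite normrM [X in _ * X]gtr0_norm ?invr_gt0// ler_pdivrMr//.
by apply: le_trans (norm_sin_le _) _; rewrite normrM (gtr0_norm t0) mulrC.
Qed.

Lemma measurable_kf e x (D : set R) : measurable_fun D (kf e x).
Proof. by rewrite /kf; meas. Qed.

Lemma integrable_kf e x : mu.-integrable `]0, +oo[ (EFin \o kf e x).
Proof.
apply: (@le_Lint _ (fun th => (2 + `|e| * `|x|) * (1 + th ^+ 2)^-1)) => //.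
- exact: measurable_kf.
- by move=> th; rewrite /= in_itv/= andbT; exact: kf_le.
- by apply: LintZ => //; exact: integrable_arctan.1.
Qed.

Definition kk e x : R := \int[mu]_(th in `]0, +oo[) kf e x th.

Lemma kk_le e x : `|kk e x| <= (2 + `|e| * `|x|) * (pi / 2).
Proof.
apply: (@le_trans _ _ (\int[mu]_(th in `]0, +oo[) `|kf e x th|)).
  by apply: le_normr_Rintegral => //; exact: integrable_kf.
rewrite -(integrable_arctan).2 -LintegralZ//; last exact: integrable_arctan.1.
apply: ler_Lint => //.
- exact: (integrable_norm (integrable_kf e x)).
- by apply: LintZ => //; exact: integrable_arctan.1.
- by move=> th; rewrite /= in_itv/= andbT; exact: kf_le.
Qed.

Lemma kk_cont e x : 0 < x -> {for x, continuous (kk e)}.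
Proof.
move=> x0; pose G th := (2 + `|e| * `|2 * x|) * (1 + th ^+ 2)^-1.
have m0y : measurable (`]0, +oo[%classic : set R) by [].
have h1 z : (`]0, 2 * x[%classic : set R) z -> mu.-integrable `]0, +oo[ (EFin \o kf e z).
  by move=> _; exact: integrable_kf.
have h2 : \forall y \ae mu, (`]0, +oo[%classic : set R) y -> {in `]0, 2 * x[%classic, continuous (kf e ^~ y)}.
  apply: aeW => y; rewrite /= in_itv/= andbT => y0 z _.
  have p0 : 1 + y ^+ 2 != 0 by rewrite gt_eqF// ltr_pwDl// sqr_ge0.
  by rewrite /kf; dcont.
have h3 : mu.-integrable `]0, +oo[ (EFin \o G).
  by apply: LintZ => //; exact: integrable_arctan.1.
have h4 z : (`]0, 2 * x[%classic : set R) z -> \forall y \ae mu, (`]0, +oo[%classic : set R) y -> `|kf e z y| <= G y.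
  rewrite /= in_itv/= => /andP[z0 z2]; apply: aeW => y; rewrite /= in_itv/= andbT => y0.
  apply: le_trans (kf_le e z y0) _.
  rewrite ler_wpM2r ?invr_ge0 ?addr_ge0 ?sqr_ge0// lerD2l ler_wpM2l//.
  by rewrite !ger0_norm ?ltW// mulr_gt0.
have := @continuity_under_integral R _ _ mu (kf e) _ m0y 0 (2 * x) h1 h2 G h3 h4 x.
by apply; rewrite inE /= in_itv/=; lra.
Qed.

Lemma cvgy_expN p : 0 < p -> expR (- (p * x)) @[x --> +oo] --> (0 : R).
Proof.
move=> p0; apply/cvgr0Pnorm_le => e e0; near=> x.
rewrite ger0_norm ?expR_ge0// -[leRHS]lnK ?posrE// ler_expR lerNl -ler_pdivrMl//.
Unshelve. all: by end_near. Qed.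

Lemma laplace_trig A B th p : 0 < p ->
  mu.-integrable `]0, +oo[ (EFin \o (fun x => expR (- (p * x)) * (A * (1 - cos (th * x)) + B * sin (th * x)))) /\
  \int[mu]_(x in `]0, +oo[) (expR (- (p * x)) * (A * (1 - cos (th * x)) + B * sin (th * x))) =
  A * (p^-1 - p / (p ^+ 2 + th ^+ 2)) + B * (th / (p ^+ 2 + th ^+ 2)).
Proof.
move=> p0; have q0 : 0 < p ^+ 2 + th ^+ 2 by rewrite ltr_pwDl ?sqr_ge0// exprn_gt0.
pose F x := expR (- (p * x)) * (A * (- p^-1 + (p * cos (th * x) - th * sin (th * x)) / (p ^+ 2 + th ^+ 2))
   - B * ((p * sin (th * x) + th * cos (th * x)) / (p ^+ 2 + th ^+ 2))).
pose f x := expR (- (p * x)) * (A * (1 - cos (th * x)) + B * sin (th * x)).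
have bd x : `|A * (1 - cos (th * x)) + B * sin (th * x)| <= 2 * `|A| + `|B|.
  have c1 := cos_le1 (th * x); have c2 := cos_geN1 (th * x).
  apply: le_trans (ler_normD _ _) _; rewrite !normrM; apply: lerD.
    by rewrite mulrC ler_wpM2r// ger0_norm; lra.
  by rewrite ler_piMr// ler_norml sin_geN1 sin_le1.
have fi : mu.-integrable `]0, +oo[ (EFin \o f).
  apply: (@le_Lint _ (fun x => (2 * `|A| + `|B|) * expR (- (p * x)))) => //.
  - by rewrite /f; meas.
  - by move=> x _; rewrite normrM mulrC (ger0_norm (expR_ge0 _)) ler_wpM2r ?expR_ge0.
  - by apply: LintZ => //; exact: (integrable_expN p0).1.
split=> //.
have d x : isder x F (f x).
  rewrite /F /f; der; field; rewrite !gt_eqF//.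
rewrite (@Lintegral_FTC_oy _ 0 (F 0) 0 f F) ?sub0r//.
- by rewrite /F !mulr0 oppr0 expR0 sin0 cos0; field; rewrite !gt_eqF.
- by move=> x _; rewrite /f; dcont.
- by apply: cont_at_right (der_cont (d 0)) _.
- pose C : R := `|A| * (p^-1 + (p + `|th|) / (p ^+ 2 + th ^+ 2)) + `|B| * ((p + `|th|) / (p ^+ 2 + th ^+ 2)).
  have FC x : `|F x| <= expR (- (p * x)) * C.
    have sn : `|sin (th * x)| <= 1 by rewrite ler_norml sin_geN1 sin_le1.
    have cn : `|cos (th * x)| <= 1 by rewrite ler_norml cos_geN1 cos_le1.
    have k (a b : R) : `|a| <= 1 -> `|b| <= 1 -> `|(p * a + th * b) / (p ^+ 2 + th ^+ 2)| <= (p + `|th|) / (p ^+ 2 + th ^+ 2).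
      move=> a1 b1; rewrite normrM [X in _ * X]gtr0_norm ?invr_gt0// ler_pM2r ?invr_gt0//.
      apply: le_trans (ler_normD _ _) _; rewrite !normrM (gtr0_norm p0) lerD//.
        by rewrite ler_piMr// ltW.
      by rewrite ler_piMr.
    rewrite normrM (ger0_norm (expR_ge0 _)) ler_wpM2l ?expR_ge0//.
    apply: le_trans (ler_normB _ _) _; rewrite !normrM lerD// ?ler_wpM2l//.
      apply: le_trans (ler_normD _ _) _; rewrite normrN gtr0_norm ?invr_gt0// lerD2l.
      by rewrite -mulrN; apply: k => //; rewrite normrN.
    by rewrite -normrM; apply: k.
  have c0 : expR (- (p * x)) * C @[x --> +oo] --> (0 : R).
    by rewrite -(mul0r C); apply: cvgM; [exact: cvgy_expN|exact: cvg_cst].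
  apply: (@squeeze_cvgr _ _ _ _ (fun x => - (expR (- (p * x)) * C)) (fun x => expR (- (p * x)) * C)) => //.
    by apply: nearW => x; rewrite -ler_norml.
  by rewrite -oppr0; exact: cvgN.
Qed.

Lemma integrable_arctan_p p : 0 < p -> mu.-integrable `]0, +oo[ (EFin \o (fun th => (p ^+ 2 + th ^+ 2)^-1)) /\
  \int[mu]_(th in `]0, +oo[) (p ^+ 2 + th ^+ 2)^-1 = pi / 2 / p.
Proof.
move=> p0; rewrite -[X in _ /\ _ = X]subr0.
have q0 (x : R) : 0 < p ^+ 2 + x ^+ 2 by rewrite ltr_pwDl ?sqr_ge0// exprn_gt0.
have d x : isder x (fun x => atan (x / p) / p) (p ^+ 2 + x ^+ 2)^-1.
  have h : 1 + (x / p) ^+ 2 != 0 by rewrite gt_eqF// ltr_pwDl// sqr_ge0.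
  der => //.
  rewrite expr_div_n; field; rewrite !gt_eqF//.
apply: (@ge0_FTC_oy _ 0 0 (pi / 2 / p) _ (fun x => atan (x / p) / p)) => //.
- by move=> x _; dcont; rewrite gt_eqF.
- by move=> x _; rewrite invr_ge0 ltW.
- by apply: cont_at_right (der_cont (d 0)) _; rewrite mul0r atan0 mul0r.
- apply: cvgM; last exact: cvg_cst.
  apply: (@cvg_comp _ _ _ (fun x => x / p) atan _ +oo); last exact: cvgy_atan.
  apply/cvgryPge => A; near=> x.
  by rewrite ler_pdivlMr//; near: x; apply: nbhs_pinfty_ge; rewrite num_real.
Unshelve. all: by end_near. Qed.

(** Partial fractions; [1 < p] keeps the two quadratic factors distinct. *)
Lemma pfrac_int p e : 1 < p ->
  mu.-integrable `]0, +oo[ (EFin \o (fun th => (th ^+ 2 / p + e) / ((p ^+ 2 + th ^+ 2) * (1 + th ^+ 2)))) /\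
  \int[mu]_(th in `]0, +oo[) ((th ^+ 2 / p + e) / ((p ^+ 2 + th ^+ 2) * (1 + th ^+ 2))) =
  pi / 2 * (1 + e) / (p * (p + 1)).
Proof.
move=> p1; have p0 : 0 < p by lra.
have [i1 e1] := @integrable_arctan R; have [i2 e2] := integrable_arctan_p p0.
have p2 : p ^+ 2 - 1 != 0 by rewrite gt_eqF//; nra.
pose a := (e - p^-1) / (p ^+ 2 - 1); pose b := (p - e) / (p ^+ 2 - 1).
have E th : (`]0, +oo[%classic : set R) th -> a * (1 + th ^+ 2)^-1 + b * (p ^+ 2 + th ^+ 2)^-1 =
    (th ^+ 2 / p + e) / ((p ^+ 2 + th ^+ 2) * (1 + th ^+ 2)).
  move=> _; have h1 : 1 + th ^+ 2 != 0 by rewrite gt_eqF// ltr_pwDl// sqr_ge0.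
  have h2 : p ^+ 2 + th ^+ 2 != 0 by rewrite gt_eqF// ltr_pwDl ?sqr_ge0// exprn_gt0.
  by rewrite /a /b; field; rewrite h1 h2 p2 gt_eqF.
have j1 := LintZ a (measurable_itv _) i1; have j2 := LintZ b (measurable_itv _) i2.
split; first by apply: (eq_Lint _ E) => //; exact: LintD.
rewrite -(eq_Lintegral E) LintegralD// !LintegralZ// e1 e2 /a /b.
have h3 : p + 1 != 0 by rewrite gt_eqF//; lra.
have gen (q : R) : (e - p^-1) / (p ^+ 2 - 1) * (q / 2) + (p - e) / (p ^+ 2 - 1) * (q / 2 / p) =
  q / 2 * (1 + e) / (p * (p + 1)).
  by field; rewrite h3 p2 gt_eqF.
exact: gen.
Qed.

(** Fubini and [laplace_trig] reduce the transform to a rational integral. The condition [3 <= p]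
    leaves room to bound x exp (- p x) by exp (- 2 x), whose integral is explicit. *)
Lemma laplace_kk e p : 3 <= p ->
  \int[mu]_(x in `]0, +oo[) (expR (- (p * x)) * kk e x) = pi / 2 * (1 + e) / (p * (p + 1)).
Proof.
move=> p3; have p0 : 0 < p by lra.
have p1 : 1 < p by lra.
have m0y : measurable (`]0, +oo[%classic : set R) by [].
pose f x th := expR (- (p * x)) * kf e x th.
have E x th : f x th = expR (- (p * x)) *
    ((1 + th ^+ 2)^-1 * (1 - cos (th * x)) + e / (th * (1 + th ^+ 2)) * sin (th * x)).
  by rewrite /f /kf; ring.
have xe x : 0 < x -> x * expR (- (p * x)) <= expR (- (2 * x)).
  move=> x0; have h := @expR_ge1Dx R x.
  have -> : - (2 * x) = x + - (3 * x) by ring.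
  have h1 : expR (- (p * x)) <= expR (- (3 * x)) by rewrite ler_expR; nra.
  have h2 : x <= expR x by lra.
  by rewrite expRD; apply: ler_pM => //; exact: ltW.
pose b th := (2 * p^-1 + `|e| * 2^-1) * (1 + th ^+ 2)^-1.
have fi th : 0 < th -> mu.-integrable `]0, +oo[ (EFin \o f ^~ th).
  move=> th0; have [i _] := laplace_trig (1 + th ^+ 2)^-1 (e / (th * (1 + th ^+ 2))) th p0.
  by apply: eq_Lint i => // x _; rewrite E.
have [ip ep] := integrable_expN p0; have [i2 e2] := @integrable_expN R 2 ltac:(lra).
have [|||||_ _ fub] := @Lfubini R `]0, +oo[ `]0, +oo[ f b m0y m0y.
- apply: (measurable_funS measurableT) => //.
  have f1 : measurable_fun setT (fun q : R * R => q.1) by exact: measurable_fst.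
  have f2 : measurable_fun setT (fun q : R * R => q.2) by exact: measurable_snd.
  by rewrite /f /kf; meas.
- by move=> x _; apply: LintZ => //; exact: integrable_kf.
- by move=> th; rewrite /= in_itv/= andbT; exact: fi.
- move=> th; rewrite /= in_itv/= andbT => th0; rewrite /b.
  have q0 : 0 <= (1 + th ^+ 2)^-1 by rewrite invr_ge0 addr_ge0// sqr_ge0.
  have -> : (2 * p^-1 + `|e| * 2^-1) * (1 + th ^+ 2)^-1 =
    2 * (1 + th ^+ 2)^-1 * p^-1 + `|e| * (1 + th ^+ 2)^-1 * 2^-1 by ring.
  rewrite -ep -e2 -!LintegralZ// -LintegralD//; [|exact: LintZ|exact: LintZ].
  apply: ler_Lint => //.
  + exact: (integrable_norm (fi th th0)).
  + by apply: LintD => //; exact: LintZ.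
  + move=> x; rewrite /= in_itv/= andbT => x0; rewrite /f normrM (ger0_norm (expR_ge0 _)).
    have := kf_le e x th0; rewrite (gtr0_norm x0) => h; have := xe x x0 => h'.
    apply: (@le_trans _ _ (expR (- (p * x)) * ((2 + `|e| * x) / (1 + th ^+ 2)))).
      by rewrite ler_wpM2l ?expR_ge0.
    have -> : expR (- (p * x)) * ((2 + `|e| * x) / (1 + th ^+ 2)) =
      2 / (1 + th ^+ 2) * expR (- (p * x)) + `|e| / (1 + th ^+ 2) * (x * expR (- (p * x))) by ring.
    by rewrite lerD2l ler_wpM2l// mulr_ge0.
- by apply: LintZ => //; exact: integrable_arctan.1.
have lhs x : expR (- (p * x)) * kk e x = \int[mu]_(th in `]0, +oo[) f x th.
  exact: (esym (LintegralZ _ m0y (integrable_kf e x))).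
rewrite (eq_Lintegral (fun x _ => lhs x)) fub.
have [_ <-] := @pfrac_int p e p1.
apply: eq_Lintegral => th; rewrite /= in_itv/= andbT => th0.
rewrite (eq_Lintegral (fun x _ => E x th)) (laplace_trig _ _ th p0).2.
have h1 : 1 + th ^+ 2 != 0 := lt0r_neq0 (ltr_pwDl ltr01 (sqr_ge0 th)).
have h2 : p ^+ 2 + th ^+ 2 != 0 := lt0r_neq0 (ltr_pwDl (exprn_gt0 2 p0) (sqr_ge0 th)).
by field; rewrite h1 h2 !gt_eqF.
Qed.

(** Both sides have the same Laplace transform at all integers from 3 on, and both are continuous,
    so uniqueness gives the integral without residues. *)
Lemma kkE e x : 0 <= x -> kk e x = pi / 2 * (1 + e) * (1 - expR (- x)).
Proof.
rewrite le_eqVlt => /orP[/eqP <-|x0].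
  rewrite oppr0 expR0 subrr mulr0 /kk (@eq_Lintegral _ _ _ (fun=> 0 * 0)).
    rewrite LintegralZ ?mul0r//; exact: (integrable0 mu).
  by move=> th _; rewrite /kf mulr0 cos0 sin0 subrr !mul0r mulr0 addr0.
pose c : R := pi / 2 * (1 + e).
(* Uniqueness is available for bounded functions, while the bound on [kk e] grows linearly; the
   factor exp (- 2 x) compensates. *)
pose D x := expR (- (2 * x)) * (kk e x - c * (1 - expR (- x))).
suff : D x = 0.
  by move=> /eqP; rewrite /D mulf_eq0 gt_eqF ?expR_gt0//= subr_eq0 => /eqP.
pose M : R := (2 + `|e|) * (pi / 2) + `|c|.
have pi0 := @pi_gt0 R.
have p4 : 0 <= pi / 2 :> R by rewrite divr_ge0// ltW.
have ex (y : R) : 0 < y -> expR (- (2 * y)) <= 1 /\ y * expR (- (2 * y)) <= 1.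
  move=> y0; have h := @expR_ge1Dx R (2 * y).
  have h1 : expR (- (2 * y)) <= 1 by rewrite expR_le1//; lra.
  split=> //; rewrite expRN ler_pdivrMr ?expR_gt0// mul1r; lra.
apply: (@laplace_zero R D M) => //.
- move=> y y0; apply: continuousM; first by dcont.
  apply: continuousB; first exact: kk_cont.
  by dcont.
- move=> y y0; have [h1 h2] := ex y y0.
  rewrite /D normrM (ger0_norm (expR_ge0 _)).
  apply: (@le_trans _ _ (expR (- (2 * y)) * ((2 + `|e| * y) * (pi / 2) + `|c|))).
    rewrite ler_wpM2l ?expR_ge0//; apply: le_trans (ler_normB _ _) _; apply: lerD.
      by have := kk_le e y; rewrite (gtr0_norm y0).
    rewrite normrM ler_piMr// ger0_norm; last by rewrite subr_ge0 expR_le1; lra.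
    by rewrite lerBlDr lerDl expR_ge0.
  have -> : expR (- (2 * y)) * ((2 + `|e| * y) * (pi / 2) + `|c|) =
    (2 * expR (- (2 * y)) + `|e| * (y * expR (- (2 * y)))) * (pi / 2) + `|c| * expR (- (2 * y)) by ring.
  apply: lerD; last by rewrite ler_piMr.
  rewrite ler_wpM2r// lerD//; last by rewrite ler_piMr.
  by lra.
(* The exponent n + 1 of the test function and the 2 hidden in [D] add up to n + 3, within the range
   of [laplace_kk]. *)
- move=> n; pose p : R := n.+3%:R.
  have p3 : 3 <= p by rewrite /p (ler_nat R 3 n.+3).
  have p0 : 0 < p by lra.
  have p1 : 0 < p + 1 by lra.
  have [i1 e1] := integrable_expN p0; have [i2 e2] := integrable_expN p1.
  have E y : expR (- (p * y)) * kk e y - c * (expR (- (p * y)) - expR (- ((p + 1) * y))) =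
      D y * expR (- (n.+1%:R * y)).
    have -> : - (p * y) = - (2 * y) + - (n.+1%:R * y).
      by rewrite /p -[n.+3]addn2 natrD; ring.
    have -> : - ((p + 1) * y) = - (2 * y) + - (n.+1%:R * y) + - y.
      by rewrite /p -[n.+3]addn2 natrD; ring.
    by rewrite /D !expRD; ring.
  have i0 : mu.-integrable `]0, +oo[ (EFin \o (fun y => expR (- (p * y)) * kk e y)).
    have [i3 _] := @integrable_expN R 2 ltac:(lra).
    apply: (@le_Lint _ (fun y => (2 + `|e|) * (pi / 2) * expR (- (2 * y)))) => //; last exact: LintZ.
      apply: open_cont_mfun => [|y]; first exact: interval_open.
      rewrite /= in_itv/= andbT => y0; apply: continuousM; first by dcont.
      exact: kk_cont.
    move=> y; rewrite /= in_itv/= andbT => y0; rewrite normrM (ger0_norm (expR_ge0 _)).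
    have k := kk_le e y; rewrite (gtr0_norm y0) in k.
    have h := @expR_ge1Dx R y.
    have h3 : expR (- (p * y)) <= expR (- (3 * y)) by rewrite ler_expR; nra.
    apply: (@le_trans _ _ (expR (- (3 * y)) * ((2 + `|e| * y) * (pi / 2)))).
      by apply: ler_pM => //; exact: expR_ge0.
    have -> : - (2 * y) = y + - (3 * y) by ring.
    rewrite expRD mulrC [leRHS]mulrA ler_wpM2r ?expR_ge0// mulrAC ler_wpM2r//.
    rewrite mulrDl; apply: lerD; first by rewrite ler_peMr//; lra.
    by rewrite ler_wpM2l//; lra.
  rewrite -(eq_Lintegral (fun y _ => E y)) LintegralB//; last by apply: LintZ => //; exact: LintB.
  rewrite LintegralZ//; last exact: LintB.
  rewrite LintegralB// laplace_kk// e1 e2 /c.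
  have gen (q : R) : q / 2 * (1 + e) / (p * (p + 1)) - q / 2 * (1 + e) * (p^-1 - (p + 1)^-1) = 0.
    by field; rewrite !gt_eqF.
  exact: gen.
Qed.

(* The kernel is even in the cosine and odd in the sine, so that negative
   arguments amount to [e = -1]. *)
Lemma kk1E x : kk 1 x = pi * (1 - expR (- Num.max x 0)).
Proof.
have [x0|x0] := leP 0 x.
  by rewrite kkE//; field.
have -> : kk 1 x = kk (-1) (- x).
  by apply: eq_Lintegral => th _; rewrite /kf mulrN cosN sinN; ring.
by rewrite kkE ?oppr_ge0 ?ltW// subrr mulr0 mul0r oppr0 expR0 subrr mulr0.
Qed.

End kernel.

Local Open Scope complex_scope.
Local Open Scope ring_scope.

Lemma Rintegral_probability1 (R : realType) d (T : measurableType d) (P : probability T R) :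
  \int[P]_w (1 : R) = 1.
Proof.
rewrite Rintegral_cst; last exact: measurableT.
rewrite mul1r; exact: (congr1 fine (@probability_setT _ _ _ P)).
Qed.

(** * From the characteristic function to the kernel [wk] *)

Section rotation_to_wk.
Context {R : realType}.
Notation mu := (@lebesgue_measure R).
Variables (alpha rho b : R).
Hypotheses (a02 : 0 < alpha <= 2) (rho01 : 0 < rho < 1) (b0 : 0 < b).
Implicit Types (r y : R).
(** The angle at which (r e^(iy))^alpha e^(- i th0) becomes positive. *)
Let beta : R := (rho - 1 / 2) * pi.
Let th0 : R := alpha * beta.
Hypothesis th0I : `|th0| < pi / 2.

(** [cexp (W r 0)] is the characteristic function of [Y] at [r], and [cexp (W r beta)] is exp (- b
    r^alpha). The factor [V] is 1 / (z - i), so that [F / r] at angle 0 is the Fourier form of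
    [kf 1]. *)
Let W r y : R[i] := (- b)%:C * cpow alpha (- th0) r y.
Let V r y : R[i] := (cpow 1 0 r y - 'i%C)^-1.
Let F r y := (1 - cexp (W r y)) * V r y.
Let dW r y : R[i] := 0 * cpow alpha (- th0) r y + (- b)%:C * ((alpha / r)%:C * cpow alpha (- th0) r y).
Let dV r y : R[i] := - ((1 / r)%:C * cpow 1 0 r y + (- 0)) / (cpow 1 0 r y - 'i%C) ^+ 2.
Let D r y := (0 + - (cexp (W r y) * dW r y)) * V r y + (1 - cexp (W r y)) * dV r y.

Let alpha0 : 0 < alpha. Proof. by case/andP: a02. Qed.

Let betaI : `|beta| < pi / 2.
Proof.
have pi0 := @pi_gt0 R; case/andP: rho01 => r0 r1.
rewrite /beta normrM (gtr0_norm pi0) mulrC ltr_pM2l// ltr_norml.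
apply/andP; split; lra.
Qed.

(** Half of the available slack on two counts: the first term keeps the rays away from the pole i,
    the second keeps the phase [alpha * y - th0] within pi / 2, so that [cexp (W r y)] stays in the
    unit disc. *)
Let eps : R := Num.min ((pi / 2 - `|beta|) / 2) ((pi / 2 - `|th0|) / (2 * alpha)).

Let eps0 : 0 < eps.
Proof. by rewrite lt_min !divr_gt0 ?mulr_gt0// subr_gt0. Qed.

Let l : R := Num.min 0 beta - eps.
Let u : R := Num.max 0 beta + eps.
Let tau : R := (`|beta| + pi / 2) / 2 + pi / 2.

Let tauI : 0 < tau < pi.
Proof. by have := betaI; have := normr_ge0 beta; have := @pi_gt0 R; rewrite /tau => ? ? ?; apply/andP; split; lra. Qed.

Let strip y : l < y < u -> [/\ - tau < y + pi / 2 < tau, `|alpha * y - th0| < pi / 2 & - (pi / 2) < y < pi / 2].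
Proof.
have pi0 := @pi_gt0 R; have h1 := betaI; have n0 := normr_ge0 beta.
move=> /andP[ly yu].
have e1 : eps <= (pi / 2 - `|beta|) / 2 by rewrite ge_min lexx.
have e2 : alpha * eps <= (pi / 2 - `|th0|) / 2.
  have : eps <= (pi / 2 - `|th0|) / (2 * alpha) by rewrite ge_min lexx orbT.
  rewrite -(ler_pM2l alpha0) => h; apply: (le_trans h).
  by rewrite le_eqVlt; apply/orP; left; apply/eqP; field; rewrite gt_eqF.
have m1 : - `|beta| <= Num.min 0 beta.
  by rewrite le_min oppr_le0 n0/=; have := ler_norm (- beta); rewrite normrN; lra.
have m2 : Num.max 0 beta <= `|beta| by rewrite ge_max n0 ler_norm.
have yb : - (pi / 2) < y < pi / 2 by move: ly yu; rewrite /l /u => ? ?; apply/andP; split; lra.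
have yt : `|y - beta| < `|beta| + eps.
  have m3 : Num.min 0 beta = 0 /\ `|beta| = beta /\ Num.max 0 beta = beta \/
       Num.min 0 beta = beta /\ `|beta| = - beta /\ Num.max 0 beta = 0.
    by case: (leP 0 beta) => h; [left; rewrite ger0_norm|right; rewrite ltr0_norm].
  move: ly yu; rewrite /l /u => ly yu; rewrite ltr_norml.
  by case: m3 => -[m3 [m4 m5]]; rewrite m3 in ly; rewrite m5 in yu; rewrite m4; apply/andP; split; lra.
split=> //.
- by move: ly yu; rewrite /tau /l /u => ? ?; apply/andP; split; lra.
- rewrite /th0 -mulrBr normrM (gtr0_norm alpha0).
  apply: (@lt_le_trans _ _ (alpha * (`|beta| + eps))); first by rewrite ltr_pM2l.
  have e3 : `|th0| = alpha * `|beta| by rewrite /th0 normrM (gtr0_norm alpha0).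
  by have := th0I; rewrite mulrDr -e3; lra.
Qed.

Let cabs_zi r y : 0 <= r -> cabs (cpow 1 0 r y - 'i%C) = Num.sqrt (nrm2 r (y + pi / 2)).
Proof.
move=> r0; rewrite /cabs /cabs2 ReD ImD ReN ImN /= !mul1r !addr0 !powRr1//.
congr Num.sqrt; rewrite /nrm2 cosD cos_pihalf sin_pihalf.
have -> : r ^+ 2 = r ^+ 2 * (cos y ^+ 2 + sin y ^+ 2) by rewrite cos2Dsin2 mulr1.
ring.
Qed.

Let den r y : 0 <= r -> l < y < u -> (Num.sqrt (wC (tau / pi)))^-1 <= cabs (cpow 1 0 r y - 'i%C) /\
   0 < wC (tau / pi).
Proof.
move=> r0 /strip[yt _ _]; have [h w0] := nrm2_lower_angle r0 tauI yt.
split=> //; rewrite cabs_zi// -(sqrtrV (ltW w0)).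
have h1 : 0 < wC (tau / pi) * nrm2 r (y + pi / 2).
  by apply: lt_le_trans h; rewrite ltr_pwDl// sqr_ge0.
rewrite ler_sqrt; last by rewrite ltW// -(pmulr_rgt0 _ w0).
rewrite -(ler_pM2l w0) divff ?gt_eqF//; apply: le_trans h.
by rewrite lerDl sqr_ge0.
Qed.

Let den1 r y : 0 <= r -> `|r - 1| <= cabs (cpow 1 0 r y - 'i%C).
Proof.
move=> r0; rewrite cabs_zi// -sqrtr_sqr ler_sqrt; first exact: nrm2_ge.
by apply: le_trans (nrm2_ge _ r0); exact: sqr_ge0.
Qed.

Let den0 r y : 0 <= r -> l < y < u -> cpow 1 0 r y - 'i%C != 0.
Proof.
move=> r0 yI; apply/eqP => E; have [h w0] := den r0 yI; move: h; rewrite E.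
by rewrite cabs_real normr0 leNgt invr_gt0 sqrtr_gt0 w0.
Qed.

Let cholW r y : 0 < r -> chol W (dW r y) r y.
Proof. by move=> r0; apply: cholM; [exact: chol_cst|exact: chol_cpow]. Qed.

Let cholV' r y : 0 < r -> l < y < u -> chol V (dV r y) r y.
Proof.
move=> r0 yI; apply: (@cholV _ (fun r y => cpow 1 0 r y - 'i%C)); first by apply: den0 => //; exact: ltW.
apply: cholD; first exact: chol_cpow.
by apply: cholN; exact: chol_cst.
Qed.

Let cholN' r y : 0 < r -> chol (fun r y => 1 - cexp (W r y)) (0 + - (cexp (W r y) * dW r y)) r y.
Proof.
move=> r0; apply: cholD; first exact: chol_cst.
by apply: cholN; apply: chol_cexp; exact: cholW.
Qed.

Lemma wkrot_chol r y : 0 < r -> l < y < u -> chol F (D r y) r y.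
Proof. by move=> r0 yI; apply: cholM; [exact: cholN'|exact: cholV']. Qed.

Lemma wkrot_ccont r y : 0 < r -> l < y < u -> ccont (D ^~ y) r.
Proof.
move=> r0 yI.
have i1 c : ccont (fun s => (c / s)%:C) r.
  by split; rewrite /=; [dcont; rewrite gt_eqF|exact: cvg_cst].
have cp a' b' := chol_ccont (chol_cpow a' b' y r0).
have cV := chol_ccont (cholV' r0 yI).
have cdW : ccont (dW ^~ y) r.
  apply: ccontD; first by apply: ccontM; [exact: ccont_cst|exact: cp].
  by apply: ccontM; [exact: ccont_cst|apply: ccontM; [exact: i1|exact: cp]].
have cE : ccont (fun s => cexp (W s y)) r := chol_ccont (chol_cexp (cholW y r0)).
apply: ccontD; apply: ccontM.
- apply: ccontD; first exact: ccont_cst.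
  by apply: ccontN; apply: ccontM; [exact: cE|exact: cdW].
- exact: cV.
- by apply: ccontD; [exact: ccont_cst|exact: ccontN].
- apply: ccontM.
    apply: ccontN; apply: ccontD; last exact: ccont_cst.
    by apply: ccontM; [exact: i1|exact: cp].
  apply: (@ccont_ext _ (fun s => V s y * V s y)); last exact: ccontM.
  by move=> s; rewrite /V expr2 invfM.
Qed.

Let ReW r y : complex.Re (W r y) = - (b * (r `^ alpha * cos (alpha * y - th0))).
Proof. by rewrite /W ReM /= mul0r subr0 mulNr. Qed.

Let ImW r y : complex.Im (W r y) = - (b * (r `^ alpha * sin (alpha * y - th0))).
Proof. by rewrite /W ImM /= mul0r addr0 mulNr. Qed.

Let ReW_le0 r y : l < y < u -> complex.Re (W r y) <= 0.
Proof.
move=> /strip[_ + _]; rewrite ltr_norml => yI.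
rewrite ReW oppr_le0 !mulr_ge0 ?powR_ge0 ?(ltW b0)// ltW// cos_gt0_pihalf//.
Qed.

Let cexpW_le r y : l < y < u -> cabs (cexp (W r y)) <= 1.
Proof. by move=> yI; rewrite cabs_cexp expR_le1 ReW_le0. Qed.

Lemma wkrot_bound r1 r2 : 0 < r1 -> exists M, forall r y, r1 <= r <= r2 -> l < y < u -> cabs (D r y) <= M.
Proof.
move=> r10; pose Z r y := r1 <= r <= r2 /\ l < y < u.
suff [M MP] : cbd Z D by exists M => r y rI yI; exact: MP.
have [_ w0] : (Num.sqrt (wC (tau / pi)))^-1 <= cabs (cpow 1 0 0 0 - 'i%C) /\ 0 < wC (tau / pi).
  apply: den => //; rewrite /l /u; have e0 := eps0.
  have : Num.min 0 beta <= 0 by rewrite ge_min lexx.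
  have : 0 <= Num.max 0 beta by rewrite le_max lexx.
  by move=> ? ?; apply/andP; split; lra.
have s0 : 0 < (Num.sqrt (wC (tau / pi)))^-1 by rewrite invr_gt0 sqrtr_gt0.
have bV : cbd Z V.
  apply: (cbdV s0) => r y [/andP[ar _] yI]; have [//|//] := @den r y _ yI.
  by apply: le_trans ar; exact: ltW.
have bi c : cbd Z (fun r _ => (c / r)%:C).
  exists (`|c| * r1^-1) => r y [/andP[ar _] _]; have r0 : 0 < r by exact: lt_le_trans ar.
  by rewrite cabs_real normrM [X in _ * X]gtr0_norm ?invr_gt0// ler_wpM2l// lef_pV2 ?posrE.
have bE : cbd Z (fun r y => cexp (W r y)) by exists 1 => r y [_ yI]; exact: cexpW_le.
have bp a' b' : cbd Z (cpow a' b') by exact: cbd_cpow.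
have bdW : cbd Z dW.
  apply: cbdD; first by apply: cbdM => //; exact: cbd_cst.
  by apply: cbdM; [exact: cbd_cst|exact: cbdM].
apply: cbdD; apply: cbdM => //.
- apply: cbdD; first exact: cbd_cst.
  by apply: cbdN; exact: cbdM.
- by apply: cbdD; [exact: cbd_cst|exact: cbdN].
- apply: cbdM.
    by apply: cbdN; apply: cbdD; [exact: cbdM|exact: cbd_cst].
  have [M MP] := cbdM bV bV; exists M => r y /MP.
  by rewrite /V expr2 invfM.
Qed.

Let one_sub_cexp (A B : R) : 0 <= A ->
  `|1 - expR (- A) * cos B| <= A + `|B| /\ `|expR (- A) * sin B| <= `|B|.
Proof.
move=> A0; have e1 : expR (- A) <= 1 by rewrite expR_le1 oppr_le0.
have e2 := expR_gt0 (- A); have e3 := @expR_ge1Dx R (- A).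
have c1 := cos_le1 B; have c2 : 1 - cos B <= `|B|.
  have := norm_sin_le (B / 2); have := cos2Dsin2 (B / 2).
  have -> : cos B = cos (B / 2) ^+ 2 - sin (B / 2) ^+ 2 by rewrite {1}(splitr B) cosD !expr2.
  have -> : `|B / 2| = `|B| / 2 by rewrite normrM (gtr0_norm (_ : 0 < 2^-1)).
  have : sin (B / 2) ^+ 2 <= `|sin (B / 2)|.
    rewrite -[X in X <= _]ger0_norm ?sqr_ge0// normrX expr2 ler_piMr//.
    by rewrite ler_norml sin_geN1 sin_le1.
  lra.
split.
  have c3 := cos_geN1 B; rewrite ger0_norm; last by nra.
  nra.
rewrite normrM (gtr0_norm e2); apply: le_trans (norm_sin_le B).
by rewrite ler_piMl.
Qed.

Let N_small r y : l < y < u -> cabs (1 - cexp (W r y)) <= 3 * b * r `^ alpha.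
Proof.
move=> yI; apply: le_trans (cabs_le_ReIm _) _.
have h : 0 <= - complex.Re (W r y) by rewrite oppr_ge0 ReW_le0.
have [h1 h2] := @one_sub_cexp _ (complex.Im (W r y)) h.
rewrite opprK in h1 h2.
rewrite ReD ImD ReN ImN Re_cexp Im_cexp /= add0r normrN.
have k1 : - complex.Re (W r y) <= b * r `^ alpha.
  by rewrite ReW opprK ler_pM2l// ler_piMr ?powR_ge0// cos_le1.
have k2 : `|complex.Im (W r y)| <= b * r `^ alpha.
  rewrite ImW normrN !normrM (gtr0_norm b0) ler_pM2l// (ger0_norm (powR_ge0 _ _)).
  by rewrite ler_piMr ?powR_ge0// ler_norml sin_geN1 sin_le1.
have -> : 3 * b * r `^ alpha = 3 * (b * r `^ alpha) by rewrite mulrA.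
lra.
Qed.

Lemma wkrot_lim0 (e : R) : 0 < e -> exists2 d : R, 0 < d &
  forall r y, 0 < r < d -> l < y < u -> cabs (F r y) <= e.
Proof.
move=> e0; pose d := Num.min (1 / 2) ((e / (6 * b)) `^ alpha^-1).
have eb : 0 < e / (6 * b) by rewrite divr_gt0// mulr_gt0.
exists d => [|r y /andP[r0]]; first by rewrite lt_min powR_gt0// andbT; lra.
rewrite lt_min => /andP[r2 re] yI.
have ra : r `^ alpha <= e / (6 * b).
  have -> : e / (6 * b) = ((e / (6 * b)) `^ alpha^-1) `^ alpha.
    by rewrite -powRrM mulVf ?gt_eqF// powRr1// ltW.
  by apply: ge0_ler_powR; rewrite ?nnegrE ?powR_ge0 ?(ltW alpha0) ?(ltW r0) ?(ltW re).
have dn : 1 / 2 <= cabs (cpow 1 0 r y - 'i%C).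
  apply: le_trans (den1 y (ltW r0)); rewrite ler0_norm; lra.
rewrite /F cabsM cabsV ler_pdivrMr; last by apply: lt_le_trans dn; lra.
apply: le_trans (N_small r yI) _.
have h : 3 * b * r `^ alpha <= e / 2.
  apply: (@le_trans _ _ (3 * b * (e / (6 * b)))); first by rewrite ler_pM2l// mulr_gt0.
  by rewrite le_eqVlt; apply/orP; left; apply/eqP; field; rewrite gt_eqF.
by apply: (le_trans h); rewrite ler_pM2l//; lra.
Qed.

Lemma wkrot_lim1 (e : R) : 0 < e -> exists d : R,
  forall r y, d < r -> l < y < u -> cabs (F r y) <= e.
Proof.
move=> e0; exists (2 / e + 1) => r y rd yI.
have ei : 0 < 2 / e by rewrite divr_gt0.
have dn : 2 / e <= cabs (cpow 1 0 r y - 'i%C).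
  have r0 : 0 <= r by lra.
  apply: le_trans (den1 y r0); rewrite ger0_norm; lra.
rewrite /F cabsM cabsV ler_pdivrMr; last by apply: lt_le_trans dn.
have h : cabs (1 - cexp (W r y)) <= 2.
  apply: le_trans (cabsD _ _) _; rewrite cabsN.
  have := cexpW_le r yI; have -> : cabs (1 : R[i]) = 1 by rewrite cabs_real normr1.
  by lra.
apply: (le_trans h); rewrite mulrC -ler_pdivrMr// .
Qed.

(** The real part of [F v 0 / v] written out, equal to E [kf 1 (Y w) v] once the characteristic
    function of [Y] is inserted. *)
Definition cint v : R := (1 - expR (- (b * v `^ alpha * cos th0)) * cos (b * v `^ alpha * sin th0)) / (1 + v ^+ 2)
  + expR (- (b * v `^ alpha * cos th0)) * sin (b * v `^ alpha * sin th0) / (v * (1 + v ^+ 2)).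

(** At angle beta the numerator is real and cos beta = sin (rho pi), while |z - i|^2 becomes
    [nrm2 r (rho * pi)]: the real part of 1 / (r (z - i)) is exactly [wk rho r]. *)
Lemma wkrot : mu.-integrable `]0, +oo[ (EFin \o cint) ->
  \int[mu]_(v in `]0, +oo[) cint v =
  \int[mu]_(v in `]0, +oo[) ((1 - expR (- (b * v `^ alpha))) * wk rho v).
Proof.
move=> ci.
have E0 r : 0 < r -> complex.Re (F r 0) / r = cint r.
  move=> r0; have p0 : 1 + r ^+ 2 != 0 by rewrite gt_eqF// ltr_pwDl// sqr_ge0.
  have n2 := cabs_zi 0 (ltW r0).
  have : cabs2 (cpow 1 0 r 0 - 'i%C) = 1 + r ^+ 2.
    rewrite -cabs_sqr n2 sqr_sqrtr /nrm2 add0r cos_pihalf mulr0 addr0//.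
    by rewrite addr_ge0// sqr_ge0.
  move=> e2; rewrite /F /V ReM ReV ImV e2 !(ReD, ImD, ReN, ImN) Re_cexp Im_cexp ReW ImW /=.
  have -> : b * (r `^ alpha * cos (alpha * 0 - th0)) = b * r `^ alpha * cos th0.
    by rewrite mulr0 sub0r cosN mulrA.
  have -> : - (b * (r `^ alpha * sin (alpha * 0 - th0))) = b * r `^ alpha * sin th0.
    by rewrite mulr0 sub0r sinN; ring.
  rewrite !mulr0 !addr0 cos0 sin0 mulr0 mulr1 powRr1 ?(ltW r0)// /cint.
  set A := expR _; set C := cos _; set B := sin _.
  by field; rewrite p0 gt_eqF.
have E1 r : 0 < r -> complex.Re (F r beta) / r = (1 - expR (- (b * r `^ alpha))) * wk rho r.
  move=> r0; have n2 := cabs_zi beta (ltW r0).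
  have bp : beta + pi / 2 = rho * pi by rewrite /beta; field.
  have e2 : cabs2 (cpow 1 0 r beta - 'i%C) = nrm2 r (rho * pi).
    rewrite -cabs_sqr n2 sqr_sqrtr ?bp// ltW// nrm2_gt0 ?(ltW r0)//.
    by have pi0 := @pi_gt0 R; case/andP: rho01 => ? ?; apply/andP; split; nra.
  have cb : cos beta = sin (rho * pi) by rewrite -bp sinD sin_pihalf cos_pihalf mulr0 mulr1 add0r.
  have sb : alpha * beta - th0 = 0 by rewrite /th0 subrr.
  rewrite /F /V ReM ReV ImV e2 !(ReD, ImD, ReN, ImN) Re_cexp Im_cexp ReW ImW sb sin0 cos0 /=.
  rewrite !mulr0 oppr0 sin0 cos0 mulr0 mul1r !addr0 cb powRr1 ?(ltW r0)// !mulr1.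
  rewrite /wk -/(nrm2 r (rho * pi)); have n0 : nrm2 r (rho * pi) != 0.
    rewrite gt_eqF// nrm2_gt0 ?(ltW r0)//.
    by have pi0 := @pi_gt0 R; case/andP: rho01 => ? ?; apply/andP; split; nra.
  set A := expR _; set C := sin _; set N := nrm2 _ _ in n0 *.
  by field; rewrite n0 gt_eqF.
have i1 : mu.-integrable `]0, +oo[ (EFin \o (fun v => (1 - expR (- (b * v `^ alpha))) * wk rho v)).
  apply: (@le_Lint _ (wk rho)) => //; last exact: integrable_wk.
    by rewrite /wk; meas.
  move=> v; rewrite /= in_itv/= andbT => v0; have w0 := wk_ge0 rho01 (ltW v0).
  have p0 : 0 <= b * v `^ alpha by rewrite mulr_ge0 ?powR_ge0// ltW.
  have e1 : expR (- (b * v `^ alpha)) <= 1 by rewrite expR_le1 oppr_le0.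
  have e2 := expR_ge0 (- (b * v `^ alpha)).
  rewrite normrM (ger0_norm w0) ler_piMl// ger0_norm; lra.
have I0 : l < 0 < u.
  rewrite /l /u; have e0 := eps0.
  have : Num.min 0 beta <= 0 by rewrite ge_min lexx.
  have : 0 <= Num.max 0 beta by rewrite le_max lexx.
  by move=> ? ?; apply/andP; split; lra.
have I1 : l < beta < u.
  rewrite /l /u; have e0 := eps0.
  have : Num.min 0 beta <= beta by rewrite ge_min lexx orbT.
  have : beta <= Num.max 0 beta by rewrite le_max lexx orbT.
  by move=> ? ?; apply/andP; split; lra.
have S v : (`]0, +oo[%classic : set R) v -> 0 < v by rewrite /= in_itv/= andbT.
rewrite -(eq_Lintegral (fun v hv => E0 v (S v hv))) -(eq_Lintegral (fun v hv => E1 v (S v hv))).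
apply/esym; apply: (rotate_Re0 I0 I1 wkrot_chol wkrot_ccont wkrot_bound wkrot_lim0 wkrot_lim1).
- by apply: eq_Lint ci => // v /S v0; rewrite E0.
- by apply: eq_Lint i1 => // v /S v0; rewrite E1.
Qed.

Context d (T : measurableType d) (P : probability T R).
Variable Y : T -> R.
Hypothesis mY : measurable_fun setT Y.
Hypothesis Ecos : forall v, 0 < v -> \int[P]_w cos (v * Y w) =
  expR (- (b * v `^ alpha * cos th0)) * cos (b * v `^ alpha * sin th0).
Hypothesis Esin : forall v, 0 < v -> \int[P]_w sin (v * Y w) =
  expR (- (b * v `^ alpha * cos th0)) * sin (b * v `^ alpha * sin th0).

Lemma bounded_integrable (f : T -> R) (M : R) : measurable_fun setT f ->
  (forall w, `|f w| <= M) -> P.-integrable setT (EFin \o f).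
Proof.
move=> mf fM; apply: (@le_Rintegrable _ _ _ P setT f (fun=> M)) => //.
exact: finite_measure_integrable_cst.
Qed.

Let ci v : P.-integrable setT (EFin \o (fun w => cos (v * Y w))).
Proof. by apply: (@bounded_integrable _ 1) => [|w]; [meas|rewrite ler_norml cos_geN1 cos_le1]. Qed.

Let si v : P.-integrable setT (EFin \o (fun w => sin (v * Y w))).
Proof. by apply: (@bounded_integrable _ 1) => [|w]; [meas|rewrite ler_norml sin_geN1 sin_le1]. Qed.

Let c1i : P.-integrable setT (EFin \o (fun _ : T => 1 : R)).
Proof. exact: finite_measure_integrable_cst. Qed.

Let P1 : \int[P]_w (1 : R) = 1.
Proof. exact: Rintegral_probability1. Qed.

Let Ecos_ge v : 0 < v -> 1 - \int[P]_w cos (v * Y w) <= 2 * b * v `^ alpha.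
Proof.
move=> v0; rewrite Ecos//; have c0 : 0 < cos th0.
  by apply: cos_gt0_pihalf; move: th0I; rewrite ltr_norml.
have p0 : 0 <= b * v `^ alpha by rewrite mulr_ge0 ?powR_ge0// ltW.
have A0 : 0 <= b * v `^ alpha * cos th0 by rewrite mulr_ge0// ltW.
have [h _] := @one_sub_cexp _ (b * v `^ alpha * sin th0) A0.
have h1 : b * v `^ alpha * cos th0 <= b * v `^ alpha by rewrite ler_piMr// cos_le1.
have h2 : `|b * v `^ alpha * sin th0| <= b * v `^ alpha.
  by rewrite normrM (ger0_norm p0) ler_piMr// ler_norml sin_geN1 sin_le1.
have := ler_norm (1 - expR (- (b * v `^ alpha * cos th0)) * cos (b * v `^ alpha * sin th0)).
have -> : 2 * b * v `^ alpha = 2 * (b * v `^ alpha) by rewrite mulrA.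
by lra.
Qed.

Let Cs : R := (b * 2 `^ alpha + 1) / 2.

(** The mean of |Y| may be infinite, so |sin| <= |v Y| is of no use for Fubini near 0. Instead |sin|
    <= sin^2 / (2 e) + e / 2 with e = v^(alpha/2), and E sin^2 = E (1 - cos (2 v Y)) / 2 is of order
    v^alpha. *)
Let Esin_le v : 0 < v -> \int[P]_w `|sin (v * Y w)| <= Cs * v `^ (alpha / 2).
Proof.
move=> v0; pose e := v `^ (alpha / 2); have e0 : 0 < e by exact: powR_gt0.
have vn0 : v != 0 by rewrite gt_eqF.
have e2 : e * e = v `^ alpha by rewrite [in RHS](splitr alpha) powRD ?vn0 ?implybT.
pose f w := e^-1 / 4 * (1 - cos (2 * v * Y w)) + e / 2 * 1.
have i1 : P.-integrable setT (EFin \o (fun w => 1 - cos (2 * v * Y w))).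
  exact: (integrableBr measurableT c1i (ci _)).
have i2 : P.-integrable setT (EFin \o (fun w => e^-1 / 4 * (1 - cos (2 * v * Y w)))).
  exact: integrableM_cst.
have i3 : P.-integrable setT (EFin \o (fun _ : T => e / 2 * 1)).
  exact: integrableM_cst.
apply: (@le_trans _ _ (\int[P]_w f w)).
  apply: le_Rintegral => //.
  - exact: (integrable_norm (si v)).
  - exact: integrableDr.
  move=> w _; rewrite /f.
  have -> : 1 - cos (2 * v * Y w) = 2 * `|sin (v * Y w)| ^+ 2.
    rewrite real_normK ?num_real//; have -> : 2 * v * Y w = v * Y w + v * Y w by ring.
    by rewrite cosD -[X in X - _ = _](cos2Dsin2 (v * Y w)); ring.
  have := sqr_ge0 (`|sin (v * Y w)| - e) => h.
  have : 0 <= e^-1 / 2 * (`|sin (v * Y w)| - e) ^+ 2.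
    by rewrite mulr_ge0// divr_ge0// invr_ge0 (ltW e0).
  have -> : e^-1 / 2 * (`|sin (v * Y w)| - e) ^+ 2 =
    e^-1 / 4 * (2 * `|sin (v * Y w)| ^+ 2) + e / 2 * 1 - `|sin (v * Y w)|.
    by field; rewrite gt_eqF.
  by rewrite subr_ge0.
rewrite /f RintegralD// RintegralZl// RintegralZl// P1 RintegralB// P1.
have v20 : 0 < 2 * v by rewrite mulr_gt0.
have h := Ecos_ge v20.
have e4 : 0 <= e^-1 / 4 by rewrite divr_ge0// invr_ge0 ltW.
have := ler_wpM2l e4 h.
rewrite powRM ?(ltW v0)// -e2.
have -> : e^-1 / 4 * (2 * b * (2 `^ alpha * (e * e))) = b * 2 `^ alpha / 2 * e by field; rewrite gt_eqF.
have -> : Cs * v `^ (alpha / 2) = b * 2 `^ alpha / 2 * e + e / 2 by rewrite /Cs -/e; field.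
by lra.
Qed.

Lemma E_kf v : \int[P]_w kf 1 (Y w) v = (1 - \int[P]_w cos (v * Y w)) / (1 + v ^+ 2) +
  \int[P]_w sin (v * Y w) / (v * (1 + v ^+ 2)).
Proof.
have i1 : P.-integrable setT (EFin \o (fun w => 1 - cos (v * Y w))).
  exact: (integrableBr measurableT c1i (ci _)).
rewrite (@eq_Rint _ _ _ P setT _ (fun w => (1 + v ^+ 2)^-1 * (1 - cos (v * Y w)) +
   (v * (1 + v ^+ 2))^-1 * sin (v * Y w))); last by move=> w _; rewrite /kf; ring.
rewrite RintegralD//; [|exact: integrableM_cst|exact: integrableM_cst].
rewrite RintegralZl// RintegralZl// RintegralB// P1.
by rewrite mulrC; congr (_ + _); rewrite mulrC.
Qed.

(** In the constant 3, the cosine term takes 2 and the sine term beyond 1 takes 1; the [bump]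
    carries the sine term near 0, with the exponent of [Esin_le]. *)
Let dom v := 3 * (1 + v ^+ 2)^-1 + Cs * bump (alpha / 2) 1 v.

Let Cs0 : 0 <= Cs.
Proof. by rewrite /Cs divr_ge0// addr_ge0// mulr_ge0 ?powR_ge0// ltW. Qed.

Let E_kf_abs v : 0 < v -> \int[P]_w `|kf 1 (Y w) v| <= dom v.
Proof.
move=> v0; have p1 : 1 <= 1 + v ^+ 2 by rewrite lerDl sqr_ge0.
have p0 : 0 < 1 + v ^+ 2 by lra.
have q0 : 0 < v * (1 + v ^+ 2) by rewrite mulr_gt0.
have i1 : P.-integrable setT (EFin \o (fun w => `|sin (v * Y w)|)) by exact: (integrable_norm (si v)).
pose g w := 2 / (1 + v ^+ 2) * 1 + (v * (1 + v ^+ 2))^-1 * `|sin (v * Y w)|.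
apply: (@le_trans _ _ (\int[P]_w g w)).
  apply: le_Rintegral => //.
  - apply: (@bounded_integrable _ (2 / (1 + v ^+ 2) + (v * (1 + v ^+ 2))^-1)).
      by rewrite /kf; meas.
    move=> w; rewrite normr_id /kf mul1r; apply: le_trans (ler_normD _ _) _; rewrite !normrM !normfV.
    rewrite (gtr0_norm p0) (gtr0_norm q0); apply: lerD.
      rewrite ler_pM2r ?invr_gt0// ler_norml; have := cos_le1 (v * Y w); have := cos_geN1 (v * Y w).
      by move=> ? ?; apply/andP; split; lra.
    by rewrite ler_piMl ?invr_ge0 ?(ltW q0)// ler_norml sin_geN1 sin_le1.
  - by apply: integrableDr => //; exact: integrableM_cst.
  move=> w _; rewrite /g /kf mul1r mulr1; apply: le_trans (ler_normD _ _) _; rewrite !normrM !normfV.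
  rewrite (gtr0_norm p0) (gtr0_norm q0) [X in _ + X]mulrC; apply: lerD => //.
  rewrite ler_pM2r ?invr_gt0// ler_norml; have := cos_le1 (v * Y w); have := cos_geN1 (v * Y w).
  by move=> ? ?; apply/andP; split; lra.
rewrite /g RintegralD//; [|exact: integrableM_cst|exact: integrableM_cst].
rewrite RintegralZl// RintegralZl// P1 mulr1 /dom.
have S1 : \int[P]_w `|sin (v * Y w)| <= 1.
  rewrite -[leRHS]P1; apply: le_Rintegral => // w _.
  by rewrite ler_norml sin_geN1 sin_le1.
have qV : 0 < (1 + v ^+ 2)^-1 by rewrite invr_gt0.
have -> : 3 * (1 + v ^+ 2)^-1 = 2 / (1 + v ^+ 2) + (1 + v ^+ 2)^-1 by ring.
rewrite -addrA lerD2l; rewrite /bump; case: ifPn => [v1|].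
  have h := Esin_le v0.
  have -> : v `^ (alpha / 2 - 1) = v `^ (alpha / 2) / v.
    have vn0 : v != 0 by rewrite gt_eqF.
    by rewrite powRD ?vn0 ?implybT// powRN powRr1// ltW.
  apply: (@le_trans _ _ (Cs * (v `^ (alpha / 2) / v))); last by rewrite lerDr ltW.
  rewrite invfM mulrAC -[leRHS]mulr1; apply: ler_pM.
  - by rewrite mulr_ge0 ?invr_ge0 ?(ltW v0)//; apply: Rintegral_ge0 => w _.
  - exact: ltW.
  - by rewrite mulrC mulrA ler_pM2r ?invr_gt0.
  - by rewrite invf_le1.
rewrite -leNgt => v1.
apply: (@le_trans _ _ (1 + v ^+ 2)^-1); last by rewrite lerDl mulr_ge0// powR_ge0.
rewrite invfM mulrAC ler_piMl ?(ltW qV)// -[leRHS]mulr1.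
apply: ler_pM => //; [by rewrite invr_ge0 ltW|exact: Rintegral_ge0|by rewrite invf_le1].
Qed.

(* By [kk1E], [1 - exp(-Y^+)] is a mixture of [cos (v Y)] and [sin (v Y)], so
   its expectation is an integral of the characteristic function of [Y]; the
   ray of integration is rotated to the angle at which that function becomes
   [exp (- b v^alpha)]. *)
Lemma E_pospart : \int[P]_w (1 - expR (- Num.max (Y w) 0)) =
  pi^-1 * \int[mu]_(v in `]0, +oo[) ((1 - expR (- (b * v `^ alpha))) * wk rho v).
Proof.
have m0y : measurable (`]0, +oo[%classic : set R) by [].
have domi : mu.-integrable `]0, +oo[ (EFin \o dom).
  apply: LintD => //; apply: LintZ => //; first exact: integrable_arctan.1.
  by apply: integrable_bump => //; rewrite divr_gt0.
have S v : (`]0, +oo[%classic : set R) v -> 0 < v by rewrite /= in_itv/= andbT.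
have [|||||_ i2 fub] := @RLfubini R _ _ P setT `]0, +oo[ (fun w v => kf 1 (Y w) v) dom measurableT m0y.
- apply: (measurable_funS measurableT) => //.
  have f1 : measurable_fun setT (fun q : T * R => Y q.1) by exact: (measurableT_comp mY (@measurable_fst _ _ _ _)).
  have f2 : measurable_fun setT (fun q : T * R => q.2) by exact: measurable_snd.
  by rewrite /kf; meas.
- by move=> w _; exact: integrable_kf.
- move=> v /S v0; have p0 : 0 < 1 + v ^+ 2 by rewrite ltr_pwDl// sqr_ge0.
  have q0 : 0 < v * (1 + v ^+ 2) by rewrite mulr_gt0.
  apply: (@bounded_integrable _ (2 / (1 + v ^+ 2) + (v * (1 + v ^+ 2))^-1)).
    by rewrite /kf; meas.
  move=> w; rewrite /kf mul1r; apply: le_trans (ler_normD _ _) _; rewrite !normrM !normfV.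
  rewrite (gtr0_norm p0) (gtr0_norm q0); apply: lerD.
    rewrite ler_pM2r ?invr_gt0// ler_norml; have := cos_le1 (v * Y w); have := cos_geN1 (v * Y w).
    by move=> ? ?; apply/andP; split; lra.
  by rewrite ler_piMl ?invr_ge0 ?(ltW q0)// ler_norml sin_geN1 sin_le1.
- by move=> v /S; exact: E_kf_abs.
- exact: domi.
have E v : (`]0, +oo[%classic : set R) v -> \int[P]_w kf 1 (Y w) v = cint v.
  by move=> /S v0; rewrite E_kf Ecos// Esin.
rewrite -wkrot; last exact: eq_Lint i2.
rewrite -(eq_Lintegral E) -fub.
have pin : pi != 0 :> R by rewrite gt_eqF// pi_gt0.
rewrite (@eq_Rint _ _ _ P setT (fun w => \int[mu]_(v in `]0, +oo[) kf 1 (Y w) v) (fun w => pi * (1 - expR (- Num.max (Y w) 0)))); last first.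
  by move=> w _; exact: kk1E.
rewrite RintegralZl ?mulKf//.
apply: (@bounded_integrable _ 1) => [|w].
  by apply: measurable_funB => //; apply: mfun_expR; apply: measurable_funN; exact: (measurable_maxr mY (measurable_cst _)).
have m0 : 0 <= Num.max (Y w) 0 by rewrite le_max lexx orbT.
have e1 : expR (- Num.max (Y w) 0) <= 1 by rewrite expR_le1 oppr_le0.
have e2 := expR_ge0 (- Num.max (Y w) 0).
rewrite ger0_norm; lra.
Qed.

End rotation_to_wk.

(** * Arguments at the negative axis *)

Section arg_limits.
Context {R : realType}.
Implicit Types r t x : R.

(** The mean value theorem in the radius, starting from [Th 0 t = 0]. The factor sin t makes the
    argument vanish as t tends to pi inside the unit disc. *)
Lemma Th_small x t : 0 <= x < 1 -> - pi < t < pi -> `|Th x t| <= `|sin t| / (1 - x) ^+ 2.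
Proof.
move=> /andP[x0 x1] tI; have p0 : 0 < (1 - x) ^+ 2 by rewrite exprn_gt0// subr_gt0.
move: x0; rewrite le_eqVlt => /orP[/eqP <-|x0].
  by rewrite Th0// normr0 mulr_ge0// invr_ge0 sqr_ge0.
have d z : 0 <= z -> isder z (Th ^~ t) (sin t / nrm2 z t).
  by move=> z0; exact: der_Th_r.
have [||c cI] := @MVT _ (Th ^~ t) (fun z => sin t / nrm2 z t) 0 x x0.
- by move=> z; rewrite in_itv/= => /andP[z0 _]; apply: d; exact: ltW.
- apply: continuous_in_subspaceT => z /set_mem/=; rewrite in_itv/= => /andP[z0 _].
  exact: (der_cont (d z z0)).
rewrite Th0// !subr0 => ->; rewrite normrM (gtr0_norm x0).
move: cI; rewrite in_itv/= => /andP[c0 cx].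
have n0 : 0 < nrm2 c t by rewrite nrm2_gt0// ltW.
rewrite normrM normfV (gtr0_norm n0) -mulrA ler_wpM2l//.
rewrite mulrC ler_pdivrMr// mulrC ler_pdivlMr//.
have := nrm2_ge t (ltW c0).
apply: le_trans; apply: (@le_trans _ _ ((1 - x) ^+ 2)).
  by rewrite ler_piMl ?ltW.
by nra.
Qed.

(** The factorisation 1 + x e^(it) = x e^(it) (1 + x^-1 e^(-it)), which exchanges the inside and the
    outside of the unit circle. *)
Lemma Th_inv x t : 0 < x -> Th x t = t - Th x^-1 t.
Proof.
move=> x0; rewrite /Th.
have -> : (x^-1 - 1) / (x^-1 + 1) = - ((x - 1) / (x + 1)).
  by field; rewrite !gt_eqF//; lra.
by rewrite mulNr atanN; field.
Qed.

(** This jump of the argument at radius 1 is the source of all the boundary contributions on the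
    cuts. *)
Lemma Th_cvg_pi x (t_ : nat -> R) : 0 <= x -> x != 1 ->
  (forall n, - pi < t_ n < pi) -> t_ n @[n --> \oo] --> (pi : R) ->
  Th x (t_ n) @[n --> \oo] --> (if 1 < x then pi else 0 : R).
Proof.
have key z : 0 <= z < 1 -> (forall n, - pi < t_ n < pi) -> t_ n @[n --> \oo] --> (pi : R) ->
    Th z (t_ n) @[n --> \oo] --> (0 : R).
  move=> z01 tI tpi.
  apply: (@squeeze_cvgr _ _ _ _ (fun n => - (`|sin (t_ n)| / (1 - z) ^+ 2))
      (fun n => `|sin (t_ n)| / (1 - z) ^+ 2)).
  - by apply: nearW => n; rewrite -ler_norml Th_small.
  - rewrite -[X in _ --> X]oppr0 -(mul0r ((1 - z) ^+ 2)^-1) -(@normr0 R R) -(@sinpi R).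
    apply: cvgN; apply: cvgM; last exact: cvg_cst.
    by apply: cvg_norm; apply: continuous_cvg => //; exact: continuous_sin.
  - rewrite -(mul0r ((1 - z) ^+ 2)^-1) -(@normr0 R R) -(@sinpi R).
    apply: cvgM; last exact: cvg_cst.
    by apply: cvg_norm; apply: continuous_cvg => //; exact: continuous_sin.
move=> x0 x1 tI tpi; case: ifPn => [x1'|]; last first.
  by rewrite -leNgt le_eqVlt (negPf x1)/= => x1'; apply: key => //; rewrite x0.
have xp : 0 < x by lra.
under eq_fun do rewrite (Th_inv _ xp).
have xI : 0 <= x^-1 < 1 by rewrite invr_ge0 x0 invf_lt1.
have e : (if true then pi else 0 : R) = pi - 0 by rewrite subr0.
by rewrite e; exact: (cvgB tpi (key _ xI tI tpi)).
Qed.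

Lemma cos_sin_Th x t : 0 <= x -> - pi < t < pi ->
  cos (Th x t) * Num.sqrt (nrm2 x t) = 1 + x * cos t /\
  sin (Th x t) * Num.sqrt (nrm2 x t) = x * sin t.
Proof.
move=> x0 tI; have n0 := nrm2_gt0 x0 tI.
have c0 := cos_half_gt0 tI; have cs := cos2Dsin2 (t / 2).
set q := (x - 1) / (x + 1) * (sin (t / 2) / cos (t / 2)).
set s0 := Num.sqrt (1 + q ^+ 2).
have s00 : 0 < s0 by rewrite sqrtr_gt0 ltr_pwDl// sqr_ge0.
have nE : Num.sqrt (nrm2 x t) = (x + 1) * cos (t / 2) * s0.
  have xc0 : 0 <= (x + 1) * cos (t / 2) by rewrite mulr_ge0 ?ltW//; lra.
  rewrite -[X in X * _]ger0_norm// -sqrtr_sqr -sqrtrM ?sqr_ge0//; congr Num.sqrt.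
  rewrite nrm2E /q; field; rewrite !gt_eqF//; lra.
have cat : cos (atan q) = s0^-1 by rewrite cos_atan.
have sat : sin (atan q) = q / s0.
  have ta : tan (atan q) = q by rewrite atanK.
  by rewrite -{2}ta /tan cat invrK -mulrA divff ?mulr1// gt_eqF.
have ct : cos t = cos (t / 2) ^+ 2 - sin (t / 2) ^+ 2.
  by rewrite {1}(splitr t) cosD !expr2.
have st : sin t = 2 * (sin (t / 2) * cos (t / 2)).
  by rewrite {1}(splitr t) sinD; ring.
split.
  rewrite /Th -/q cosD cat sat nE ct -[X in _ = X + _]cs /q.
  field; rewrite !gt_eqF//; lra.
rewrite /Th -/q sinD cat sat nE st /q.
  field; rewrite !gt_eqF//; lra.
Qed.

(** Modulus and cosine identify the argument up to sign, and the sign of the imaginary part matches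
    that of t because [Th x t] lies between 0 and t. *)
Lemma cArg_Th u x t : 0 < u -> 0 <= x -> - pi < t < pi ->
  cArg ((u + u * x * cos t) +i* (u * x * sin t)) = Th x t.
Proof.
move=> u0 x0 tI; have n0 := nrm2_gt0 x0 tI; have pi0 := @pi_gt0 R.
have [cosTh sinTh] := cos_sin_Th x0 tI.
have r0 : 0 < Num.sqrt (nrm2 x t) by rewrite sqrtr_gt0.
have modE : Num.sqrt ((u + u * x * cos t) ^+ 2 + (u * x * sin t) ^+ 2) =
    u * Num.sqrt (nrm2 x t).
  rewrite -[X in _ = X * _](ger0_norm (ltW u0)) -sqrtr_sqr -sqrtrM ?sqr_ge0//; congr Num.sqrt.
  rewrite /nrm2; have -> : u ^+ 2 * (1 + 2 * x * cos t + x ^+ 2) =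
    u ^+ 2 * (1 + 2 * x * cos t + x ^+ 2 * (cos t ^+ 2 + sin t ^+ 2)).
    by rewrite cos2Dsin2 mulr1.
  by ring.
have E : (u + u * x * cos t) / (u * Num.sqrt (nrm2 x t)) = cos (Th x t).
  have -> : u + u * x * cos t = u * (1 + x * cos t) by ring.
  rewrite -cosTh; field; rewrite !gt_eqF//.
rewrite /cArg modE E.
case: (leP 0 (u * x * sin t)) => sg.
  have Th0pi : 0 <= Th x t <= pi.
    case: (leP 0 t) => t0.
      have /andP[h1 h2] : 0 <= Th x t <= t.
        by apply: Th_bound => //; rewrite t0; case/andP: tI.
      by rewrite h1/= (le_trans h2)// ltW//; case/andP: tI.
    have sn : sin t < 0.
      by rewrite -oppr_gt0 -sinN sin_gt0_pi// oppr_gt0 t0/= ltrNl; case/andP: tI.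
    (* A nonnegative imaginary part with t < 0 is possible only at x = 0, where both sides
       vanish. *)
    have xz : x = 0.
      apply/eqP; rewrite eq_le x0 andbT leNgt; apply/negP => xp.
      by move: sg; rewrite leNgt nmulr_llt0 ?mulr_gt0.
    by rewrite xz Th0// lexx ltW.
  by rewrite cosK// in_itv/=.
have xp : 0 < x.
  rewrite lt_neqAle x0 andbT; apply: contraTneq sg => <-.
  by rewrite mulr0 mul0r ltxx.
have sn : sin t < 0 by move: sg; rewrite pmulr_rlt0// mulr_gt0.
have t0 : t < 0.
  rewrite ltNge; apply/negP => t0; move: sn; rewrite ltNge sin_ge0_pi// t0/=.
  by case/andP: tI => _ /ltW.
have /andP[h1 h2] : 0 <= Th x (- t) <= - t.
  by apply: Th_bound => //; rewrite oppr_ge0 ltW//= ltrNl; case/andP: tI.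
rewrite ThN in h1 h2; rewrite cosKN ?opprK//; apply/andP; split; last by lra.
by case/andP: tI => ? ?; lra.
Qed.

End arg_limits.

Section Ld_bounds.
Context {R : realType}.

Lemma Ld_small (x : R) : 0 <= x -> x <= 1 / 2 -> Ld x <= 3 * x.
Proof.
move=> x0 x2; have p1 : 0 < 1 - x by lra.
have h1 := @ln_le_sub1 R (1 + x) ltac:(lra).
have p2 : 0 < (1 - x)^-1 by rewrite invr_gt0.
have h2 := @ln_le_sub1 R _ p2.
have h3 : (1 - x)^-1 - 1 <= 2 * x.
  have -> : (1 - x)^-1 - 1 = x / (1 - x) by field; rewrite gt_eqF.
  by rewrite ler_pdivrMr//; nra.
have h4 := @ln_le_sub1 R _ p1.
rewrite /Ld (gtr0_norm p1); rewrite lnV ?posrE// in h2.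
rewrite ler0_norm; lra.
Qed.

Lemma Ld_large (x : R) : 2 <= x -> Ld x <= 2 * ln (1 + x).
Proof.
move=> x2; rewrite /Ld (_ : `|1 - x| = x - 1); last by rewrite ler0_norm; lra.
have : 0 <= ln (x - 1) by rewrite ln_ge0//; lra.
have : ln (x - 1) <= ln (1 + x) by rewrite ler_ln ?posrE; lra.
by move=> ? ?; rewrite ger0_norm; lra.
Qed.

End Ld_bounds.

(** * Logarithms over a strip of angles *)

Section clog1p_bounds.
Context {R : realType}.
Variables (K b r1 r2 l u tau : R).
Hypotheses (K0 : 0 < K) (r10 : 0 < r1) (taupi : 0 < tau < pi).
Hypothesis strip : forall y, l < y < u -> - tau < y + b < tau.
Implicit Types r y : R.

Let Z r y := r1 <= r <= r2 /\ l < y < u.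

Definition dclog1p K b r y : R[i] :=
  ((cos (y + b) + r / K) / (K * nrm2 (r / K) (y + b))) +i*
  (sin (y + b) / (K * nrm2 (r / K) (y + b))).

Lemma strip_pi y : l < y < u -> - pi < y + b < pi.
Proof. by move=> /strip; case/andP: taupi => ? ? /andP[? ?]; apply/andP; split; lra. Qed.

Let x0 r y : Z r y -> 0 < r / K.
Proof. by case=> /andP[h _] _; rewrite divr_gt0// (lt_le_trans r10). Qed.

Lemma La_bound x t : 0 <= x -> - tau < t < tau ->
  `|La x t| <= `|ln (wC (tau / pi))| + ln (1 + x).
Proof.
move=> x00 tI; have [h w0] := nrm2_lower_angle x00 taupi tI.
have p1 : 0 < 1 + x by rewrite ltr_pwDl.
have n0 : 0 < nrm2 x t.
  by rewrite -(pmulr_rgt0 _ w0) (lt_le_trans _ h)// ltr_pwDl// sqr_ge0.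
have l1 : 0 <= ln (1 + x) by rewrite ln_ge0// lerDl.
have hu : ln (nrm2 x t) <= 2 * ln (1 + x).
  have := nrm2_le t x00; rewrite -[in X in X -> _]ler_ln ?posrE// ?exprn_gt0 ?(addrC x)//.
  by rewrite lnXn// mulr2n; lra.
have hl : - ln (wC (tau / pi)) <= ln (nrm2 x t).
  have wV : 0 < (wC (tau / pi))^-1 by rewrite invr_gt0.
  rewrite -lnV ?posrE// ler_ln ?posrE//.
  rewrite -(ler_pM2l w0) divff ?gt_eqF//; apply: le_trans h.
  by rewrite lerDl sqr_ge0.
have a1 := ler_norm (ln (wC (tau / pi))); have a2 := normr_ge0 (ln (wC (tau / pi))).
by rewrite /La ler_norml; apply/andP; split; lra.
Qed.

Lemma cbd_clog1p : cbd Z (clog1p K b).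
Proof.
apply: (@cbd_ReIm _ _ _ (pi + (`|ln (wC (tau / pi))| + ln (1 + r2 / K)))) => r y rZ.
have xp := x0 rZ; have [/andP[_ rr2] yI] := rZ; have tI := strip yI.
have pi0 := @pi_gt0 R.
have A0 := normr_ge0 (ln (wC (tau / pi))).
have p1 : 0 < 1 + r / K by rewrite ltr_pwDl// ltW.
have B0 : ln (1 + r / K) <= ln (1 + r2 / K).
  have h : 1 + r / K <= 1 + r2 / K by rewrite lerD2l ler_pM2r// invr_gt0.
  by rewrite ler_ln ?posrE// (lt_le_trans p1).
have B1 : 0 <= ln (1 + r / K) by rewrite ln_ge0// lerDl ltW.
split => /=.
  by have := La_bound (ltW xp) tI; lra.
have := @Th_norm _ (r / K) (y + b) (ltW xp) (strip_pi yI).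
have : `|y + b| <= pi by have /andP[? ?] := strip_pi yI; rewrite ler_norml !ltW.
lra.
Qed.

Lemma cbd_dclog1p : cbd Z (dclog1p K b).
Proof.
apply: (@cbd_ReIm _ _ _ ((1 + r2 / K) / K * wC (tau / pi))) => r y rZ.
have xp := x0 rZ; have [/andP[_ rr2] yI] := rZ; have tI := strip yI.
have [h w0] := nrm2_lower_angle (ltW xp) taupi tI.
have n0 : 0 < nrm2 (r / K) (y + b).
  by rewrite -(pmulr_rgt0 _ w0) (lt_le_trans _ h)// ltr_pwDl// sqr_ge0.
have h' : (nrm2 (r / K) (y + b))^-1 <= wC (tau / pi).
  rewrite -[leLHS]mul1r ler_pdivrMr//; apply: le_trans h; rewrite lerDl sqr_ge0.
  by [].
have key c : `|c| <= 1 + r2 / K ->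
    `|c / (K * nrm2 (r / K) (y + b))| <= (1 + r2 / K) / K * wC (tau / pi).
  move=> hc; have KV : 0 < K^-1 by rewrite invr_gt0.
  have nV : 0 < (nrm2 (r / K) (y + b))^-1 by rewrite invr_gt0.
  rewrite invfM mulrA !normrM (gtr0_norm KV) (gtr0_norm nV); apply: ler_pM => //.
  - by rewrite mulr_ge0// ltW.
  - exact: ltW.
  - by rewrite ler_pM2r.
have rK : r / K <= r2 / K by rewrite ler_pM2r// invr_gt0.
split; apply: key.
  apply: le_trans (ler_normD _ _) _; rewrite (gtr0_norm xp) lerD//.
  by rewrite ler_norml cos_geN1 cos_le1.
apply: (@le_trans _ _ 1); first by rewrite ler_norml sin_geN1 sin_le1.
by rewrite lerDl (le_trans (ltW xp)).
Qed.

Lemma ccont_dclog1p r y : 0 < r -> l < y < u -> ccont (dclog1p K b ^~ y) r.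
Proof.
move=> r0 yI; have n0 : K * nrm2 (r / K) (y + b) != 0.
  by rewrite gt_eqF// mulr_gt0// nrm2_gt0 ?strip_pi// divr_ge0 ?ltW.
by split; rewrite /= /nrm2 in n0 *; dcont.
Qed.

End clog1p_bounds.

(** * The exponent J *)

Section A2.
Context {R : realType}.
Variables (rho u : R).
Hypotheses (rho01 : 0 < rho < 1) (u0 : 0 < u).
Implicit Types r y : R.
Notation mu := (@lebesgue_measure R).
Let del : R := pi - rho * pi.
(** Since e^(i del) = - e^(- i rho pi), this is Log (u - z e^(- i rho pi)) + Log (u - z e^(i rho
    pi)). Its branch points sit at the angles rho pi and - rho pi, hence the strips |y| < m with m <
    rho pi. *)
Let S r y := (2 * ln u)%:C + (clog1p u del r y + clog1p u (- del) r y).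
Let F r y := S r y * (1 + cpow 1 0 r y)^-1.
Let D r y := (0 + (dclog1p u del r y + dclog1p u (- del) r y)) * (1 + cpow 1 0 r y)^-1 +
  S r y * (- (0 + (1 / r)%:C * cpow 1 0 r y) / (1 + cpow 1 0 r y) ^+ 2).

Let rpi : 0 < rho * pi < pi.
Proof.
have := @pi_gt0 R; case/andP: rho01 => r0 r1 p0.
by rewrite mulr_gt0//= gtr_pMl.
Qed.

Section strip.
Variable m : R.
Hypothesis mI : 0 < m < rho * pi.
Let tau := m + del.

Let tauI : 0 < tau < pi.
Proof. by rewrite /tau /del; case/andP: mI rpi => ? ? /andP[? ?]; apply/andP; split; lra. Qed.

Let sp y : - m < y < m -> - tau < y + del < tau.
Proof. by rewrite /tau /del; case/andP: rpi mI => ? ? /andP[? ?] /andP[? ?]; apply/andP; split; lra. Qed.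

Let sm y : - m < y < m -> - tau < y - del < tau.
Proof. by rewrite /tau /del; case/andP: rpi mI => ? ? /andP[? ?] /andP[? ?]; apply/andP; split; lra. Qed.

Lemma A2_cos y : - m < y < m -> cos (rho * pi) <= cos y.
Proof.
move=> /andP[y1 y2]; rewrite -(cos_norm y).
have pi0 := @pi_gt0 R.
have h : `|y| < rho * pi by rewrite ltr_norml; case/andP: mI => ? ?; apply/andP; split; lra.
have /andP[q1 q2] := rpi.
have tI : rho * pi \in `[0, pi] by rewrite in_itv/= (ltW q1) (ltW q2).
have aI : `|y| \in `[0, pi] by rewrite in_itv/= normr_ge0 (le_trans (ltW h)) ?(ltW q2).
by apply: ltW; rewrite ltr_cos.
Qed.

Let den r y : 0 <= r -> - m < y < m -> (Num.sqrt (wC rho))^-1 <= cabs (1 + cpow 1 0 r y).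
Proof.
move=> r0 yI; have w0 := wC_gt0 rho01; rewrite cabs_1Dcpow// -(sqrtrV (ltW w0)) ler_sqrt; last first.
  by apply: ltW; apply: nrm2_gt0 => //; case/andP: mI rpi yI => ? ? /andP[? ?] /andP[? ?]; apply/andP; split; lra.
rewrite -(ler_pM2l (wC_gt0 rho01)) divff ?gt_eqF ?wC_gt0//.
apply: le_trans (nrm2_lower rho01 r0 (A2_cos yI)).
by rewrite lerDl sqr_ge0.
Qed.

Let den0 r y : 0 <= r -> - m < y < m -> 1 + cpow 1 0 r y != 0.
Proof.
move=> r0 yI; apply/eqP => E; have := den r0 yI; rewrite E.
rewrite cabs_real normr0 leNgt invr_gt0 sqrtr_gt0 wC_gt0//.
Qed.

Lemma A2_chol r y : 0 < r -> - m < y < m -> chol F (D r y) r y.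
Proof.
move=> r0 yI; apply: cholM; last apply: cholV; last first.
- by apply: cholD; [exact: chol_cst|exact: chol_cpow].
- by apply: den0 => //; exact: ltW.
apply: cholD; first exact: chol_cst.
apply: cholD; apply: chol_clog1p => //.
- exact: (strip_pi tauI sp).
- exact: (strip_pi tauI sm).
Qed.

Lemma A2_ccont r y : 0 < r -> - m < y < m -> ccont (D ^~ y) r.
Proof.
move=> r0 yI.
have c1 : chol (fun s t => (1 + cpow 1 0 s t)^-1)
   (- (0 + (1 / r)%:C * cpow 1 0 r y) / (1 + cpow 1 0 r y) ^+ 2) r y.
  apply: cholV; first by apply: den0 => //; exact: ltW.
  by apply: cholD; [exact: chol_cst|exact: chol_cpow].
have cS : chol S (0 + (dclog1p u del r y + dclog1p u (- del) r y)) r y.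
  apply: cholD; first exact: chol_cst.
  apply: cholD; apply: chol_clog1p => //.
  - exact: (strip_pi tauI sp).
  - exact: (strip_pi tauI sm).
have c1' := chol_ccont c1.
have r1 : ccont (fun s => (1 / s)%:C) r.
  by split; rewrite /=; [dcont; rewrite gt_eqF|exact: cvg_cst].
apply: ccontD; apply: ccontM.
- apply: ccontD; first exact: ccont_cst.
  apply: ccontD.
    exact: (ccont_dclog1p u0 tauI sp).
  exact: (ccont_dclog1p u0 tauI sm).
- exact: c1'.
- exact: chol_ccont cS.
- apply: ccontM.
    apply: ccontN; apply: ccontD; first exact: ccont_cst.
    apply: ccontM => //.
    exact: chol_ccont (chol_cpow 1 0 y r0).
  apply: (@ccont_ext _ (fun s => (1 + cpow 1 0 s y)^-1 * (1 + cpow 1 0 s y)^-1)).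
    by move=> s; rewrite expr2 invfM.
  exact: ccontM.
Qed.

Lemma A2_bound a b : 0 < a -> exists M, forall r y, a <= r <= b -> - m < y < m -> cabs (D r y) <= M.
Proof.
move=> a0.
suff [M MP] : cbd (fun r y => a <= r <= b /\ - m < y < m) D.
  by exists M => r y rI yI; exact: MP.
have w0 : 0 < (Num.sqrt (wC rho))^-1 by rewrite invr_gt0 sqrtr_gt0 wC_gt0.
have bV : cbd (fun r y => a <= r <= b /\ - m < y < m) (fun r y => (1 + cpow 1 0 r y)^-1).
  apply: (cbdV w0) => r y [/andP[ar _] yI]; apply: den => //.
  by apply: le_trans ar; exact: ltW.
apply: cbdD; apply: cbdM => //.
- apply: cbdD; first exact: cbd_cst.
  by apply: cbdD; [exact: cbd_dclog1p sp|exact: cbd_dclog1p sm].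
- apply: cbdD; first exact: cbd_cst.
  by apply: cbdD; [exact: cbd_clog1p sp|exact: cbd_clog1p sm].
- apply: cbdM.
    apply: cbdN; apply: cbdD; first exact: cbd_cst.
    apply: cbdM; last exact: cbd_cpow.
    exists a^-1 => r y [/andP[ar _] _]; rewrite cabs_real mul1r.
    have r0 : 0 < r by exact: lt_le_trans ar.
    by rewrite gtr0_norm ?invr_gt0// lef_pV2 ?posrE.
  have [M MP] := cbdM bV bV; exists M => r y /MP.
  by rewrite expr2 invfM.
Qed.

Let L r y := clog1p u del r y + clog1p u (- del) r y.

Let L_bound r y : 0 < r -> r / u != 1 -> - m < y < m -> cabs (L r y) <= 2 * Ld (r / u) + 2 * pi
  /\ cabs (L r y) <= 2 * Ld (r / u) + 4 * pi * (r / u).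
Proof.
move=> r0 r1 yI; have x0 : 0 <= r / u by rewrite divr_ge0 ?ltW.
have tp := strip_pi tauI sp yI; have tm := strip_pi tauI sm yI.
have l1 := @La_norm _ _ (y + del) x0 r1; have l2 := @La_norm _ _ (y - del) x0 r1.
have e : `|complex.Re (L r y)| <= 2 * Ld (r / u).
  rewrite /L ReD /=; apply: le_trans (ler_normD _ _) _; rewrite /Ld; lra.
have f1 : `|complex.Im (L r y)| <= 2 * pi.
  rewrite /L ImD /=; apply: le_trans (ler_normD _ _) _.
  have := Th_norm x0 tp; have := Th_norm x0 tm.
  have : `|y + del| <= pi by case/andP: tp => ? ?; rewrite ler_norml !ltW.
  have : `|y - del| <= pi by case/andP: tm => ? ?; rewrite ler_norml !ltW.
  by lra.
have f2 : `|complex.Im (L r y)| <= 4 * pi * (r / u).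
  rewrite /L ImD /=; apply: le_trans (ler_normD _ _) _.
  have := Th_lin x0 tp; have := Th_lin x0 tm.
  by lra.
by split; apply: le_trans (cabs_le_ReIm _) _; rewrite lerD.
Qed.

Let den1 r y : 0 <= r -> `|r - 1| <= cabs (1 + cpow 1 0 r y).
Proof.
move=> r0; rewrite cabs_1Dcpow// -sqrtr_sqr ler_sqrt; first exact: nrm2_ge.
by apply: le_trans (nrm2_ge _ r0); exact: sqr_ge0.
Qed.

Lemma A2_lim0 (e : R) : 0 < e -> exists2 d : R, 0 < d &
  forall r y, 0 < r < d -> - m < y < m -> `|complex.Re (F r y) - 2 * ln u| <= e.
Proof.
move=> e0; have pi0 := @pi_gt0 R.
(* Two logarithms contribute 2 * 3 by [Ld_small], two arguments 4 pi by [Th_lin], and the outer 2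
   pays for |1 + z| >= 1/2. *)
pose C := 2 * ((6 + 4 * pi) / u + `|2 * ln u|).
have C0 : 0 <= C by rewrite mulr_ge0// addr_ge0// divr_ge0 ?ltW//; lra.
pose d := Num.min (Num.min (u / 2) (1 / 2)) (e / (C + 1)).
exists d => [|r y /andP[r0]].
  by rewrite !lt_min !divr_gt0//; lra.
rewrite /d !lt_min => /andP[/andP[ru r2] re] yI.
have x0 : 0 < r / u by rewrite divr_gt0.
have x2 : r / u <= 1 / 2 by rewrite ler_pdivrMr//; lra.
have [_ hL] := L_bound r0 (ltac:(lra) : r / u != 1) yI.
have n0 := den0 (ltW r0) yI.
have E : F r y - (2 * ln u)%:C = (L r y - (2 * ln u)%:C * cpow 1 0 r y) / (1 + cpow 1 0 r y).
  by rewrite /F /S -/(L r y); field.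
have -> : complex.Re (F r y) - 2 * ln u = complex.Re (F r y - (2 * ln u)%:C).
  by rewrite ReD ReN.
apply: le_trans (cabs_ge_Re _) _; rewrite E cabsM cabsV.
have dn : 1 / 2 <= cabs (1 + cpow 1 0 r y).
  apply: le_trans (den1 y (ltW r0)); rewrite ler0_norm; lra.
rewrite ler_pdivrMr; last by apply: lt_le_trans dn; lra.
apply: (@le_trans _ _ (C * r / 2)).
  apply: le_trans (cabsD _ _) _.
  rewrite cabsN cabsM cabs_real cabs_cpow powRr1 ?(ltW r0)//.
  have := Ld_small (ltW x0) x2.
  have -> : C * r / 2 = (6 + 4 * pi) * (r / u) + `|2 * ln u| * r.
    by rewrite /C; field; rewrite gt_eqF.
  by rewrite mulrDl; lra.
have : C * r <= e.
  have C1 : 0 < C + 1 by lra.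
  by move: re; rewrite ltr_pdivlMr// => re; nra.
have : e / 2 <= e * cabs (1 + cpow 1 0 r y) by rewrite ler_pM2l//; lra.
lra.
Qed.

Lemma A2_lim1 (e : R) : 0 < e -> exists d : R,
  forall r y, d < r -> - m < y < m -> `|complex.Re (F r y) - 0| <= e.
Proof.
move=> e0; have pi0 := @pi_gt0 R.
pose C := `|2 * ln u| + 2 * pi.
have e8 : 0 < e / 8 by rewrite divr_gt0.
have [d d0 dP] := @ln1p_sublinear R (e / 8) u (C / 4) e8 u0.
exists (d + 2 + 2 * u) => r y rd yI.
have r0 : 0 < r by apply: lt_trans rd; rewrite !addr_gt0// mulr_gt0.
have x2 : 2 <= r / u by rewrite ler_pdivlMr//; lra.
have [hL _] := L_bound r0 (ltac:(lra) : r / u != 1) yI.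
rewrite subr0; apply: le_trans (cabs_ge_Re _) _; rewrite /F cabsM cabsV.
have dn : r / 2 <= cabs (1 + cpow 1 0 r y).
  have r2 : 2 < r by have := u0; lra.
  apply: le_trans (den1 y (ltW r0)); rewrite ger0_norm; lra.
rewrite ler_pdivrMr; last by apply: lt_le_trans dn; lra.
apply: (@le_trans _ _ (e * (r / 2))); last by rewrite ler_pM2l.
have := dP r ltac:(have := u0; lra); have := Ld_large x2.
rewrite /S -/(L r y); have := cabsD (2 * ln u)%:C (L r y).
rewrite cabs_real /C; lra.
Qed.

Lemma A2_rotate y0 y1 : - m < y0 -> y0 < y1 -> y1 < m ->
  mu.-integrable `]0, +oo[ (EFin \o (fun r => complex.Im (F r y0) / r)) ->
  mu.-integrable `]0, +oo[ (EFin \o (fun r => complex.Im (F r y1) / r)) ->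
  \int[mu]_(r in `]0, +oo[) (complex.Im (F r y1) / r) -
  \int[mu]_(r in `]0, +oo[) (complex.Im (F r y0) / r) = (0 - 2 * ln u) * (y1 - y0).
Proof.
move=> my0 y01 y1m; apply: (rotate_Im my0 y01 y1m A2_chol A2_ccont A2_bound A2_lim0 A2_lim1).
Qed.

End strip.

Let P r y := 2 * ln u + (La (r / u) (y + del) + La (r / u) (y - del)).
Let V r y := Th (r / u) (y + del) + Th (r / u) (y - del).
Let K r y := (V r y * ((1 + r * cos y) / r) - P r y * sin y) / nrm2 r y.

Let Im_F r y : 0 < r -> - pi < y < pi -> complex.Im (F r y) / r = K r y.
Proof.
move=> r0 yI; have n0 := nrm2_gt0 (ltW r0) yI.
rewrite /F ImM ReV ImV; have := cabs_1Dcpow y (ltW r0).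
move=> /(congr1 (fun x => x ^+ 2)); rewrite cabs_sqr sqr_sqrtr ?(ltW n0)// => ->.
rewrite !(ReD, ImD) /= !powRr1 ?(ltW r0)// /K /V /P mul1r !addr0 add0r.
by field; rewrite !gt_eqF.
Qed.

Definition A2_dom v : R := wC rho * (2 * `|ln u| + 4 * pi / u + 2 * pi) * (1 + v ^+ 2)^-1 +
  2 * wC rho * (Ld (v `^ 1 / u) / (1 + v ^+ 2)).

Lemma integrable_A2_dom : mu.-integrable `]0, +oo[ (EFin \o A2_dom).
Proof.
apply: LintD => //; apply: LintZ => //; first exact: integrable_arctan.1.
apply: integrable_Ld => //; lra.
Qed.

(** One estimate for all integrands of this section: [c1] stands for a sum of arguments, [c2] for a
    logarithm of moduli, [c3] for a sine. The linear bound on [c1] cancels the factor 1 / r at 0,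
    the constant one serves elsewhere. *)
Let domE c1 c2 c3 r y : 0 < r -> cos (rho * pi) <= cos y -> `|c1| <= 2 * pi -> `|c1| <= 4 * pi * (r / u) ->
  `|c3| <= 1 -> `|c2| <= 2 * `|ln u| + 2 * Ld (r / u) ->
  `|(c1 * ((1 + r * cos y) / r) - c2 * c3) / nrm2 r y| <= A2_dom r.
Proof.
move=> r0 cy h1 h2 h3 h4; have w0 := wC_gt0 rho01.
have p0 : 0 < 1 + r ^+ 2 by rewrite ltr_pwDl// sqr_ge0.
have nl := nrm2_lower rho01 (ltW r0) cy.
have n0 : 0 < nrm2 r y by rewrite -(pmulr_rgt0 _ w0) (lt_le_trans p0).
have nV : (nrm2 r y)^-1 <= wC rho / (1 + r ^+ 2).
  by rewrite ler_pdivlMr// mulrC ler_pdivrMr.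
rewrite /A2_dom powRr1 ?(ltW r0)//.
have -> : wC rho * (2 * `|ln u| + 4 * pi / u + 2 * pi) * (1 + r ^+ 2)^-1 +
  2 * wC rho * (Ld (r / u) / (1 + r ^+ 2)) =
  ((2 * `|ln u| + 2 * Ld (r / u)) + (4 * pi / u + 2 * pi)) * (wC rho / (1 + r ^+ 2)).
  by field; rewrite !gt_eqF.
rewrite normrM; apply: ler_pM => //; last by rewrite gtr0_norm ?invr_gt0.
apply: le_trans (ler_normB _ _) _; rewrite addrC lerD//.
  rewrite normrM; apply: le_trans h4; rewrite -[leRHS]mulr1; exact: ler_wpM2l.
have -> : c1 * ((1 + r * cos y) / r) = c1 / r + c1 * cos y by field; rewrite gt_eqF.
apply: le_trans (ler_normD _ _) _; apply: lerD.
  rewrite normrM [X in _ * X]gtr0_norm ?invr_gt0// ler_pdivrMr//.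
  by apply: le_trans h2 _; rewrite -!mulrA [u^-1 * r]mulrC.
rewrite normrM; apply: le_trans h1; rewrite -[leRHS]mulr1; apply: ler_wpM2l => //.
by rewrite ler_norml cos_geN1 cos_le1.
Qed.

Let angp y : - (rho * pi) < y <= 0 -> - pi < y + del < pi.
Proof. by rewrite /del; case/andP: rpi => ? ? /andP[? ?]; apply/andP; split; lra. Qed.

Let angm y : - (rho * pi) < y <= 0 -> - pi < y - del < pi.
Proof. by rewrite /del; case/andP: rpi => ? ? /andP[? ?]; apply/andP; split; lra. Qed.

Let cosle y : - (rho * pi) <= y <= 0 -> cos (rho * pi) <= cos y.
Proof.
rewrite le_eqVlt => /andP[/orP[/eqP <-|y1 y2]]; first by rewrite cosN.
have [->|y0] := eqVneq y 0; first by rewrite cos0 cos_le1.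
have {}y2 : y < 0 by rewrite lt_neqAle y0.
have mI : 0 < (rho * pi - y) / 2 < rho * pi by apply/andP; split; lra.
by apply: (A2_cos mI); apply/andP; split; lra.
Qed.

Let V_bound r y : 0 < r -> - (rho * pi) < y <= 0 ->
  `|V r y| <= 2 * pi /\ `|V r y| <= 4 * pi * (r / u).
Proof.
move=> r0 yI; have x0 : 0 <= r / u by rewrite ltW// divr_gt0.
have tp := angp yI; have tm := angm yI.
have b1 := Th_norm x0 tp; have b2 := Th_norm x0 tm.
have b3 := Th_lin x0 tp; have b4 := Th_lin x0 tm.
have b5 : `|y + del| <= pi by case/andP: tp => ? ?; rewrite ler_norml !ltW.
have b6 : `|y - del| <= pi by case/andP: tm => ? ?; rewrite ler_norml !ltW.
by rewrite /V; split; apply: le_trans (ler_normD _ _) _; lra.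
Qed.

Let P_bound r y : 0 < r -> r != u -> `|P r y| <= 2 * `|ln u| + 2 * Ld (r / u).
Proof.
move=> r0 ru; have x0 : 0 <= r / u by rewrite ltW// divr_gt0.
have x1 : r / u != 1 by apply: contra ru => /eqP h; rewrite -[u]mul1r -h mulfVK// gt_eqF.
have l1 := @La_norm _ _ (y + del) x0 x1; have l2 := @La_norm _ _ (y - del) x0 x1.
rewrite /P; apply: le_trans (ler_normD _ _) _; rewrite normrM (ger0_norm (ler0n _ 2)).
rewrite lerD2l; apply: le_trans (ler_normD _ _) _; rewrite /Ld; lra.
Qed.

Let K_bound r y : 0 < r -> r != u -> - (rho * pi) < y <= 0 -> `|K r y| <= A2_dom r.
Proof.
move=> r0 ru yI; have [v1 v2] := V_bound r0 yI; have p := P_bound y r0 ru.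
apply: domE => //; last by rewrite ler_norml sin_geN1 sin_le1.
by apply: cosle; case/andP: yI => /ltW -> ->.
Qed.

Let mK y : measurable_fun (setT : set R) (K ^~ y).
Proof. by rewrite /K /V /P /La /Th /nrm2; meas. Qed.

Let K_int y : - (rho * pi) < y <= 0 -> mu.-integrable `]0, +oo[ (EFin \o (K ^~ y)).
Proof.
move=> yI; apply: (@le_Lint_except _ A2_dom u) => //; last exact: integrable_A2_dom.
  exact: mfunS.
by move=> r; rewrite /= in_itv/= andbT => r0 ru; exact: K_bound.
Qed.

(** At angle 0 the two logarithms are conjugate, so the imaginary part vanishes and only the
    boundary term at r = 0, where the real part tends to 2 ln u, survives the rotation. *)
Let K_rot y : - (rho * pi) < y < 0 -> \int[mu]_(r in `]0, +oo[) K r y = - (2 * ln u * y).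
Proof.
move=> /andP[y1 y2]; have pi0 := @pi_gt0 R; have /andP[q1 q2] := rpi.
pose m := (rho * pi - y) / 2.
have mI : 0 < m < rho * pi by rewrite /m; apply/andP; split; lra.
have E z : - pi < z < pi -> \int[mu]_(r in `]0, +oo[) (complex.Im (F r z) / r) =
    \int[mu]_(r in `]0, +oo[) K r z.
  by move=> zI; apply: eq_Lintegral => r; rewrite /= in_itv/= andbT => r0; exact: Im_F.
have I z : - (rho * pi) < z <= 0 ->
    mu.-integrable `]0, +oo[ (EFin \o (fun r => complex.Im (F r z) / r)).
  move=> zI; apply: (@eq_Lint _ _ (K ^~ z)) => //; last exact: K_int.
  move=> r; rewrite /= in_itv/= andbT => r0; rewrite Im_F//.
  by case/andP: zI => ? ?; apply/andP; split; lra.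
have my : - m < y by rewrite /m; lra.
have yI : - (rho * pi) < y <= 0 by rewrite y1 ltW.
have zI : - (rho * pi) < 0 <= (0 : R) by rewrite lexx oppr_lt0 q1.
have m0 : 0 < m by case/andP: mI.
have rot := A2_rotate mI my y2 m0 (I _ yI) (I _ zI).
rewrite !E in rot; [|apply/andP; split; lra|apply/andP; split; lra].
have Z : \int[mu]_(r in `]0, +oo[) K r 0 = 0 :> R.
  rewrite -[RHS](mul0r (\int[mu]_(r in `]0, +oo[) K r 0)) -LintegralZ//; last first.
    by apply: K_int; apply/andP; split; lra.
  apply: eq_Lintegral => r _; rewrite /K /V !add0r ThN subrr sin0 mul0r mulr0 subrr mul0r.
  by rewrite mulr0.
by rewrite Z in rot; lra.
Qed.

(** The real part of [S] on the ray of angle - rho pi: one logarithm is then taken at angle pi - 2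
    rho pi, the other at angle - pi, where it reduces to ln |1 - v / u|. *)
Definition A2_log v : R := 2 * ln u + (La (v / u) (pi - 2 * rho * pi) + ln `|1 - v / u|).

Let J0 v := (1 + v * cos (rho * pi)) / v / nrm2 v (rho * pi).
Let Vi v := Th (v / u) (pi - 2 * rho * pi) - (if 1 < v / u then pi else 0).
Let Ki v := (Vi v * ((1 + v * cos (rho * pi)) / v) + A2_log v * sin (rho * pi)) / nrm2 v (rho * pi).

Let dang : - pi < pi - 2 * rho * pi < pi.
Proof. by case/andP: rpi => ? ?; rewrite -mulrA; apply/andP; split; lra. Qed.

Let mif (E : set R) : measurable_fun E (fun v : R => if 1 < v / u then pi else 0 : R).
Proof.
apply: mfunS; apply: measurable_fun_ifT => //.
by apply: measurable_fun_ltr => //; meas.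
Qed.

Let mKi : measurable_fun (setT : set R) Ki.
Proof.
rewrite /Ki /Vi /A2_log /La /Th /nrm2; meas.
Qed.

(** Angles strictly inside the strip that tend to the singular ray - rho pi. *)
Let y_ (n : nat) : R := - (rho * pi) + rho * pi * n.+2%:R^-1.

Let y_I n : - (rho * pi) < y_ n < 0.
Proof.
case/andP: rpi => q1 q2; rewrite /y_.
have n1 : (n.+2%:R : R)^-1 < 1 by rewrite invf_lt1// ltr1n.
have n0 : 0 < (n.+2%:R : R)^-1 by rewrite invr_gt0.
have h : 0 < rho * pi / n.+2%:R < rho * pi.
  by rewrite mulr_gt0//= -[ltRHS]mulr1 ltr_pM2l.
by case/andP: h => h0 h1; rewrite ltrDl h0 addrC subr_lt0.
Qed.

Let y_cvg : y_ n @[n --> \oo] --> - (rho * pi).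
Proof.
rewrite -[X in _ --> X]addr0 -(mulr0 (rho * pi)); apply: cvgD; first exact: cvg_cst.
apply: cvgM; first exact: cvg_cst.
have := @cvg_harmonic R; rewrite -(cvg_shiftS (@harmonic R)); exact.
Qed.

(** Everything extends continuously to the limiting ray except the argument of the second logarithm,
    which tends to - pi exactly when r > u. *)
Let K_cvg r : 0 < r -> r != u -> K r (y_ n) @[n --> \oo] --> Ki r.
Proof.
move=> r0 ru; have x0 : 0 < r / u by rewrite divr_gt0.
have x1 : r / u != 1 by apply: contra ru => /eqP h; rewrite -[u]mul1r -h mulfVK// gt_eqF.
have cc (f : R -> R) a b : {for a, continuous f} -> a = - (rho * pi) -> f a = b ->
    f (y_ n) @[n --> \oo] --> b.
  by move=> + ea <-; rewrite ea => fc; exact: (continuous_cvg _ fc y_cvg).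
have ey : - (rho * pi) + del = pi - 2 * rho * pi by rewrite /del; ring.
have em : - (rho * pi) - del = - pi by rewrite /del; ring.
have c1 : Th (r / u) (y_ n + del) @[n --> \oo] --> Th (r / u) (pi - 2 * rho * pi).
  apply: (@cc (fun y => Th (r / u) (y + del)) (- (rho * pi))) => //; last by rewrite ey.
  have a1 : - pi < - (rho * pi) + del < pi by rewrite ey.
  have [_ _ _ d1] := chol_clog1p u0 r0 a1.
  exact: (der_cont d1).
have c2 : Th (r / u) (y_ n - del) @[n --> \oo] --> - (if 1 < r / u then pi else 0 : R).
  have e n : Th (r / u) (y_ n - del) = - Th (r / u) (del - y_ n) by rewrite -ThN [- (del - y_ n)]opprB.
  under eq_fun do rewrite e.
  apply: cvgN; apply: Th_cvg_pi => //; first exact: ltW.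
    move=> n; have yI : - (rho * pi) < y_ n <= 0 by case/andP: (y_I n) => -> /ltW ->.
    by have /andP[? ?] := angm yI; apply/andP; split; lra.
  have -> : pi = del - - (rho * pi) by rewrite /del; ring.
  by apply: cvgB => //; exact: cvg_cst.
have cL (c : R) : 0 < nrm2 (r / u) (- (rho * pi) + c) ->
    La (r / u) (y_ n + c) @[n --> \oo] --> La (r / u) (- (rho * pi) + c).
  move=> h; apply: (@cc (fun y => La (r / u) (y + c)) (- (rho * pi))) => //.
  by rewrite /La /nrm2 in h *; dcont.
have c3 := cL del ltac:(rewrite ey; apply: nrm2_gt0 => //; exact: ltW).
have c4 := cL (- del) ltac:(rewrite em; apply: lt_le_trans (nrm2_ge _ (ltW x0)); rewrite lt_neqAle sqr_ge0 andbT eq_sym sqrf_eq0 subr_eq0; exact: x1).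
have e4 : La (r / u) (- (rho * pi) - del) = ln `|1 - r / u|.
  have p0 : 0 < `|1 - r / u| by rewrite normr_gt0 subr_eq0 eq_sym.
  rewrite em LaN /La /nrm2 cospi.
  have -> : 1 + 2 * (r / u) * -1 + (r / u) ^+ 2 = `|1 - r / u| ^+ 2.
    by rewrite real_normK ?num_real//; ring.
  by rewrite lnXn// mulr2n; field.
rewrite e4 in c4; rewrite ey in c3.
have cn : nrm2 r (y_ n) @[n --> \oo] --> nrm2 r (rho * pi).
  apply: (@cc (nrm2 r) (- (rho * pi))) => //; last by rewrite /nrm2 cosN.
  by rewrite /nrm2; dcont.
have cs : sin (y_ n) @[n --> \oo] --> - sin (rho * pi).
  by apply: (@cc sin (- (rho * pi))); rewrite ?sinN//; exact: continuous_sin.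
have cz : cos (y_ n) @[n --> \oo] --> cos (rho * pi).
  by apply: (@cc cos (- (rho * pi))); rewrite ?cosN//; exact: continuous_cos.
rewrite /K /Ki; apply: cvgM.
  rewrite -[A2_log r * _]opprK -mulrN; apply: cvgB.
    apply: cvgM; first by apply: cvgD.
    apply: cvgM; last exact: cvg_cst.
    apply: cvgD; first exact: cvg_cst.
    by apply: cvgM => //; exact: cvg_cst.
  apply: cvgM => //; apply: cvgD; first exact: cvg_cst.
  exact: cvgD.
apply: cvgV => //; rewrite gt_eqF// nrm2_gt0 ?ltW//.
by have pi0 := @pi_gt0 R; case/andP: rpi => ? ?; apply/andP; split; lra.
Qed.

Let Ki_lim : mu.-integrable `]0, +oo[ (EFin \o Ki) /\
  \int[mu]_(r in `]0, +oo[) Ki r = 2 * ln u * (rho * pi).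
Proof.
have h1 x : (`]0, +oo[%classic : set R) x -> x != u -> K x (y_ n) @[n --> \oo] --> Ki x.
  by rewrite /= in_itv/= andbT; exact: K_cvg.
have h2 n x : (`]0, +oo[%classic : set R) x -> x != u -> `|K x (y_ n)| <= A2_dom x.
  rewrite /= in_itv/= andbT => x0 xu; apply: K_bound => //.
  by case/andP: (y_I n) => -> /ltW ->.
have [i c] := @Ldominated_cvg_except _ A2_dom u `]0, +oo[ (fun n => K ^~ (y_ n)) Ki
  (measurable_itv _) (fun n => mfunS (mK _)) (mfunS mKi) h1 integrable_A2_dom h2.
split=> //; have e n := K_rot (y_I n).
move: c; under eq_fun do rewrite e; move=> c.
apply: (cvg_unique _ c) => //.
have -> : 2 * ln u * (rho * pi) = - (2 * ln u * - (rho * pi)) by ring.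
by apply: cvgN; apply: cvgM => //; exact: cvg_cst.
Qed.

Let Jt v := Th (v / u) (pi - 2 * rho * pi) * J0 v.
(** [Li] is the contribution of the jump by pi; subtracting it from the limit of the rotated
    integrand leaves [Jt], the integrand of J, and the logarithmic part. *)
Let Li v := if 1 < v / u then pi * J0 v else 0 : R.

(** The complex number in J is u (1 + (v / u) e^(it)) with t = pi - 2 rho pi, because cos and sin of
    t are - cos (2 rho pi) and sin (2 rho pi). *)
Let J_integrandE v : 0 < v -> J_integrand rho u v = Jt v.
Proof.
move=> v0; have x0 : 0 <= v / u by rewrite divr_ge0 ?ltW.
rewrite /J_integrand /Jt /J0 -(cArg_Th u0 x0 dang) -/(nrm2 v (rho * pi)).
have -> : u * (v / u) = v by field; rewrite gt_eqF.
rewrite cosB sinB cospi sinpi !(mulN1r, mul0r, addr0, sub0r, opprK) mulrN.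
by rewrite mulrC; congr (_ * _); rewrite -mulrA [_^-1 * v^-1]mulrC mulrA.
Qed.

Let dom_c c2 v : 0 < v -> v != u -> `|c2| <= 2 * `|ln u| + 2 * Ld (v / u) -> `|wk rho v * c2| <= A2_dom v.
Proof.
move=> v0 vu h; have pi0 := @pi_gt0 R.
have := @domE 0 c2 (- sin (rho * pi)) v (rho * pi) v0 (lexx _).
rewrite normr0 mul0r add0r mulrN opprK normrN => h'.
have -> : wk rho v * c2 = c2 * sin (rho * pi) / nrm2 v (rho * pi) by rewrite /wk /nrm2; ring.
apply: h' => //.
- by rewrite mulr_ge0// ltW.
- by rewrite !mulr_ge0// ?invr_ge0 ltW.
- by rewrite ler_norml sin_geN1 sin_le1.
Qed.

Lemma integrable_wk_log : mu.-integrable `]0, +oo[ (EFin \o (fun v => wk rho v * A2_log v)).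
Proof.
apply: (@le_Lint_except _ A2_dom u) => //; last exact: integrable_A2_dom.
  by rewrite /wk /A2_log /La /nrm2; meas.
move=> v; rewrite /= in_itv/= andbT => v0 vu; apply: dom_c => //.
have x0 : 0 <= v / u by rewrite divr_ge0 ?ltW.
have x1 : v / u != 1 by apply: contra vu => /eqP h; rewrite -[u]mul1r -h mulfVK// gt_eqF.
have l1 := @La_norm _ _ (pi - 2 * rho * pi) x0 x1.
have l2 : 0 <= ln (1 + v / u) by rewrite ln_ge0// lerDl.
rewrite /A2_log; apply: le_trans (ler_normD _ _) _; rewrite normrM (ger0_norm (ler0n _ 2)).
by rewrite lerD2l; apply: le_trans (ler_normD _ _) _; rewrite /Ld; lra.
Qed.

Let Jt_int : mu.-integrable `]0, +oo[ (EFin \o Jt).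
Proof.
apply: (@le_Lint _ A2_dom) => //; last exact: integrable_A2_dom.
  by rewrite /Jt /J0 /Th /nrm2; meas.
move=> v; rewrite /= in_itv/= andbT => v0; have pi0 := @pi_gt0 R.
have x0 : 0 <= v / u by rewrite divr_ge0 ?ltW.
have b1 := Th_norm x0 dang; have b2 := Th_lin x0 dang.
have b3 : `|pi - 2 * rho * pi| <= pi by case/andP: dang => ? ?; rewrite ler_norml !ltW.
have := @domE (Th (v / u) (pi - 2 * rho * pi)) 0 0 v (rho * pi) v0 (lexx _).
have -> : (Th (v / u) (pi - 2 * rho * pi) * ((1 + v * cos (rho * pi)) / v) - 0 * 0) /
  nrm2 v (rho * pi) = Jt v by rewrite /Jt /J0; ring.
apply=> //.
- lra.
- by apply: le_trans b2 _; rewrite ler_wpM2r// ler_wpM2r// ?ltW//; lra.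
- by rewrite normr0.
- by rewrite normr0 addr_ge0// mulr_ge0// /Ld addr_ge0// ln_ge0// lerDl.
Qed.

Lemma integrable_J : mu.-integrable `]0, +oo[ (EFin \o J_integrand rho u).
Proof.
apply: (@eq_Lint _ _ Jt) => //.
by move=> v; rewrite /= in_itv/= andbT => /J_integrandE.
Qed.

Let KiE v : 0 < v -> Ki v = Jt v + wk rho v * A2_log v - Li v.
Proof.
move=> v0; rewrite /Ki /Vi /Jt /Li /J0 /wk -/(nrm2 v (rho * pi)).
by case: ifP => _; ring.
Qed.

Let Li_int : mu.-integrable `]0, +oo[ (EFin \o Li) /\
  \int[mu]_(v in `]0, +oo[) Li v =
  \int[mu]_(v in `]0, +oo[) Jt v + \int[mu]_(v in `]0, +oo[) (wk rho v * A2_log v) - 2 * ln u * (rho * pi).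
Proof.
have [i e] := Ki_lim; have i2 := integrable_wk_log.
have i3 := @LintD _ _ _ _ (measurable_itv _) Jt_int i2.
have h v : (`]0, +oo[%classic : set R) v -> Jt v + wk rho v * A2_log v - Ki v = Li v.
  by rewrite /= in_itv/= andbT => v0; rewrite KiE//; ring.
split; first by apply: (@eq_Lint _ _ (fun v => Jt v + wk rho v * A2_log v - Ki v)) => //; exact: LintB.
rewrite -(eq_Lintegral h) LintegralB// LintegralD// e.
by [].
Qed.

Let lim_ln_La : (ln r - La r (rho * pi)) @[r --> +oo] --> (0 : R).
Proof.
have pV : (x : R) `^ (-1) @[x --> +oo] --> (0 : R) by apply: cvgy_powRN.
have c : (- ln (1 + 2 * cos (rho * pi) * x `^ (-1) + x `^ (-1) * x `^ (-1)) / 2) @[x --> +oo] --> (0 : R).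
  have h : (1 + 2 * cos (rho * pi) * x `^ (-1) + x `^ (-1) * x `^ (-1)) @[x --> +oo] --> (1 : R).
    rewrite -[X in _ --> X]addr0 -[X in _ --> X + _]addr0.
    rewrite -[X in _ --> _ + X + _](mulr0 (2 * cos (rho * pi))) -[X in _ --> _ + X](mulr0 (0 : R)).
    apply: cvgD; last exact: cvgM.
    by apply: cvgD; [exact: cvg_cst|apply: cvgM => //; exact: cvg_cst].
  have cl : {for (1 : R), continuous (@ln R)} by apply: continuous_ln.
  have hl : ln (1 + 2 * cos (rho * pi) * x `^ (-1) + x `^ (-1) * x `^ (-1)) @[x --> +oo] --> (0 : R).
    by rewrite -(@ln1 R); exact: (continuous_cvg _ cl h).
  have z : 0 = - 0 / 2 :> R by rewrite oppr0 mul0r.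
  by rewrite [X in _ --> X]z; apply: cvgM; [exact: cvgN|exact: cvg_cst].
apply: cvg_trans c; apply: near_eq_cvg; near=> r.
have r0 : 0 < r by near: r; exact: nbhs_pinfty_gt.
have pi0 := @pi_gt0 R.
have n0 : 0 < nrm2 r (rho * pi).
  by rewrite nrm2_gt0 ?ltW//; case/andP: rpi => ? ?; apply/andP; split; lra.
have r2 : 0 < r ^+ 2 by rewrite exprn_gt0.
rewrite powR_inv1 ?ltW//.
have -> : 1 + 2 * cos (rho * pi) * r^-1 + r^-1 * r^-1 = nrm2 r (rho * pi) / r ^+ 2.
  by rewrite /nrm2; field; rewrite gt_eqF.
by rewrite ln_div ?posrE// lnXn// /La mulr2n; field.
Unshelve. all: by end_near. Qed.

(** [J0] is the derivative of ln r - [La r (rho * pi)], which tends to 0 at infinity; only the value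
    at [u] remains. *)
Let Li_val : \int[mu]_(v in `]0, +oo[) Li v = - (pi * (ln u - La u (rho * pi))).
Proof.
have sub : (`]u, +oo[%classic : set R) `<=` `]0, +oo[.
  by move=> v; rewrite /= !in_itv/= !andbT; exact: lt_trans.
have mI : measurable (`]u, +oo[%classic : set R) by [].
have iI : mu.-integrable `]u, +oo[ (EFin \o (fun v => pi * J0 v)).
  apply: (@eq_Lint _ _ Li) => //; last exact: integrableS Li_int.1.
  by move=> v; rewrite /= in_itv/= andbT => uv; rewrite /Li ltr_pdivlMr// mul1r uv.
have [_ e] := @integrable_restr _ `]u, +oo[ `]0, +oo[ (fun v => pi * J0 v) mI (measurable_itv _) sub iI.
have -> : \int[mu]_(v in `]0, +oo[) Li v = \int[mu]_(v in `]u, +oo[) (pi * J0 v).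
  rewrite -e; apply: eq_Lintegral => v _; rewrite /Li patchE.
  case: ifP => uv; case: ifPn => //; rewrite ?inE ?notin_setE /= in_itv/= andbT.
    by rewrite ltr_pdivlMr// mul1r in uv.
  by move=> h; rewrite ltr_pdivlMr// mul1r h in uv.
have pi0 := @pi_gt0 R.
have n0 r : u < r -> 0 < nrm2 r (rho * pi).
  move=> ur; rewrite nrm2_gt0 ?ltW ?(lt_trans u0)//; case/andP: rpi => ? ?; apply/andP; split; lra.
have d r : u <= r -> isder r (fun r => pi * (ln r - La r (rho * pi))) (pi * J0 r).
  move=> ur; have r0 : 0 < r by exact: lt_le_trans ur.
  have n1 : 0 < 1 + 2 * r * cos (rho * pi) + r ^+ 2.
    by rewrite -/(nrm2 r (rho * pi)) nrm2_gt0 ?ltW//; case/andP: rpi => ? ?; apply/andP; split; lra.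
  by rewrite /La /nrm2 /J0; der => //; rewrite /nrm2; field; rewrite !gt_eqF.
rewrite (@Lintegral_FTC_oy _ u (pi * (ln u - La u (rho * pi))) (pi * 0) _
   (fun r => pi * (ln r - La r (rho * pi)))) ?mulr0 ?sub0r//.
- move=> r ur; have r0 : r != 0 by rewrite gt_eqF// (lt_trans u0).
  have n1 := n0 _ ur.
  by rewrite /J0 /nrm2 in n1 *; dcont => //; rewrite gt_eqF.
- by move=> r /ltW; exact: d.
- by apply: cont_at_right (der_cont (d u (lexx _))) _.
- by rewrite -[0](mulr0 pi); apply: cvgM; [exact: cvg_cst|exact: lim_ln_La].
Qed.

(* Rotate [(Log (u - s e^(- i rho pi)) + Log (u - s e^(i rho pi))) / (1 + s)]
   from [s > 0] to [s] on the ray of angle [- rho pi]. *)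
Lemma J_term_identity : J_term rho u +
    pi^-1 * (\int[mu]_(v in `]0, +oo[) (wk rho v * A2_log v)) =
  (2 * rho - 1) * ln u + La u (rho * pi).
Proof.
have pi0 := @pi_gt0 R; have e := Li_int.2; rewrite Li_val in e.
rewrite /J_term (@eq_Lintegral _ _ _ Jt); last first.
  by move=> v; rewrite /= in_itv/= andbT => /J_integrandE.
have -> : \int[mu]_(v in `]0, +oo[) Jt v = - (pi * (ln u - La u (rho * pi))) -
    \int[mu]_(v in `]0, +oo[) (wk rho v * A2_log v) + 2 * ln u * (rho * pi).
  by rewrite e; ring.
have gen (p a b l q : R) : p != 0 ->
    p^-1 * (- (p * (l - b)) - a + 2 * l * (q * p)) + p^-1 * a = (2 * q - 1) * l + b.
  by move=> p0; field.
by apply: gen; rewrite gt_eqF.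
Qed.

End A2.

(** * Holomorphy of integrals depending on a parameter *)

Section chol_integral.
Context {R : realType}.
Notation mu := (@lebesgue_measure R).
Implicit Types r y s t v : R.

Lemma chol_scale (c : R) (F : R -> R -> R[i]) (D : R[i]) r y : chol F D r y ->
  chol (fun s t => (c * complex.Re (F s t)) +i* (c * complex.Im (F s t)))
    ((c * complex.Re D) +i* (c * complex.Im D)) r y.
Proof.
by move=> [f1 f2 f3 f4]; split => /=;
  [apply: isder_eq (derM (der_cst c _) f1) _|apply: isder_eq (derM (der_cst c _) f2) _|
   apply: isder_eq (derM (der_cst c _) f3) _|apply: isder_eq (derM (der_cst c _) f4) _]; ring.
Qed.

(** All four polar partial derivatives are taken under the integral sign. The angular ones carry a
    factor [r], whence the second majorant [r * G v]. *)
Lemma chol_integral (E : set R) (f df : R -> R -> R -> R[i]) (G : R -> R) (r1 r2 l u r y : R) :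
  measurable E -> 0 <= r1 -> r1 < r < r2 -> l < y < u ->
  (forall s t, r1 < s < r2 -> l < t < u ->
    mu.-integrable E (EFin \o (fun v => complex.Re (f v s t))) /\
    mu.-integrable E (EFin \o (fun v => complex.Im (f v s t)))) ->
  (forall v s t, E v -> r1 < s < r2 -> l < t < u -> chol (f v) (df v s t) s t) ->
  measurable_fun E (fun v => complex.Re (df v r y)) ->
  measurable_fun E (fun v => complex.Im (df v r y)) ->
  mu.-integrable E (EFin \o G) ->
  (forall v s t, E v -> r1 < s < r2 -> l < t < u -> cabs (df v s t) <= G v) ->
  chol (fun s t => (\int[mu]_(v in E) complex.Re (f v s t)) +i* (\int[mu]_(v in E) complex.Im (f v s t)))
    ((\int[mu]_(v in E) complex.Re (df v r y)) +i* (\int[mu]_(v in E) complex.Im (df v r y))) r y.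
Proof.
move=> mE r10 rI yI fi fd m1 m2 Gi dG.
have r0 : 0 < r by case/andP: rI => h _; exact: le_lt_trans h.
have Re_le v s t : E v -> r1 < s < r2 -> l < t < u -> `|complex.Re (df v s t)| <= G v.
  by move=> Ev sI tI; exact: le_trans (cabs_ge_Re _) (dG v s t Ev sI tI).
have Im_le v s t : E v -> r1 < s < r2 -> l < t < u -> `|complex.Im (df v s t)| <= G v.
  by move=> Ev sI tI; exact: le_trans (cabs_ge_Im _) (dG v s t Ev sI tI).
have i1 : mu.-integrable E (EFin \o (fun v => complex.Re (df v r y))).
  by apply: (@le_Lint _ G) => // v Ev; exact: Re_le.
have i2 : mu.-integrable E (EFin \o (fun v => complex.Im (df v r y))).
  by apply: (@le_Lint _ G) => // v Ev; exact: Im_le.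
have rGi : mu.-integrable E (EFin \o (fun v => r * G v)) by exact: LintZ.
split => /=.
- apply: (@der_under_integral _ E G (fun s v => complex.Re (f v s y)) (fun s v => complex.Re (df v s y)) r1 r2) => //.
  + by move=> s sI; have [] := fi s y sI yI.
  + by move=> s v sI Ev; have [] := fd v s y Ev sI yI.
  + by move=> s v sI Ev; exact: Re_le.
- apply: (@der_under_integral _ E G (fun s v => complex.Im (f v s y)) (fun s v => complex.Im (df v s y)) r1 r2) => //.
  + by move=> s sI; have [] := fi s y sI yI.
  + by move=> s v sI Ev; have [] := fd v s y Ev sI yI.
  + by move=> s v sI Ev; exact: Im_le.
- apply: (isder_eq (a := \int[mu]_(v in E) (- r * complex.Im (df v r y)))); last by rewrite LintegralZ// mulNr.
  apply: (@der_under_integral _ E (fun v => r * G v) (fun t v => complex.Re (f v r t)) (fun t v => - r * complex.Im (df v r t)) l u) => //.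
  + by move=> t tI; have [] := fi r t rI tI.
  + by move=> t v tI Ev; have [_ _ + _] := fd v r t Ev rI tI; rewrite mulNr.
  + by move=> t v tI Ev; rewrite normrM normrN (gtr0_norm r0) ler_pM2l// Im_le.
- apply: (isder_eq (a := \int[mu]_(v in E) (r * complex.Re (df v r y)))); last by rewrite LintegralZ.
  apply: (@der_under_integral _ E (fun v => r * G v) (fun t v => complex.Im (f v r t)) (fun t v => r * complex.Re (df v r t)) l u) => //.
  + by move=> t tI; have [] := fi r t rI tI.
  + by move=> t v tI Ev; have [] := fd v r t Ev rI tI.
  + by move=> t v tI Ev; rewrite normrM (gtr0_norm r0) ler_pM2l// Re_le.
Qed.

Lemma cont_integral (E : set R) (f : R -> R -> R) (G : R -> R) (r1 r2 r : R) :
  measurable E -> r1 < r < r2 ->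
  (forall s, r1 < s < r2 -> measurable_fun E (f s)) ->
  (forall s v, r1 < s < r2 -> E v -> {for s, continuous (f ^~ v)}) ->
  mu.-integrable E (EFin \o G) ->
  (forall s v, r1 < s < r2 -> E v -> `|f s v| <= G v) ->
  {for r, continuous (fun s => \int[mu]_(v in E) f s v)}.
Proof.
move=> mE rI mf cf Gi fG.
have h1 z : (`]r1, r2[%classic : set R) z -> mu.-integrable E (EFin \o f z).
  rewrite /= in_itv/= => zI; apply: (@le_Lint _ G) => //; first exact: mf.
  by move=> v Ev; exact: fG.
have h2 : \forall v \ae mu, E v -> {in `]r1, r2[%classic, continuous (f ^~ v)}.
  by apply: aeW => v Ev z; rewrite inE /= in_itv/= => zI; exact: cf.
have h4 z : (`]r1, r2[%classic : set R) z -> \forall v \ae mu, E v -> `|f z v| <= G v.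
  by rewrite /= in_itv/= => zI; apply: aeW => v Ev; exact: fG.
have := @continuity_under_integral R _ _ mu f _ mE r1 r2 h1 h2 G Gi h4 r.
by apply; rewrite inE /= in_itv/=.
Qed.

End chol_integral.

(** * A Stieltjes representation *)

Section kappa.
Context {R : realType}.
Notation mu := (@lebesgue_measure R).
Variables (alpha rho : R).
Hypotheses (a02 : 0 < alpha <= 2) (rho01 : 0 < rho < 1).
Implicit Types r y s t v : R.

Let alpha0 : 0 < alpha. Proof. by case/andP: a02. Qed.
Let pin0 : 0 < pi^-1 :> R. Proof. by rewrite invr_gt0 pi_gt0. Qed.

Definition rat v r : R := v `^ alpha / r `^ alpha.

Lemma rat_gt0 v r : 0 < v -> 0 < r -> 0 < rat v r.
Proof. by move=> v0 r0; rewrite divr_gt0// powR_gt0. Qed.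

Lemma rat_div v r : 0 < v -> 0 < r -> rat v r = (v / r) `^ alpha.
Proof.
move=> v0 r0; rewrite /rat powRM ?invr_ge0 ?ltW//; congr (_ * _).
by rewrite -(powR_inv1 (ltW r0)) -powRrM mulN1r powRN.
Qed.

Lemma rat_neq1 v r : 0 < v -> 0 < r -> v != r -> rat v r != 1.
Proof.
move=> v0 r0; apply: contra => /eqP h; rewrite rat_div// in h.
have vr : 0 <= v / r by rewrite divr_ge0// ltW.
have : (v / r) `^ alpha `^ alpha^-1 = 1 by rewrite h powR1.
have an : alpha != 0 by rewrite gt_eqF.
rewrite -powRrM divff// powRr1// => e.
by rewrite -[r]mul1r -e mulfVK// gt_eqF.
Qed.

Lemma rat_gt1 v r : 0 < v -> 0 < r -> (1 < rat v r) = (r < v).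
Proof.
move=> v0 r0; rewrite /rat ltr_pdivlMr ?powR_gt0// mul1r.
apply/idP/idP => [|h]; last by apply: gt0_ltr_powR => //; rewrite nnegrE ltW.
apply: contraTT; rewrite -!leNgt => h.
by apply: ge0_ler_powR => //; rewrite ?nnegrE ltW.
Qed.

(** Log (1 + v^alpha / z) at z = (r e^(iy))^alpha; dividing by z turns the angle into - alpha y. *)
Definition mlog v r y : R[i] := La (rat v r) (- (alpha * y)) +i* Th (rat v r) (- (alpha * y)).

Definition dmlog v r y : R[i] :=
  let x := rat v r in let t := - (alpha * y) in
  (- (alpha / r) * (x * (cos t + x) / nrm2 x t)) +i* (- (alpha / r) * (x * sin t / nrm2 x t)).

Lemma der_rat v r : 0 < r -> isder r (rat v) (- (alpha / r) * rat v r).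
Proof.
move=> r0; have p0 : r `^ alpha != 0 by rewrite gt_eqF// powR_gt0.
have rn : r != 0 by rewrite gt_eqF.
have E : r `^ (alpha - 1) = r `^ alpha / r by rewrite powRD ?rn ?implybT// powRN powRr1// ltW.
have h : isder r (rat v) _ := derM (der_cst (v `^ alpha) r) (@derV _ (fun s => s `^ alpha) r _ p0 (der_pow alpha r0 (der_id r))).
apply: (isder_eq h).
by rewrite E /rat; field; rewrite rn p0.
Qed.

Lemma chol_mlog v r y : 0 < v -> 0 < r -> - pi < alpha * y < pi -> chol (mlog v) (dmlog v r y) r y.
Proof.
move=> v0 r0 yI; have x0 : 0 <= rat v r by rewrite ltW// rat_gt0.
have tI : - pi < - (alpha * y) < pi by case/andP: yI => ? ?; apply/andP; split; lra.
have n0 : nrm2 (rat v r) (- (alpha * y)) != 0 by rewrite gt_eqF// nrm2_gt0.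
have rn : r != 0 by rewrite gt_eqF.
have l := der_rat v r0.
have m : isder y (fun z => - (alpha * z)) (- alpha).
  by apply: (isder_eq (derN (derM (der_cst alpha y) (der_id y)))); ring.
split=> /=.
- by apply: (isder_eq (@der_comp _ (La ^~ (- (alpha * y))) (rat v) r _ _ (der_La_r x0 tI) l)); field; rewrite n0.
- by apply: (isder_eq (@der_comp _ (Th ^~ (- (alpha * y))) (rat v) r _ _ (der_Th_r x0 tI) l)); field; rewrite n0.
- by apply: (isder_eq (@der_comp _ (La (rat v r)) (fun z => - (alpha * z)) y _ _ (der_La_t x0 tI) m)); field; rewrite n0.
- by apply: (isder_eq (@der_comp _ (Th (rat v r)) (fun z => - (alpha * z)) y _ _ (der_Th_t x0 tI) m)); field; rewrite n0.
Qed.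

(** The bound is uniform in [v]: with x = [rat v r], the quotient x (1 + x) / (1 + x^2) is at most
    2, so differentiating the logarithm costs only a multiple of alpha / r. *)
Lemma cabs_dmlog v r y tau : 0 < v -> 0 < r -> 0 < tau < pi -> - tau < alpha * y < tau ->
  cabs (dmlog v r y) <= 4 * wC (tau / pi) * (alpha / r).
Proof.
move=> v0 r0 tauI yI; have x0 := rat_gt0 v0 r0.
have tI : - tau < - (alpha * y) < tau by case/andP: yI => ? ?; apply/andP; split; lra.
have [h w0] := nrm2_lower_angle (ltW x0) tauI tI.
have p0 : 0 < 1 + rat v r ^+ 2 by rewrite ltr_pwDl// sqr_ge0.
have n0 : 0 < nrm2 (rat v r) (- (alpha * y)) by rewrite -(pmulr_rgt0 _ w0) (lt_le_trans p0).
have ar : 0 < alpha / r by rewrite divr_gt0.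
have key c : `|c| <= 1 + rat v r ->
    `|- (alpha / r) * (rat v r * c / nrm2 (rat v r) (- (alpha * y)))| <= 2 * wC (tau / pi) * (alpha / r).
  move=> c1; rewrite normrM normrN (gtr0_norm ar) mulrC ler_pM2r//.
  rewrite normrM [X in _ * X]gtr0_norm ?invr_gt0// ler_pdivrMr// normrM (gtr0_norm x0).
  apply: (@le_trans _ _ (rat v r * (1 + rat v r))); first by rewrite ler_pM2l.
  have := sqr_ge0 (1 - rat v r); nra.
apply: le_trans (cabs_le_ReIm _) _; rewrite /=.
have -> : 4 * wC (tau / pi) * (alpha / r) = 2 * wC (tau / pi) * (alpha / r) + 2 * wC (tau / pi) * (alpha / r) by ring.
apply: lerD; apply: key.
  apply: le_trans (ler_normD _ _) _; rewrite (gtr0_norm x0) lerD2r.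
  by rewrite ler_norml cos_geN1 cos_le1.
apply: (@le_trans _ _ 1); last by rewrite lerDl ltW.
by rewrite ler_norml sin_geN1 sin_le1.
Qed.

Let wp v : R := - pi^-1 * wk rho v.

(* [kap r y = exp (- (1/pi) int w(v) Log (1 + v^alpha / z) dv)] at
   [z = (r e^(iy))^alpha]. *)
Definition lkap r y : R[i] :=
  (\int[mu]_(v in `]0, +oo[) (wp v * La (rat v r) (- (alpha * y)))) +i*
  (\int[mu]_(v in `]0, +oo[) (wp v * Th (rat v r) (- (alpha * y)))).

Definition dlkap r y : R[i] :=
  (\int[mu]_(v in `]0, +oo[) (wp v * complex.Re (dmlog v r y))) +i*
  (\int[mu]_(v in `]0, +oo[) (wp v * complex.Im (dmlog v r y))).

Definition kap r y : R[i] := cexp (lkap r y).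

Let m0y : measurable (`]0, +oo[%classic : set R). Proof. exact: measurable_itv. Qed.

Let S v : (`]0, +oo[%classic : set R) v -> 0 < v.
Proof. by rewrite /= in_itv/= andbT. Qed.

Let wp_abs v : 0 < v -> `|wp v| = pi^-1 * wk rho v.
Proof.
move=> v0; rewrite /wp mulNr normrN ger0_norm// mulr_ge0 ?(ltW pin0)//.
by apply: wk_ge0 => //; exact: ltW.
Qed.

Let mwp (D : set R) : measurable_fun D wp.
Proof. by apply: mfunS; rewrite /wp /wk; meas. Qed.

Let kdom r v := pi^-1 * wC rho * (Ld (v `^ alpha / r `^ alpha) / (1 + v ^+ 2)).

Let kdomi r : 0 < r -> mu.-integrable `]0, +oo[ (EFin \o kdom r).
Proof. by move=> r0; apply: LintZ => //; apply: integrable_Ld => //; rewrite powR_gt0. Qed.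

Let wp_le v : 0 < v -> `|wp v| <= pi^-1 * wC rho / (1 + v ^+ 2).
Proof.
move=> v0; rewrite wp_abs// -mulrA ler_pM2l//; apply: wk_le => //; exact: ltW.
Qed.

Lemma La_dom v r t : 0 < v -> 0 < r -> v != r -> `|wp v * La (rat v r) t| <= kdom r v.
Proof.
move=> v0 r0 vr; have x0 := rat_gt0 v0 r0.
have l := @La_norm _ _ t (ltW x0) (rat_neq1 v0 r0 vr).
rewrite normrM; apply: (@le_trans _ _ (pi^-1 * wC rho / (1 + v ^+ 2) * Ld (rat v r))).
  by apply: ler_pM => //; exact: wp_le.
by rewrite /kdom -/(rat v r) le_eqVlt; apply/orP; left; apply/eqP; ring.
Qed.

Lemma integrable_wpLa r t : 0 < r -> mu.-integrable `]0, +oo[ (EFin \o (fun v => wp v * La (rat v r) t)).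
Proof.
move=> r0; apply: (@le_Lint_except _ (kdom r) r) => //; last exact: kdomi.
  by apply: measurable_funM => //; rewrite /La /nrm2 /rat; meas.
by move=> v /S v0 vr; exact: La_dom.
Qed.

Let wpi : mu.-integrable `]0, +oo[ (EFin \o (fun v => pi^-1 * wk rho v)).
Proof. by apply: LintZ => //; exact: integrable_wk. Qed.

Lemma integrable_wpTh r t : 0 < r -> - pi < t < pi -> mu.-integrable `]0, +oo[ (EFin \o (fun v => wp v * Th (rat v r) t)).
Proof.
move=> r0 tI; apply: (@le_Lint _ (fun v => pi * (pi^-1 * wk rho v))) => //; last exact: LintZ.
  by apply: measurable_funM => //; rewrite /Th /rat; meas.
move=> v /S v0; rewrite normrM wp_abs// mulrC ler_wpM2r//.
  by rewrite mulr_ge0 ?(ltW pin0)// wk_ge0// ltW.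
apply: le_trans (Th_norm _ tI) _; first by rewrite ltW// rat_gt0.
by case/andP: tI => ? ?; rewrite ler_norml !ltW.
Qed.

Section strip.
Variable tau : R.
Hypothesis tauI : 0 < tau < pi.
Let ly := - (tau / alpha).
Let uy := tau / alpha.

Let yst y : ly < y < uy -> - tau < alpha * y < tau.
Proof.
rewrite /ly /uy => /andP[h1 h2]; rewrite mulrC -ltr_pdivlMr// h2 andbT.
by rewrite -ltr_pdivrMr// mulNr.
Qed.

Let yst2 y : - tau < alpha * y < tau -> ly < y < uy.
Proof.
by rewrite /ly /uy => /andP[h1 h2]; rewrite ltr_pdivlMr// -mulNr ltr_pdivrMr// [y * _]mulrC h1.
Qed.

Let ypi y : - tau < alpha * y < tau -> - pi < alpha * y < pi.
Proof. by case/andP: tauI => ? ? /andP[? ?]; apply/andP; split; lra. Qed.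

Let ypiN y : - tau < alpha * y < tau -> - pi < - (alpha * y) < pi.
Proof. by case/andP: tauI => ? ? /andP[? ?]; apply/andP; split; lra. Qed.

Let dkdom r v := 4 * wC (tau / pi) * (alpha / (r / 2)) * (pi^-1 * wk rho v).

Let dkdomi r : mu.-integrable `]0, +oo[ (EFin \o dkdom r).
Proof. exact: LintZ. Qed.

Let wC0 : 0 < wC (tau / pi).
Proof.
have [_ //] : 1 + 0 ^+ 2 <= wC (tau / pi) * nrm2 0 0 /\ 0 < wC (tau / pi).
apply: nrm2_lower_angle => //; case/andP: tauI => ? ?; rewrite oppr_lt0; exact/andP.
Qed.

Let dk_le v r s t : 0 < v -> 0 < r -> r / 2 < s -> - tau < alpha * t < tau ->
  cabs ((wp v * complex.Re (dmlog v s t)) +i* (wp v * complex.Im (dmlog v s t))) <= dkdom r v.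
Proof.
move=> v0 r0 rs tI; have r20 : 0 < r / 2 by rewrite divr_gt0.
have s0 : 0 < s by exact: lt_trans rs.
have -> : (wp v * complex.Re (dmlog v s t)) +i* (wp v * complex.Im (dmlog v s t)) =
   (wp v)%:C * dmlog v s t.
  by apply/eqP; rewrite eq_complex /= !mul0r subr0 addr0 !eqxx.
rewrite cabsM cabs_real wp_abs// mulrC; apply: ler_wpM2r.
  by rewrite mulr_ge0 ?(ltW pin0)// wk_ge0// ltW.
apply: le_trans (cabs_dmlog v0 s0 tauI tI) _.
by rewrite ler_pM2l ?mulr_gt0// ler_pM2l// lef_pV2 ?posrE// ltW.
Qed.

Lemma chol_lkap r y : 0 < r -> - tau < alpha * y < tau -> chol lkap (dlkap r y) r y.
Proof.
move=> r0 yI; have yI' := yst2 yI.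
have rI : r / 2 < r < 2 * r by apply/andP; split; lra.
have r20 : 0 <= r / 2 by rewrite divr_ge0// ltW.
change (chol (fun s t => lkap s t) (dlkap r y) r y); rewrite /lkap /dlkap.
apply: (@chol_integral _ `]0, +oo[ (fun v s t => (wp v * La (rat v s) (- (alpha * t))) +i* (wp v * Th (rat v s) (- (alpha * t))))
  (fun v s t => (wp v * complex.Re (dmlog v s t)) +i* (wp v * complex.Im (dmlog v s t))) (dkdom r)
  (r / 2) (2 * r) ly uy r y m0y r20 rI yI').
- move=> s t /andP[s1 _] tI; have s0 : 0 < s by exact: le_lt_trans s1.
  by split => /=; [exact: integrable_wpLa|apply: integrable_wpTh => //; exact: ypiN (yst tI)].
- move=> v s t /S v0 /andP[s1 _] tI; have s0 : 0 < s by exact: le_lt_trans s1.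
  exact: (chol_scale (wp v) (chol_mlog v0 s0 (ypi (yst tI)))).
- by apply: measurable_funM; [exact: mwp|rewrite /= /rat /nrm2; meas].
- by apply: measurable_funM; [exact: mwp|rewrite /= /rat /nrm2; meas].
- exact: dkdomi.
- by move=> v s t /S v0 /andP[s1 _] tI; apply: dk_le => //; exact: yst.
Qed.

Lemma chol_kap r y : 0 < r -> - tau < alpha * y < tau -> chol kap (kap r y * dlkap r y) r y.
Proof. by move=> r0 yI; apply: chol_cexp; exact: chol_lkap. Qed.

Lemma ccont_dlkap r y : 0 < r -> - tau < alpha * y < tau -> ccont (dlkap ^~ y) r.
Proof.
move=> r0 yI.
have rI : r / 2 < r < 2 * r by apply/andP; split; lra.
have r20 : 0 <= r / 2 by rewrite divr_ge0// ltW.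
have n0 s v : r / 2 < s < 2 * r -> 0 < v -> nrm2 (rat v s) (- (alpha * y)) != 0.
  move=> /andP[s1 _] v0; have s0 : 0 < s by exact: le_lt_trans s1.
  by rewrite gt_eqF// nrm2_gt0 ?ypiN// ltW// rat_gt0.
split => /=; apply: (@cont_integral _ `]0, +oo[ _ (dkdom r) (r / 2) (2 * r)) => //.
- by move=> s _; apply: measurable_funM => //; rewrite /= /rat /nrm2; meas.
- move=> s v sI /S v0; have n1 := n0 s v sI v0; case/andP: sI => s1 _.
  have s0 : 0 < s by exact: le_lt_trans s1.
  have p0 : s `^ alpha != 0 by rewrite gt_eqF// powR_gt0.
  have sn : s != 0 by rewrite gt_eqF.
  by rewrite /= /nrm2 /rat in n1 *; dcont.
- move=> s v /andP[s1 _] /S v0; apply: le_trans (dk_le v0 r0 s1 yI).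
  exact: (cabs_ge_Re (_ +i* _)).
- by move=> s _; apply: measurable_funM => //; rewrite /= /rat /nrm2; meas.
- move=> s v sI /S v0; have n1 := n0 s v sI v0; case/andP: sI => s1 _.
  have s0 : 0 < s by exact: le_lt_trans s1.
  have p0 : s `^ alpha != 0 by rewrite gt_eqF// powR_gt0.
  have sn : s != 0 by rewrite gt_eqF.
  by rewrite /= /nrm2 /rat in n1 *; dcont.
- move=> s v /andP[s1 _] /S v0; apply: le_trans (dk_le v0 r0 s1 yI).
  exact: (cabs_ge_Im (_ +i* _)).
Qed.

Lemma cbd_dlkap r1 r2 : 0 < r1 -> exists M, forall r y, r1 <= r <= r2 -> - tau < alpha * y < tau -> cabs (dlkap r y) <= M.
Proof.
move=> r10; pose I := \int[mu]_(v in `]0, +oo[) dkdom r1 v.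
suff [M MP] : cbd (fun r y => r1 <= r <= r2 /\ - tau < alpha * y < tau) dlkap.
  by exists M => r y rI yI; exact: MP.
apply: (@cbd_ReIm _ _ _ I) => r y [/andP[r1r _] yI].
have r1r' : r1 / 2 < r by lra.
have E v : (`]0, +oo[%classic : set R) v -> `|wp v * complex.Re (dmlog v r y)| <= dkdom r1 v /\
    `|wp v * complex.Im (dmlog v r y)| <= dkdom r1 v.
  move=> /S v0; have h := dk_le v0 r10 r1r' yI; split; apply: le_trans h.
    exact: (cabs_ge_Re (_ +i* _)).
  exact: (cabs_ge_Im (_ +i* _)).
have key (f : R -> R) : measurable_fun (`]0, +oo[%classic : set R) f ->
    (forall v, (`]0, +oo[%classic : set R) v -> `|f v| <= dkdom r1 v) -> `|\int[mu]_(v in `]0, +oo[) f v| <= I.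
  move=> mf fG; have fi : mu.-integrable `]0, +oo[ (EFin \o f) by apply: (@le_Lint _ (dkdom r1)).
  apply: (@le_trans _ _ (\int[mu]_(v in `]0, +oo[) `|f v|)); first exact: le_normr_Rintegral.
  by apply: ler_Lint => //; exact: (integrable_norm fi).
split => /=; apply: key.
- by apply: measurable_funM => //; rewrite /= /rat /nrm2; meas.
- by move=> v /E[].
- by apply: measurable_funM => //; rewrite /= /rat /nrm2; meas.
- by move=> v /E[].
Qed.

End strip.

End kappa.

(** * Size and boundary values of [kap] *)

Section kappa_bounds.
Context {R : realType}.
Notation mu := (@lebesgue_measure R).
Implicit Types r y s t v x : R.

Lemma ler_Lint_except (w : R) (D : set R) (f g : R -> R) : measurable D ->
  mu.-integrable D (EFin \o f) -> mu.-integrable D (EFin \o g) ->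
  (forall x, D x -> x != w -> f x <= g x) -> \int[mu]_(x in D) f x <= \int[mu]_(x in D) g x.
Proof.
move=> mD fi gi fg.
have mDw : measurable (D `\` [set w]) by apply: measurableD => //; exact: measurable_set1.
have sub : D `\` [set w] `<=` D by exact: subDsetl.
rewrite -(Lintegral_except w mD (integrable_mfun fi)) -(Lintegral_except w mD (integrable_mfun gi)).
apply: ler_Lint => //; [exact: integrableS fi|exact: integrableS gi|].
by move=> x [Dx /eqP xw]; exact: fg.
Qed.

Lemma eq_Lintegral_except (w : R) (D : set R) (f g : R -> R) : measurable D ->
  measurable_fun D f -> measurable_fun D g ->
  (forall x, D x -> x != w -> f x = g x) -> \int[mu]_(x in D) f x = \int[mu]_(x in D) g x.
Proof.
move=> mD mf mg fg; rewrite -(Lintegral_except w mD mf) -(Lintegral_except w mD mg).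
by apply: eq_Lintegral => x [Dx /eqP xw]; exact: fg.
Qed.

(** The modulus is smallest at the angle pi, so a lower bound there holds at every angle. *)
Lemma La_ge x t : 0 <= x -> x != 1 -> ln `|1 - x| <= La x t.
Proof.
move=> x0 x1; have p0 : 0 < `|1 - x| by rewrite normr_gt0 subr_eq0 eq_sym.
have h := nrm2_ge t x0.
have e : `|1 - x| ^+ 2 = (x - 1) ^+ 2 by rewrite real_normK ?num_real//; ring.
rewrite -e in h; rewrite /La ler_pdivlMr// mulrC mulr_natl -lnXn//.
by rewrite ler_ln ?posrE// ?exprn_gt0// (lt_le_trans _ h)// exprn_gt0.
Qed.

Lemma La_cvg_pi x (t_ : nat -> R) : 0 <= x -> x != 1 ->
  t_ n @[n --> \oo] --> (pi : R) -> La x (t_ n) @[n --> \oo] --> ln `|1 - x|.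
Proof.
move=> x0 x1 tpi.
have p0 : 0 < `|1 - x| by rewrite normr_gt0 subr_eq0 eq_sym.
have np : nrm2 x pi = `|1 - x| ^+ 2 by rewrite /nrm2 cospi real_normK ?num_real//; ring.
have -> : ln `|1 - x| = La x pi by rewrite /La np lnXn// mulr2n; field.
have c : {for (pi : R), continuous (La x)}.
  have n0 : 0 < nrm2 x pi by rewrite np exprn_gt0.
  by rewrite /La /nrm2 in n0 *; dcont.
exact: (continuous_cvg _ c tpi).
Qed.

Lemma Th_cvgy t : - pi < t < pi -> Th r t @[r --> +oo] --> t.
Proof.
move=> tI; have pi0 := @pi_gt0 R.
have pV : (x : R) `^ (-1) @[x --> +oo] --> (0 : R) by apply: cvgy_powRN.
have h : 2 * pi * (x : R) `^ (-1) @[x --> +oo] --> (0 : R).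
  by rewrite -[X in _ --> X](mulr0 (2 * pi)); apply: cvgM => //; exact: cvg_cst.
apply/cvgrPdist_le => e e0; move/cvgrPdist_le : h => /(_ e e0) h.
near=> r; have r0 : 0 < r by near: r; exact: nbhs_pinfty_gt.
have rV : 0 <= r^-1 by rewrite invr_ge0 ltW.
rewrite Th_inv// opprB addrC subrK; apply: le_trans (Th_lin rV tI) _.
have : `|0 - 2 * pi * r `^ (-1)| <= e by near: r.
by rewrite sub0r normrN powR_inv1 ?(ltW r0)// ger0_norm// mulr_ge0// mulr_ge0// ltW.
Unshelve. all: by end_near. Qed.

Lemma Th1 t : - pi < t < pi -> Th 1 t = t / 2.
Proof. by move=> _; rewrite /Th subrr mul0r mul0r atan0 addr0. Qed.

Variables (alpha rho : R).
Hypotheses (a02 : 0 < alpha <= 2) (rho01 : 0 < rho < 1).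

Let alpha0 : 0 < alpha. Proof. by case/andP: a02. Qed.
Let pin0 : 0 < pi^-1 :> R. Proof. by rewrite invr_gt0 pi_gt0. Qed.
Let m0y : measurable (`]0, +oo[%classic : set R). Proof. exact: measurable_itv. Qed.
Let S v : (`]0, +oo[%classic : set R) v -> 0 < v.
Proof. by rewrite /= in_itv/= andbT. Qed.

Let rpi : - pi < rho * pi < pi.
Proof. by have pi0 := @pi_gt0 R; case/andP: rho01 => ? ?; apply/andP; split; nra. Qed.

Lemma int_wk_tail u : 0 <= u -> mu.-integrable `]u, +oo[ (EFin \o wk rho) /\
  \int[mu]_(v in `]u, +oo[) wk rho v = rho * pi - Th u (rho * pi).
Proof.
move=> u0.
have n0 v : u < v -> 0 < 1 + 2 * v * cos (rho * pi) + v ^+ 2.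
  by move=> uv; apply: (nrm2_gt0 _ rpi); exact: le_trans (ltW uv).
apply: (@ge0_FTC_oy _ u (Th u (rho * pi)) (rho * pi) (wk rho) (Th ^~ (rho * pi))).
- by move=> v uv; have n1 := n0 v uv; rewrite /wk; dcont => //; rewrite gt_eqF.
- by move=> v uv; apply: der_Th_r => //; exact: le_trans (ltW uv).
- by move=> v uv; apply: wk_ge0 => //; exact: le_trans (ltW uv).
- by apply: cont_at_right (der_cont (der_Th_r u0 rpi)) _.
- exact: Th_cvgy.
Qed.

(** The mass of [wk rho] beyond [u]. It is also the argument acquired on the cut, since the
    logarithms with v > u jump by pi and [kap] carries the factor 1 / pi. *)
Definition eta u : R := rho * pi - Th u (rho * pi).

Lemma int_wk_if (P : R -> bool) u c : 0 <= u -> (forall v, 0 < v -> P v = (u < v)) ->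
  \int[mu]_(v in `]0, +oo[) (wk rho v * (if P v then c else 0)) = c * eta u.
Proof.
move=> u0 Pv; have [i e] := int_wk_tail u0.
have sub : (`]u, +oo[%classic : set R) `<=` `]0, +oo[.
  by move=> v; rewrite /= !in_itv/= !andbT; exact: le_lt_trans.
have mI : measurable (`]u, +oo[%classic : set R) by [].
have [_ e'] := integrable_restr mI m0y sub (LintZ c mI i).
rewrite /eta -e -LintegralZ// -e'; apply: eq_Lintegral => v /S v0; rewrite patchE Pv//.
have -> : (v \in `]u, +oo[%classic) = (u < v) by rewrite mem_setE in_itv/= andbT.
by case: ifP; rewrite ?mulr0// mulrC.
Qed.

Definition kC : R := pi^-1 * wC rho * (4 / alpha).

Let wk_phi v r : 0 < v -> 0 < r -> 0 <= pi^-1 * wk rho v * (2 * phi (rat alpha v r)) /\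
  pi^-1 * wk rho v * (2 * phi (rat alpha v r)) <= pi^-1 * wC rho * (phi (v `^ alpha / r `^ alpha) / v).
Proof.
move=> v0 r0; have x0 := rat_gt0 alpha v0 r0; have ph := phi_ge0 (ltW x0).
have w0 := wk_ge0 rho01 (ltW v0); have w1 := wk_le rho01 (ltW v0).
split.
  by rewrite mulr_ge0// mulr_ge0// ltW.
rewrite -/(rat alpha v r) -[leLHS]mulrA -[leRHS]mulrA ler_pM2l//.
have -> : wC rho * (phi (rat alpha v r) / v) = wC rho / (2 * v) * (2 * phi (rat alpha v r)).
  by field; rewrite gt_eqF.
apply: ler_wpM2r; first by rewrite mulr_ge0.
apply: (le_trans w1); rewrite ler_pM2l ?wC_gt0//.
have p0 : 0 < 1 + v ^+ 2 by rewrite ltr_pwDl// sqr_ge0.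
rewrite lef_pV2 ?posrE// ?mulr_gt0//.
by have := sqr_ge0 (v - 1); nra.
Qed.

Let int_phi_r r : 0 < r -> mu.-integrable `]0, +oo[ (EFin \o (fun v => pi^-1 * wC rho * (phi (v `^ alpha / r `^ alpha) / v))) /\
   \int[mu]_(v in `]0, +oo[) (pi^-1 * wC rho * (phi (v `^ alpha / r `^ alpha) / v)) = kC.
Proof.
move=> r0; have [i e] := int_phi alpha0 (powR_gt0 alpha r0).
by split; [exact: LintZ|rewrite LintegralZ// e].
Qed.

(** Only the negative part of ln |1 - x| can make [kap] large. It is dominated by [phi], and wk <=
    wC / (2 v) reduces its integral to [int_phi], whose value is independent of the radius. *)
Lemma Re_lkap_le r y : 0 < r -> complex.Re (lkap alpha rho r y) <= kC.
Proof.
move=> r0; have [i e] := int_phi_r r0; rewrite -e /=.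
apply: (@ler_Lint_except r) => //; first exact: integrable_wpLa.
move=> v /S v0 vr; have [_ h] := wk_phi v0 r0; apply: le_trans h.
have x0 := rat_gt0 alpha v0 r0; have x1 := rat_neq1 a02 v0 r0 vr.
rewrite !mulNr -mulrN ler_wpM2l//; first by rewrite mulr_ge0 ?(ltW pin0)// wk_ge0// ltW.
have := La_ge (- (alpha * y)) (ltW x0) x1; have := Nln_le_phi (ltW x0); lra.
Qed.

Lemma kap_le r y : 0 < r -> cabs (kap alpha rho r y) <= expR kC.
Proof. by move=> r0; rewrite cabs_cexp ler_expR Re_lkap_le. Qed.

Definition k0 : R := expR (kC + rho / 2 * ln 2).

(** Some positive power of r is needed for integrability against dr / r at 0. If ln 2 + alpha ln r
    <= 0, then for v > 1 the logarithm is at least - ln 2 - alpha ln r. The interval v > 1 has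
    [wk]-mass rho pi / 2, hence the exponent alpha rho / 2 and the constant [k0]; for other r the
    bound follows from [Re_lkap_le]. *)
Lemma kap_small r y : 0 < r -> cabs (kap alpha rho r y) <= k0 * r `^ (alpha * rho / 2).
Proof.
move=> r0; have pi0 := @pi_gt0 R; have rho0 : 0 < rho by case/andP: rho01.
rewrite cabs_cexp /powR gt_eqF// -expRD ler_expR.
have Eq : kC + rho / 2 * ln 2 + alpha * rho / 2 * ln r = kC + rho / 2 * (ln 2 + alpha * ln r) by field.
rewrite Eq; have [neg|pos] := leP (ln 2 + alpha * ln r) 0; last first.
  by apply: le_trans (Re_lkap_le y r0) _; rewrite lerDl mulr_ge0 ?divr_ge0 ?ltW.
set L := ln 2 + alpha * ln r in neg *.
have [i e] := int_phi_r r0.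
have if1 := @int_wk_if (fun v => 1 < v) 1 (pi^-1 * L) ler01 (fun v _ => erefl).
have ifi : mu.-integrable `]0, +oo[ (EFin \o (fun v => wk rho v * (if 1 < v then pi^-1 * L else 0))).
  apply: (@le_Lint _ (fun v => `|pi^-1 * L| * wk rho v)) => //.
  - apply: measurable_funM; first by apply: mfunS; rewrite /wk; meas.
    apply: mfunS; apply: measurable_fun_ifT => //; exact: measurable_fun_ltr.
  - move=> v /S v0; rewrite normrM mulrC (ger0_norm (wk_ge0 rho01 (ltW v0))).
    by apply: ler_wpM2r; [exact: wk_ge0 (ltW v0)|case: ifP => // _; rewrite normr0].
  - by apply: LintZ => //; exact: integrable_wk.
have eta1 : pi^-1 * L * eta 1 = rho / 2 * L.
  have gen (p q l : R) : p != 0 -> p^-1 * l * (q * p - q * p / 2) = q / 2 * l by move=> p0; field.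
  by rewrite /eta Th1// gen// gt_eqF.
rewrite -eta1 -if1 -e -LintegralD//=.
apply: (@ler_Lint_except r) => //; [exact: integrable_wpLa|exact: LintD|].
move=> v /S v0 vr; have [h0 h] := wk_phi v0 r0.
have x0 := rat_gt0 alpha v0 r0; have x1 := rat_neq1 a02 v0 r0 vr.
have la := La_ge (- (alpha * y)) (ltW x0) x1.
have w0 : 0 <= pi^-1 * wk rho v by rewrite mulr_ge0 ?(ltW pin0)// wk_ge0// ltW.
case: ifPn => [v1|_]; last first.
  rewrite mulr0 addr0; apply: le_trans h.
  rewrite !mulNr -mulrN ler_wpM2l//.
  have := Nln_le_phi (ltW x0); lra.
apply: (@le_trans _ _ (pi^-1 * wk rho v * (2 * phi (rat alpha v r)) + wk rho v * (pi^-1 * L))); last first.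
  by rewrite lerD2r.
have -> : - pi^-1 * wk rho v * La (rat alpha v r) (- (alpha * y)) = pi^-1 * wk rho v * - La (rat alpha v r) (- (alpha * y)) by ring.
have -> : wk rho v * (pi^-1 * L) = pi^-1 * wk rho v * L by ring.
rewrite -mulrDr ler_wpM2l//.
have lnx : ln (rat alpha v r) = alpha * ln v - alpha * ln r.
  by rewrite /rat ln_div ?posrE ?powR_gt0// !ln_powR.
have lnv : 0 <= alpha * ln v by rewrite mulr_ge0 ?(ltW alpha0)// ln_ge0// ltW.
have lx2 : ln 2 <= ln (rat alpha v r) by rewrite lnx; rewrite /L in neg; lra.
have x2 : 2 <= rat alpha v r by move: lx2; rewrite ler_ln ?posrE.
have k1 : ln (rat alpha v r / 2) <= ln `|1 - rat alpha v r|.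
  by rewrite ler0_norm ?ler_ln ?posrE; lra.
rewrite ln_div ?posrE// lnx in k1.
have ph := phi_ge0 (ltW x0).
rewrite /L; lra.
Qed.

(* At [z = - r^alpha], reached from above, the boundary value of [kap] has
   modulus [exp (- Apot r)] and argument [eta r]. *)
Definition Apot r : R := pi^-1 * \int[mu]_(v in `]0, +oo[) (wk rho v * ln `|1 - rat alpha v r|).

Let ldom r v := pi^-1 * wC rho * (Ld (v `^ alpha / r `^ alpha) / (1 + v ^+ 2)).

Let ldomi r : 0 < r -> mu.-integrable `]0, +oo[ (EFin \o ldom r).
Proof. by move=> r0; apply: LintZ => //; apply: integrable_Ld => //; rewrite powR_gt0. Qed.

Lemma integrable_wk_ln r : 0 < r -> mu.-integrable `]0, +oo[ (EFin \o (fun v => wk rho v * ln `|1 - rat alpha v r|)).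
Proof.
move=> r0; apply: (@le_Lint _ (fun v => pi * ldom r v)) => //; last by apply: LintZ => //; exact: ldomi.
  by rewrite /wk /rat; meas.
move=> v /S v0; have x0 := rat_gt0 alpha v0 r0.
have w0 := wk_ge0 rho01 (ltW v0); have w1 := wk_le rho01 (ltW v0).
have pn : pi != 0 :> R by rewrite gt_eqF// pi_gt0.
rewrite /ldom -[pi^-1 * _ * _]mulrA mulVKf// -/(rat alpha v r) normrM (ger0_norm w0).
have -> : wC rho * (Ld (rat alpha v r) / (1 + v ^+ 2)) = wC rho / (1 + v ^+ 2) * Ld (rat alpha v r) by ring.
apply: ler_pM => //; rewrite /Ld lerDl ln_ge0// lerDl ltW//.
Qed.

(** As alpha y tends to pi, [Th (rat v r) (- (alpha * y))] tends to - pi for v > r and to 0 for v <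
    r, while the moduli tend to |1 - rat|. The majorants are uniform in the angle, except at v =
    r. *)
Lemma lkap_lim r (y_ : nat -> R) : 0 < r -> (forall n, - pi < alpha * y_ n < pi) ->
  alpha * y_ n @[n --> \oo] --> (pi : R) ->
  complex.Re (lkap alpha rho r (y_ n)) @[n --> \oo] --> - Apot r /\
  complex.Im (lkap alpha rho r (y_ n)) @[n --> \oo] --> eta r.
Proof.
move=> r0 yI yc; have pn : pi != 0 :> R by rewrite gt_eqF// pi_gt0.
split => /=.
  have -> : - Apot r = \int[mu]_(v in `]0, +oo[) (- pi^-1 * wk rho v * ln `|1 - rat alpha v r|).
    rewrite /Apot -mulNr -LintegralZ//; last exact: integrable_wk_ln.
    by apply: eq_Lintegral => v _; rewrite mulrA.
  apply: (@Ldominated_cvg_except _ (ldom r) r _ _ _ _ _ _ _ _ _).2 => //.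
  - by move=> n; rewrite /wk /La /nrm2 /rat; meas.
  - by rewrite /wk /rat; meas.
  - move=> v /S v0 vr; apply: cvgM; first exact: cvg_cst.
    have e n : La (rat alpha v r) (- (alpha * y_ n)) = La (rat alpha v r) (alpha * y_ n) by rewrite LaN.
    under eq_fun do rewrite e.
    apply: La_cvg_pi => //; first by rewrite ltW// rat_gt0.
    exact: rat_neq1.
  - exact: ldomi.
  - by move=> n v /S v0 vr; exact: La_dom.
have -> : eta r = \int[mu]_(v in `]0, +oo[) (- pi^-1 * wk rho v * - (if 1 < rat alpha v r then pi else 0)).
  rewrite -[eta r](mulKf pn) -(@int_wk_if (fun v => 1 < rat alpha v r) r pi (ltW r0)); last first.
    by move=> v v0; rewrite rat_gt1.
  rewrite -LintegralZ//; last first.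
    apply: (@le_Lint _ (fun v => pi * wk rho v)) => //.
    - apply: measurable_funM; first by apply: mfunS; rewrite /wk; meas.
      apply: mfunS; apply: measurable_fun_ifT => //; apply: measurable_fun_ltr => //.
      by rewrite /rat; meas.
    - move=> v /S v0; rewrite normrM mulrC (ger0_norm (wk_ge0 rho01 (ltW v0))).
      apply: ler_wpM2r; first exact: wk_ge0 (ltW v0).
      by case: ifP; rewrite ?normr0 ?ger0_norm// pi_ge0.
    - by apply: LintZ => //; exact: integrable_wk.
  by apply: eq_Lintegral => v _; rewrite mulrN !mulNr opprK mulrA.
apply: (@Ldominated_cvg_except _ (fun v => pi * (pi^-1 * wk rho v)) r _ _ _ _ _ _ _ _ _).2 => //.
- by move=> n; rewrite /wk /Th /rat; meas.
- apply: measurable_funM; first by rewrite /wk; meas.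
  apply: measurable_funN; apply: mfunS; apply: measurable_fun_ifT => //; apply: measurable_fun_ltr => //.
  by rewrite /rat; meas.
- move=> v /S v0 vr; apply: cvgM; first exact: cvg_cst.
  have e n : Th (rat alpha v r) (- (alpha * y_ n)) = - Th (rat alpha v r) (alpha * y_ n) by rewrite ThN.
  under eq_fun do rewrite e.
  apply: cvgN; apply: Th_cvg_pi => //; first by rewrite ltW// rat_gt0.
  exact: rat_neq1.
- by apply: LintZ => //; apply: LintZ => //; exact: integrable_wk.
- move=> n v /S v0 vr.
  have tI : - pi < - (alpha * y_ n) < pi by case/andP: (yI n) => ? ?; apply/andP; split; lra.
  rewrite normrM [X in X * _]normrM normrN (gtr0_norm pin0) (ger0_norm (wk_ge0 rho01 (ltW v0))) mulrC ler_wpM2r//.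
    by rewrite mulr_ge0 ?(ltW pin0)// wk_ge0// ltW.
  apply: le_trans (Th_norm _ tI) _; first by rewrite ltW// rat_gt0.
  by case/andP: tI => ? ?; rewrite ler_norml !ltW.
Qed.

End kappa_bounds.

(** * Elementary inequalities *)

Section elementary_bounds.
Context {R : realType}.

Lemma mvt_bound (f df : R -> R) (l u a b M : R) : l < a < u -> l < b < u ->
  (forall x, l < x < u -> isder x f (df x)) -> (forall x, l < x < u -> `|df x| <= M) ->
  `|f b - f a| <= M * `|b - a|.
Proof.
wlog ab : a b / a < b => [H aI bI fd dM|].
  have [ab|ab|->] := ltgtP a b; first exact: H.
    by rewrite distrC (distrC b); exact: H.
  by rewrite !subrr normr0 mulr0.
move=> /andP[la _] /andP[_ bu] fd dM.
have I x : x \in `[a, b] -> l < x < u.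
  by rewrite in_itv/= => /andP[h1 h2]; rewrite (lt_le_trans la h1) (le_lt_trans h2 bu).
have [||c cI ->] := @MVT _ f df a b ab.
- by move=> x xI; apply: fd; apply: I; exact: subset_itv_oo_cc xI.
- by apply: continuous_in_subspaceT => x /set_mem xI; exact: der_cont (fd x (I x xI)).
rewrite normrM ler_wpM2r// dM// I//; exact: subset_itv_oo_cc cI.
Qed.

Lemma powR_small (a e : R) : 0 < a -> 0 < e ->
  exists2 d : R, 0 < d & forall r : R, 0 < r < d -> r `^ a <= e.
Proof.
move=> a0 e0; exists (e `^ a^-1) => [|r /andP[r0 rd]]; first exact: powR_gt0.
have -> : e = (e `^ a^-1) `^ a by rewrite -powRrM mulVf ?gt_eqF// powRr1// ltW.
by apply: ge0_ler_powR; rewrite ?nnegrE ?powR_ge0 ?(ltW a0) ?(ltW r0) ?(ltW rd).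
Qed.

Lemma powRN_small (a e : R) : 0 < a -> 0 < e ->
  exists2 d : R, 1 < d & forall r : R, d < r -> r `^ (- a) <= e.
Proof.
move=> a0 e0; have eV : 0 < e^-1 by rewrite invr_gt0.
exists (e^-1 `^ a^-1 + 1) => [|r rd]; first by rewrite ltrDr powR_gt0.
have r0 : 0 < r by apply: lt_trans rd; rewrite addr_gt0// powR_gt0.
rewrite powRN -[e]invrK lef_pV2 ?posrE ?powR_gt0//.
have -> : e^-1 = (e^-1 `^ a^-1) `^ a by rewrite -powRrM mulVf ?gt_eqF// powRr1// ltW.
apply: ge0_ler_powR; rewrite ?nnegrE ?powR_ge0 ?(ltW a0) ?(ltW r0)//.
by apply: le_trans (ltW rd); rewrite lerDl.
Qed.

Lemma sin_ge_half (z : R) : 0 <= z <= 1 -> z / 2 <= sin z.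
Proof.
move=> /andP[z0 z1].
have c12 (c : R) : 0 <= c <= 1 -> 1 / 2 <= cos c.
  move=> /andP[c0 c1]; have := norm_sin_le (c / 2).
  rewrite (ger0_norm (_ : 0 <= c / 2)) ?divr_ge0// ler_norml => /andP[h1 h2].
  have -> : cos c = 1 - 2 * sin (c / 2) ^+ 2.
    by rewrite {1}(splitr c) cosD -[X in _ = X - _](cos2Dsin2 (c / 2)); ring.
  have : sin (c / 2) ^+ 2 <= (1 / 2) ^+ 2 by rewrite -real_normK ?num_real// lerXn2r ?nnegrE//; rewrite ler_norml; apply/andP; split; lra.
  lra.
move: z0; rewrite le_eqVlt => /orP[/eqP <-|z0]; first by rewrite sin0 mul0r.
have [|c cI] := @MVT R sin cos 0 z z0.
  by apply: continuous_in_subspaceT => x _; exact: continuous_sin.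
rewrite sin0 !subr0 => ->; move: cI; rewrite in_itv/= => /andP[c0 c1].
have := c12 c; rewrite (ltW c0) (le_trans (ltW c1) z1) => /(_ isT).
by rewrite -(ler_pM2r z0); lra.
Qed.

(** The derivative a c^(a-1) is at least a / 2 for c between 1/2 and 2, because |a - 1| <= 1. *)
Lemma powR_sub1_ge (a t : R) : 0 < a <= 2 -> 1 / 2 <= t <= 2 -> a / 2 * `|t - 1| <= `|t `^ a - 1|.
Proof.
move=> /andP[a0 a2] /andP[t1 t2].
have low (c : R) : 1 / 2 <= c <= 2 -> 1 / 2 <= c `^ (a - 1).
  move=> /andP[c1 c2]; have c0 : 0 < c by lra.
  rewrite /powR gt_eqF//.
  have -> : 1 / 2 = expR (- ln 2) :> R by rewrite expRN lnK ?posrE// mul1r.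
  rewrite ler_expR.
  have l1 : ln c <= ln 2 by rewrite ler_ln ?posrE.
  have l2 : - ln 2 <= ln c by rewrite -lnV ?posrE// ler_ln ?posrE//; lra.
  have : `|(a - 1) * ln c| <= 1 * ln 2.
    rewrite normrM; apply: ler_pM => //; rewrite ler_norml; apply/andP; split; lra.
  by rewrite ler_norml mul1r => /andP[].
have d (c : R) : 0 < c -> isder c (fun x => x `^ a) (a * c `^ (a - 1)).
  by move=> c0; apply: (isder_eq (der_pow a c0 (der_id c))); rewrite mulr1.
have key (x y : R) : 1 / 2 <= x -> x < y -> y <= 2 -> a / 2 * (y - x) <= y `^ a - x `^ a.
  move=> x1 xy y2; have [||c cI ->] := @MVT _ (fun x : R => x `^ a) (fun c => a * c `^ (a - 1)) x y xy.
  - by move=> z; rewrite in_itv/= => /andP[h1 _]; apply: d; lra.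
  - apply: continuous_in_subspaceT => z /set_mem/=; rewrite in_itv/= => /andP[h1 _].
    by apply: der_cont (d z _); lra.
  move: cI; rewrite in_itv/= => /andP[h1 h2].
  rewrite ler_pM2r ?subr_gt0// ler_pM2l//.
  have := low c ltac:(apply/andP; split; lra); lra.
have [h|h|->] := ltgtP t 1; last by rewrite powR1 !subrr normr0 mulr0.
  have := key t 1 t1 h ltac:(lra); rewrite powR1 => k.
  rewrite ltr0_norm ?subr_lt0// opprB; apply: (le_trans k).
  by rewrite -opprB ler_normr lexx orbT.
have := key 1 t ltac:(lra) h t2; rewrite powR1 => k.
by rewrite gtr0_norm ?subr_gt0//; apply: (le_trans k); exact: ler_norm.
Qed.

End elementary_bounds.

(** * The Cauchy integral at Q *)

Section stieltjes.
Context {R : realType}.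
Notation mu := (@lebesgue_measure R).
Variables (alpha rho Q : R).
Hypotheses (a02 : 0 < alpha <= 2) (rho01 : 0 < rho < 1) (Q0 : 0 < Q).
Implicit Types r y s t v x : R.

Let alpha0 : 0 < alpha. Proof. by case/andP: a02. Qed.
Let rho0 : 0 < rho. Proof. by case/andP: rho01. Qed.
Let pi0 : 0 < pi :> R. Proof. exact: pi_gt0. Qed.
Let m0y : measurable (`]0, +oo[%classic : set R). Proof. exact: measurable_itv. Qed.
Let S v : (`]0, +oo[%classic : set R) v -> 0 < v.
Proof. by rewrite /= in_itv/= andbT. Qed.

Let r0 : R := Q `^ alpha^-1.
Let r00 : 0 < r0. Proof. exact: powR_gt0. Qed.
Let r0a : r0 `^ alpha = Q.
Proof. by rewrite /r0 -powRrM mulVf ?gt_eqF// powRr1// ltW. Qed.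

Notation kap := (kap alpha rho).
Notation lkap := (lkap alpha rho).
Notation dlkap := (dlkap alpha rho).

Definition kQ : R := expR (complex.Re (lkap r0 0)).

(** The coefficient making [Nf] vanish at z = Q, that is, at radius [r0] and angle 0. The correction
    z^(1/2) is small at 0 and of lower order than z - Q at infinity, so [H] leaves no boundary term
    at either end. *)
Let cN : R[i] := (- (kQ / Num.sqrt Q))%:C.
Let Nf r y := kap r y + cN * cpow (alpha / 2) 0 r y.
Let dN r y := kap r y * dlkap r y + (0 * cpow (alpha / 2) 0 r y + cN * ((alpha / 2 / r)%:C * cpow (alpha / 2) 0 r y)).
Let Z r y := cpow alpha 0 r y + - Q%:C.
Let dZ r y := (alpha / r)%:C * cpow alpha 0 r y + - 0.
Let H r y := Nf r y * (Z r y)^-1.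
Let dH r y := dN r y * (Z r y)^-1 + Nf r y * (- dZ r y / Z r y ^+ 2).

Let Im_lkap0 r : complex.Im (lkap r 0) = 0.
Proof.
rewrite /= (@eq_Lintegral _ _ _ (fun=> 0 * 0)); last first.
  by move=> v _; rewrite mulr0 oppr0 Th_r0 !mulr0.
by rewrite LintegralZ ?mul0r//; exact: (integrable0 mu).
Qed.

Let kap0 r : kap r 0 = (expR (complex.Re (lkap r 0)))%:C.
Proof.
by apply/eqP; rewrite /kap eq_complex Re_cexp Im_cexp Im_lkap0 cos0 sin0 mulr1 mulr0 /= !eqxx.
Qed.

Let cabs_Z r y : 0 < r -> cabs (Z r y) = Q * Num.sqrt (nrm2 (r `^ alpha / Q) (alpha * y - pi)).
Proof.
move=> rp; rewrite /cabs /cabs2 ReD ImD ReN ImN /= !addr0 oppr0 addr0.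
rewrite -[X in _ = X * _](ger0_norm (ltW Q0)) -sqrtr_sqr -sqrtrM ?sqr_ge0//; congr Num.sqrt.
rewrite /nrm2 cosB cospi sinpi mulr0 addr0.
have -> : (r `^ alpha / Q) ^+ 2 = (r `^ alpha / Q) ^+ 2 * (cos (alpha * y) ^+ 2 + sin (alpha * y) ^+ 2).
  by rewrite cos2Dsin2 mulr1.
by field; rewrite gt_eqF.
Qed.

Let Z_abs r y : 0 < r -> `|r `^ alpha - Q| <= cabs (Z r y) /\ Q * `|sin (alpha * y)| <= cabs (Z r y).
Proof.
move=> rp; have x0 : 0 <= r `^ alpha / Q by rewrite divr_ge0 ?powR_ge0 ?ltW.
have nn : 0 <= nrm2 (r `^ alpha / Q) (alpha * y - pi).
  exact: le_trans (sqr_ge0 _) (nrm2_ge _ x0).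
rewrite cabs_Z//; split.
  have -> : r `^ alpha - Q = Q * (r `^ alpha / Q - 1) by field; rewrite gt_eqF.
  by rewrite normrM (gtr0_norm Q0) ler_pM2l// -sqrtr_sqr ler_sqrt// nrm2_ge.
rewrite ler_pM2l// -sqrtr_sqr ler_sqrt//.
have -> : sin (alpha * y) ^+ 2 = sin (alpha * y - pi) ^+ 2.
  by rewrite sinB cospi sinpi mulr0 subr0 mulrN1 sqrrN.
exact: nrm2_sin.
Qed.

Let CN : R := k0 alpha rho + expR (kC alpha rho) + `|kQ / Num.sqrt Q|.

Let k0_gt0 : 0 < k0 alpha rho. Proof. exact: expR_gt0. Qed.

Let CN0 : 0 < CN.
Proof. by rewrite /CN ltr_wpDr// addr_gt0// expR_gt0. Qed.

(** Near 0 the weaker of the two powers is that of [kap_small]; beyond 1 the square root dominates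
    the bounded function [kap]. *)
Let N_le r y : 0 < r -> cabs (Nf r y) <= CN * (if r < 1 then r `^ (alpha * rho / 2) else r `^ (alpha / 2)).
Proof.
move=> rp; have k1 := kap_le a02 rho01 y rp; have k2 := kap_small a02 rho01 y rp.
apply: le_trans (cabsD _ _) _; rewrite cabsM cabs_cpow cabs_real normrN /CN.
set c := `|_|; have c0 : 0 <= c by exact: normr_ge0.
have e0 := expR_gt0 (kC alpha rho).
case: ifPn => [r1|].
  have h : r `^ (alpha / 2) <= r `^ (alpha * rho / 2).
    rewrite /powR gt_eqF// ler_expR; have l0 : ln r <= 0 by rewrite ln_le0// ltW.
    rewrite ler_wnM2r// ler_pM2r// ler_piMr ?(ltW alpha0)//; by case/andP: rho01 => _ /ltW.
  have p0 := powR_ge0 r (alpha * rho / 2).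
  have : c * r `^ (alpha / 2) <= c * r `^ (alpha * rho / 2) by rewrite ler_wpM2l.
  have : 0 <= expR (kC alpha rho) * r `^ (alpha * rho / 2) by rewrite mulr_ge0// ltW.
  by rewrite !mulrDl; lra.
rewrite -leNgt => r1.
have h : 1 <= r `^ (alpha / 2).
  by rewrite /powR gt_eqF// -[leLHS]expR0 ler_expR mulr_ge0 ?ln_ge0// divr_ge0// ltW.
have : 0 <= (r `^ (alpha / 2) - 1) * expR (kC alpha rho) by rewrite mulr_ge0 ?subr_ge0// ltW.
have : 0 <= k0 alpha rho * r `^ (alpha / 2) by rewrite mulr_ge0 ?powR_ge0// ltW.
by rewrite !mulrDl; lra.
Qed.

Let H_le r y m : 0 < r -> 0 < m -> m <= cabs (Z r y) -> m * r `^ alpha <= cabs (Z r y) ->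
  cabs (H r y) <= CN / m * (if r < 1 then r `^ (alpha * rho / 2) else r `^ (- (alpha / 2))).
Proof.
move=> rp m0 h1 h2; have n := N_le y rp; have z0 : 0 < cabs (Z r y) by exact: lt_le_trans h1.
rewrite /H cabsM cabsV ler_pdivrMr//; apply: (le_trans n).
rewrite -[leRHS]mulrA -[leRHS]mulrA ler_pM2l//.
have rn : r != 0 by rewrite gt_eqF.
case: ifP => _.
  rewrite mulrCA ler_peMr ?powR_ge0// mulrC ler_pdivlMr// mul1r//.
have -> : r `^ (alpha / 2) = m^-1 * (r `^ (- (alpha / 2)) * (m * r `^ alpha)).
  have -> : r `^ alpha = r `^ (alpha / 2) * r `^ (alpha / 2).
    by rewrite -powRD ?rn ?implybT// -splitr.
  rewrite powRN; field; rewrite gt_eqF ?powR_gt0// gt_eqF//.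
by rewrite ler_pM2l ?invr_gt0// ler_wpM2l ?powR_ge0.
Qed.

Let dom m r := CN / m * bump (alpha * rho / 2) (alpha / 2) r.

Let domi m : mu.-integrable `]0, +oo[ (EFin \o dom m).
Proof. by apply: LintZ => //; apply: integrable_bump; rewrite ?divr_gt0 ?mulr_gt0. Qed.

Let H_dom r y m : 0 < r -> 0 < m -> m <= cabs (Z r y) -> m * r `^ alpha <= cabs (Z r y) ->
  `|complex.Im (H r y) / r| <= dom m r.
Proof.
move=> rp m0 h1 h2; have h := H_le rp m0 h1 h2; have rn : r != 0 by rewrite gt_eqF.
rewrite normrM [X in _ * X]gtr0_norm ?invr_gt0// ler_pdivrMr//.
apply: le_trans (cabs_ge_Im _) _; apply: (le_trans h); rewrite /dom /bump -[leRHS]mulrA.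
rewrite ler_pM2l ?divr_gt0//.
have e p : r `^ (p - 1) = r `^ p / r by rewrite powRD ?rn ?implybT// [r `^ (-1)]powRN powRr1// ltW.
by case: ifP => _; rewrite e mulfVK.
Qed.

Let chol_N r y tau : 0 < r -> 0 < tau < pi -> - tau < alpha * y < tau -> chol Nf (dN r y) r y.
Proof.
move=> rp tI yI; apply: cholD; first exact: (chol_kap _ _ tI).
by apply: cholM; [exact: chol_cst|exact: chol_cpow].
Qed.

Let chol_Z r y : 0 < r -> chol Z (dZ r y) r y.
Proof. by move=> rp; apply: cholD; [exact: chol_cpow|apply: cholN; exact: chol_cst]. Qed.

Let chol_H r y tau : 0 < r -> 0 < tau < pi -> - tau < alpha * y < tau -> Z r y != 0 -> chol H (dH r y) r y.
Proof.
move=> rp tI yI z0; apply: cholM; first exact: (chol_N rp tI yI).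
by apply: cholV => //; exact: chol_Z.
Qed.

Let cst_div_ccont c r : 0 < r -> ccont (fun s => (c / s)%:C) r.
Proof. by move=> rp; split; rewrite /=; [dcont; rewrite gt_eqF|exact: cvg_cst]. Qed.

Let ccont_dH r y tau : 0 < r -> 0 < tau < pi -> - tau < alpha * y < tau -> Z r y != 0 -> ccont (dH ^~ y) r.
Proof.
move=> rp tI yI z0.
have cp a' b' := chol_ccont (chol_cpow a' b' y rp).
have cV := chol_ccont (cholV z0 (chol_Z y rp)).
have cK := chol_ccont (chol_kap a02 rho01 tI rp yI).
have cdl := ccont_dlkap a02 rho01 tI rp yI.
apply: ccontD; apply: ccontM.
- apply: ccontD; first by apply: ccontM; [exact: cK|exact: cdl].
  apply: ccontD; first by apply: ccontM; [exact: ccont_cst|exact: cp].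
  by apply: ccontM; [exact: ccont_cst|apply: ccontM; [exact: cst_div_ccont|exact: cp]].
- exact: cV.
- exact: chol_ccont (chol_N rp tI yI).
- apply: ccontM.
    apply: ccontN; apply: ccontD; last exact: ccont_cst.
    by apply: ccontM; [exact: cst_div_ccont|exact: cp].
  apply: (@ccont_ext _ (fun s => (Z s y)^-1 * (Z s y)^-1)).
    by move=> s; rewrite expr2 invfM.
  by apply: ccontM; exact: cV.
Qed.

Let bound_div (P : R -> R -> Prop) c r1 r2 : 0 < r1 -> cbd (fun r y => r1 <= r <= r2 /\ P r y) (fun r _ => (c / r)%:C).
Proof.
move=> r10; exists (`|c| * r1^-1) => r y [/andP[ar _] _]; have rp : 0 < r by exact: lt_le_trans ar.
by rewrite cabs_real normrM [X in _ * X]gtr0_norm ?invr_gt0// ler_wpM2l// lef_pV2 ?posrE.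
Qed.

Let bound_pow (P : R -> R -> Prop) a r1 r2 : 0 < r1 -> cbd (fun r y => r1 <= r <= r2 /\ P r y) (cpow a 0).
Proof.
move=> r10; have [M MP] := @cbd_cpow R a 0 r1 r2 (-1) 1 r10; exists M => r y [rI _].
have := MP r 0; rewrite !cabs_cpow; apply; split => //; apply/andP; split; lra.
Qed.

Let bound_dN r1 r2 tau : 0 < r1 -> 0 < tau < pi ->
  cbd (fun r y => r1 <= r <= r2 /\ - tau < alpha * y < tau) dN.
Proof.
move=> r10 tI; apply: cbdD; first apply: cbdM.
- by exists (expR (kC alpha rho)) => r y [/andP[ar _] _]; apply: kap_le => //; exact: lt_le_trans ar.
- have [M MP] := cbd_dlkap a02 rho01 tI r2 r10; exists M => r y [rI yI]; exact: MP.
- apply: cbdD; first by apply: cbdM; [exact: cbd_cst|exact: bound_pow].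
  by apply: cbdM; [exact: cbd_cst|apply: cbdM; [exact: bound_div|exact: bound_pow]].
Qed.

(** * Angles bounded away from the pole and from the cut *)

Section away.
Variable delta : R.
Hypothesis deltaI : 0 < delta < pi / 2.
Let tau := pi - delta.

Let tauI : 0 < tau < pi.
Proof. by case/andP: deltaI => ? ?; have := pi0; rewrite /tau => ?; apply/andP; split; lra. Qed.

Let wC0 : 0 < wC (tau / pi).
Proof.
have I : 0 < tau / pi < 1 by case/andP: tauI => ? ?; rewrite divr_gt0//= ltr_pdivrMr// mul1r.
exact: wC_gt0.
Qed.

Definition mZ : R := Num.min Q 1 / Num.sqrt (wC (tau / pi)).

Lemma mZ_gt0 : 0 < mZ.
Proof. by rewrite divr_gt0 ?sqrtr_gt0// lt_min Q0 ltr01. Qed.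

Lemma Z_away r y : 0 < r -> - tau < alpha * y - pi < tau -> mZ <= cabs (Z r y) /\ mZ * r `^ alpha <= cabs (Z r y).
Proof.
move=> rp yI; have x0 : 0 <= r `^ alpha / Q by rewrite divr_ge0 ?powR_ge0 ?ltW.
have [h _] := nrm2_lower_angle x0 tauI yI.
have s0 : 0 < Num.sqrt (wC (tau / pi)) by rewrite sqrtr_gt0.
have key x : 0 <= x -> x ^+ 2 <= 1 + (r `^ alpha / Q) ^+ 2 -> Q * (x / Num.sqrt (wC (tau / pi))) <= cabs (Z r y).
  move=> xp h2; rewrite cabs_Z// ler_pM2l// ler_pdivrMr// -[X in X <= _]ger0_norm// -sqrtr_sqr -sqrtrM ?ler_sqrt.
  - by rewrite mulrC; apply: le_trans h2 h.
  - by rewrite mulrC; apply: le_trans h; rewrite addr_ge0// sqr_ge0.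
  - exact: le_trans (sqr_ge0 _) (nrm2_ge _ x0).
have k1 := @key 1 ler01; have k2 := @key (r `^ alpha / Q) x0.
rewrite /mZ; split.
  apply: le_trans (k1 _); last by rewrite expr1n lerDl sqr_ge0.
  by rewrite mul1r ler_pM2r ?invr_gt0// ge_min lexx.
apply: le_trans (k2 _); last by rewrite lerDr.
have -> : Q * (r `^ alpha / Q / Num.sqrt (wC (tau / pi))) = 1 / Num.sqrt (wC (tau / pi)) * r `^ alpha.
  by field; rewrite !gt_eqF.
by rewrite ler_wpM2r ?powR_ge0// ler_pM2r ?invr_gt0// ge_min lexx orbT.
Qed.

Let l := delta / alpha.
Let u := tau / alpha.

Let strip y : l < y < u -> (- tau < alpha * y < tau) /\ (- tau < alpha * y - pi < tau).
Proof.
rewrite /l /u => /andP[h1 h2]; rewrite ltr_pdivrMr// mulrC in h1; rewrite ltr_pdivlMr// mulrC in h2.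
by case/andP: deltaI => ? ?; have := pi0; rewrite /tau in h2 * => ?; split; apply/andP; split; lra.
Qed.

Let Zn0 r y : 0 < r -> l < y < u -> Z r y != 0.
Proof.
move=> rp /strip[_ yI]; have [h _] := Z_away rp yI; apply/eqP => E; move: h.
by rewrite E cabs_real normr0 leNgt mZ_gt0.
Qed.

Lemma Hstrip_bound r1 r2 : 0 < r1 -> exists M, forall r y, r1 <= r <= r2 -> l < y < u -> cabs (dH r y) <= M.
Proof.
move=> r10; pose ZZ r y := r1 <= r <= r2 /\ l < y < u.
suff [M MP] : cbd ZZ dH by exists M => r y rI yI; exact: MP.
have bV : cbd ZZ (fun r y => (Z r y)^-1).
  apply: (cbdV mZ_gt0) => r y [/andP[ar _] /strip[_ yI]].
  by have [] := Z_away (lt_le_trans r10 ar) yI.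
have bN : cbd ZZ dN.
  by have [M MP] := bound_dN r2 r10 tauI; exists M => r y [rI /strip[yI _]]; exact: MP.
have bK : cbd ZZ Nf.
  apply: cbdD; last by apply: cbdM; [exact: cbd_cst|exact: bound_pow].
  by exists (expR (kC alpha rho)) => r y [/andP[ar _] _]; apply: kap_le => //; exact: lt_le_trans ar.
apply: cbdD; apply: cbdM.
- exact: bN.
- exact: bV.
- exact: bK.
- apply: cbdM.
    apply: cbdN; apply: cbdD; last exact: cbd_cst.
    by apply: cbdM; [exact: bound_div|exact: bound_pow].
  have [M MP] := cbdM bV bV; exists M => r y /MP.
  by rewrite expr2 invfM.
Qed.

Lemma Hstrip_lim0 (e : R) : 0 < e -> exists2 d : R, 0 < d &
  forall r y, 0 < r < d -> l < y < u -> `|complex.Re (H r y) - 0| <= e.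
Proof.
move=> e0; have m0 := mZ_gt0; have c0 : 0 < CN / mZ by rewrite divr_gt0.
have a0 : 0 < alpha * rho / 2 by rewrite divr_gt0 ?mulr_gt0.
have [d d0 dP] := powR_small a0 (divr_gt0 e0 c0).
exists (Num.min d 1) => [|r y /andP[rp]]; first by rewrite lt_min d0 ltr01.
rewrite lt_min => /andP[rd r1] /strip[_ yI]; have [h1 h2] := Z_away rp yI.
rewrite subr0; apply: le_trans (cabs_ge_Re _) _; apply: le_trans (H_le rp m0 h1 h2) _.
rewrite r1 mulrC -ler_pdivlMr//; apply: dP; exact/andP.
Qed.

Lemma Hstrip_lim1 (e : R) : 0 < e -> exists d : R,
  forall r y, d < r -> l < y < u -> `|complex.Re (H r y) - 0| <= e.
Proof.
move=> e0; have m0 := mZ_gt0; have c0 : 0 < CN / mZ by rewrite divr_gt0.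
have [d d1 dP] := powRN_small (divr_gt0 alpha0 (ltr0Sn _ 1)) (divr_gt0 e0 c0).
exists d => r y rd /strip[_ yI]; have rp : 0 < r by lra.
have [h1 h2] := Z_away rp yI.
rewrite subr0; apply: le_trans (cabs_ge_Re _) _; apply: le_trans (H_le rp m0 h1 h2) _.
rewrite ltNge (ltW (lt_trans d1 rd))/= mulrC -ler_pdivlMr//; exact: dP.
Qed.

Lemma Hstrip_meas y : l < y < u -> measurable_fun (`]0, +oo[%classic : set R) (fun r => complex.Im (H r y) / r).
Proof.
move=> yI; have [yt _] := strip yI.
apply: open_cont_mfun => [|r /S rp]; first exact: interval_open.
have [_ c] := chol_ccont (chol_H rp tauI yt (Zn0 rp yI)).
apply: continuousM; first exact: c.
by apply: continuousV; rewrite ?gt_eqF.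
Qed.

Lemma Hstrip_int y : l < y < u -> mu.-integrable `]0, +oo[ (EFin \o (fun r => complex.Im (H r y) / r)).
Proof.
move=> yI; apply: (@le_Lint _ (dom mZ)) => //; first exact: Hstrip_meas.
move=> r /S rp; have [_ y2] := strip yI; have [h1 h2] := Z_away rp y2.
by apply: H_dom => //; exact: mZ_gt0.
Qed.

Lemma Hstrip_rot y0 y1 : l < y0 < u -> l < y1 < u ->
  \int[mu]_(r in `]0, +oo[) (complex.Im (H r y1) / r) = \int[mu]_(r in `]0, +oo[) (complex.Im (H r y0) / r).
Proof.
wlog y01 : y0 y1 / y0 < y1 => [K h0 h1|h0 h1].
  have [y01|y10|->//] := ltgtP y0 y1; first exact: K.
  by apply/esym; exact: K.
have [/andP[l0 _] /andP[_ u1]] := (h0, h1).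
apply/eqP; rewrite -subr_eq0; apply/eqP; rewrite -[RHS](mul0r (y1 - y0)) -[X in X * _](subr0 0).
apply: (rotate_Im l0 y01 u1 _ _ Hstrip_bound Hstrip_lim0 Hstrip_lim1 (Hstrip_int h0) (Hstrip_int h1)).
- by move=> r y rp yI; have [yt _] := strip yI; apply: (chol_H rp tauI yt); exact: Zn0.
- by move=> r y rp yI; have [yt _] := strip yI; apply: (ccont_dH rp tauI yt); exact: Zn0.
Qed.

End away.

Let I y := \int[mu]_(r in `]0, +oo[) (complex.Im (H r y) / r).

Let common y0 : 0 < alpha * y0 < pi -> exists2 dl : R, 0 < dl < pi / 2 &
  forall d, 0 < d <= dl -> d / alpha < y0 < (pi - d) / alpha.
Proof.
move=> /andP[h1 h2]; exists (Num.min (Num.min (alpha * y0) (pi - alpha * y0)) 1 / 2).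
  have : Num.min (Num.min (alpha * y0) (pi - alpha * y0)) 1 <= 1 by rewrite ge_min lexx orbT.
  have : 0 < Num.min (Num.min (alpha * y0) (pi - alpha * y0)) 1 by rewrite !lt_min h1 subr_gt0 h2 ltr01.
  have := @pi_ge2 R; move=> ? ? ?; apply/andP; split; lra.
move=> d /andP[d0 dd]; rewrite ltr_pdivrMr// ltr_pdivlMr// [y0 * _]mulrC.
have h3 : Num.min (Num.min (alpha * y0) (pi - alpha * y0)) 1 <= alpha * y0 by rewrite !ge_min lexx.
have h4 : Num.min (Num.min (alpha * y0) (pi - alpha * y0)) 1 <= pi - alpha * y0 by rewrite !ge_min lexx orbT.
apply/andP; split; lra.
Qed.

(** Two angles with alpha y between 0 and pi lie in a common strip avoiding both the positive and
    the negative axis, where the rotation has no boundary terms. *)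
Lemma I_const y0 y1 : 0 < alpha * y0 < pi -> 0 < alpha * y1 < pi -> I y0 = I y1.
Proof.
move=> /common[d0 /andP[d00 d01] h0] /common[d1 /andP[d10 d11] h1].
have dI : 0 < Num.min d0 d1 < pi / 2 by rewrite lt_min d00 d10 gt_min d01.
apply: (Hstrip_rot dI).
  by apply: h1; rewrite ge_min lexx orbT andbT lt_min d00.
by apply: h0; rewrite ge_min lexx andbT lt_min d00.
Qed.

(** Near Q the numerator is Lipschitz and vanishes at Q, while |z - Q| dominates both y and |r - r0|
    up to constants, so the quotient [H] is bounded. The 12 is 2 (4 + 2): real and imaginary parts,
    each with an angular and a radial term. *)
Let Lip : exists2 LC : R, 0 <= LC & forall r y, r0 / 2 <= r <= 2 * r0 -> 0 < alpha * y <= 1 / 4 -> cabs (H r y) <= LC.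
Proof.
have r01 : 0 < r0 / 4 by rewrite divr_gt0.
have tI : 0 < (1 : R) < pi by rewrite ltr01/=; have := @pi_ge2 R; lra.
have [M MP] := bound_dN (4 * r0) r01 tI.
have M0 : 0 <= M.
  apply: le_trans (MP r0 0 _); first exact: cabs_ge0.
  by rewrite mulr0 oppr_lt0 ltr01; split=> //; have := r00; move=> ?; apply/andP; split; lra.
exists (12 * M * r0 / (alpha * Q)) => [|r y /andP[ra rb] /andP[y1 y2]].
  by rewrite divr_ge0 ?mulr_ge0 ?(ltW r00) ?(ltW alpha0) ?(ltW Q0).
have h0 := r00; have rp : 0 < r by lra.
have yp : 0 < y by rewrite -(pmulr_rgt0 _ alpha0).
have yu : y < alpha^-1 by rewrite -[ltRHS]mul1r ltr_pdivlMr// mulrC; lra.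
have yI z : - alpha^-1 < z < alpha^-1 -> - 1 < alpha * z < 1.
  have an : alpha != 0 by rewrite gt_eqF.
  move=> /andP[]; rewrite -(ltr_pM2l alpha0) -(ltr_pM2l alpha0 z) mulrN divff// => -> ->.
  by [].
have aV : 0 < alpha^-1 by rewrite invr_gt0.
have zI : - alpha^-1 < 0 < alpha^-1 by rewrite oppr_lt0 aV.
have yI' : - alpha^-1 < y < alpha^-1 by rewrite yu andbT; lra.
have rI s : r0 / 4 < s < 4 * r0 -> r0 / 4 <= s <= 4 * r0 by move=> /andP[/ltW -> /ltW ->].
have rr : r0 / 4 < r < 4 * r0 by apply/andP; split; lra.
have rr0 : r0 / 4 < r0 < 4 * r0 by apply/andP; split; lra.
have cN' s z : r0 / 4 < s < 4 * r0 -> - alpha^-1 < z < alpha^-1 -> chol Nf (dN s z) s z.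
  by move=> /andP[s1 _] zz; apply: (chol_N _ tI); [exact: lt_trans s1|exact: yI].
have bd s z : r0 / 4 < s < 4 * r0 -> - alpha^-1 < z < alpha^-1 -> cabs (dN s z) <= M.
  by move=> sI zz; apply: MP; split; [exact: rI|exact: yI].
have N0 : Nf r0 0 = 0.
  have sq : Q = Num.sqrt Q ^+ 2 by rewrite sqr_sqrtr// ltW.
  have sq0 : Num.sqrt Q != 0 by rewrite gt_eqF// sqrtr_gt0.
  have r0h : r0 `^ (alpha / 2) = Num.sqrt Q.
    have rn : r0 != 0 by rewrite gt_eqF.
    have e : r0 `^ (alpha / 2) * r0 `^ (alpha / 2) = Q by rewrite -powRD ?rn ?implybT// -splitr r0a.
    by rewrite -[in RHS]e -expr2 sqrtr_sqr ger0_norm// powR_ge0.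
  rewrite /Nf kap0 /cN /cpow mulr0 addr0 cos0 sin0 mulr1 mulr0 r0h -/kQ.
  by apply/eqP; rewrite eq_complex ReD ImD ReM ImM /= !mul0r !mulr0 subr0 !addr0 mulNr mulfVK// subrr !eqxx.
have key (g : R[i] -> R) : g = (fun w => complex.Re w) \/ g = (fun w => complex.Im w) -> `|g (Nf r y)| <= M * (r * y) + M * `|r - r0|.
  move=> gE; have g0 : g 0 = 0 by case: gE => ->.
  have e : g (Nf r y) = (g (Nf r y) - g (Nf r 0)) + (g (Nf r 0) - g (Nf r0 0)).
    by rewrite N0 g0; ring.
  rewrite e; apply: le_trans (ler_normD _ _) _; apply: lerD.
    have -> : M * (r * y) = r * M * `|y - 0| by rewrite subr0 gtr0_norm//; ring.
    case: gE => ->.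
      apply: (@mvt_bound _ (fun z => complex.Re (Nf r z)) (fun z => - (r * complex.Im (dN r z))) (- alpha^-1) alpha^-1 0 y (r * M) zI yI').
        by move=> z zz; have [_ _ + _] := cN' r z rr zz.
      by move=> z zz; rewrite normrN normrM (gtr0_norm rp) ler_pM2l//; apply: le_trans (cabs_ge_Im _) (bd r z rr zz).
    apply: (@mvt_bound _ (fun z => complex.Im (Nf r z)) (fun z => r * complex.Re (dN r z)) (- alpha^-1) alpha^-1 0 y (r * M) zI yI').
      by move=> z zz; have [] := cN' r z rr zz.
    by move=> z zz; rewrite normrM (gtr0_norm rp) ler_pM2l//; apply: le_trans (cabs_ge_Re _) (bd r z rr zz).
  case: gE => ->.
    apply: (@mvt_bound _ (fun s => complex.Re (Nf s 0)) (fun s => complex.Re (dN s 0)) (r0 / 4) (4 * r0) r0 r M rr0 rr).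
      by move=> s ss; have [] := cN' s 0 ss zI.
    by move=> s ss; apply: le_trans (cabs_ge_Re _) (bd s 0 ss zI).
  apply: (@mvt_bound _ (fun s => complex.Im (Nf s 0)) (fun s => complex.Im (dN s 0)) (r0 / 4) (4 * r0) r0 r M rr0 rr).
    by move=> s ss; have [] := cN' s 0 ss zI.
  by move=> s ss; apply: le_trans (cabs_ge_Im _) (bd s 0 ss zI).
have [Z1 Z2] := Z_abs y rp; set z := cabs (Z r y) in Z1 Z2 *.
have aQ : 0 < alpha * Q by rewrite mulr_gt0.
have hy : alpha * Q * y <= 2 * z.
  have := @sin_ge_half _ (alpha * y) ltac:(apply/andP; split; lra).
  have := ler_norm (sin (alpha * y)); move=> k1 k2.
  have : Q * (alpha * y / 2) <= z by apply: le_trans Z2; rewrite ler_pM2l//; lra.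
  have -> : alpha * Q * y = 2 * (Q * (alpha * y / 2)) by field.
  by rewrite ler_pM2l.
have hr : alpha * Q * `|r - r0| <= 2 * r0 * z.
  have tI' : 1 / 2 <= r / r0 <= 2 by rewrite ler_pdivlMr// ler_pdivrMr//; apply/andP; split; lra.
  have := powR_sub1_ge a02 tI'.
  have -> : (r / r0) `^ alpha = r `^ alpha / Q by rewrite -rat_div// /rat r0a.
  have -> : r / r0 - 1 = (r - r0) / r0 by field; rewrite gt_eqF.
  have -> : r `^ alpha / Q - 1 = (r `^ alpha - Q) / Q by field; rewrite gt_eqF.
  rewrite !normrM !normfV (gtr0_norm r00) (gtr0_norm Q0) => k.
  have : `|r `^ alpha - Q| / Q <= z / Q by rewrite ler_pM2r ?invr_gt0.
  move=> /(le_trans k) k'.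
  have -> : alpha * Q * `|r - r0| = 2 * r0 * Q * (alpha / 2 * (`|r - r0| / r0)) by field; rewrite gt_eqF.
  have -> : 2 * r0 * z = 2 * r0 * Q * (z / Q) by field; rewrite gt_eqF.
  by rewrite ler_pM2l// !mulr_gt0.
have nz : cabs (Nf r y) <= 12 * M * r0 / (alpha * Q) * z.
  apply: le_trans (cabs_le_ReIm _) _.
  have a1 := key (fun w => complex.Re w) (or_introl erefl).
  have a2 := key (fun w => complex.Im w) (or_intror erefl).
  have b1 : M * (r * y) <= M * (2 * r0 * y) by rewrite ler_wpM2l// ler_pM2r.
  have b2 : M * (2 * r0 * y) <= 4 * M * r0 / (alpha * Q) * z.
    have -> : M * (2 * r0 * y) = 2 * M * r0 / (alpha * Q) * (alpha * Q * y) by field; rewrite !gt_eqF.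
    have -> : 4 * M * r0 / (alpha * Q) * z = 2 * M * r0 / (alpha * Q) * (2 * z) by ring.
    apply: ler_wpM2l => //; apply: divr_ge0; last exact: ltW.
    by rewrite mulr_ge0 ?(ltW r00)// mulr_ge0.
  have b3 : M * `|r - r0| <= 2 * M * r0 / (alpha * Q) * z.
    have -> : M * `|r - r0| = M / (alpha * Q) * (alpha * Q * `|r - r0|) by field; rewrite !gt_eqF.
    have -> : 2 * M * r0 / (alpha * Q) * z = M / (alpha * Q) * (2 * r0 * z) by ring.
    by apply: ler_wpM2l => //; apply: divr_ge0 => //; exact: ltW.
  have -> : 12 * M * r0 / (alpha * Q) * z = 2 * (4 * M * r0 / (alpha * Q) * z + 2 * M * r0 / (alpha * Q) * z) by ring.
  lra.
rewrite /H cabsM cabsV -/z.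
have [z0|z0] := eqVneq z 0.
  rewrite z0 invr0 mulr0 divr_ge0 ?mulr_ge0 ?(ltW r00) ?(ltW alpha0) ?(ltW Q0)//.
have zp : 0 < z by rewrite lt_neqAle eq_sym z0 cabs_ge0.
by rewrite ler_pdivrMr.
Qed.

(** The constant value is found by letting the angle tend to 0, where [kap] and the square root are
    real and [H] has no imaginary part for r distinct from [r0]. *)
Lemma I_zero y : 0 < alpha * y < pi -> I y = 0.
Proof.
move=> yI; have h0 := r00; have pi2 := @pi_ge2 R.
pose y_ (n : nat) : R := (4 * alpha)^-1 / n.+1%:R.
have yE n : alpha * y_ n = (1 / 4) / n.+1%:R by rewrite /y_; field; rewrite !gt_eqF// ltr0Sn.
have yn n : 0 < alpha * y_ n <= 1 / 4.
  by rewrite yE divr_gt0//= ler_piMr// invf_le1// ler1n.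
have ypi n : 0 < alpha * y_ n < pi by case/andP: (yn n) => -> h /=; lra.
have yc : y_ n @[n --> \oo] --> (0 : R).
  rewrite -[X in _ --> X](mulr0 (4 * alpha)^-1); apply: cvgM; first exact: cvg_cst.
  exact: cvg_harmonic.
have E n : I (y_ n) = I y by exact: I_const.
have [LC LC0 LP] := Lip.
(* For r below r0 / 2 one has r^alpha <= q Q, for r above 2 r0 one has Q <= q r^alpha. In both cases
   [Z] is bounded below as [H_dom] requires, with the constant [m]. *)
pose q : R := 2^-1 `^ alpha.
have q0 : 0 < q by exact: powR_gt0.
have q1 : q < 1.
  rewrite /q /powR gt_eqF//; apply: (@lt_le_trans _ _ (expR 0)); last by rewrite expR0.
  by rewrite ltr_expR pmulr_rlt0// lnV ?posrE// oppr_lt0 ln_gt0// ltr1n.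
pose m := (1 - q) * Num.min 1 Q.
have m0 : 0 < m by rewrite mulr_gt0 ?subr_gt0// lt_min ltr01.
have mle1 : m <= 1 - q by rewrite /m ler_piMr ?subr_ge0 ?(ltW q1)// ge_min lexx.
have mleQ : m <= (1 - q) * Q by rewrite /m ler_wpM2l ?subr_ge0 ?(ltW q1)// ge_min lexx orbT.
have mono a b : 0 < a -> a <= b -> a `^ alpha <= b `^ alpha.
  by move=> a0 ab; apply: ge0_ler_powR; rewrite ?nnegrE ?(ltW alpha0) ?(ltW a0) ?(le_trans (ltW a0) ab).
(* The second term covers the radii between r0 / 2 and 2 r0 through [Lip]; its decaying factor makes
   a bounded estimate integrable over the whole half-line. *)
pose G r := dom m r + LC / (r0 / 2) * (1 + 4 * r0 ^+ 2) * (1 + r ^+ 2)^-1.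
have Gb n r : 0 < r -> `|complex.Im (H r (y_ n)) / r| <= G r.
  move=> rp; have p0 : 0 < 1 + r ^+ 2 by rewrite ltr_pwDl// sqr_ge0.
  have c0 : 0 <= LC / (r0 / 2) * (1 + 4 * r0 ^+ 2).
    by rewrite mulr_ge0 ?divr_ge0 ?(ltW r00)// addr_ge0// mulr_ge0// sqr_ge0.
  have d0 : 0 <= dom m r.
    by rewrite /dom mulr_ge0 ?bump_ge0// divr_ge0 ?(ltW CN0) ?(ltW m0).
  have [Z1 _] := Z_abs (y_ n) rp.
  have out : m <= cabs (Z r (y_ n)) -> m * r `^ alpha <= cabs (Z r (y_ n)) -> `|complex.Im (H r (y_ n)) / r| <= G r.
    move=> h1 h2; apply: le_trans (H_dom rp m0 h1 h2) _.
    by rewrite /G lerDl mulr_ge0// invr_ge0 ltW.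
  have [ra|ra] := ltP r (r0 / 2).
    have ha : r `^ alpha <= q * Q.
      have -> : q * Q = (r0 / 2) `^ alpha by rewrite powRM ?invr_ge0 ?(ltW r00)// r0a mulrC.
      by apply: mono => //; exact: ltW.
    have hz : (1 - q) * Q <= cabs (Z r (y_ n)).
      apply: le_trans Z1; rewrite distrC; apply: le_trans (ler_norm _); rewrite mulrBl mul1r; lra.
    apply: out; first exact: le_trans mleQ hz.
    apply: le_trans hz; apply: ler_pM; rewrite ?(ltW m0) ?powR_ge0//.
    by apply: (le_trans ha); rewrite ler_piMl ?(ltW Q0)// ltW.
  have [rb|rb] := ltP (2 * r0) r.
    have ha : Q <= q * r `^ alpha.
      have -> : q * r `^ alpha = (r / 2) `^ alpha by rewrite powRM ?invr_ge0 ?(ltW rp)// mulrC.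
      by rewrite -[leLHS]r0a; apply: mono => //; lra.
    have ra0 := powR_gt0 alpha rp.
    have hz : (1 - q) * r `^ alpha <= cabs (Z r (y_ n)).
      apply: le_trans Z1; apply: le_trans (ler_norm _); rewrite mulrBl mul1r; lra.
    apply: out; last by apply: le_trans hz; rewrite ler_pM2r.
    apply: (le_trans mleQ); apply: le_trans hz; rewrite ler_wpM2l ?subr_ge0 ?(ltW q1)//.
    by apply: (le_trans ha); rewrite ler_piMl ?(ltW ra0)// ltW.
  have := LP r (y_ n) ltac:(apply/andP; split; lra) (yn n) => hL.
  rewrite normrM [X in _ * X]gtr0_norm ?invr_gt0//.
  apply: (@le_trans _ _ (LC / (r0 / 2))).
    apply: ler_pM => //; first by rewrite invr_ge0 ltW.
      exact: le_trans (cabs_ge_Im _) hL.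
    by rewrite lef_pV2 ?posrE// divr_gt0.
  rewrite /G; apply: (@le_trans _ _ (LC / (r0 / 2) * (1 + 4 * r0 ^+ 2) / (1 + r ^+ 2))); last by rewrite lerDr.
  rewrite -mulrA ler_peMr ?divr_ge0 ?(ltW r00)// ler_pdivlMr// mul1r lerD2l.
  have -> : 4 * r0 ^+ 2 = (2 * r0) ^+ 2 by ring.
  by rewrite lerXn2r ?nnegrE ?(ltW rp)// mulr_ge0// ltW.
have Gi : mu.-integrable `]0, +oo[ (EFin \o G).
  by apply: LintD => //; apply: LintZ => //; exact: integrable_arctan.1.
have ms n : measurable_fun (`]0, +oo[%classic : set R) (fun r => complex.Im (H r (y_ n)) / r).
  have [d /andP[d0 d1] dP] := common (ypi n).
  have dI : 0 < d < pi / 2 by rewrite d0.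
  by apply: (Hstrip_meas dI); apply: dP; rewrite d0 lexx.
have pc r : (`]0, +oo[%classic : set R) r -> r != r0 -> complex.Im (H r (y_ n)) / r @[n --> \oo] --> (0 : R).
  move=> /S rp rn0; have tI : 0 < (1 : R) < pi by rewrite ltr01/=; lra.
  have z0 : Z r 0 != 0.
    apply/eqP => /(congr1 (fun w => complex.Re w)); rewrite /Z /= mulr0 addr0 cos0 mulr1 => /eqP.
    rewrite subr_eq0 => /eqP h; move/negP: rn0; apply; apply/eqP.
    have an : alpha != 0 by rewrite gt_eqF.
    by rewrite /r0 -h -powRrM divff// powRr1// ltW.
  have yI0 : - 1 < alpha * 0 < 1 by rewrite mulr0 oppr_lt0 ltr01.
  have [_ _ _ d] := chol_H rp tI yI0 z0.
  have c : {for (0 : R), continuous (fun t => complex.Im (H r t))} := der_cont d.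
  have Im0 : complex.Im (H r 0) = 0.
    by rewrite /H /Nf /Z kap0 /cpow !mulr0 !addr0 cos0 sin0 !mulr0 ImM ImV ReV /= !(mulr0, mul0r, addr0, add0r, oppr0).
  have -> : 0 = complex.Im (H r 0) / r :> R by rewrite Im0 mul0r.
  by apply: cvgM; [exact: (continuous_cvg _ c yc)|exact: cvg_cst].
have [_ cv] := @Ldominated_cvg_except _ G r0 `]0, +oo[ (fun n r => complex.Im (H r (y_ n)) / r) (fun=> 0)
  m0y ms (@measurable_cst _ _ _ _ _ _) pc Gi (fun n r hr _ => Gb n r (S hr)).
have cv' : I (y_ n) @[n --> \oo] --> \int[mu]_(r in `]0, +oo[) (0 : R) := cv.
move: cv'; under eq_fun do rewrite E; move=> cv'.
have z : \int[mu]_(r in `]0, +oo[) (0 : R) = 0.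
  rewrite (@eq_Lintegral _ _ _ (fun=> 0 * 0)); last by move=> v _; rewrite mulr0.
  by rewrite LintegralZ ?mul0r//; exact: (integrable0 mu).
rewrite z in cv'; exact: (cvg_unique _ (cvg_cst (I y)) cv').
Qed.

(** The imaginary part of the boundary value of [kap] on the cut, divided by [u]: up to alpha / pi,
    the density of the Stieltjes measure. *)
Definition Gden u : R := expR (- Apot alpha rho u) * sin (eta rho u) / u.

Let Hl r := - ((expR (- Apot alpha rho r) * sin (eta rho r) - kQ / Num.sqrt Q * r `^ (alpha / 2)) / (r `^ alpha + Q)) / r.

(** The other end of the rotation: at alpha y = pi one has z = - r^alpha, the square root is i
    r^(alpha/2), and the imaginary part of [H] combines [Gden] with the square root term. *)
Let Hl_int : mu.-integrable `]0, +oo[ (EFin \o Hl) /\ \int[mu]_(r in `]0, +oo[) Hl r = 0.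
Proof.
(* The angles alpha y stay between 3 pi / 4 and pi, hence far from the zero of z - Q, and one lower
   bound on [Z] serves for all n. *)
pose y_ (n : nat) : R := (pi - (pi / 4) / n.+1%:R) / alpha.
have pi1 := pi0; have an : alpha != 0 by rewrite gt_eqF.
have yE n : alpha * y_ n = pi - (pi / 4) / n.+1%:R by rewrite /y_ mulrC mulfVK.
have p40 : 0 < pi / 4 :> R by rewrite divr_gt0.
have fr n : 0 < (pi / 4 : R) / n.+1%:R <= pi / 4.
  by rewrite divr_gt0//= ler_piMr ?(ltW p40)// invf_le1// ler1n.
have yI n : 0 < alpha * y_ n < pi by rewrite yE; move: (fr n); set w := pi / 4 / _ => /andP[? ?]; apply/andP; split; lra.
have yI' n : - pi < alpha * y_ n < pi by case/andP: (yI n) => ? ->; rewrite andbT; lra.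
have dI : 0 < (pi / 4 : R) < pi / 2.
  by rewrite p40/= ltr_pM2l// ltf_pV2 ?posrE// ltr_nat.
have yZ n : - (pi - pi / 4) < alpha * y_ n - pi < pi - pi / 4.
  by rewrite yE; move: (fr n); set w := pi / 4 / _ => /andP[? ?]; apply/andP; split; lra.
have yc : alpha * y_ n @[n --> \oo] --> (pi : R).
  have c : pi - pi / 4 / n.+1%:R @[n --> \oo] --> (pi - pi / 4 * 0 : R).
    apply: cvgB; first exact: cvg_cst.
    by apply: cvgM; [exact: cvg_cst|exact: cvg_harmonic].
  by rewrite mulr0 subr0 in c; under eq_fun do rewrite yE; exact: c.
pose m := mZ (pi / 4).
have m0 : 0 < m by exact: mZ_gt0.
have b n r : (`]0, +oo[%classic : set R) r -> `|complex.Im (H r (y_ n)) / r| <= dom m r.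
  by move=> /S rp; have [h1 h2] := Z_away dI rp (yZ n); exact: H_dom.
have ms n : measurable_fun (`]0, +oo[%classic : set R) (fun r => complex.Im (H r (y_ n)) / r).
  have [d /andP[d0 d1] dP] := common (yI n).
  have dI' : 0 < d < pi / 2 by rewrite d0.
  by apply: (Hstrip_meas dI'); apply: dP; rewrite d0 lexx.
have pc r : (`]0, +oo[%classic : set R) r -> complex.Im (H r (y_ n)) / r @[n --> \oo] --> Hl r.
  move=> /S rp; have [l1 l2] := lkap_lim a02 rho01 rp yI' yc.
  have cR : complex.Re (kap r (y_ n)) @[n --> \oo] --> expR (- Apot alpha rho r) * cos (eta rho r).
    by apply: cvgM; [apply: (continuous_cvg _ _ l1); exact: continuous_expR|apply: (continuous_cvg _ _ l2); exact: continuous_cos].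
  have cI : complex.Im (kap r (y_ n)) @[n --> \oo] --> expR (- Apot alpha rho r) * sin (eta rho r).
    by apply: cvgM; [apply: (continuous_cvg _ _ l1); exact: continuous_expR|apply: (continuous_cvg _ _ l2); exact: continuous_sin].
  have yc2 : alpha / 2 * y_ n @[n --> \oo] --> (pi / 2 : R).
    have e n : alpha / 2 * y_ n = alpha * y_ n / 2 by ring.
    under eq_fun do rewrite e.
    by apply: cvgM => //; exact: cvg_cst.
  have cc : cos (alpha / 2 * y_ n) @[n --> \oo] --> (0 : R).
    by rewrite -[X in _ --> X]cos_pihalf; apply: (continuous_cvg _ _ yc2); exact: continuous_cos.
  have cs : sin (alpha / 2 * y_ n) @[n --> \oo] --> (1 : R).
    by rewrite -[X in _ --> X]sin_pihalf; apply: (continuous_cvg _ _ yc2); exact: continuous_sin.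
  have dc : cos (alpha * y_ n) @[n --> \oo] --> (- 1 : R).
    by rewrite -[X in _ --> X]cospi; apply: (continuous_cvg _ _ yc); exact: continuous_cos.
  have ds : sin (alpha * y_ n) @[n --> \oo] --> (0 : R).
    by rewrite -[X in _ --> X]sinpi; apply: (continuous_cvg _ _ yc); exact: continuous_sin.
  pose c := - (kQ / Num.sqrt Q); pose a := r `^ (alpha / 2); pose p := r `^ alpha.
  have p0 : 0 < p by exact: powR_gt0.
  have pQ : p + Q != 0 by rewrite gt_eqF// addr_gt0.
  have E n : complex.Im (H r (y_ n)) =
    ((complex.Im (kap r (y_ n)) + c * (a * sin (alpha / 2 * y_ n))) * (p * cos (alpha * y_ n) - Q) -
     (complex.Re (kap r (y_ n)) + c * (a * cos (alpha / 2 * y_ n))) * (p * sin (alpha * y_ n))) /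
    ((p * cos (alpha * y_ n) - Q) ^+ 2 + (p * sin (alpha * y_ n)) ^+ 2).
    rewrite /H ImM ReV ImV /Nf /cabs2 /Z !(ReD, ImD, ReM, ImM, ReN, ImN) /cN /cpow /= -/a -/p -/c.
    rewrite !mul0r !addr0 subr0 oppr0 !addr0; ring.
  under eq_fun do rewrite E.
  have -> : Hl r = ((expR (- Apot alpha rho r) * sin (eta rho r) + c * (a * 1)) * (p * -1 - Q) -
     (expR (- Apot alpha rho r) * cos (eta rho r) + c * (a * 0)) * (p * 0)) /
      ((p * -1 - Q) ^+ 2 + (p * 0) ^+ 2) / r.
    rewrite /Hl -/a -/p /c; set x := expR _; set w := sin _; set w' := cos _; set kk' := kQ / _.
    have -> : (p * -1 - Q) ^+ 2 + (p * 0) ^+ 2 = (p + Q) ^+ 2 by ring.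
    have rn : r != 0 by rewrite gt_eqF.
    by field; rewrite rn pQ.
  apply: cvgM; last exact: cvg_cst.
  have cD : p * cos (alpha * y_ n) - Q @[n --> \oo] --> p * -1 - Q.
    by apply: cvgB; [apply: cvgM => //; exact: cvg_cst|exact: cvg_cst].
  have cE : p * sin (alpha * y_ n) @[n --> \oo] --> p * 0.
    by apply: cvgM => //; exact: cvg_cst.
  apply: cvgM.
    apply: cvgB; apply: cvgM => //.
      by apply: cvgD => //; apply: cvgM; [exact: cvg_cst|apply: cvgM => //; exact: cvg_cst].
    by apply: cvgD => //; apply: cvgM; [exact: cvg_cst|apply: cvgM => //; exact: cvg_cst].
  apply: cvgV.
    by rewrite mulr0 expr0n addr0 mulrN1 -opprD sqrrN sqrf_eq0.
  by apply: cvgD; rewrite !expr2; under eq_fun do rewrite expr2; apply: cvgM.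
have [i cv] := @Ldominated_cvg _ (dom m) `]0, +oo[ (fun n r => complex.Im (H r (y_ n)) / r) Hl m0y ms pc (domi m) b.
split=> //.
have E n : \int[mu]_(r in `]0, +oo[) (complex.Im (H r (y_ n)) / r) = 0 by exact: (I_zero (yI n)).
move: cv; under eq_fun do rewrite E; move=> cv.
by apply/esym; exact: (cvg_unique _ (cvg_cst (0 : R)) cv).
Qed.

(** In the variable r^(alpha/2) / sqrt Q this is the arctangent integral. *)
Let half_int : mu.-integrable `]0, +oo[ (EFin \o (fun r => r `^ (alpha / 2) / (r `^ alpha + Q) / r)) /\
  \int[mu]_(r in `]0, +oo[) (r `^ (alpha / 2) / (r `^ alpha + Q) / r) = pi / (alpha * Num.sqrt Q).
Proof.
have s0 : 0 < Num.sqrt Q by rewrite sqrtr_gt0.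
have sq : Num.sqrt Q ^+ 2 = Q by rewrite sqr_sqrtr// ltW.
have a20 : 0 < alpha / 2 by rewrite divr_gt0.
rewrite -[X in _ /\ _ = X]subr0.
have ab r : 0 < r -> r `^ alpha = r `^ (alpha / 2) ^+ 2.
  move=> rp; have rn : r != 0 by rewrite gt_eqF.
  by rewrite [in LHS](splitr alpha) powRD ?rn ?implybT// expr2.
apply: (@ge0_FTC_oy _ 0 0 (pi / (alpha * Num.sqrt Q)) _ (fun r => 2 / (alpha * Num.sqrt Q) * atan (r `^ (alpha / 2) / Num.sqrt Q))).
- move=> r rp; have p0 : r `^ alpha + Q != 0 by rewrite gt_eqF// addr_gt0// powR_gt0.
  have rn : r != 0 by rewrite gt_eqF.
  by dcont.
- move=> r rp; have rn : r != 0 by rewrite gt_eqF.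
  have E : r `^ (alpha / 2 - 1) = r `^ (alpha / 2) / r by rewrite powRD ?rn ?implybT// powRN powRr1// ltW.
  have h1 : 1 + (r `^ (alpha / 2) / Num.sqrt Q) ^+ 2 != 0 by rewrite gt_eqF// ltr_pwDl// sqr_ge0.
  have sn : Num.sqrt Q != 0 by rewrite gt_eqF.
  der => //; rewrite E ab// -[in RHS]sq.
  have h2 : (r `^ (alpha / 2)) ^+ 2 + Num.sqrt Q ^+ 2 != 0 by rewrite gt_eqF// ltr_wpDl ?sqr_ge0// exprn_gt0.
  move: h2 sn; set x := r `^ _; set z := Num.sqrt Q => h2 sn.
  have h3 : z ^+ 2 + x ^+ 2 != 0 by rewrite addrC.
  by field; rewrite ?rn ?sn ?h2 ?h3 ?(gt_eqF alpha0).
- by move=> r rp; rewrite !divr_ge0 ?addr_ge0 ?powR_ge0 ?(ltW Q0) ?(ltW rp).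
- have c0 : r `^ (alpha / 2) @[r --> (0 : R)^'+] --> (0 : R).
    apply/cvgr0Pnorm_le => e e0; have [d d0 dP] := powR_small a20 e0.
    near=> r; rewrite ger0_norm ?powR_ge0// dP//; apply/andP; split; near: r.
      exact: nbhs_right_gt.
    exact: nbhs_right_lt.
  have c1 : r `^ (alpha / 2) / Num.sqrt Q @[r --> (0 : R)^'+] --> (0 : R).
    by rewrite -[X in _ --> X](mul0r (Num.sqrt Q)^-1); apply: cvgM => //; exact: cvg_cst.
  rewrite -[X in _ --> X](mulr0 (2 / (alpha * Num.sqrt Q))); apply: cvgM; first exact: cvg_cst.
  by rewrite -[X in _ --> X](@atan0 R); apply: (continuous_cvg _ _ c1); exact: continuous_atan.
- have -> : pi / (alpha * Num.sqrt Q) = 2 / (alpha * Num.sqrt Q) * (pi / 2).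
    have gen (p a z : R) : a != 0 -> z != 0 -> p / (a * z) = 2 / (a * z) * (p / 2) by move=> h1 h2; field; rewrite h1 h2.
    by apply: gen; rewrite gt_eqF.
  apply: cvgM; first exact: cvg_cst.
  apply: (@cvg_comp _ _ _ (fun r => r `^ (alpha / 2) / Num.sqrt Q) atan _ +oo); last exact: cvgy_atan.
  apply/cvgryPge => A; have B0 : 0 < (Num.sqrt Q * (`|A| + 1))^-1 by rewrite invr_gt0 mulr_gt0// ltr_wpDl.
  have [d d1 dP] := powRN_small a20 B0.
  near=> r; have rd : d < r by near: r; apply: nbhs_pinfty_gt; rewrite num_real.
  have rp : 0 < r by rewrite (lt_trans _ rd)// (lt_trans _ d1).
  have := dP r rd; rewrite powRN lef_pV2 ?posrE ?powR_gt0//; last by rewrite mulr_gt0// ltr_wpDl.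
  move=> h; rewrite ler_pdivlMr// mulrC; apply: le_trans h; rewrite ler_pM2l//.
  by have := ler_norm A; lra.
Unshelve. all: by end_near. Qed.

(* Rotate [(kap(z) - kap(Q) (z / Q)^(1/2)) / (z - Q)], whose numerator vanishes
   at [Q], from the positive to the negative axis. *)
Lemma stieltjes_kQ : mu.-integrable `]0, +oo[ (EFin \o (fun u => Gden u * (Q / (u `^ alpha + Q)))) /\
  alpha / pi * \int[mu]_(u in `]0, +oo[) (Gden u * (Q / (u `^ alpha + Q))) = kQ.
Proof.
have [i1 e1] := Hl_int; have [i2 e2] := half_int.
pose K := kQ / Num.sqrt Q.
have j2 := LintZ (Q * K) m0y i2; have j1 := LintZ (- Q) m0y i1.
have E r : (`]0, +oo[%classic : set R) r -> - Q * Hl r + Q * K * (r `^ (alpha / 2) / (r `^ alpha + Q) / r) = Gden r * (Q / (r `^ alpha + Q)).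
  move=> /S rp; have pQ : r `^ alpha + Q != 0 by rewrite gt_eqF// addr_gt0// powR_gt0.
  rewrite /Hl /Gden -/K; set x := expR _; set w := sin _; set p := r `^ alpha in pQ *.
  by field; rewrite pQ gt_eqF.
split; first by apply: (eq_Lint _ E) => //; exact: LintD.
rewrite -(eq_Lintegral E) LintegralD// !LintegralZ// e1 e2 mulr0 add0r /K.
have sq : Num.sqrt Q * Num.sqrt Q = Q by rewrite -expr2 sqr_sqrtr// ltW.
have s0 : Num.sqrt Q != 0 by rewrite gt_eqF// sqrtr_gt0.
have gen (p k z a : R) : p != 0 -> a != 0 -> z != 0 -> a / p * (z * z * (k / z) * (p / (a * z))) = k.
  by move=> h1 h2 h3; field; rewrite h1 h2 h3.
by rewrite -{1}sq; apply: gen => //; rewrite gt_eqF.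
Qed.

Lemma kQE : kQ = expR (- (pi^-1 * \int[mu]_(v in `]0, +oo[) (wk rho v * ln (1 + v `^ alpha / Q)))).
Proof.
congr expR => /=.
transitivity (- pi^-1 * \int[mu]_(v in `]0, +oo[) (wk rho v * ln (1 + v `^ alpha / Q))); last by rewrite mulNr.
rewrite -LintegralZ//.
  apply: eq_Lintegral => v /S v0; have x0 := rat_gt0 alpha v0 r00.
  rewrite mulr0 oppr0 /rat r0a in x0 *; rewrite -mulrA; congr (_ * (_ * _)).
  rewrite /La /nrm2 cos0 mulr1.
  have -> : 1 + 2 * (v `^ alpha / Q) + (v `^ alpha / Q) ^+ 2 = (1 + v `^ alpha / Q) ^+ 2 by ring.
  by rewrite lnXn ?mulr2n; [field|rewrite addr_gt0].
apply: (@le_Lint _ (fun v => wC rho * (Ld (v `^ alpha / Q) / (1 + v ^+ 2)))) => //.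
- by rewrite /wk; meas.
- move=> v /S v0; have x0 : 0 < v `^ alpha / Q by rewrite divr_gt0// powR_gt0.
  have w0 := wk_ge0 rho01 (ltW v0); have w1 := wk_le rho01 (ltW v0).
  rewrite normrM (ger0_norm w0).
  have -> : wC rho * (Ld (v `^ alpha / Q) / (1 + v ^+ 2)) = wC rho / (1 + v ^+ 2) * Ld (v `^ alpha / Q) by ring.
  apply: ler_pM => //; rewrite ger0_norm ?ln_ge0 ?lerDl ?(ltW x0)// /Ld lerDr//.
- by apply: LintZ => //; apply: integrable_Ld.
Qed.

End stieltjes.

Local Close Scope complex_scope.

(** * The exponents I and J as boundary values *)

Section sup_kernel.
Context {R : realType}.
Notation mu := (@lebesgue_measure R).
Variables (alpha rho : R).
Hypotheses (a02 : 0 < alpha <= 2) (rho01 : 0 < rho < 1).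
Implicit Types u v : R.

Let alpha0 : 0 < alpha. Proof. by case/andP: a02. Qed.
Let m0y : measurable (`]0, +oo[%classic : set R). Proof. exact: measurable_itv. Qed.
Let S v : (`]0, +oo[%classic : set R) v -> 0 < v.
Proof. by rewrite /= in_itv/= andbT. Qed.
Let rpi : - pi < rho * pi < pi.
Proof. by have pi0 := @pi_gt0 R; case/andP: rho01 => ? ?; apply/andP; split; nra. Qed.
Let dang : - pi < pi - 2 * rho * pi < pi.
Proof. by have pi0 := @pi_gt0 R; case/andP: rho01 => ? ?; apply/andP; split; nra. Qed.

Lemma int_wk : \int[mu]_(v in `]0, +oo[) wk rho v = rho * pi.
Proof. by have [_ ->] := int_wk_tail rho01 (lexx 0); rewrite Th0// subr0. Qed.

(** Factoring out [u] and [u^alpha] separates the logarithm into the function that also occurs in J,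
    a constant, and the potential [Apot]. At v = u the argument of [ln] is zero by convention, so
    that point is left out. *)
Lemma I_integrandE u v : 0 < u -> 0 < v -> v != u ->
  I_integrand alpha rho u v = wk rho v * A2_log rho u v - alpha * ln u * wk rho v -
    wk rho v * ln `|1 - rat alpha v u|.
Proof.
move=> u0 v0 vu; rewrite /I_integrand -/(wk rho v).
suff -> : ln ((v - u) * Num.sqrt (u ^+ 2 - 2 * u * v * cos (2 * rho * pi) + v ^+ 2) / (v `^ alpha - u `^ alpha)) =
   A2_log rho u v - alpha * ln u - ln `|1 - rat alpha v u| by ring.
have x0 : 0 < v / u by rewrite divr_gt0.
have n0 := nrm2_gt0 (ltW x0) dang.
have q0 : v / u != 1 by apply: contra vu => /eqP h; rewrite -[u]mul1r -h mulfVK// gt_eqF.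
have r1 := rat_neq1 a02 v0 u0 vu.
have d1 : 0 < `|1 - v / u| by rewrite normr_gt0 subr_eq0 eq_sym.
have d2 : 0 < `|1 - rat alpha v u| by rewrite normr_gt0 subr_eq0 eq_sym.
have ua : 0 < u `^ alpha by exact: powR_gt0.
have sqE : Num.sqrt (u ^+ 2 - 2 * u * v * cos (2 * rho * pi) + v ^+ 2) = u * Num.sqrt (nrm2 (v / u) (pi - 2 * rho * pi)).
  rewrite -[X in _ = X * _](ger0_norm (ltW u0)) -sqrtr_sqr -sqrtrM ?sqr_ge0//; congr Num.sqrt.
  by rewrite /nrm2 cosB cospi sinpi mul0r addr0; field; rewrite gt_eqF.
have s0 : 0 < Num.sqrt (nrm2 (v / u) (pi - 2 * rho * pi)) by rewrite sqrtr_gt0.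
have E : (v - u) / (v `^ alpha - u `^ alpha) = u * `|1 - v / u| / (u `^ alpha * `|1 - rat alpha v u|).
  have e1 : v - u = - (u * (1 - v / u)) by field; rewrite gt_eqF.
  have e2 : v `^ alpha - u `^ alpha = - (u `^ alpha * (1 - rat alpha v u)).
    by rewrite /rat; field; rewrite gt_eqF.
  rewrite e1 e2 invrN mulrNN.
  have [h|h] := ltP 1 (v / u).
    have h' : 1 < rat alpha v u by rewrite rat_gt1//; rewrite ltr_pdivlMr// mul1r in h.
    by rewrite !ltr0_norm ?subr_lt0// !mulrN invrN mulrNN.
  have h1 : v / u < 1 by rewrite lt_neqAle q0.
  have h' : rat alpha v u < 1.
    rewrite lt_neqAle r1/= leNgt rat_gt1// -leNgt.
    by rewrite ler_pdivrMr// mul1r in h.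
  by rewrite !gtr0_norm ?subr_gt0.
rewrite mulrAC E sqE.
have -> : u * `|1 - v / u| / (u `^ alpha * `|1 - rat alpha v u|) * (u * Num.sqrt (nrm2 (v / u) (pi - 2 * rho * pi))) =
  (u * `|1 - v / u| * (u * Num.sqrt (nrm2 (v / u) (pi - 2 * rho * pi)))) / (u `^ alpha * `|1 - rat alpha v u|) by ring.
have ls : ln (Num.sqrt (nrm2 (v / u) (pi - 2 * rho * pi))) = La (v / u) (pi - 2 * rho * pi).
  by rewrite /La -{2}(sqr_sqrtr (ltW n0)) lnXn// mulr2n; field.
rewrite ln_div ?posrE ?mulr_gt0// !lnM ?posrE ?mulr_gt0// ls ln_powR /A2_log.
ring.
Qed.

Let wk_i : mu.-integrable `]0, +oo[ (EFin \o wk rho). Proof. exact: integrable_wk. Qed.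

Let Iexp u v := wk rho v * A2_log rho u v - alpha * ln u * wk rho v - wk rho v * ln `|1 - rat alpha v u|.

Let Iexp_i u : 0 < u -> mu.-integrable `]0, +oo[ (EFin \o Iexp u).
Proof.
move=> u0; apply: LintB => //; last exact: integrable_wk_ln.
by apply: LintB => //; [exact: integrable_wk_log|exact: LintZ].
Qed.

Let mI u (D : set R) : measurable_fun D (I_integrand alpha rho u).
Proof. by rewrite /I_integrand; meas. Qed.

Lemma integrable_I u : 0 < u -> mu.-integrable `]0, +oo[ (EFin \o I_integrand alpha rho u).
Proof.
move=> u0; apply: (@le_Lint_except _ (fun v => `|Iexp u v|) u) => //.
  by move=> v /S v0 vu; rewrite I_integrandE.
exact: (integrable_norm (Iexp_i u0)).
Qed.

Lemma I_termE u : 0 < u -> I_term alpha rho u =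
  pi^-1 * \int[mu]_(v in `]0, +oo[) (wk rho v * A2_log rho u v) - alpha * rho * ln u - Apot alpha rho u.
Proof.
move=> u0; rewrite /I_term /Apot.
have i1 := integrable_wk_log rho01 u0; have i2 := integrable_wk_ln a02 rho01 u0.
have i3 := LintZ (alpha * ln u) m0y wk_i.
rewrite (@eq_Lintegral_except _ u _ _ (Iexp u)) => //; last first.
- by move=> v /S v0 vu; rewrite I_integrandE.
- exact: integrable_mfun (Iexp_i u0).
rewrite /Iexp LintegralB//; last exact: LintB.
rewrite LintegralB// LintegralZ// int_wk.
have gen (p a b l r : R) : p != 0 -> p^-1 * (a - l * (r * p) - b) = p^-1 * a - l * r - p^-1 * b by move=> p0; field.
by rewrite gen ?gt_eqF ?pi_gt0//; ring.
Qed.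

(** The integrals of [A2_log] cancel in I + J. What remains is a power of [u], the factor sqrt
    ([nrm2]) and exp (- Apot); then sin (eta) sqrt ([nrm2]) = sin (rho pi) gives the density. *)
Lemma sup_kernelE u : 0 < u ->
  u `^ (- ((2 - alpha) * rho)) * sin (rho * pi) / (1 + 2 * u * cos (rho * pi) + u ^+ 2) *
  expR (I_term alpha rho u + J_term rho u) = Gden alpha rho u.
Proof.
move=> u0; have n0 : 0 < nrm2 u (rho * pi) by rewrite nrm2_gt0// ltW.
have s0 : 0 < Num.sqrt (nrm2 u (rho * pi)) by rewrite sqrtr_gt0.
have [c s] := cos_sin_Th (ltW u0) rpi.
have se : sin (eta rho u) * Num.sqrt (nrm2 u (rho * pi)) = sin (rho * pi).
  rewrite /eta sinB mulrBl -!mulrA c s; ring.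
have A2 := J_term_identity rho01 u0.
have -> : I_term alpha rho u + J_term rho u =
    ((2 - alpha) * rho) * ln u + (- ln u) + La u (rho * pi) + - Apot alpha rho u.
  rewrite I_termE//; set X := pi^-1 * _ in A2 *.
  have -> : J_term rho u = (2 * rho - 1) * ln u + La u (rho * pi) - X by rewrite -A2 addrK.
  ring.
rewrite !expRD expRN lnK ?posrE//.
have -> : expR (La u (rho * pi)) = Num.sqrt (nrm2 u (rho * pi)).
  rewrite /La -{1}(sqr_sqrtr (ltW n0)) lnXn// mulr2n.
  have -> : (ln (Num.sqrt (nrm2 u (rho * pi))) + ln (Num.sqrt (nrm2 u (rho * pi)))) / 2 = ln (Num.sqrt (nrm2 u (rho * pi))) by field.
  by rewrite lnK.
rewrite -/(nrm2 u (rho * pi)) /Gden -se.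
have -> : expR ((2 - alpha) * rho * ln u) = u `^ ((2 - alpha) * rho) by rewrite /powR gt_eqF.
rewrite powRN; have p0 : 0 < u `^ ((2 - alpha) * rho) by exact: powR_gt0.
rewrite -[in nrm2 u _](mul1r u) mul1r -{2}(sqr_sqrtr (ltW n0)).
by field; rewrite !gt_eqF.
Qed.

End sup_kernel.

(** * Spitzer's identity *)

Section joint_law.
Context d (T : measurableType d) (R : realType) (P : probability T R).

Lemma measurable_pair (U V : T -> R) : measurable_fun setT U -> measurable_fun setT V ->
  measurable_fun setT (fun w => (U w, V w)).
Proof. by move=> mU mV; exact: measurable_fun_pair. Qed.

(** The law of (U, V) under P restricted to E and divided by P E agrees with the product law on
    rectangles, which determines it. The event E allows independence from the past to be carried
    along; if P E = 0 both sides vanish. *)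
Lemma joint_law (U V : {RV P >-> R}) (E : set T) (C : set (R * R)) :
  measurable E ->
  (forall A B : set R, measurable A -> measurable B ->
    P (E `&` (U @^-1` A `&` V @^-1` B)) = (P E * (P (U @^-1` A) * P (V @^-1` B)))%E) ->
  measurable C ->
  P (E `&` (fun w => (U w, V w)) @^-1` C) = (P E * (distribution P U \x distribution P V)%E C)%E.
Proof.
move=> mE h mC.
have mUV : measurable_fun setT (fun w => (U w, V w)).
  by apply: measurable_pair; exact: measurable_funP.
have mCi (C' : set (R * R)) : measurable C' -> measurable ((fun w => (U w, V w)) @^-1` C').
  by move=> mC'; rewrite -[X in measurable X]setTI; exact: mUV.
have [PE0|PE0] := eqVneq (P E) 0%E.
  rewrite PE0 mul0e; apply/eqP; rewrite -measure_le0 -PE0; apply: le_measure; rewrite ?inE//.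
    by apply: measurableI => //; exact: mCi.
have fE : P E \is a fin_num by exact: fin_num_measure.
have fE0 : 0 <= (fine (P E))^-1 by rewrite invr_ge0 fine_ge0.
pose m0 : {measure set (R * R) -> \bar R} := pushforward (mrestr P mE) (fun w => (U w, V w)).
pose m' : {measure set (R * R) -> \bar R} := mscale (NngNum fE0) (m0 mUV).
have m'E C' : m' C' = ((fine (P E))^-1%:E * P (E `&` (fun w => (U w, V w)) @^-1` C'))%E.
  by rewrite /m' /mscale/= /pushforward /mrestr setIC.
have fn : fine (P E) != 0 by rewrite fine_eq0.
have key : (P E * (fine (P E))^-1%:E = 1)%E.
  by rewrite -[X in (X * _)%E](fineK fE) -EFinM mulfV.
rewrite (@product_measure_unique _ _ _ _ _ (distribution P U) (distribution P V) m')//.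
  by rewrite m'E muleA key mul1e.
move=> A B mA mB; rewrite m'E.
rewrite (_ : _ @^-1` _ = U @^-1` A `&` V @^-1` B)//.
by rewrite h// muleA [X in (X * _)%E]muleC key mul1e.
Unshelve. all: exact: mUV.
Qed.

Definition independent2 (U V : T -> R) := forall A B : set R, measurable A -> measurable B ->
  P (U @^-1` A `&` V @^-1` B) = (P (U @^-1` A) * P (V @^-1` B))%E.

Lemma expectation_joint (U V : T -> R) (F : R * R -> R) (M : R) :
  measurable_fun setT U -> measurable_fun setT V -> independent2 U V ->
  measurable_fun setT F -> (forall p, 0 <= F p <= M) ->
  \int[P]_w F (U w, V w) = \int[P]_w \int[P]_w' F (U w, V w').
Proof.
move=> mU mV h mF F0.
pose U' : {RV P >-> R} := HB.pack U (isMeasurableFun.Build _ _ _ _ _ mU).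
pose V' : {RV P >-> R} := HB.pack V (isMeasurableFun.Build _ _ _ _ _ mV).
have mUV := measurable_pair mU mV.
have mFE : measurable_fun setT (EFin \o F) by exact/measurable_EFinP.
have F0E p : (0 <= (EFin \o F) p)%E by case/andP: (F0 p) => ? _; rewrite /= lee_fin.
have E1 : (\int[P]_w (F (U w, V w))%:E = \int[P]_w \int[P]_w' (F (U w, V w'))%:E)%E.
  transitivity (\int[pushforward P (fun w => (U w, V w))]_z (F z)%:E)%E.
    by rewrite (@ge0_integral_pushforward _ _ _ _ _ _ mUV P setT _ measurableT mFE (fun p _ => F0E p)) preimage_setT.
  transitivity (\int[(distribution P U' \x distribution P V')%E]_z (F z)%:E)%E.
    apply: eq_measure_integral => C mC _.
    have PT := @probability_setT _ _ _ P.
    have := @joint_law U' V' setT C measurableT _ mC; rewrite setTI PT mul1e => hh; apply: hh.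
    by move=> A B mA mB; rewrite setTI mul1e; exact: h.
  rewrite (fubini_tonelli1 (EFin \o F))//.
  have mG : measurable_fun setT (fubini_F (distribution P V') (EFin \o F)).
    exact: measurable_fun_fubini_tonelli_F.
  rewrite (@ge0_integral_pushforward _ _ _ _ _ U)//; last first.
    by move=> y _; apply: integral_ge0 => *; exact: F0E.
  apply: eq_integral => w _ /=; rewrite /fubini_F.
  rewrite (@ge0_integral_pushforward _ _ _ _ _ V)//.
  exact: measurableT_comp (pair1_measurable _).
rewrite /Rintegral E1; congr fine; apply: eq_integral => w _.
rewrite fineK//; apply: integrable_fin_num => //.
apply: (@bounded_integrable _ _ _ _ (fun w' => F (U w, V w')) M).
  apply: (measurableT_comp mF); apply: measurable_pair => //.
by move=> w'; case/andP: (F0 (U w, V w')) => a b; rewrite ger0_norm.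
Unshelve. all: exact: mUV.
Qed.

End joint_law.

(** * Convolution operators and the Wiener-Hopf argument *)

Section convolution.
Context d (T : measurableType d) (R : realType) (P : probability T R).
Implicit Types (Y Z : T -> R) (f g : R -> R).

Definition bdmeas f := measurable_fun setT f /\ exists M : R, forall x, `|f x| <= M.

(** The transition operator of a step distributed as [Y]. Working with operators on bounded
    functions avoids convolutions of laws. *)
Definition conv Y f x : R := \int[P]_w f (x + Y w).

Lemma conv_integrable Y f x : measurable_fun setT Y -> bdmeas f ->
  P.-integrable setT (EFin \o (fun w => f (x + Y w))).
Proof.
move=> mY [mf [M fM]]; apply: (@bounded_integrable _ _ _ _ _ M) => //.
by apply: (measurableT_comp mf); apply: measurable_funD.
Qed.

Lemma Rintegral_le_bound (f : T -> R) (M : R) : measurable_fun setT f ->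
  (forall w, `|f w| <= M) -> `|\int[P]_w f w| <= M.
Proof.
move=> mf fM; have fi := @bounded_integrable _ _ _ P _ _ mf fM.
apply: le_trans (le_normr_Rintegral measurableT fi) _.
have ci : P.-integrable setT (EFin \o (fun _ : T => M * 1)).
  exact: finite_measure_integrable_cst.
apply: le_trans (_ : _ <= \int[P]_w (M * 1)) _.
  apply: le_Rintegral => //; first exact: (integrable_norm fi).
  by move=> w _; rewrite mulr1.
rewrite RintegralZl//; last exact: finite_measure_integrable_cst.
by rewrite Rintegral_probability1 mulr1.
Qed.

Lemma conv_fubini Y Z f x : measurable_fun setT Y -> measurable_fun setT Z -> bdmeas f ->
  [/\ measurable_fun setT (fun w => \int[P]_w' f (x + Z w + Y w')) &
   \int[P]_w \int[P]_w' f (x + Z w + Y w') = \int[P]_w' \int[P]_w f (x + Z w + Y w')].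
Proof.
move=> mY mZ bf; have [mf [M fM]] := bf.
have [|||||i1 _ e] := @Rfubini _ _ _ _ _ P P setT setT (fun w w' => f (x + Z w + Y w')) (fun=> M) measurableT measurableT.
- apply: (measurable_funS measurableT) => //; apply: (measurableT_comp mf).
  apply: measurable_funD; first apply: measurable_funD => //.
    exact: (measurableT_comp mZ measurable_fst).
  exact: (measurableT_comp mY measurable_snd).
- by move=> w _; exact: conv_integrable.
- move=> w _; apply: (eq_integrable_fun _ _ (conv_integrable (x + Y w) mZ bf)) => // w' _.
  by rewrite addrAC.
- move=> w _; rewrite -[leLHS]ger0_norm ?Rintegral_ge0//; apply: Rintegral_le_bound.
    apply: mfun_norm; apply: (measurableT_comp mf); apply: measurable_funD => //.
    by apply: measurable_funD.
  by move=> w'; rewrite normr_id.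
- exact: finite_measure_integrable_cst.
by split => //; exact: integrable_mfun i1.
Qed.

Lemma conv_bdmeas Y f : measurable_fun setT Y -> bdmeas f -> bdmeas (conv Y f).
Proof.
move=> mY bf; have [mf [M fM]] := bf; split; last first.
  exists M => x; apply: Rintegral_le_bound => //.
  by apply: (measurableT_comp mf); apply: measurable_funD.
(* Only measurability in [x] is wanted from Fubini, so the second measure may be any finite one; the
   Dirac mass at 0 is used. *)
have [|||||_ i1 _] := @Rfubini _ _ _ _ _ P (@dirac _ R (0 : R) R) setT setT (fun w x => f (x + Y w)) (fun=> M) measurableT measurableT.
- apply: (measurable_funS measurableT) => //; apply: (measurableT_comp mf).
  apply: measurable_funD; first exact: measurable_snd.
  exact: (measurableT_comp mY measurable_fst).
- move=> w _; apply: (@le_Rintegrable _ _ _ _ _ _ (fun=> M)) => //.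
  - by apply: (measurableT_comp mf); apply: measurable_funD.
  - exact: finite_measure_integrable_cst.
- by move=> x _; exact: conv_integrable.
- move=> x _; rewrite -[leLHS]ger0_norm ?Rintegral_ge0//; apply: Rintegral_le_bound.
    by apply: mfun_norm; apply: (measurableT_comp mf); apply: measurable_funD.
  by move=> w'; rewrite normr_id.
- exact: finite_measure_integrable_cst.
exact: integrable_mfun i1.
Qed.

Lemma convC Y Z f x : measurable_fun setT Y -> measurable_fun setT Z -> bdmeas f ->
  conv Z (conv Y f) x = conv Y (conv Z f) x.
Proof.
move=> mY mZ bf; have [_ e] := conv_fubini x mY mZ bf; rewrite /conv e.
by apply: eq_Rint => w _; apply: eq_Rint => w' _; rewrite addrAC.
Qed.

Lemma bdmeasB f g : bdmeas f -> bdmeas g -> bdmeas (fun x => f x - g x).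
Proof.
move=> [mf [M fM]] [mg [N gN]]; split; first exact: measurable_funB.
exists (M + N) => x; apply: le_trans (ler_normB _ _) _; exact: lerD.
Qed.

Lemma bdmeasZ c f : bdmeas f -> bdmeas (fun x => c * f x).
Proof.
move=> [mf [M fM]]; split; first exact: measurable_funM.
by exists (`|c| * M) => x; rewrite normrM ler_wpM2l.
Qed.

Lemma bdmeas_sum n (F : nat -> R -> R) : (forall i, bdmeas (F i)) ->
  bdmeas (fun x => \sum_(i < n) F i x).
Proof.
move=> h; elim: n => [|n [m1 [M hM]]].
  under eq_fun do rewrite big_ord0; split => //.
  by exists 0 => x; rewrite normr0.
under eq_fun do rewrite big_ord_recr/=.
have [m2 [N hN]] := h n; split; first exact: measurable_funD.
by exists (M + N) => x; apply: le_trans (ler_normD _ _) _; exact: lerD.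
Qed.

Lemma convB Y f g x : measurable_fun setT Y -> bdmeas f -> bdmeas g ->
  conv Y (fun x => f x - g x) x = conv Y f x - conv Y g x.
Proof. by move=> mY bf bg; rewrite /conv RintegralB//; exact: conv_integrable. Qed.

Lemma convZ Y c f x : measurable_fun setT Y -> bdmeas f ->
  conv Y (fun x => c * f x) x = c * conv Y f x.
Proof. by move=> mY bf; rewrite /conv RintegralZl//; exact: conv_integrable. Qed.

Lemma conv_sum Y n (F : nat -> R -> R) x : measurable_fun setT Y -> (forall i, bdmeas (F i)) ->
  conv Y (fun x => \sum_(i < n) F i x) x = \sum_(i < n) conv Y (F i) x.
Proof.
move=> mY h; elim: n => [|n IH].
  rewrite big_ord0 /conv; under eq_Rintegral do rewrite big_ord0.
  by have := @Rintegral_cst _ _ _ P setT measurableT 0; rewrite mul0r.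
rewrite big_ord_recr/= -IH; have := convB x mY (bdmeas_sum n h) (bdmeasZ (-1) (h n)).
rewrite convZ// mulN1r opprK => <-; congr (conv _ _ _); apply/funext => y.
by rewrite big_ord_recr/= mulN1r opprK.
Qed.

Lemma conv_cst Y M x : conv Y (fun=> M) x = M.
Proof.
rewrite /conv -[LHS](@eq_Rint _ _ _ P setT (fun=> M * 1)) => [|w _]; last by rewrite mulr1.
by rewrite RintegralZl ?Rintegral_probability1 ?mulr1//; exact: finite_measure_integrable_cst.
Qed.

Lemma eq_law_Rintegral Y Z f : measurable_fun setT Y -> measurable_fun setT Z ->
  (forall A : set R, measurable A -> P (Y @^-1` A) = P (Z @^-1` A)) ->
  measurable_fun setT f -> (forall x, 0 <= f x) ->
  \int[P]_w f (Y w) = \int[P]_w f (Z w).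
Proof.
move=> mY mZ h mf f0; congr fine.
have mfE : measurable_fun setT (EFin \o f) by exact/measurable_EFinP.
have f0' (x : R) : x \in setT -> (0 <= (EFin \o f) x)%E by rewrite /= lee_fin.
have := @ge0_integral_pushforward _ _ _ _ _ _ mY P setT _ measurableT mfE f0'.
have := @ge0_integral_pushforward _ _ _ _ _ _ mZ P setT _ measurableT mfE f0'.
rewrite !preimage_setT => <- <-; apply: eq_measure_integral => A mA _; exact: h.
Qed.

Lemma eq_law_conv Y Z f x : measurable_fun setT Y -> measurable_fun setT Z ->
  (forall A : set R, measurable A -> P (Y @^-1` A) = P (Z @^-1` A)) ->
  bdmeas f -> conv Y f x = conv Z f x.
Proof.
move=> mY mZ h bf; have [mf [M fM]] := bf.
have bc : bdmeas (fun=> - M) by split => //; exists `|- M|.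
have bg := bdmeasB bf bc.
(* Adding the bound [M] makes the function nonnegative, as the change of variables requires. *)
have -> : f = (fun y => (f y - - M) - M) by apply/funext => y; rewrite opprK addrK.
have bM : bdmeas (fun=> M) by split => //; exists `|M|.
rewrite !(convB _ _ bg bM)// !conv_cst; congr (_ - _).
apply: (@eq_law_Rintegral Y Z (fun y => f (x + y) - - M)) => //.
  by case: bg => mg _; apply: (measurableT_comp mg); exact: measurable_funD.
by move=> y; have := fM (x + y); rewrite ler_norml opprK => /andP[a b]; lra.
Qed.

Lemma conv_joint Y Z f x : measurable_fun setT Y -> measurable_fun setT Z ->
  independent2 P Y Z -> bdmeas f ->
  conv (fun w => Y w + Z w) f x = conv Y (conv Z f) x.
Proof.
move=> mY mZ h bf; have [mf [M fM]] := bf.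
have bc : bdmeas (fun=> M) by split => //; exists `|M|.
have bg : bdmeas (fun x => f x - - M).
  by apply: bdmeasB => //; split => //; exists `|-M|.
have g0 y : 0 <= f y - - M <= M + M.
  by have := fM y; rewrite ler_norml opprK => /andP[a b]; apply/andP; split; lra.
have mYZ : measurable_fun setT (fun w => Y w + Z w) by exact: measurable_funD.
have -> : f = (fun y => (f y - - M) - M) by apply/funext => y; rewrite opprK addrK.
rewrite convB// conv_cst//.
have -> : conv Z (fun y => (f y - - M) - M) = (fun y => conv Z (fun y => f y - - M) y - M).
  by apply/funext => y; rewrite convB// conv_cst.
rewrite (convB _ mY (conv_bdmeas mZ bg) bc) conv_cst//; congr (_ - _).
have mg : measurable_fun setT (fun p : R * R => f (x + (p.1 + p.2)) - - M).
  case: bg => mg _; apply: (measurableT_comp mg); apply: measurable_funD => //.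
  by apply: measurable_funD; [exact: measurable_fst|exact: measurable_snd].
rewrite /conv (@expectation_joint _ _ _ P Y Z (fun p => f (x + (p.1 + p.2)) - - M) (M + M) mY mZ h mg (fun p => g0 _)).
by apply: eq_Rint => w _; apply: eq_Rint => w' _ /=; rewrite addrA.
Qed.

Section wiener_hopf.
Variable S : nat -> T -> R.
Hypothesis mS : forall n, measurable_fun setT (S n).
Hypothesis convS : forall n f, bdmeas f -> conv (S n.+2) f = conv (S n.+1) (conv (S 1%N) f).

Let Sp n w := Num.max (S n w) 0.

Let mSp n : measurable_fun setT (Sp n).
Proof. exact: (measurable_maxr (mS n) (measurable_cst _)). Qed.

Variable W : nat -> R -> R.
Hypothesis bW : forall n, bdmeas (W n).
Hypothesis W_rec : forall n x, n.+1%:R * W n.+1 x = \sum_(i < n.+1) conv (Sp i.+1) (W (n - i)%N) x.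

Let V n x := if n is n'.+1 then W n'.+1 x - conv (S 1%N) (W n') x else W 0%N x.

Let bV n : bdmeas (V n).
Proof. by case: n => [|n]; [exact: bW|apply: bdmeasB => //; exact: conv_bdmeas]. Qed.

Let V_rec n x : n.+1%:R * V n.+1 x =
  \sum_(i < n.+1) (conv (Sp i.+1) (V (n - i)%N) x - conv (S i.+1) (V (n - i)%N) x).
Proof.
(* The operators commute, so the recurrence for [W n] can be applied under [conv (S 1)]. *)
have e1 : \sum_(i < n.+1) conv (Sp i.+1) (V (n - i)%N) x =
    n.+1%:R * W n.+1 x - n%:R * conv (S 1%N) (W n) x.
  rewrite W_rec; case: n => [|n].
    by rewrite mul0r subr0 !big_ord_recr !big_ord0.
  rewrite [in LHS]big_ord_recr/= subnn [in RHS]big_ord_recr/= subnn addrAC; congr (_ + _).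
  rewrite -convZ//.
  have -> : (fun x => n.+1%:R * W n.+1 x) = (fun x => \sum_(i < n.+1) conv (Sp i.+1) (W (n - i)%N) x).
    by apply/funext => y; rewrite W_rec.
  rewrite (@conv_sum _ n.+1 (fun i => conv (Sp i.+1) (W (n - i)%N)) x)//; last first.
    by move=> i; exact: conv_bdmeas.
  rewrite -sumrB; apply: eq_bigr => i _.
  have -> : (n.+1 - i)%N = (n - i).+1 by rewrite subSn// -ltnS.
  rewrite (convC x (mSp i.+1) (mS 1%N) (bW (n - i)%N)).
  exact: (convB x (mSp i.+1) (bW _) (conv_bdmeas (mS 1%N) (bW _))).
(* Telescoping: [convS] turns [conv (S i.+1)] after [conv (S 1)] into [conv (S i.+2)], so that all
   terms but the first cancel. *)
have e2 : \sum_(i < n.+1) conv (S i.+1) (V (n - i)%N) x = conv (S 1%N) (W n) x.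
  rewrite [LHS](_ : _ = \sum_(i < n.+1) conv (S i.+1) (W (n - i)%N) x - \sum_(i < n) conv (S i.+2) (W (n - i.+1)%N) x).
    by rewrite big_ord_recl/= subn0 addrK.
  rewrite big_ord_recr [in RHS]big_ord_recr/= subnn addrAC; congr (_ + _).
  rewrite -sumrB; apply: eq_bigr => i _.
  have -> : (n - i)%N = (n - i.+1).+1 by rewrite subnSK.
  rewrite convB//; last exact: conv_bdmeas.
  by rewrite convS.
by rewrite sumrB e1 e2 /V mulrBr -natr1; ring.
Qed.

Hypothesis W0 : forall x : R, x <= 0 -> W 0%N x = W 0%N 0.

(* [V n] is the defect [W n - T W (n - 1)].  It inherits from [W] the recurrence
   [n V n = sum_k (p_k - T_k) V (n - k)], and [p_k - T_k] annihilates on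
   [(-oo, 0]] the functions that are constant there. *)
Lemma wiener_hopf n (x : R) : x <= 0 -> W n.+1 x = conv (S 1%N) (W n) x.
Proof.
suff V0 : forall x : R, x <= 0 -> V n.+1 x = 0 by move=> /V0/eqP; rewrite subr_eq0 => /eqP.
elim/ltn_ind: n => n IH {}x x0.
suff : n.+1%:R * V n.+1 x = 0 by move/eqP; rewrite mulf_eq0 pnatr_eq0/= => /eqP.
rewrite V_rec big1// => i _.
have Vc (y z : R) : y <= 0 -> z <= 0 -> V (n - i)%N y = V (n - i)%N z.
  case E : (n - i)%N => [|k] y0 z0; first by rewrite /V W0// (W0 z0).
  by rewrite !IH//; have := leq_subr i n; rewrite E.
apply/eqP; rewrite subr_eq0; apply/eqP; apply: eq_Rint => w _.
rewrite /Sp; case: leP => // s0; apply: Vc; lra.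
Qed.

End wiener_hopf.

End convolution.

Section positive_part.
Context (R : realType).

Lemma measurable_max0 d (T : measurableType d) (f : T -> R) : measurable_fun setT f ->
  measurable_fun setT (fun x => Num.max (f x) 0).
Proof. by move=> mf; exact: (measurable_maxr mf (measurable_cst _)). Qed.

Lemma bdmeas_exp_max0 : bdmeas (fun x : R => expR (- Num.max x 0)).
Proof.
split; first by apply: mfun_expR; apply: measurable_funN; exact: measurable_max0.
by exists 1 => y; rewrite ger0_norm ?expR_ge0// expR_le1 oppr_le0 le_max lexx orbT.
Qed.

Lemma bdmeas_max0 (f : R -> R) : bdmeas f -> bdmeas (fun x : R => f (Num.max x 0)).
Proof.
case=> mf [M fM]; split; last by exists M => x.
by apply: (measurableT_comp mf); exact: measurable_max0.
Qed.

End positive_part.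

(** * Spitzer operators *)

Section spitzer_operators.
Context d (T : measurableType d) (R : realType) (P : probability T R).
Variable S : nat -> T -> R.
Hypothesis mS : forall n, measurable_fun setT (S n).
Hypothesis convS : forall n f, bdmeas f -> conv P (S n.+2) f = conv P (S n.+1) (conv P (S 1%N) f).

Let Sp n w := Num.max (S n w) 0.

Let mSp n : measurable_fun setT (Sp n).
Proof. exact: (measurable_maxr (mS n) (measurable_cst _)). Qed.

(* [spitzer_aux N n] does not depend on [N >= n]. *)
Fixpoint spitzer_aux (N : nat) (n : nat) (f : R -> R) (x : R) {struct N} : R :=
  if N is N'.+1 then
    if (n <= N')%N then spitzer_aux N' n f x
    else n%:R^-1 * \sum_(i < n) conv P (Sp i.+1) (spitzer_aux N' (n - i.+1)%N f) x
  else f x.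

(** The coefficient of s^n in exp (sum_k s^k p_k / k), where p_k is the convolution with the
    positive part of [S k]. Newton's recurrence defines it without power series of operators. *)
Definition spitzer n := spitzer_aux n n.

Let spitzer_auxE N n f x : (n <= N)%N -> spitzer_aux N n f x = spitzer n f x.
Proof.
elim: N => [|N IH]; first by rewrite leqn0 => /eqP ->.
rewrite leq_eqVlt => /predU1P[-> //|]; rewrite ltnS => nN.
by rewrite /= nN IH.
Qed.

Lemma spitzer_rec n f x :
  n.+1%:R * spitzer n.+1 f x = \sum_(i < n.+1) conv P (Sp i.+1) (spitzer (n - i)%N f) x.
Proof.
rewrite /spitzer /= ltnn mulVKf ?pnatr_eq0//.
apply: eq_bigr => i _; congr (conv _ _ _ _); apply/funext => y.
by rewrite subSS spitzer_auxE// leq_subr.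
Qed.

Lemma spitzer_ind (Q : nat -> Prop) : Q 0%N ->
  (forall n, (forall i, (i <= n)%N -> Q i) -> Q n.+1) -> forall n, Q n.
Proof.
by move=> h0 hS; elim/ltn_ind => -[//|n] IH; apply: hS => i ni; apply: IH; rewrite ltnS.
Qed.

Let spitzerE n f : spitzer n.+1 f = (fun x => n.+1%:R^-1 * \sum_(i < n.+1) conv P (Sp i.+1) (spitzer (n - i)%N f) x).
Proof. by apply/funext => x; rewrite -spitzer_rec mulKf ?pnatr_eq0. Qed.

Lemma spitzer_bdmeas n f : bdmeas f -> bdmeas (spitzer n f).
Proof.
move=> bf; elim/spitzer_ind: n => // n IH; rewrite spitzerE; apply: bdmeasZ.
apply: (@bdmeas_sum _ _ (fun i => conv P (Sp i.+1) (spitzer (n - i)%N f))) => i.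
by apply: conv_bdmeas => //; apply: IH; exact: leq_subr.
Qed.

Lemma spitzer_conv n f Y : measurable_fun setT Y -> bdmeas f ->
  spitzer n (conv P Y f) = conv P Y (spitzer n f).
Proof.
move=> mY bf; elim/spitzer_ind: n => // n IH; rewrite !spitzerE.
apply/funext => x; rewrite convZ//; last first.
  apply: (@bdmeas_sum _ _ (fun i => conv P (Sp i.+1) (spitzer (n - i)%N f))) => i.
  by apply: conv_bdmeas => //; exact: spitzer_bdmeas.
rewrite (@conv_sum _ _ _ P Y n.+1 (fun i => conv P (Sp i.+1) (spitzer (n - i)%N f)) x)//; last first.
  by move=> i; apply: conv_bdmeas => //; exact: spitzer_bdmeas.
congr (_ * _); apply: eq_bigr => i _; rewrite (IH (n - i)%N (leq_subr _ _)).
exact: (convC P x mY (mSp i.+1) (spitzer_bdmeas _ bf)).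
Qed.

Lemma eq_spitzer_ge0 n f g : (forall x, 0 <= x -> f x = g x) ->
  forall x, 0 <= x -> spitzer n f x = spitzer n g x.
Proof.
move=> fg; elim/spitzer_ind: n => // n IH x x0; rewrite !spitzerE; congr (_ * _).
apply: eq_bigr => i _; apply: eq_Rint => w _; apply: IH; rewrite ?leq_subr//.
by rewrite addr_ge0// le_max lexx orbT.
Qed.

(** From the point 0 only nonnegative arguments of [f] matter, so [f] may be made constant on the
    negative half-line; [wiener_hopf] then trades one index for one free step. This mirrors M_(n+1)
    = max (Y + M_n, 0). *)
Lemma spitzer_max n f : bdmeas f ->
  spitzer n.+1 f 0 = conv P (S 1%N) (spitzer n (fun x => f (Num.max x 0))) 0.
Proof.
move=> bf; have bfp : bdmeas (fun x => f (Num.max x 0)). exact: bdmeas_max0.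
rewrite (@eq_spitzer_ge0 n.+1 f (fun x => f (Num.max x 0))) => [|x x0|//]; last by rewrite max_l.
apply: (wiener_hopf mS convS (fun n => spitzer_bdmeas n bfp)) => //.
  by move=> m x; rewrite spitzer_rec.
by move=> x x0; rewrite /spitzer /= max_r// maxxx.
Qed.

(** On the nonnegative half-line, convolution with a nonnegative variable multiplies exp (- x) by a
    scalar, so the operator recurrence becomes one between numbers. *)
Lemma spitzer_exp n (x : R) : 0 <= x ->
  spitzer n (fun x : R => expR (- Num.max x 0)) x = expR (- x) * spitzer n (fun x : R => expR (- Num.max x 0)) 0.
Proof.
elim/spitzer_ind: n x => [|n IH] x x0; first by rewrite /spitzer/= max_l// maxxx oppr0 expR0 mulr1.
rewrite !spitzerE mulrCA; congr (_ * _); rewrite mulr_sumr; apply: eq_bigr => i _.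
have bf := bdmeas_exp_max0 R.
rewrite -convZ//; last exact: spitzer_bdmeas.
apply: eq_Rint => w _; have s0 : 0 <= Sp i.+1 w by rewrite le_max lexx orbT.
have h := IH (n - i)%N (leq_subr _ _).
by rewrite add0r (h _ s0) (h _ (addr_ge0 x0 s0)) opprD expRD mulrA.
Qed.

Lemma spitzer_exp_rec n :
  n.+1%:R * spitzer n.+1 (fun x : R => expR (- Num.max x 0)) 0 =
  \sum_(i < n.+1) \int[P]_w expR (- Num.max (S i.+1 w) 0) *
    spitzer (n - i)%N (fun x : R => expR (- Num.max x 0)) 0.
Proof.
rewrite spitzer_rec; apply: eq_bigr => i _.
have s0 w : 0 <= Sp i.+1 w by rewrite le_max lexx orbT.
rewrite /conv -[RHS]mulrC -RintegralZl//; last first.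
  apply: (@bounded_integrable _ _ _ _ _ 1) => [|w].
    by apply: mfun_expR; apply: measurable_funN; exact: mSp.
  by rewrite ger0_norm ?expR_ge0// expR_le1 oppr_le0; exact: s0.
by apply: eq_Rint => w _; rewrite add0r spitzer_exp// mulrC.
Qed.

End spitzer_operators.

(** * Maxima of random walks *)

Section random_walk.
Context d (T : measurableType d) (R : realType) (P : probability T R).
Variable Y : nat -> T -> R.
Hypothesis mY : forall n, measurable_fun setT (Y n).
Hypothesis Yind : forall m j (A : nat -> set R), (forall i, measurable (A i)) ->
  P (\big[setI/setT]_(i < j) (Y (m + i)%N @^-1` A i)) = (\prod_(i < j) P (Y (m + i)%N @^-1` A i))%E.

(** The maximum of 0 and the partial sums of [n] steps starting with [Y m], unfolded from the first
    step so that the remaining maximum involves only later steps. *)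
Fixpoint walk_max n m w : R :=
  if n is n'.+1 then Num.max (Y m w + walk_max n' m.+1 w) 0 else 0.

Lemma measurable_walk_max n m : measurable_fun setT (walk_max n m).
Proof.
elim: n m => [|n IH] m; first exact: (@measurable_cst _ _ _ _ setT (0 : R)).
by apply: measurable_max0; apply: measurable_funD.
Qed.

Let mpre (f : T -> R) (A : set R) : measurable_fun setT f -> measurable A -> measurable (f @^-1` A).
Proof. by move=> mf mA; rewrite -[X in measurable X]setTI; exact: mf. Qed.

Let mev m j (A : nat -> set R) : (forall i, measurable (A i)) ->
  measurable (\big[setI/setT]_(i < j) (Y (m + i)%N @^-1` A i)).
Proof. by move=> mA; apply: bigsetI_measurable => i _; exact: mpre. Qed.

(** The induction applies [joint_law] to the next step and the later maximum, with the past as the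
    conditioning event; the case of an empty past evaluates the second factor. *)
Lemma walk_max_indep n m j (A : nat -> set R) (B : set R) : (forall i, measurable (A i)) ->
  measurable B ->
  P (\big[setI/setT]_(i < j) (Y (m + i)%N @^-1` A i) `&` walk_max n (m + j)%N @^-1` B) =
  (P (\big[setI/setT]_(i < j) (Y (m + i)%N @^-1` A i)) * P (walk_max n (m + j)%N @^-1` B))%E.
Proof.
have PT : P setT = 1%E by exact: probability_setT.
elim: n m j A B => [|n IH] m j A B mA mB.
  have [B0|B0] := pselect (B 0).
    have -> : walk_max 0 (m + j) @^-1` B = setT by apply/seteqP; split.
    by rewrite setIT PT mule1.
  have -> : walk_max 0 (m + j) @^-1` B = set0 by apply/seteqP; split.
  by rewrite setI0 measure0 mule0.
pose U := Y (m + j)%N; pose V := walk_max n (m + j).+1.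
have mV : measurable_fun setT V by exact: measurable_walk_max.
have indE k (A' : nat -> set R) (A1 B1 : set R) : (forall i, measurable (A' i)) ->
    measurable A1 -> measurable B1 -> forall m', (m' + k = m + j)%N ->
    P (\big[setI/setT]_(i < k) (Y (m' + i)%N @^-1` A' i) `&` (U @^-1` A1 `&` V @^-1` B1)) =
    (P (\big[setI/setT]_(i < k) (Y (m' + i)%N @^-1` A' i)) * (P (U @^-1` A1) * P (V @^-1` B1)))%E.
  move=> mA' mA1 mB1 m' mk.
  pose A2 i := if (i < k)%N then A' i else A1.
  have mA2 i : measurable (A2 i) by rewrite /A2; case: ifP.
  have := IH m' k.+1 A2 B1 mA2 mB1.
  rewrite Yind// !big_ord_recr/= addnS mk /A2 ltnn.
  have -> : \big[setI/setT]_(i < k) (Y (m' + i)%N @^-1` (if (i < k)%N then A' i else A1)) =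
      \big[setI/setT]_(i < k) (Y (m' + i)%N @^-1` A' i).
    by apply: eq_bigr => i _; rewrite ltn_ord.
  have -> : (\prod_(i < k) P (Y (m' + i)%N @^-1` (if (i < k)%N then A' i else A1)) =
      \prod_(i < k) P (Y (m' + i)%N @^-1` A' i))%E.
    by apply: eq_bigr => i _; rewrite ltn_ord.
  by rewrite -Yind// -/U -/V setIA muleA.
pose U' : {RV P >-> R} := HB.pack U (isMeasurableFun.Build _ _ _ _ _ (mY (m + j))).
pose V' : {RV P >-> R} := HB.pack V (isMeasurableFun.Build _ _ _ _ _ mV).
pose C : set (R * R) := [set p | B (Num.max (p.1 + p.2) 0)].
have mC : measurable C.
  rewrite [C](_ : _ = (fun p : R * R => Num.max (p.1 + p.2) 0) @^-1` B)//.
  rewrite -[X in measurable X]setTI.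
  suff h : measurable_fun setT (fun p : R * R => Num.max (p.1 + p.2) 0) by exact: h.
  apply: measurable_max0.
  by apply: measurable_funD; [exact: measurable_fst|exact: measurable_snd].
have h1 := @joint_law _ _ _ P U' V' _ C (mev m j mA) (fun A1 B1 mA1 mB1 => indE j A A1 B1 mA mA1 mB1 m erefl) mC.
have h2 : P (setT `&` (fun w => (U' w, V' w)) @^-1` C) = (P setT * (distribution P U' \x distribution P V') C)%E.
  apply: joint_law => // A1 B1 mA1 mB1.
  by have := indE 0%N A A1 B1 mA mA1 mB1 (m + j)%N (addn0 _); rewrite !big_ord0.
rewrite setTI PT mul1e in h2.
have -> : walk_max n.+1 (m + j) @^-1` B = (fun w => (U' w, V' w)) @^-1` C by [].
by rewrite h1 h2.
Qed.

Variable S : nat -> T -> R.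
Hypothesis mS : forall n, measurable_fun setT (S n).
Hypothesis convS : forall n f, bdmeas f -> conv P (S n.+2) f = conv P (S n.+1) (conv P (S 1%N) f).
Hypothesis lawS : forall n (A : set R), measurable A -> P (Y n @^-1` A) = P (S 1%N @^-1` A).

(** Integrating out the first step, independent of the later maximum, is one application of
    [conv (S 1)], and [spitzer_max] performs the same step on the operator side. *)
Lemma expectation_walk_max n m (f : R -> R) : bdmeas f -> (forall x, 0 <= f x) ->
  \int[P]_w f (walk_max n m w) = spitzer P S n f 0.
Proof.
elim: n m f => [|n IH] m f bf f0.
  rewrite /spitzer/= -[LHS](@eq_Rint _ _ _ P setT (fun=> f 0 * 1)) => [|w _]; last by rewrite mulr1.
  by rewrite RintegralZl ?Rintegral_probability1 ?mulr1//; exact: finite_measure_integrable_cst.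
pose fp x := f (Num.max x 0).
have bfp : bdmeas fp by exact: bdmeas_max0.
rewrite spitzer_max// -/fp -spitzer_conv//.
rewrite -(IH m.+1); first last.
- by move=> x; apply: Rintegral_ge0 => w _; exact: f0.
- exact: conv_bdmeas.
have ind : independent2 P (walk_max n m.+1) (Y m).
  move=> A B mA mB; have := @walk_max_indep n m 1 (fun=> B) A (fun=> mB) mA.
  by rewrite !big_ord1 addn0 addn1 setIC muleC.
have [mf [M fM]] := bfp.
have mF : measurable_fun setT (fun p : R * R => fp (p.1 + p.2)).
  by apply: (measurableT_comp mf); apply: measurable_funD; [exact: measurable_fst|exact: measurable_snd].
have F0 (p : R * R) : 0 <= fp (p.1 + p.2) <= M.
  by rewrite /fp f0/= (le_trans (ler_norm _) (fM _)).
have := @expectation_joint _ _ _ P _ _ (fun p => fp (p.1 + p.2)) M (measurable_walk_max n m.+1) (mY m) ind mF F0.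
rewrite (@eq_Rint _ _ _ P setT _ (fun w => f (walk_max n.+1 m w))) => [->|w _]; last by rewrite /= addrC.
apply: eq_Rint => w _; rewrite /conv.
apply: (@eq_law_Rintegral _ _ _ P (Y m) (S 1%N) (fun y => fp (walk_max n m.+1 w + y)) (mY m) (mS 1) (@lawS m)).
- by apply: (measurableT_comp mf); apply: measurable_funD.
- by move=> x; exact: f0.
Qed.

Lemma walk_max_ge0 n m w : 0 <= walk_max n m w.
Proof. by case: n => [|n] //=; rewrite le_max lexx orbT. Qed.

Lemma spitzer_recurrence n :
  n.+1%:R * \int[P]_w expR (- walk_max n.+1 0 w) =
  \sum_(i < n.+1) \int[P]_w expR (- Num.max (S i.+1 w) 0) * \int[P]_w expR (- walk_max (n - i) 0 w).
Proof.
have E k : \int[P]_w expR (- walk_max k 0 w) = spitzer P S k (fun x : R => expR (- Num.max x 0)) 0.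
  rewrite -(@expectation_walk_max k 0 _ (bdmeas_exp_max0 R)); last by move=> x; exact: expR_ge0.
  by apply: eq_Rint => w _; rewrite max_l// walk_max_ge0.
by rewrite E spitzer_exp_rec//; apply: eq_bigr => i _; rewrite E.
Qed.

End random_walk.

(** * Generating functions and Laplace transforms in time *)

Section generating_function.
Context {R : realType}.
Notation mu := (@lebesgue_measure R).

Lemma sum_triangle (F : nat -> nat -> R) N :
  \sum_(n < N) \sum_(i < n.+1) F i (n - i)%N = \sum_(i < N) \sum_(j < N - i) F i j.
Proof.
elim: N => [|N IH]; first by rewrite !big_ord0.
rewrite big_ord_recr/= IH [RHS]big_ord_recr/= subSnn big_ord1 [in LHS]big_ord_recr/= subnn addrA.
congr (_ + _); rewrite -big_split/=; apply: eq_bigr => i _.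
by rewrite subSn 1?ltnW// big_ord_recr.
Qed.

Lemma polyexp_cvg0 (r : R) : 0 <= r < 1 -> (N%:R * N.+1%:R * r ^+ N) @[N --> \oo] --> (0 : R).
Proof.
case/andP=> r0 r1; pose d := 1 - r; have d0 : 0 < d by rewrite subr_gt0.
have re : r <= expR (- d) by apply: le_trans (expR_ge1Dx _); rewrite /d; lra.
rewrite -cvg_shiftS /=.
apply: (@squeeze_cvgr _ _ _ _ (fun=> 0) (fun N : nat => 54 / d ^+ 3 * N.+1%:R^-1)).
- apply: nearW => N; apply/andP; split; first by rewrite !mulr_ge0// exprn_ge0.
  have n0 : 0 < N.+1%:R :> R by rewrite ltr0n.
  set n : R := N.+1%:R in n0 *.
  have e1 : r ^+ N.+1 <= expR (- (d * n)).
    by rewrite -mulNr mulrC expRM_natl; apply: lerXn2r; rewrite ?nnegrE ?expR_ge0.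
  (* Any cubic lower bound of the exponential beats the quadratic factor; the cube of 3 and the
     bound n + 1 <= 2 n produce 54. *)
  have e2 : (d * n / 3) ^+ 3 <= expR (d * n).
    have -> : expR (d * n) = expR (d * n / 3) ^+ 3 by rewrite -expRM_natl; congr expR; field.
    apply: lerXn2r; rewrite ?nnegrE ?expR_ge0 ?divr_ge0 ?mulr_ge0 ?(ltW d0) ?(ltW n0)//.
    by apply: le_trans (expR_ge1Dx _); lra.
  have e3 : expR (- (d * n)) <= (d * n / 3) ^- 3.
    rewrite expRN lef_pV2 ?posrE ?expR_gt0//.
    by rewrite exprn_gt0// divr_gt0// mulr_gt0.
  have n1 : N.+2%:R <= 2 * n by rewrite /n -natrM ler_nat; lia.
  apply: (@le_trans _ _ (n * (2 * n) * (d * n / 3) ^- 3)).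
    apply: ler_pM => //; rewrite ?mulr_ge0 ?exprn_ge0 ?(ltW n0)//; last exact: le_trans e1 e3.
    by rewrite ler_pM2l.
  rewrite le_eqVlt; apply/orP; left; apply/eqP; field.
  by rewrite !gt_eqF.
- exact: cvg_cst.
- rewrite -[X in _ --> X](mulr0 (54 / d ^+ 3)); apply: cvgM; first exact: cvg_cst.
  exact: cvg_harmonic.
Qed.

Lemma der_sum n (F dF : nat -> R -> R) (x : R) : (forall i, (i < n)%N -> isder x (F i) (dF i x)) ->
  isder x (fun y => \sum_(i < n) F i y) (\sum_(i < n) dF i x).
Proof.
elim: n => [|n IH] h.
  by rewrite /isder big_ord0; under eq_fun do rewrite big_ord0; exact: der_cst.
rewrite /isder big_ord_recr; under eq_fun do rewrite big_ord_recr/=.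
by apply: derD; [apply: IH => i /ltnW/h|exact: h].
Qed.

Section recurrence.
Variables (a g : nat -> R).
Hypothesis a01 : forall n, 0 <= a n <= 1.
Hypothesis g01 : forall n, 0 <= g n <= 1.
Hypothesis a0 : a 0%N = 1.
Hypothesis a_rec : forall n, n.+1%:R * a n.+1 = \sum_(i < n.+1) g i * a (n - i)%N.

Let A N (r : R) := \sum_(n < N.+1) a n * r ^+ n.
Let L N (r : R) := \sum_(k < N) g k / k.+1%:R * r ^+ k.+1.
Let D N (r : R) := A N r * expR (- L N r).
Let A' N (r : R) := \sum_(n < N) n.+1%:R * a n.+1 * r ^+ n.
Let L' N (r : R) := \sum_(k < N) g k * r ^+ k.

Let A'E N (r : R) : A' N r = \sum_(i < N) \sum_(j < N - i) g i * a j * r ^+ (i + j).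
Proof.
rewrite -(sum_triangle (fun i j => g i * a j * r ^+ (i + j))); apply: eq_bigr => n _.
rewrite a_rec mulr_suml; apply: eq_bigr => i _; rewrite subnKC//.
by rewrite -ltnS.
Qed.

(** The recurrence matches all products of total degree below [N]. At most N (N + 1) products are
    left, each at most r^N because the coefficients lie in the unit interval. *)
Let B N (r : R) : 0 <= r <= 1 -> 0 <= A N r * L' N r - A' N r <= N%:R * N.+1%:R * r ^+ N.
Proof.
case/andP=> r0 r1.
have -> : A N r * L' N r = \sum_(i < N) \sum_(j < N.+1) g i * a j * r ^+ (i + j).
  rewrite mulrC mulr_suml; apply: eq_bigr => i _; rewrite mulr_sumr; apply: eq_bigr => j _.
  by rewrite exprD; ring.
rewrite A'E -sumrB.
have key (i : 'I_N) : 0 <= \sum_(j < N.+1) g i * a j * r ^+ (i + j) -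
    \sum_(j < N - i) g i * a j * r ^+ (i + j) <= N.+1%:R * r ^+ N.
  rewrite -!(big_mkord xpredT (fun j => g i * a j * r ^+ (i + j))).
  have le1 : (N - i <= N.+1)%N by rewrite (leq_trans (leq_subr _ _)).
  rewrite (big_cat_nat (n := N - i))//= addrAC subrr add0r.
  apply/andP; split.
    apply: sumr_ge0 => j _; rewrite !mulr_ge0 ?exprn_ge0//.
      by case/andP: (g01 i).
    by case/andP: (a01 j).
  rewrite big_nat; apply: (@le_trans _ _ (\sum_(N - i <= j < N.+1 | (N - i <= j < N.+1)%N) r ^+ N)).
    apply: ler_sum => j /andP[j1 _]; case/andP: (g01 i) => g0 g1; case/andP: (a01 j) => b0 b1.
    apply: (@le_trans _ _ (r ^+ (i + j))).
      by rewrite ler_piMl ?exprn_ge0// mulr_ile1.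
    by apply: ler_wiXn2l => //; rewrite -leq_subLR.
  rewrite -big_nat big_const_nat iter_addr addr0 -[leLHS]mulr_natl.
  apply: ler_wpM2r; first exact: exprn_ge0.
  by rewrite ler_nat leq_subr.
apply/andP; split; first by apply: sumr_ge0 => i _; case/andP: (key i).
apply: (@le_trans _ _ (\sum_(i < N) N.+1%:R * r ^+ N)); first by apply: ler_sum => i _; case/andP: (key i).
by rewrite sumr_const card_ord -[leLHS]mulr_natl mulrA.
Qed.

Let dD N (r : R) : isder r (D N) ((A' N r - A N r * L' N r) * expR (- L N r)).
Proof.
have dA : isder r (A N) (A' N r).
  rewrite /isder /A; under eq_fun do rewrite big_ord_recl expr0 mulr1/=.
  have h : isder r (fun y => \sum_(i < N) a i.+1 * y ^+ i.+1) (A' N r).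
    by apply: (@der_sum N (fun i y => a i.+1 * y ^+ i.+1) (fun i y => i.+1%:R * a i.+1 * y ^+ i)) => i _; der; ring.
  by apply: (der_eq (derD (der_cst (a 0%N) r) h)); rewrite add0r.
have dL : isder r (L N) (L' N r).
  apply: (@der_sum N (fun k y => g k / k.+1%:R * y ^+ k.+1) (fun k y => g k * y ^+ k)) => k _.
  by der; field.
apply: (der_eq (derM dA (der_exp (derN dL)))) => /=; ring.
Qed.

(* [D N] has derivative [O(N^2 r^N)]: the recurrence cancels the coefficients
   of [A' - A L'] below degree [N]. *)
Lemma gen_cvg1 (r : R) : 0 <= r < 1 -> D N r @[N --> \oo] --> (1 : R).
Proof.
case/andP=> r0 r1.
have D0 N : D N 0 = 1.
  rewrite /D /A /L big_ord_recl expr0 a0 mulr1 !big1 ?oppr0 ?expR0 ?addr0 ?mulr1// => i _.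
    by rewrite exprS mul0r mulr0.
  by rewrite exprS mul0r mulr0.
have bd N : `|D N r - 1| <= N%:R * N.+1%:R * r ^+ N.
  have [->|rn0] := eqVneq r 0; first by rewrite D0 subrr normr0 mulr_ge0// exprn_ge0.
  have rp : 0 < r by rewrite lt_neqAle eq_sym rn0.
  have cD : {within `[0, r], continuous (D N)}.
    by apply: continuous_subspaceT => x; exact: der_cont (dD N x).
  have [|c cI] := @MVT R (D N) (fun r => (A' N r - A N r * L' N r) * expR (- L N r)) 0 r rp _ cD.
    by move=> x _; exact: dD.
  rewrite D0 => ->; rewrite subr0.
  move: cI; rewrite in_itv/= => /andP[c0 c1].
  have cI : 0 <= c <= 1 by apply/andP; split; lra.
  have := B N cI => /andP[b0 b1].
  have l0 : 0 <= L N c.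
    apply: sumr_ge0 => k _; rewrite mulr_ge0 ?exprn_ge0 ?(ltW c0)// divr_ge0//.
    by case/andP: (g01 k).
  rewrite !normrM (gtr0_norm rp) (ger0_norm (expR_ge0 _)).
  have e1 : expR (- L N c) <= 1 by rewrite expR_le1 oppr_le0.
  rewrite distrC (ger0_norm b0).
  have bc : A N c * L' N c - A' N c <= N%:R * N.+1%:R * r ^+ N.
    apply: (le_trans b1); apply: ler_wpM2l; first by rewrite mulr_ge0.
    by apply: lerXn2r; rewrite ?nnegrE ?(ltW c0)// ltW.
  apply: le_trans (_ : _ <= A N c * L' N c - A' N c) bc.
  by rewrite -mulrA ler_piMr// mulr_ile1 ?expR_ge0// ltW.
apply/cvgrPdist_le => e e0; have r01 : 0 <= r < 1 by rewrite r0.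
have /cvgrPdist_le/(_ _ e0) := polyexp_cvg0 r01.
apply: filterS => N; rewrite sub0r normrN => h; rewrite distrC.
by apply: (le_trans (bd N)); apply: le_trans (ler_norm _) h.
Qed.

End recurrence.

(** The constant sequences 1 satisfy the recurrence, so [gen_cvg1] compares the geometric sum with
    the exponential of the logarithmic series. *)
Lemma log_series (r : R) : 0 <= r < 1 ->
  \sum_(k < N) k.+1%:R^-1 * r ^+ k.+1 @[N --> \oo] --> - ln (1 - r).
Proof.
move=> r01; have /andP[r0 r1] := r01.
have c01 (n : nat) : 0 <= (1 : R) <= 1 by rewrite ler01 lexx.
have c_rec n : n.+1%:R * 1 = \sum_(i < n.+1) 1 * 1 :> R.
  by rewrite mulr1 (eq_bigr (fun=> 1)) ?sumr_const ?card_ord// => i _; rewrite mulr1.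
have := @gen_cvg1 (fun=> 1) (fun=> 1) c01 c01 erefl c_rec r r01.
have rn : r ^+ N.+1 @[N --> \oo] --> (0 : R).
  by have := @cvg_expr _ r; rewrite ger0_norm// => /(_ r1); rewrite -cvg_shiftS.
have geo : \sum_(n < N.+1) 1 * r ^+ n @[N --> \oo] --> (1 - r)^-1.
  have d0 : 1 - r != 0 by rewrite gt_eqF// subr_gt0.
  have -> : (fun N => \sum_(n < N.+1) 1 * r ^+ n) = (fun N => (1 - r ^+ N.+1) / (1 - r)).
    apply/funext => N; apply: (mulIf d0); rewrite divfK//.
    rewrite -[X in _ = X - _](expr1n _ N.+1) subrXX mulrC; congr (_ * _); apply: eq_bigr => i _.
    by rewrite expr1n.
  rewrite [X in _ --> X](_ : _ = (1 - 0) / (1 - r)); last by rewrite subr0 mul1r.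
  by apply: cvgM; [apply: cvgB => //; exact: cvg_cst|exact: cvg_cst].
move=> h; have d0 : 0 < (1 - r)^-1 by rewrite invr_gt0 subr_gt0.
have h2 : (\sum_(n < N.+1) 1 * r ^+ n)^-1 * ((\sum_(n < N.+1) 1 * r ^+ n) *
    expR (- \sum_(k < N) 1 / k.+1%:R * r ^+ k.+1)) @[N --> \oo] --> 1 - r.
  rewrite [X in _ --> X](_ : _ = ((1 - r)^-1)^-1 * 1); last by rewrite invrK mulr1.
  by apply: cvgM h; apply: cvgV geo; rewrite gt_eqF.
have cl : {for 1 - r, continuous (@ln R)}.
  by apply: (@der_cont _ _ _ (1 - r)^-1); apply: is_derive1_ln; rewrite subr_gt0.
have h3 : - ln ((\sum_(n < N.+1) 1 * r ^+ n)^-1 * ((\sum_(n < N.+1) 1 * r ^+ n) *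
    expR (- \sum_(k < N) 1 / k.+1%:R * r ^+ k.+1))) @[N --> \oo] --> - ln (1 - r).
  by apply: cvgN; exact: (continuous_cvg _ cl h2).
apply: cvg_trans h3; apply: near_eq_cvg; apply: nearW => N /=.
have s0 : 0 < \sum_(n < N.+1) 1 * r ^+ n.
  rewrite big_ord_recl expr0 mulr1 ltr_pwDl// sumr_ge0// => i _.
  by rewrite mul1r exprn_ge0.
rewrite mulKf ?gt_eqF// expRK opprK; apply: eq_bigr => i _.
by rewrite mul1r.
Qed.

Section kernel.
Variables (a g : nat -> R) (w x : R -> R).
Hypothesis a01 : forall n, 0 <= a n <= 1.
Hypothesis g01 : forall n, 0 <= g n <= 1.
Hypothesis a0 : a 0%N = 1.
Hypothesis a_rec : forall n, n.+1%:R * a n.+1 = \sum_(i < n.+1) g i * a (n - i)%N.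
Let I : set R := `]0, +oo[%classic.
Hypothesis wi : mu.-integrable I (EFin \o w).
Hypothesis w0 : forall v : R, 0 < v -> 0 <= w v.
Hypothesis mx : measurable_fun I x.
Hypothesis x0 : forall v : R, 0 < v -> 0 <= x v.
Hypothesis gE : forall k, g k = 1 - \int[mu]_(v in I) ((1 - expR (- (k.+1%:R * x v))) * w v).

Let S v : I v -> 0 < v. Proof. by rewrite /I /= in_itv/= andbT. Qed.
Let mI : measurable I. Proof. exact: measurable_itv. Qed.

(** Inserting [gE], the series of g k r^(k+1) / (k+1) is summed under the integral: r^k (1 - exp (-
    k x)) / k adds up to ln ((1 - r exp (- x)) / (1 - r)), and the constant 1 in [gE] produces the
    factor 1 - r. *)
Lemma generating_function (r : R) : 0 <= r < 1 ->
  (1 - r) * (\sum_(n < N.+1) a n * r ^+ n) @[N --> \oo] -->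
  expR (- \int[mu]_(v in I) (w v * ln ((1 - r * expR (- x v)) / (1 - r)))).
Proof.
move=> r01; have /andP[r0 r1] := r01.
have h := gen_cvg1 a01 g01 a0 a_rec r01.
pose ls N (y : R) := \sum_(k < N) k.+1%:R^-1 * y ^+ k.+1.
pose F N v := w v * (ls N r - ls N (r * expR (- x v))).
have e01 v : 0 < v -> 0 <= r * expR (- x v) <= r.
  move=> v0; rewrite mulr_ge0 ?expR_ge0//=; rewrite ler_piMr// expR_le1 oppr_le0; exact: x0.
have lsc (y : R) : 0 <= y <= r -> ls N y @[N --> \oo] --> - ln (1 - y).
  by case/andP=> y0 yr; apply: log_series; rewrite y0 (le_lt_trans yr).
have ls_ge0 N (y : R) : 0 <= y -> 0 <= ls N y.
  by move=> y0; apply: sumr_ge0 => k _; rewrite mulr_ge0 ?exprn_ge0.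
have ls_le N (y z : R) : 0 <= y -> y <= z -> ls N y <= ls N z.
  move=> y0 yz; apply: ler_sum => k _; rewrite ler_pM2l// lerXn2r// nnegrE//; exact: le_trans yz.
have rr : 0 <= r <= r by rewrite r0 lexx.
have ls_bd N : ls N r <= - ln (1 - r).
  rewrite -(cvg_lim (@Rhausdorff _) (lsc r rr)); apply: nondecreasing_cvgn_le.
    apply/nondecreasing_seqP => n; rewrite /ls big_ord_recr/= lerDl.
    by rewrite mulr_ge0 ?exprn_ge0.
  by apply/cvg_ex; exists (- ln (1 - r)); exact: lsc.
have mF N : measurable_fun I (F N).
  apply: measurable_funM; first exact: integrable_mfun wi.
  apply: measurable_funB => //; apply: (measurable_sum (I := 'I_N)) => k.
  by meas.
have FE N v : I v -> `|F N v| <= - ln (1 - r) * w v.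
  move=> /S v0; have /andP[e0 e1] := e01 v v0.
  have h1 := ls_ge0 N _ e0; have h2 := ls_le N _ _ e0 e1; have h3 := ls_bd N.
  rewrite normrM (ger0_norm (w0 v0)) mulrC ler_wpM2r ?w0// ger0_norm; lra.
have Fc v : I v -> F ^~ v @ \oo --> w v * ln ((1 - r * expR (- x v)) / (1 - r)).
  move=> /S v0; have /andP[e0 e1] := e01 v v0.
  rewrite ln_div ?posrE; try lra.
  apply: cvgM; first exact: cvg_cst.
  have -> : ln (1 - r * expR (- x v)) - ln (1 - r) = - ln (1 - r) - - ln (1 - r * expR (- x v)) by ring.
  by apply: cvgB; apply: lsc => //; apply/andP.
have [_ hF] := @Ldominated_cvg _ (fun v => - ln (1 - r) * w v) I F _ mI mF Fc (LintZ (- ln (1 - r)) mI wi) FE.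
have ki k : mu.-integrable I (EFin \o (fun v => (1 - expR (- (k.+1%:R * x v))) * w v)).
  apply: (@le_Lint _ w) => //.
    by apply: measurable_funM; [meas|exact: integrable_mfun wi].
  move=> v /S v0; have e1 : expR (- (k.+1%:R * x v)) <= 1 by rewrite expR_le1 oppr_le0 mulr_ge0// x0.
  have e0 := expR_ge0 (- (k.+1%:R * x v)).
  rewrite normrM (ger0_norm (w0 v0)) ler_piMl ?w0// ger0_norm; lra.
have LE N : \sum_(k < N) g k / k.+1%:R * r ^+ k.+1 = ls N r - \int[mu]_(v in I) F N v.
  pose G k v := k.+1%:R^-1 * r ^+ k.+1 * ((1 - expR (- (k.+1%:R * x v))) * w v).
  have Gi k : mu.-integrable I (EFin \o G k) by apply: LintZ.
  have -> : \int[mu]_(v in I) F N v = \sum_(k < N) \int[mu]_(v in I) G k v.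
    elim: N => [|N IH].
      rewrite big_ord0 (@eq_Lintegral _ _ _ (fun v => 0 * w v)) => [|v _]; first by rewrite LintegralZ// mul0r.
      by rewrite /F /ls !big_ord0 subrr mulr0 mul0r.
    rewrite big_ord_recr/= -IH -LintegralD//; last first.
      by apply: (@le_Lint _ _ _ _ mI (mF N) (FE N)); apply: LintZ.
    apply: eq_Lintegral => v _; rewrite /F /ls !big_ord_recr/= /G exprMn.
    have -> : expR (- (N.+1%:R * x v)) = expR (- x v) ^+ N.+1 by rewrite -expRM_natl mulrN.
    ring.
  rewrite -sumrB; apply: eq_bigr => k _; rewrite LintegralZ// gE; ring.
have c1 : expR (ls N r) @[N --> \oo] --> expR (- ln (1 - r)).
  exact: (continuous_cvg _ (@continuous_expR R _) (lsc r rr)).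
have c2 : expR (- \int[mu]_(v in I) F N v) @[N --> \oo] --> 
    expR (- \int[mu]_(v in I) (w v * ln ((1 - r * expR (- x v)) / (1 - r)))).
  exact: (continuous_cvg _ (@continuous_expR R _) (cvgN hF)).
have d0 : 1 - r != 0 by rewrite gt_eqF// subr_gt0.
set J := expR _ in c2 *.
rewrite [X in _ --> X](_ : _ = (1 - r) * (1 * expR (- ln (1 - r)) * J)); last first.
  by rewrite expRN lnK ?posrE ?subr_gt0// mul1r mulVKf.
rewrite (_ : (fun N => _) = (fun N => (1 - r) * ((\sum_(n < N.+1) a n * r ^+ n) *
    expR (- \sum_(k < N) g k / k.+1%:R * r ^+ k.+1) * expR (ls N r) * expR (- \int[mu]_(v in I) F N v)))).
  by apply: cvgM; [exact: cvg_cst|apply: cvgM c2; exact: cvgM].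
apply/funext => N; rewrite LE -!mulrA -!expRD.
set K := Rintegral _ _ _; have -> : - (ls N r - K) + (ls N r + - K) = 0 by ring.
by rewrite expR0 mulr1.
Qed.

End kernel.

End generating_function.

(** * Laplace transforms of step functions and their limit *)

Section laplace_step.
Context {R : realType}.
Notation mu := (@lebesgue_measure R).
Let I : set R := `]0, +oo[%classic.
Let S v : I v -> 0 < v. Proof. by rewrite /I /= in_itv/= andbT. Qed.
Let mI : measurable I. Proof. exact: measurable_itv. Qed.

Lemma laplace_halfline (q c : R) : 0 < q -> 0 <= c ->
  mu.-integrable I (EFin \o (fun s => q * expR (- (q * s)) * (c <= s)%R%:R)) /\
  \int[mu]_(s in I) (q * expR (- (q * s)) * (c <= s)%R%:R) = expR (- (q * c)).
Proof.
move=> q0 c0.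
have [i1 e1] : mu.-integrable `]c, +oo[ (EFin \o (fun s => q * expR (- (q * s)))) /\
    \int[mu]_(s in `]c, +oo[) (q * expR (- (q * s))) = 0 - - expR (- (q * c)).
  have dF (s : R) : isder s (fun s => - expR (- (q * s))) (q * expR (- (q * s))).
    by der; ring.
  apply: (@ge0_FTC_oy _ c (- expR (- (q * c))) 0 _ (fun s => - expR (- (q * s)))).
  - by move=> s _; dcont.
  - by move=> s _; exact: dF.
  - by move=> s _; rewrite mulr_ge0 ?expR_ge0 ?(ltW q0).
  - exact: cont_at_right (der_cont (dF c)) erefl.
  - rewrite -[X in _ --> X]oppr0; apply: cvgN.
    exact: cvgy_expN.
have sub : (`]c, +oo[%classic : set R) `<=` I.
  by move=> s; rewrite /I /= !in_itv/= !andbT; exact: le_lt_trans.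
have mc : measurable (`]c, +oo[%classic : set R) by exact: measurable_itv.
have [i2 e2] := integrable_restr mc mI sub i1.
have mf : measurable_fun I (fun s : R => q * expR (- (q * s)) * (c <= s)%R%:R).
  apply: measurable_funM; first by meas.
  apply: mfunS; have -> : (fun s : R => (c <= s)%R%:R) = \1_(`[c, +oo[%classic : set R) :> (R -> R).
    by apply/funext => s; rewrite indicE mem_setE in_itv/= andbT.
  by apply: measurable_indic; exact: measurable_itv.
have E s : I s -> s != c -> ((fun s => q * expR (- (q * s))) \_ `]c, +oo[) s = q * expR (- (q * s)) * (c <= s)%R%:R.
  move=> /S s0 sc; rewrite patchE mem_setE in_itv/= andbT.
  by rewrite le_eqVlt eq_sym (negbTE sc)/=; case: ifP => _; rewrite ?mulr1 ?mulr0.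
split.
  apply: (@le_Lint_except _ (fun s => `|((fun s => q * expR (- (q * s))) \_ `]c, +oo[) s|) c) => //.
    by move=> s sI sc; rewrite E.
  exact: (integrable_norm i2).
rewrite -(@eq_Lintegral_except _ c _ _ _ mI (integrable_mfun i2) mf E) e2 e1; ring.
Qed.

(** With r = exp (- q h), the interval from n h to (n + 1) h has mass (1 - r) r^n under the
    exponential law of rate q, so the generating function at r is a Laplace transform. *)
Lemma laplace_step (a : nat -> R) (h q : R) : 0 < h -> 0 < q ->
  (forall n, 0 <= a n <= 1) ->
  measurable_fun I (fun s => a (Num.truncn (s / h))) /\
  (1 - expR (- (q * h))) * (\sum_(n < N.+1) a n * expR (- (q * h)) ^+ n) @[N --> \oo] -->
  \int[mu]_(s in I) (q * expR (- (q * s)) * a (Num.truncn (s / h))).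
Proof.
move=> h0 q0 a01; set r := expR (- (q * h)).
pose b (n : nat) (s : R) : R := (n == Num.truncn (s / h))%:R.
have bE n s : I s -> b n s = ((n%:R * h)%R <= s)%R%:R - ((n.+1%:R * h)%R <= s)%R%:R.
  move=> /S s0; have sh : 0 <= s / h by rewrite divr_ge0 ?ltW.
  rewrite /b eq_sym truncn_eq// ler_pdivlMr// ltr_pdivrMr//.
  have m : n%:R * h <= n.+1%:R * h by rewrite ler_pM2r// ler_nat.
  case: (leP (n%:R * h) s) => l1; case: (leP (n.+1%:R * h) s) => l2 /=; rewrite ?subr0 ?subrr//.
  by have := le_lt_trans (le_trans m l2) l1; rewrite ltxx.
have nh n : 0 <= n%:R * h by rewrite mulr_ge0 ?(ltW h0).
have rn n : r ^+ n = expR (- (q * (n%:R * h))).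
  by rewrite /r -expRM_natl; congr expR; ring.
pose F N s := \sum_(n < N.+1) a n * (q * expR (- (q * s)) * b n s).
have bi n : mu.-integrable I (EFin \o (fun s => q * expR (- (q * s)) * b n s)) /\
    \int[mu]_(s in I) (q * expR (- (q * s)) * b n s) = (1 - r) * r ^+ n.
  have [i1 e1] := laplace_halfline q0 (nh n); have [i2 e2] := laplace_halfline q0 (nh n.+1).
  have E s : I s -> q * expR (- (q * s)) * ((n%:R * h)%R <= s)%R%:R - q * expR (- (q * s)) * ((n.+1%:R * h)%R <= s)%R%:R = q * expR (- (q * s)) * b n s.
    by move=> sI; rewrite bE// mulrBr.
  split; first by apply: (eq_Lint mI E); exact: LintB.
  by rewrite -(eq_Lintegral E) LintegralB// e1 e2 -!rn exprS; ring.
have Fi N : mu.-integrable I (EFin \o F N) /\ \int[mu]_(s in I) F N s = \sum_(n < N.+1) a n * ((1 - r) * r ^+ n).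
  have [i e] := @Rintegral_sum R _ _ mu I 'I_N.+1 (index_enum _) (fun n s => a n * (q * expR (- (q * s)) * b n s)) mI (fun n => LintZ (a n) mI (bi n).1).
  split; first exact: i.
  by rewrite e; apply: eq_bigr => n _; rewrite LintegralZ ?(bi n).2//; exact: (bi n).1.
have FE N s : F N s = if (Num.truncn (s / h) < N.+1)%N then q * expR (- (q * s)) * a (Num.truncn (s / h)) else 0.
  case: ifPn => [l|]; last first.
    rewrite -leqNgt => l; apply: big1 => n _; rewrite /b; case: eqP => [E|_]; last by rewrite !mulr0.
    by have := ltn_ord n; rewrite E ltnNge l.
  rewrite /F (bigD1 (Ordinal l))//= big1 => [|n nl]; rewrite /b; last first.
    case: eqP => [E|_]; last by rewrite !mulr0.
    by case/eqP: nl; exact: val_inj.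
  by rewrite eqxx mulr1 addr0 mulrC.
have [qi _] := laplace_halfline q0 (lexx 0).
have Fc s : I s -> F ^~ s @ \oo --> q * expR (- (q * s)) * a (Num.truncn (s / h)).
  move=> sI; apply: cvg_near_cst; near=> N; rewrite FE ifT//.
  by rewrite ltnS; near: N; exact: nbhs_infty_ge.
have Fb N s : I s -> `|F N s| <= q * expR (- (q * s)) * (0 <= s)%R%:R.
  move=> /S s0; rewrite (ltW s0) mulr1 FE; have p0 : 0 <= q * expR (- (q * s)) by rewrite mulr_ge0 ?expR_ge0 ?(ltW q0).
  case: ifP => _; last by rewrite normr0.
  by have /andP[a0 a1] := a01 (Num.truncn (s / h)); rewrite normrM (ger0_norm p0) (ger0_norm a0) ler_piMr.
have [fi fc] := Ldominated_cvg mI (fun N => integrable_mfun (Fi N).1) Fc qi Fb.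
split.
  have m := integrable_mfun fi.
  rewrite (_ : (fun s => _) = (fun s => q^-1 * expR (q * s) * (q * expR (- (q * s)) * a (Num.truncn (s / h))))).
    by apply: measurable_funM => //; meas.
  apply/funext => s; have E1 : q^-1 * expR (q * s) * (q * expR (- (q * s))) = 1.
    by rewrite mulrACA -expRD subrr expR0 mulr1 mulVf// gt_eqF.
  by rewrite [RHS]mulrA E1 mul1r.
rewrite (_ : (fun N => _) = (fun N => \int[mu]_(s in I) F N s))//.
apply/funext => N; rewrite (Fi N).2 mulr_sumr; apply: eq_bigr => n _; ring.
Unshelve. all: by end_near.
Qed.

(** The upper bound, from 1 - exp (- h y) <= h y and q h exp (- q h) <= 1 - exp (- q h), is the
    limit as h tends to 0, and thus a majorant free of [h]. *)
Lemma expR_ratio (h q y : R) : 0 < h -> 0 < q -> 0 <= y ->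
  1 <= (1 - expR (- (q * h)) * expR (- (h * y))) / (1 - expR (- (q * h))) <= 1 + y / q.
Proof.
move=> h0 q0 y0; have qh : 0 < q * h by rewrite mulr_gt0.
have hy : 0 <= h * y by rewrite mulr_ge0 ?(ltW h0).
have e1 : expR (- (q * h)) < 1 by rewrite expR_lt1 oppr_lt0.
have e2 : expR (- (h * y)) <= 1 by rewrite expR_le1 oppr_le0.
have e3 := expR_gt0 (- (q * h)); have e4 := expR_gt0 (- (h * y)).
have d0 : 0 < 1 - expR (- (q * h)) by rewrite subr_gt0.
rewrite ler_pdivlMr// ler_pdivrMr// mul1r; apply/andP; split; first by nra.
have e5 : 1 - expR (- (h * y)) <= h * y by have := expR_ge1Dx (- (h * y)); lra.
have e6 : q * h * expR (- (q * h)) <= 1 - expR (- (q * h)).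
  have := expR_ge1Dx (q * h); rewrite -[X in X <= _ -> _](mulr1) => e.
  have : expR (q * h) * expR (- (q * h)) = 1 by rewrite -expRD subrr expR0.
  by nra.
have -> : (1 + y / q) * (1 - expR (- (q * h))) = 1 - expR (- (q * h)) + y / q * (1 - expR (- (q * h))) by ring.
have e7 : y / q * (q * h * expR (- (q * h))) <= y / q * (1 - expR (- (q * h))).
  by rewrite ler_wpM2l// divr_ge0// ltW.
have e8 : y / q * (q * h * expR (- (q * h))) = h * y * expR (- (q * h)) by field; rewrite gt_eqF.
nra.
Qed.

Lemma cvg_one_sub_expR (h : nat -> R) (x : R) : (forall N, 0 < h N) -> h N @[N --> \oo] --> (0 : R) ->
  0 <= x -> (1 - expR (- (h N * x))) / h N @[N --> \oo] --> x.
Proof.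
move=> h0 hc x0.
apply: (@squeeze_cvgr _ _ _ _ (fun N => x / (1 + h N * x)) (fun=> x)).
- apply: nearW => N; have hx : 0 <= h N * x by rewrite mulr_ge0 ?(ltW (h0 N)).
  have p : 0 < 1 + h N * x by lra.
  have e1 := expR_ge1Dx (- (h N * x)).
  have e2 : expR (- (h N * x)) <= (1 + h N * x)^-1.
    by rewrite expRN lef_pV2 ?posrE ?expR_gt0// expR_ge1Dx.
  rewrite ler_pdivlMr// ler_pdivrMr//; apply/andP; split; last by lra.
  have : (1 + h N * x)^-1 = 1 - x / (1 + h N * x) * h N by field; rewrite gt_eqF.
  by lra.
- rewrite [X in _ --> X](_ : _ = x / (1 + 0 * x)); last by rewrite mul0r addr0 divr1.
  apply: cvgM; first exact: cvg_cst.
  apply: cvgV; first by rewrite mul0r addr0 oner_neq0.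
  by apply: cvgD; [exact: cvg_cst|apply: cvgM => //; exact: cvg_cst].
- exact: cvg_cst.
Qed.

Section limit.
Variables (a : nat -> nat -> R) (h : nat -> R) (w y phi : R -> R).
Hypothesis a01 : forall N n, 0 <= a N n <= 1.
Hypothesis a0 : forall N, a N 0%N = 1.
Hypothesis g01 : forall N k, 0 <= 1 - \int[mu]_(v in I) ((1 - expR (- (k.+1%:R * (h N * y v)))) * w v) <= 1.
Hypothesis a_rec : forall N n, n.+1%:R * a N n.+1 = \sum_(i < n.+1)
  (1 - \int[mu]_(v in I) ((1 - expR (- (i.+1%:R * (h N * y v)))) * w v)) * a N (n - i)%N.
Hypothesis h0 : forall N, 0 < h N.
Hypothesis hc : h N @[N --> \oo] --> (0 : R).
Hypothesis wi : mu.-integrable I (EFin \o w).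
Hypothesis w0 : forall v : R, 0 < v -> 0 <= w v.
Hypothesis my : measurable_fun I y.
Hypothesis y0 : forall v : R, 0 < v -> 0 <= y v.
Hypothesis phic : forall s, 0 < s -> a N (Num.truncn (s / h N)) @[N --> \oo] --> phi s.

Lemma laplace_limit (q : R) : 0 < q ->
  mu.-integrable I (EFin \o (fun v => w v * ln (1 + y v / q))) ->
  mu.-integrable I (EFin \o (fun s => q * expR (- (q * s)) * phi s)) /\
  \int[mu]_(s in I) (q * expR (- (q * s)) * phi s) =
  expR (- \int[mu]_(v in I) (w v * ln (1 + y v / q))).
Proof.
move=> q0 wli.
pose r N := expR (- (q * h N)).
have r01 N : 0 <= r N < 1 by rewrite expR_ge0 expR_lt1 oppr_lt0 mulr_gt0.
have E N : \int[mu]_(s in I) (q * expR (- (q * s)) * a N (Num.truncn (s / h N))) =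
    expR (- \int[mu]_(v in I) (w v * ln ((1 - r N * expR (- (h N * y v))) / (1 - r N)))).
  have mhy : measurable_fun I (fun v => h N * y v) by meas.
  have hy0 (v : R) : 0 < v -> 0 <= h N * y v by move=> v0; rewrite mulr_ge0 ?y0// ltW.
  have := @generating_function R (a N) _ w (fun v => h N * y v) (a01 N) (g01 N) (a0 N) (a_rec N) wi w0 mhy hy0 (fun k => erefl) (r N) (r01 N).
  have [_] := laplace_step (h0 N) q0 (a01 N).
  exact: cvg_unique.
have [qi _] := laplace_halfline q0 (lexx 0).
have m1 N : measurable_fun I (fun s => q * expR (- (q * s)) * a N (Num.truncn (s / h N))).
  have [m _] := laplace_step (h0 N) q0 (a01 N).
  by apply: measurable_funM => //; meas.
have c1 s : I s -> q * expR (- (q * s)) * a N (Num.truncn (s / h N)) @[N --> \oo] --> q * expR (- (q * s)) * phi s.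
  by move=> /S s0; apply: cvgM; [exact: cvg_cst|exact: phic].
have b1 N s : I s -> `|q * expR (- (q * s)) * a N (Num.truncn (s / h N))| <= q * expR (- (q * s)) * (0 <= s)%R%:R.
  move=> /S s0; rewrite (ltW s0) mulr1; have p0 : 0 <= q * expR (- (q * s)) by rewrite mulr_ge0 ?expR_ge0 ?(ltW q0).
  by have /andP[? ?] := a01 N (Num.truncn (s / h N)); rewrite normrM (ger0_norm p0) ger0_norm// ler_piMr.
have [pi_ pc] := Ldominated_cvg mI m1 c1 qi b1.
split=> //.
have R1 N (v : R) : 0 < v -> 1 <= (1 - r N * expR (- (h N * y v))) / (1 - r N) <= 1 + y v / q.
  by move=> v0; apply: expR_ratio => //; exact: y0.
have c2 v : I v -> w v * ln ((1 - r N * expR (- (h N * y v))) / (1 - r N)) @[N --> \oo] --> w v * ln (1 + y v / q).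
  move=> /S v0; have yv := y0 v0; apply: cvgM; first exact: cvg_cst.
  have p0 : 0 < 1 + y v / q by rewrite ltr_pwDl// divr_ge0// ltW.
  have cl : {for 1 + y v / q, continuous (@ln R)}.
    by apply: (@der_cont _ _ _ (1 + y v / q)^-1); exact: is_derive1_ln.
  suff cR : (1 - r N * expR (- (h N * y v))) / (1 - r N) @[N --> \oo] --> 1 + y v / q.
    exact: (continuous_cvg _ cl cR).
  (* Dividing numerator and denominator by the mesh exhibits two difference quotients, with limits q
     + y v and q. *)
  rewrite (_ : (fun N => _) = (fun N => (1 - expR (- (h N * (q + y v)))) / h N / ((1 - expR (- (h N * q))) / h N))); last first.
    apply/funext => N; have -> : expR (- (h N * (q + y v))) = r N * expR (- (h N * y v)).
      by rewrite -expRD; congr expR; ring.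
    rewrite /r [h N * q]mulrC; have hn : h N != 0 by rewrite gt_eqF.
    have dn : 1 - expR (- (q * h N)) != 0 by rewrite gt_eqF// subr_gt0; case/andP: (r01 N).
    set A := 1 - expR _ * _; set B := 1 - expR _ in dn *; by field; rewrite hn dn.
  rewrite [X in _ --> X](_ : _ = (q + y v) / q); last by field; rewrite gt_eqF.
  apply: cvgM; first by apply: cvg_one_sub_expR => //; rewrite addr_ge0// ltW.
  by apply: cvgV; [rewrite gt_eqF|apply: cvg_one_sub_expR => //; exact: ltW].
have m2 N : measurable_fun I (fun v => w v * ln ((1 - r N * expR (- (h N * y v))) / (1 - r N))).
  have mw := integrable_mfun wi; meas.
have b2 N v : I v -> `|w v * ln ((1 - r N * expR (- (h N * y v))) / (1 - r N))| <= w v * ln (1 + y v / q).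
  move=> /S v0; have /andP[l1 l2] := R1 N v v0.
  rewrite normrM (ger0_norm (w0 v0)) ger0_norm ?ln_ge0// ler_wpM2l ?w0//.
  have l0 := lt_le_trans ltr01 l1.
  by rewrite ler_ln ?posrE// (lt_le_trans l0).
have [_ h2] := Ldominated_cvg mI m2 c2 wli b2.
have h3 : expR (- \int[mu]_(v in I) (w v * ln ((1 - r N * expR (- (h N * y v))) / (1 - r N)))) @[N --> \oo] -->
    expR (- \int[mu]_(v in I) (w v * ln (1 + y v / q))).
  by apply: (continuous_cvg _ (@continuous_expR R _)); exact: cvgN.
move: pc; under eq_fun do rewrite E; move=> pc.
exact: (cvg_unique _ pc h3).
Qed.

End limit.
End laplace_step.

(** * Uniqueness for monotone functions *)

Section laplace_monotone.
Context {R : realType}.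
Notation mu := (@lebesgue_measure R).
Let I : set R := `]0, +oo[%classic.
Let S v : I v -> 0 < v. Proof. by rewrite /I /= in_itv/= andbT. Qed.
Let mI : measurable I. Proof. exact: measurable_itv. Qed.

(* Functions with equal Laplace transforms differ on no interval, which
   suffices when [phi] is monotone and [F] is continuous. *)
Lemma laplace_unique_monotone (phi F : R -> R) (t : R) :
  (forall s t : R, 0 < s -> s <= t -> phi t <= phi s) ->
  (forall s : R, 0 < s -> 0 <= phi s <= 1) ->
  (forall s : R, 0 < s -> {for s, continuous F}) ->
  (forall s : R, 0 < s -> 0 <= F s <= 1) ->
  (forall q : R, 0 < q -> mu.-integrable I (EFin \o (fun s => q * expR (- (q * s)) * phi s))) ->
  (forall q : R, 0 < q -> mu.-integrable I (EFin \o (fun s => q * expR (- (q * s)) * F s)) /\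
    \int[mu]_(s in I) (q * expR (- (q * s)) * phi s) = \int[mu]_(s in I) (q * expR (- (q * s)) * F s)) ->
  0 < t -> phi t = F t.
Proof.
move=> phi_dec phi01 cF F01 phii phiL t0.
have mphi : measurable_fun I phi.
  apply: (@eq_measurable_fun _ _ _ _ I (fun s => expR s * (1 * expR (- (1 * s)) * phi s))).
    by move=> s _; rewrite mul1r mul1r mulrA -expRD subrr expR0 mul1r.
  by apply: measurable_funM; [meas|exact: integrable_mfun (phii 1 ltr01)].
have mF : measurable_fun I F.
  by apply: open_cont_mfun; [exact: interval_open|move=> s /S; exact: cF].
(* The sign [e] treats both inequalities. If [phi t] exceeds [F t], monotonicity keeps [phi] large
   on the left of [t]; if it is smaller, [phi] stays small on the right. In each case the difference
   keeps its sign on an interval. *)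
have key (e : R) : e ^+ 2 = 1 -> (forall s, 0 < s -> s < t -> e = 1 -> phi t <= phi s) ->
    (forall s, t < s -> e = -1 -> phi s <= phi t) -> e * (phi t - F t) <= 0.
  move=> e2 hl hr; rewrite leNgt; apply/negP => p.
  have [eps ep epsE] : exists2 eps : R, 0 < eps & eps * 2 = e * (phi t - F t).
    by exists (e * (phi t - F t) / 2); rewrite ?divfK// divr_gt0.
  have e1 : `|e| = 1 by apply/eqP; rewrite -(@sqrp_eq1 R `|e|)// real_normK ?num_real// e2.
  have /cvgrPdist_le/(_ _ ep)/nbhs_ballP[d /= d0 dm] := cF t t0.
  pose D s := e * (phi s - F s).
  have [dd [dd0 dd1 dd2]] : exists dd : R, [/\ 0 < dd, dd <= d & dd <= t].
    by exists (Num.min d t); rewrite lt_min d0 t0 !ge_min !lexx orbT.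
  have mD : measurable_fun I D by rewrite /D; meas.
  have DM s : 0 < s -> `|D s| <= 1.
    move=> s0; rewrite normrM e1 mul1r ler_norml.
    by have /andP[? ?] := phi01 s s0; have /andP[? ?] := F01 s s0; apply/andP; split; lra.
  have D0 n : \int[mu]_(s in I) (D s * expR (- (n.+1%:R * s))) = 0.
    have n0 : 0 < n.+1%:R :> R by rewrite ltr0n.
    have i1 := phii _ n0; have [i2 E2] := phiL _ n0.
    have E s : I s -> e / n.+1%:R * (n.+1%:R * expR (- (n.+1%:R * s)) * phi s - n.+1%:R * expR (- (n.+1%:R * s)) * F s) = D s * expR (- (n.+1%:R * s)).
      move=> _; rewrite /D; move: n0 => /lt0r_neq0; move: (n.+1%:R) (expR _) => x y h; field.
      exact: h.
    rewrite -(eq_Lintegral E) LintegralZ//; last exact: LintB.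
    by rewrite LintegralB// E2 subrr mulr0.
  have near_t s : `|t - s| < dd -> `|F t - F s| <= eps.
    by move=> h; apply: dm; apply: lt_le_trans h dd1.
  have /orP[/eqP eE|/eqP eE] : (e == 1) || (e == -1) by rewrite -sqrf_eq1 e2.
    have tdd : t - dd < t by lra.
    have tdd0 : 0 <= t - dd by lra.
    apply: (@laplace_no_interval R D 1 eps (t - dd) t mD DM D0 tdd0 tdd ep).
    move=> s /andP[s1 s2]; have s0 : 0 < s by lra.
    have := near_t s; rewrite gtr0_norm ?subr_gt0// => near_s; have {near_s} := near_s ltac:(lra).
    rewrite ler_norml => /andP[h1 h2]; have := hl s s0 s2 eE.
    by rewrite /D eE; rewrite eE in epsE; lra.
  have tdd : t < t + dd by lra.
  apply: (@laplace_no_interval R D 1 eps t (t + dd) mD DM D0 (ltW t0) tdd ep).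
  move=> s /andP[s1 s2].
  have := near_t s; rewrite ltr0_norm ?subr_lt0// => near_s; have {near_s} := near_s ltac:(lra).
  rewrite ler_norml => /andP[h1 h2]; have := hr s s1 eE.
  by rewrite /D eE; rewrite eE in epsE; lra.
have h1 : phi t - F t <= 0.
  rewrite -[leLHS]mul1r; apply: key; rewrite ?expr1n//.
    by move=> s s0 st _; apply: phi_dec => //; exact: ltW.
  by move=> s _ h; lra.
have h2 : - (phi t - F t) <= 0.
  rewrite -mulN1r; apply: key; rewrite ?sqrrN ?expr1n//.
    by move=> s _ _ h; lra.
  by move=> s st _; apply: phi_dec => //; exact: ltW.
lra.
Qed.

End laplace_monotone.

(** * Mixtures of exponentials *)

Section mixture.
Context {R : realType}.
Notation mu := (@lebesgue_measure R).
Variables (alpha rho c : R).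
Hypotheses (a02 : 0 < alpha <= 2) (rho01 : 0 < rho < 1) (c0 : 0 < c).

Let I : set R := `]0, +oo[%classic.
Let S v : I v -> 0 < v. Proof. by rewrite /I /= in_itv/= andbT. Qed.
Let mI : measurable I. Proof. exact: measurable_itv. Qed.
Let alpha0 : 0 < alpha. Proof. by case/andP: a02. Qed.

Lemma integrable_wk_ln1p (Q : R) : 0 < Q ->
  mu.-integrable I (EFin \o (fun v => wk rho v * ln (1 + v `^ alpha / Q))).
Proof.
move=> Q0; apply: (@le_Lint _ (fun v => wC rho * (Ld (v `^ alpha / Q) / (1 + v ^+ 2)))) => //.
- by rewrite /wk; meas.
- move=> v /S v0; have x0 : 0 < v `^ alpha / Q by rewrite divr_gt0// powR_gt0.
  have w0 := wk_ge0 rho01 (ltW v0); have w1 := wk_le rho01 (ltW v0).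
  rewrite normrM (ger0_norm w0).
  have -> : wC rho * (Ld (v `^ alpha / Q) / (1 + v ^+ 2)) = wC rho / (1 + v ^+ 2) * Ld (v `^ alpha / Q) by ring.
  apply: ler_pM => //; rewrite ger0_norm ?ln_ge0 ?lerDl ?(ltW x0)// /Ld lerDr//.
- by apply: LintZ => //; apply: integrable_Ld.
Qed.

Lemma kQ_le1 (Q : R) : 0 < Q -> kQ alpha rho Q <= 1.
Proof.
move=> Q0; rewrite kQE// expR_le1 oppr_le0 mulr_ge0// ?invr_ge0 ?pi_ge0//.
apply: Rintegral_ge0 => v /S v0; rewrite mulr_ge0 ?(wk_ge0 rho01 (ltW v0))// ln_ge0// lerDl.
by rewrite divr_ge0 ?powR_ge0 ?(ltW Q0).
Qed.

(** Measurability is inherited from the Stieltjes integrand at Q = 1, multiplied back by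
    [u^alpha + 1]. *)
Lemma measurable_Gden : measurable_fun I (Gden alpha rho).
Proof.
have [i _] := stieltjes_kQ a02 rho01 ltr01.
apply: (@eq_measurable_fun _ _ _ _ I (fun u => Gden alpha rho u * (1 / (u `^ alpha + 1)) * (u `^ alpha + 1))).
  move=> u /set_mem/S u0; rewrite -mulrA div1r mulVf ?mulr1//.
  by rewrite gt_eqF// ltr_wpDl// powR_ge0.
by apply: measurable_funM; [exact: integrable_mfun i|meas].
Qed.

(** The sign is read off from the closed form: a power, the kernel [wk] and an exponential. *)
Lemma Gden_ge0 u : 0 < u -> 0 <= Gden alpha rho u.
Proof.
move=> u0; rewrite -sup_kernelE// mulr_ge0 ?expR_ge0//.
have := wk_ge0 rho01 (ltW u0); rewrite /wk => h.
by rewrite -mulrA mulr_ge0 ?powR_ge0.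
Qed.

Definition mix_term s u := Gden alpha rho u * expR (- (c * s * u `^ alpha)).
Definition mix s := alpha / pi * \int[mu]_(u in I) mix_term s u.

(** Since exp (- x) <= 1 / (1 + x), the mixture at time s is controlled by the Stieltjes transform
    at Q = 1 / (c s), which gives integrability of the density against the exponential. *)
Lemma mix_term_le s u : 0 < s -> 0 < u ->
  mix_term s u <= Gden alpha rho u * ((c * s)^-1 / (u `^ alpha + (c * s)^-1)).
Proof.
move=> s0 u0; rewrite ler_wpM2l ?Gden_ge0//.
have cs : 0 < c * s by rewrite mulr_gt0.
have p : 0 < c * s * u `^ alpha by rewrite mulr_gt0// powR_gt0.
have -> : (c * s)^-1 / (u `^ alpha + (c * s)^-1) = (1 + c * s * u `^ alpha)^-1.
  have -> : u `^ alpha + (c * s)^-1 = (1 + c * s * u `^ alpha) / (c * s).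
    by move: cs => /lt0r_neq0; move: (c * s) (u `^ alpha) => x y h1; field.
  by rewrite invf_div mulKf// gt_eqF.
by rewrite expRN lef_pV2 ?posrE ?expR_gt0 ?expR_ge1Dx// addr_gt0.
Qed.

Lemma mix_term_ge0 s u : 0 < u -> 0 <= mix_term s u.
Proof. by move=> u0; rewrite mulr_ge0 ?expR_ge0 ?Gden_ge0. Qed.

Lemma integrable_mix_term s : 0 < s -> mu.-integrable I (EFin \o mix_term s).
Proof.
move=> s0; have cs : 0 < (c * s)^-1 by rewrite invr_gt0 mulr_gt0.
have [i _] := stieltjes_kQ a02 rho01 cs.
apply: (le_Lint mI _ _ i).
  by apply: measurable_funM; [exact: measurable_Gden|meas].
by move=> u /S u0; rewrite ger0_norm ?mix_term_ge0//; exact: mix_term_le.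
Qed.

(** The upper bound is the Stieltjes transform at Q = 1 / (c s), which equals [kQ] and is at most
    1. *)
Lemma mix01 s : 0 < s -> 0 <= mix s <= 1.
Proof.
move=> s0; have cs : 0 < (c * s)^-1 by rewrite invr_gt0 mulr_gt0.
have ap : 0 <= alpha / pi by rewrite divr_ge0 ?(ltW alpha0) ?pi_ge0.
apply/andP; split.
  by rewrite mulr_ge0//; apply: Rintegral_ge0 => u /S; exact: mix_term_ge0.
apply: le_trans (kQ_le1 cs); have [i <-] := stieltjes_kQ a02 rho01 cs.
rewrite ler_wpM2l//; apply: ler_Lint => //; first exact: integrable_mix_term.
by move=> u /S u0; exact: mix_term_le.
Qed.

Lemma mix_cont s : 0 < s -> {for s, continuous mix}.
Proof.
move=> s0; apply: cvgM; first exact: cvg_cst.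
have sI : s / 2 < s < s + 1 by apply/andP; split; lra.
have s20 : 0 < s / 2 by lra.
apply: (cont_integral mI sI _ _ (integrable_mix_term s20)).
- move=> z /andP[z0 _]; apply: integrable_mfun (integrable_mix_term _); lra.
- by move=> z u _ _; rewrite /mix_term; dcont.
- move=> z u /andP[z0 _] /S u0; rewrite ger0_norm ?mix_term_ge0// ler_wpM2l ?Gden_ge0//.
  by rewrite ler_expR lerN2 ler_wpM2r ?powR_ge0// ler_pM2l// ltW.
Qed.

(** By Fubini, the transform of exp (- c s u^alpha) in s turns the mixture into the Stieltjes
    transform at Q = q / c. *)
Lemma laplace_mix (q : R) : 0 < q ->
  mu.-integrable I (EFin \o (fun s => q * expR (- (q * s)) * mix s)) /\
  \int[mu]_(s in I) (q * expR (- (q * s)) * mix s) = kQ alpha rho (q / c).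
Proof.
move=> q0; have qc : 0 < q / c by rewrite divr_gt0.
have [i1 e1] := stieltjes_kQ a02 rho01 qc.
(* Extension by zero, so that the integrand is measurable on the whole plane. *)
pose G0 := Gden alpha rho \_ I.
have mG0 : measurable_fun setT G0 by apply/(measurable_restrictT _ mI); exact: measurable_Gden.
have G0E u : I u -> G0 u = Gden alpha rho u by move=> uI; rewrite /G0 patchE mem_set.
pose f s u := q * expR (- (q * s)) * (G0 u * expR (- (c * s * u `^ alpha))).
have fE s u : I u -> f s u = q * expR (- (q * s)) * mix_term s u by move=> uI; rewrite /f G0E.
pose b u := Gden alpha rho u * (q / c / (u `^ alpha + q / c)).
have p0 u : 0 <= c * u `^ alpha by rewrite mulr_ge0 ?powR_ge0 ?(ltW c0).
have fE2 s u : f s u = q * G0 u * expR (- ((q + c * u `^ alpha) * s)).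
  rewrite /f; have -> : - ((q + c * u `^ alpha) * s) = - (q * s) + - (c * s * u `^ alpha) by ring.
  by rewrite expRD; ring.
have qp u : 0 < q + c * u `^ alpha by rewrite ltr_pwDl.
have fi u : mu.-integrable I (EFin \o f ^~ u) /\ \int[mu]_(s in I) f s u = q * G0 u * (q + c * u `^ alpha)^-1.
  have [j e] := integrable_expN (qp u).
  split; first by apply: (eq_Lint mI (fun s _ => esym (fE2 s u))); exact: LintZ.
  by rewrite (eq_Lintegral (fun s _ => fE2 s u)) LintegralZ// e.
have bE u : I u -> q * G0 u * (q + c * u `^ alpha)^-1 = b u.
  move=> uI; rewrite G0E// /b; have := qp u; have := powR_gt0 alpha (S uI).
  move: (u `^ alpha) (Gden alpha rho u) => x y x0 q1.
  have -> : x + q / c = (q + c * x) / c by field; rewrite gt_eqF.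
  by rewrite invf_div; field; rewrite !gt_eqF.
have [|||||j1 j2 e2] := @Lfubini R I I f b mI mI.
- apply: (measurable_funS measurableT) => //; rewrite /f.
  have m1 : measurable_fun setT (fun p : R * R => p.1) by exact: measurable_fst.
  have m2 : measurable_fun setT (fun p : R * R => p.2) by exact: measurable_snd.
  have m3 : measurable_fun setT (fun p : R * R => G0 p.2) by exact: measurableT_comp mG0 m2.
  by meas.
- move=> s /S s0; apply: (eq_Lint mI (fun u uI => esym (fE s u uI))).
  by apply: LintZ => //; exact: integrable_mix_term.
- by move=> u _; exact: (fi u).1.
- move=> u uI; rewrite -bE// -(fi u).2; rewrite le_eqVlt; apply/orP; left; apply/eqP.
  apply: eq_Lintegral => s _; rewrite ger0_norm// fE//.
  by apply: mulr_ge0; [rewrite mulr_ge0 ?expR_ge0 ?(ltW q0)|exact: mix_term_ge0 (S uI)].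
- exact: i1.
have E s : I s -> alpha / pi * \int[mu]_(u in I) f s u = q * expR (- (q * s)) * mix s.
  move=> /S s0; have -> : \int[mu]_(u in I) f s u = q * expR (- (q * s)) * \int[mu]_(u in I) mix_term s u.
    rewrite -(LintegralZ _ mI (integrable_mix_term s0)); exact: (eq_Lintegral (fE s)).
  by rewrite mulrCA.
have j3 := LintZ (alpha / pi) mI j1.
split; first exact: (eq_Lint mI E j3).
rewrite -(eq_Lintegral E) (LintegralZ (alpha / pi) mI j1) e2 -e1; congr (_ * _).
by apply: eq_Lintegral => u uI; rewrite (fi u).2 bE.
Qed.

Lemma mix_unique (phi : R -> R) (t : R) :
  (forall s t : R, 0 < s -> s <= t -> phi t <= phi s) ->
  (forall s : R, 0 < s -> 0 <= phi s <= 1) ->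
  (forall q : R, 0 < q -> mu.-integrable I (EFin \o (fun s => q * expR (- (q * s)) * phi s)) /\
    \int[mu]_(s in I) (q * expR (- (q * s)) * phi s) = kQ alpha rho (q / c)) ->
  0 < t -> phi t = mix t.
Proof.
move=> phi_dec phi01 phiL t0.
apply: (laplace_unique_monotone phi_dec phi01 mix_cont mix01) => // q q0.
  by case: (phiL q q0).
have [i e] := laplace_mix q0; split; first exact: i.
by rewrite (phiL q q0).2 e.
Qed.

End mixture.

(** * The running supremum of a stable process *)

Section integral_sandwich.
Context d (T : measurableType d) (R : realType) (P : probability T R).

(** The integral is a supremum over simple functions below the integrand, a definition that is
    monotone without any measurability. *)
Lemma ge0_le_nnintegral (f g : T -> \bar R) : (forall w, (0 <= f w)%E) -> (forall w, (f w <= g w)%E) ->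
  (\int[P]_w f w <= \int[P]_w g w)%E.
Proof.
move=> f0 fg; have g0 w : (0 <= g w)%E by exact: le_trans (fg w).
rewrite !ge0_integralTE//.
by apply: ereal_sup_le => _ [h hf <-]; exists h => //= w; exact: le_trans (fg w).
Qed.

(* [f] need not be measurable: the integral is monotone on all non-negative
   functions, so [f] is sandwiched up to a null set. *)
Lemma ge0_ae_eq_integral_nonmeasurable (f g : T -> R) : measurable_fun setT g ->
  (forall w, 0 <= f w) -> (forall w, 0 <= g w) -> {ae P, forall w, f w = g w} ->
  (\int[P]_w (f w)%:E = \int[P]_w (g w)%:E)%E.
Proof.
move=> mg f0 g0 [N [mN PN fgN]].
have fg w : ~ N w -> f w = g w by move=> Nw; apply: contrapT => /fgN.
(* [l] and [u] are measurable and equal [g] off the null set; on it they are 0 and +oo, hence they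
   bracket [f] everywhere. *)
pose l w := g w * \1_(~` N) w; pose u w := ((l w)%:E + +oo * (\1_N w)%:E)%E.
have mN' : measurable (~` N) by exact: measurableC.
have ml : measurable_fun setT l by apply: measurable_funM => //; exact: measurable_indic.
have mu_ : measurable_fun setT u.
  apply: emeasurable_funD; first exact/measurable_EFinP.
  by apply: measurable_funeM; apply/measurable_EFinP; exact: measurable_indic.
have lE w : ~ N w -> l w = g w by move=> Nw; rewrite /l indicE mem_set// mulr1.
have lN w : N w -> l w = 0 by move=> Nw; rewrite /l indicE memNset ?mulr0//; exact.
have uE w : ~ N w -> u w = (g w)%:E by move=> Nw; rewrite /u lE// indicE memNset// mule0 adde0.
have uN w : N w -> u w = +oo%E by move=> Nw; rewrite /u lN// indicE mem_set// mule1 add0e.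
have l0 w : 0 <= l w by have [Nw|Nw] := pselect (N w); [rewrite lN|rewrite lE].
have lf w : ((l w)%:E <= (f w)%:E)%E.
  by rewrite lee_fin; have [Nw|Nw] := pselect (N w); [rewrite lN|rewrite lE// fg].
have fu w : ((f w)%:E <= u w)%E.
  by have [Nw|Nw] := pselect (N w); [rewrite uN// leey|rewrite uE// fg].
have u0 w : (0 <= u w)%E by apply: le_trans (fu w); rewrite lee_fin.
have ae (v : T -> \bar R) : measurable_fun setT v -> (forall w, (0 <= v w)%E) ->
    (forall w, ~ N w -> v w = (g w)%:E) -> (\int[P]_w (v w) = \int[P]_w (g w)%:E)%E.
  move=> mv v0 vg; apply: ge0_ae_eq_integral => //.
  - exact/measurable_EFinP.
  - by move=> w _; rewrite lee_fin.
  - exists N; split => // w /= h; apply: contrapT => Nw; apply: h => _.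
    by rewrite vg.
apply/eqP; rewrite eq_le; apply/andP; split.
  by rewrite -(ae u mu_ u0 uE); apply: ge0_le_nnintegral => // w; rewrite lee_fin.
rewrite -(ae (EFin \o l)) => [||w|w Nw] /=.
- by apply: ge0_le_nnintegral => // w; rewrite lee_fin.
- exact/measurable_EFinP.
- by rewrite lee_fin.
- by rewrite lE.
Qed.

End integral_sandwich.

Section cadlag_paths.
Context {R : realType}.
Implicit Types (f : R -> R) (s t : R).

(** A supremum argument on the times up to which the path is bounded above: the left limit brings
    boundedness to the supremum itself, right-continuity carries it beyond. *)
Lemma cadlag_bounded f t : cadlag f -> 0 <= t -> exists M : R, forall s, 0 <= s <= t -> f s <= M.
Proof.
case=> fr fl t0.
pose B (u : R) := exists M : R, forall s : R, 0 <= s <= u -> f s <= M.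
have right (u : R) : 0 <= u -> B u -> exists2 e : R, 0 < e & B (u + e).
  move=> u0 [M hM]; have /cvgrPdist_lt/(_ _ ltr01) := fr u u0.
  rewrite near_withinE => /nbhs_ballP[e /= e0 he].
  exists (e / 2); first lra.
  exists (Num.max M (f u + 1)) => s /andP[s0 su]; rewrite le_max.
  have [su'|us] := leP s u; first by rewrite hM// s0.
  apply/orP; right; have := he s; rewrite /ball /= ltr0_norm ?subr_lt0// => h.
  by have := h ltac:(lra) us; rewrite ltr_norml => /andP[? ?]; lra.
pose A : set R := [set u | 0 <= u <= t /\ B u].
have A0 : A 0.
  split; first by rewrite lexx.
  by exists (f 0) => s /andP[s0 s1]; have -> : s = 0 by apply/eqP; rewrite eq_le s0 s1.
have hA : has_sup A by split; [exists 0|exists t => u [/andP[]]].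
pose S := sup A.
have S0 : 0 <= S by apply: sup_upper_bound.
have St : S <= t by apply: ge_sup; [exists 0|move=> u [/andP[]]].
have BS : B S.
  have [S0'|Sn] := ltP 0 S; last first.
    have -> : S = 0 by apply/eqP; rewrite eq_le S0 Sn.
    by case: A0.
  have /cvg_ex[l /cvgrPdist_lt/(_ _ ltr01)] := fl S S0'.
  rewrite near_withinE => /nbhs_ballP[e /= e0 he].
  have [u [_ [M hM]] uS] := sup_adherent e0 hA.
  exists (Num.max M (Num.max (l + 1) (f S))) => s /andP[s0 sS]; rewrite !le_max.
  have [su|us] := leP s u; first by rewrite hM// s0.
  apply/orP; right; move: sS; rewrite le_eqVlt => /predU1P[->|sS]; first by rewrite lexx orbT.
  apply/orP; left; have := he s; rewrite /ball /= gtr0_norm ?subr_gt0// => h.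
  rewrite -/S in uS.
  by have := h ltac:(lra) sS; rewrite ltr_norml => /andP[? ?]; lra.
move: St; rewrite le_eqVlt => /predU1P[<- //|St].
have [e e0 [M hM]] := right S S0 BS.
have : A (Num.min (S + e) t).
  split; first by rewrite ge_min lexx orbT andbT le_min t0 andbT; lra.
  by exists M => s /andP[s0]; rewrite le_min => /andP[s1 _]; rewrite hM// s0.
move/(sup_upper_bound hA); rewrite -/S ge_min => /orP[h|h]; lra.
Qed.

End cadlag_paths.

(** * Maxima over dyadic grids *)

Section grid.
Context d (T : measurableType d) (R : realType) (X : R -> T -> R).
Implicit Types (h s t : R) (w : T).

Definition grid_step h (m : nat) w : R := X (m.+1%:R * h) w - X (m%:R * h) w.

Lemma walk_max_ge h n (m : nat) k w : (k <= n)%N ->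
  X ((m + k)%:R * h) w - X (m%:R * h) w <= walk_max (grid_step h) n m w.
Proof.
elim: n m k => [|n IH] m [|k] //=; rewrite ?addn0 ?subrr//.
  by rewrite le_max lexx orbT.
move=> kn; have := IH m.+1 k kn; rewrite addSnnS => h1.
by rewrite le_max; apply/orP; left; rewrite /grid_step; lra.
Qed.

Lemma walk_max_attained h n (m : nat) w : exists2 k, (k <= n)%N &
  walk_max (grid_step h) n m w = X ((m + k)%:R * h) w - X (m%:R * h) w.
Proof.
elim: n m => [|n IH] m /=; first by exists 0%N; rewrite ?addn0 ?subrr.
have [k kn ->] := IH m.+1; rewrite /grid_step.
case: (leP (X (m.+1%:R * h) w - X (m%:R * h) w + (X ((m.+1 + k)%:R * h) w - X (m.+1%:R * h) w)) 0) => _.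
  by exists 0%N; rewrite ?addn0 ?subrr.
by exists k.+1 => //; rewrite addSnnS; lra.
Qed.

Lemma walk_max_mono h n n' (m : nat) w : (n <= n')%N ->
  walk_max (grid_step h) n m w <= walk_max (grid_step h) n' m w.
Proof.
move=> nn; have [k kn ->] := walk_max_attained h n m w.
by apply: walk_max_ge; exact: leq_trans nn.
Qed.

(** Halving makes the grids nested, and [t] belongs to each of them. *)
Definition mesh t (N : nat) : R := t / 2 ^+ N.

Lemma mesh_gt0 t N : 0 < t -> 0 < mesh t N.
Proof. by move=> t0; rewrite divr_gt0// exprn_gt0. Qed.

Lemma mesh_half t N : mesh t N = 2 * mesh t N.+1.
Proof. by rewrite /mesh exprS; field; rewrite expf_neq0. Qed.

Lemma mesh_cvg0 t : mesh t N @[N --> \oo] --> (0 : R).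
Proof.
rewrite -[X in _ --> X](mulr0 t); apply: cvgM; first exact: cvg_cst.
under eq_fun do rewrite -exprVn; apply: cvg_expr.
by rewrite ger0_norm ?invr_ge0// invf_lt1// ltr1n.
Qed.

(** A coarse grid point of index [k] is the fine grid point of index [2 * k], still before time
    [s]. *)
Lemma walk_max_refine t s N w : 0 < t -> 0 <= s ->
  walk_max (grid_step (mesh t N)) (Num.truncn (s / mesh t N)) 0 w <=
  walk_max (grid_step (mesh t N.+1)) (Num.truncn (s / mesh t N.+1)) 0 w.
Proof.
move=> t0 s0; have h0 := mesh_gt0 N t0; have h1 := mesh_gt0 N.+1 t0.
have [k kn ->] := walk_max_attained (mesh t N) (Num.truncn (s / mesh t N)) 0 w.
have kE : (0 + k)%:R * mesh t N = (0 + 2 * k)%:R * mesh t N.+1.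
  by rewrite mesh_half !add0n natrM; ring.
have -> : X (0%:R * mesh t N) w = X (0%:R * mesh t N.+1) w by rewrite !mul0r.
rewrite kE; apply: walk_max_ge.
have sh0 : 0 <= s / mesh t N by rewrite divr_ge0 ?(ltW h0).
rewrite (truncn_ge_nat _ sh0) in kn.
have sh1 : 0 <= s / mesh t N.+1 by rewrite divr_ge0 ?(ltW h1).
rewrite (truncn_ge_nat _ sh1) ler_pdivlMr// natrM.
by move: kn; rewrite ler_pdivlMr// mesh_half; lra.
Qed.

Lemma walk_max_cvg t w (M : R) : 0 < t -> X 0 w = 0 -> cadlag (X ^~ w) ->
  (forall s, 0 <= s <= t -> X s w <= M) ->
  (forall e : R, 0 < e -> exists2 s, 0 <= s <= t & M - e < X s w) ->
  walk_max (grid_step (mesh t N)) (Num.truncn (t / mesh t N)) 0 w @[N --> \oo] --> M.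
Proof.
move=> t0 X0 [rc _] ub app.
have le_M N : walk_max (grid_step (mesh t N)) (Num.truncn (t / mesh t N)) 0 w <= M.
  have h0 := mesh_gt0 N t0.
  have [k kn ->] := walk_max_attained (mesh t N) (Num.truncn (t / mesh t N)) 0 w.
  rewrite mul0r X0 subr0 add0n; apply: ub.
  rewrite truncn_ge_nat ?divr_ge0 ?(ltW h0) ?(ltW t0)// ler_pdivlMr// in kn.
  by rewrite kn andbT mulr_ge0// ltW.
apply/cvgrPdist_lt => e e0; have e20 : 0 < e / 2 by lra.
have [s /andP[s0 st] Xs] := app _ e20.
have [dl dl0 hd] : exists2 d : R, 0 < d & forall z, s < z < s + d -> M - e < X z w.
  have /cvgrPdist_lt/(_ _ e20) := rc s s0.
  rewrite near_withinE => /nbhs_ballP[dl /= dl0 hd]; exists dl => // z /andP[sz zd].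
  have := hd z; rewrite /ball /= ltr0_norm ?subr_lt0// => h.
  by have := h ltac:(lra) sz; rewrite ltr_norml => /andP[? ?]; lra.
have key N k : (k <= Num.truncn (t / mesh t N))%N -> X (k%:R * mesh t N) w <= walk_max (grid_step (mesh t N)) (Num.truncn (t / mesh t N)) 0 w.
  by move=> kn; have := walk_max_ge (mesh t N) 0 w kn; rewrite mul0r X0 subr0 add0n.
have kt N k : k%:R * mesh t N <= t -> (k <= Num.truncn (t / mesh t N))%N.
  have h0 := mesh_gt0 N t0.
  by rewrite truncn_ge_nat ?divr_ge0 ?(ltW h0) ?(ltW t0)// ler_pdivlMr.
(* A supremum approached only at the final time has no room on its right; there the membership of
   [t] in every grid is what matters. Otherwise right-continuity lets the first grid point after [s]
   do, once the mesh is small. *)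
move: st; rewrite le_eqVlt => /predU1P[st|st].
  apply: nearW => N; rewrite ger0_norm ?subr_ge0 ?le_M//.
  have E : (2 ^ N)%:R * mesh t N = t by rewrite /mesh natrX mulrCA mulfV ?mulr1// expf_neq0.
  by have := key N (2 ^ N)%N (kt N _ _); rewrite E lexx => /(_ isT); rewrite st in Xs; lra.
pose dd := Num.min dl (t - s); have dd0 : 0 < dd by rewrite lt_min dl0 subr_gt0.
have /cvgrPdist_lt/(_ _ dd0) := mesh_cvg0 t.
apply: filterS => N; have h0 := mesh_gt0 N t0.
rewrite sub0r normrN (gtr0_norm h0) lt_min => /andP[hN1 hN2].
have sh : 0 <= s / mesh t N by rewrite divr_ge0 ?(ltW h0).
have /andP[k1 k2] := truncn_itv sh.
rewrite ler_pdivlMr// in k1; rewrite ltr_pdivrMr// in k2.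
set k := Num.truncn (s / mesh t N) in k1 k2.
have k3 : k.+1%:R * mesh t N = k%:R * mesh t N + mesh t N by rewrite -natr1; ring.
have kk : k.+1%:R * mesh t N <= t by rewrite k3; lra.
have h1 := key N k.+1 (kt N _ kk).
have h2 : M - e < X (k.+1%:R * mesh t N) w by apply: hd; rewrite k2/= k3; lra.
by rewrite ger0_norm ?subr_ge0 ?le_M//; lra.
Qed.

End grid.

(** * Spitzer's identity along the grids *)

Section running_maximum.
Context d (T : measurableType d) (R : realType) (P : probability T R).
Notation mu := (@lebesgue_measure R).
Variables (X : R -> T -> R) (alpha rho c : R).
Let th0 : R := alpha * ((rho - 1 / 2) * pi).
Hypotheses (a02 : 0 < alpha <= 2) (rho01 : 0 < rho < 1) (c0 : 0 < c).
Hypothesis th0I : `|th0| < pi / 2.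
Hypothesis mX : forall t, measurable_fun setT (X t).
Hypothesis X0 : {ae P, forall w, X 0 w = 0}.
Hypothesis Xind : forall (n : nat) (s : nat -> R), 0 <= s 0%N -> (forall i, s i <= s i.+1) ->
  mutually_independent P (fun (i : 'I_n) w => X (s i.+1) w - X (s i) w).
Hypothesis Xstat : forall s t : R, 0 <= s -> 0 <= t -> forall A : set R, measurable A ->
  P ((fun w => X (s + t) w - X s w) @^-1` A) = P (X t @^-1` A).
Hypothesis Xcad : {ae P, forall w, cadlag (X ^~ w)}.
Hypothesis Xcos : forall s v : R, 0 < s -> 0 < v -> \int[P]_w cos (v * X s w) =
  expR (- (s * c * v `^ alpha * cos th0)) * cos (s * c * v `^ alpha * sin th0).
Hypothesis Xsin : forall s v : R, 0 < s -> 0 < v -> \int[P]_w sin (v * X s w) =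
  expR (- (s * c * v `^ alpha * cos th0)) * sin (s * c * v `^ alpha * sin th0).

Let I : set R := `]0, +oo[%classic.
Let S v : I v -> 0 < v. Proof. by rewrite /I /= in_itv/= andbT. Qed.
Let mI : measurable I. Proof. exact: measurable_itv. Qed.

Let w_ v : R := pi^-1 * wk rho v.
Let y_ v : R := c * v `^ alpha.

Lemma bigsetI_ord n (F : nat -> set T) w :
  (\big[setI/setT]_(i < n) F i) w <-> (forall i, (i < n)%N -> F i w).
Proof.
elim: n => [|n IH]; first by rewrite big_ord0.
rewrite big_ord_recr/=; split=> [[/IH h Fn] i|h].
  by rewrite ltnS leq_eqVlt => /predU1P[-> //|]; exact: h.
by split; [apply/IH => i /ltnW/h|exact: h].
Qed.

Let nat_ge0 (h : R) n : 0 < h -> 0 <= n%:R * h.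
Proof. by move=> h0; rewrite mulr_ge0// ltW. Qed.

Lemma grid_step_indep (h : R) m j (A : nat -> set R) : 0 < h -> (forall i, measurable (A i)) ->
  P (\big[setI/setT]_(i < j) (grid_step X h (m + i)%N @^-1` A i)) =
  (\prod_(i < j) P (grid_step X h (m + i)%N @^-1` A i))%E.
Proof.
move=> h0 mA.
have := @Xind j (fun i => (m + i)%:R * h) (nat_ge0 _ h0) _ (fun i => A i) (fun i => mA i).
rewrite /grid_step; set B := bigcap _ _; move=> hB.
have -> : \big[setI/setT]_(i < j) ((fun w => X ((m + i).+1%:R * h) w - X ((m + i)%:R * h) w) @^-1` A i) = B.
  apply/seteqP; split=> w.
    move/(@bigsetI_ord j (fun i => (fun w => X ((m + i).+1%:R * h) w - X ((m + i)%:R * h) w) @^-1` A i)) => hw i _.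
    by have := hw i (ltn_ord i); rewrite /= addnS.
  move=> hw; apply/(@bigsetI_ord j (fun i => (fun w => X ((m + i).+1%:R * h) w - X ((m + i)%:R * h) w) @^-1` A i)) => i ij.
  by have := hw (Ordinal ij) Logic.I; rewrite /= addnS.
rewrite hB => [|i]; first by apply: eq_bigr => i _; rewrite addnS.
by rewrite ler_pM2r// ler_nat leq_add2l.
Qed.

Lemma grid_step_law (h : R) n (A : set R) : 0 < h -> measurable A ->
  P (grid_step X h n @^-1` A) = P (X h @^-1` A).
Proof.
move=> h0 mA; rewrite -(@Xstat (n%:R * h) h (nat_ge0 _ h0) (ltW h0) A mA); congr (P _).
by rewrite /grid_step -natr1 mulrDl mul1r.
Qed.

(** Subtracting [X 0], which vanishes only almost surely, makes this a genuine increment, so that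
    independence and stationarity apply verbatim. *)
Let Sw h n w : R := X (n%:R * h) w - X 0 w.

Let mSw h n : measurable_fun setT (Sw h n).
Proof. exact: measurable_funB. Qed.

Let mstep h n : measurable_fun setT (grid_step X h n).
Proof. exact: measurable_funB. Qed.

Let Sw_law (h : R) n (A : set R) : 0 < h -> measurable A -> P (Sw h n @^-1` A) = P (X (n%:R * h) @^-1` A).
Proof. by move=> h0 mA; rewrite -(@Xstat 0 (n%:R * h) (lexx 0) (nat_ge0 _ h0) A mA) add0r. Qed.

Let conv_Sw (h : R) n (f : R -> R) : 0 < h -> bdmeas f ->
  conv P (Sw h n.+2) f = conv P (Sw h n.+1) (conv P (Sw h 1%N) f).
Proof.
move=> h0 bf; apply/funext => x.
have ind : independent2 P (Sw h n.+1) (grid_step X h n.+1).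
  (* Times 0, (n + 1) h, (n + 2) h: the first increment merges n + 1 grid steps, the second is a
     single one. *)
  move=> A B mA mB; pose s (i : nat) : R := if i is i'.+1 then (n + i)%:R * h else 0.
  have s_mono i : s i <= s i.+1.
    by case: i => [|i] /=; [exact: nat_ge0|rewrite ler_pM2r// ler_nat leq_add2l].
  have mAB (i : 'I_2) : measurable (if i == ord0 then A else B) by case: ifP.
  have hI := @Xind 2 s (lexx 0) s_mono _ mAB.
  rewrite big_ord_recl big_ord1 in hI.
  have E1 : Sw h n.+1 = (fun w => X (s 1%N) w - X (s 0%N) w) by rewrite /s addn1.
  have E2 : grid_step X h n.+1 = (fun w => X (s 2%N) w - X (s 1%N) w) by rewrite /s addn1 addn2.
  rewrite E1 E2; apply: etrans hI; congr (P _); apply/seteqP; split=> w.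
    by move=> [wA wB] [[|[|//]] i2] _.
  by move=> hw; split; [exact: (hw ord0 Logic.I)|exact: (hw ord_max Logic.I)].
have -> : conv P (Sw h n.+2) f = conv P (fun w => Sw h n.+1 w + grid_step X h n.+1 w) f.
  by congr (conv P _ f); apply/funext => w; rewrite /Sw /grid_step; ring.
rewrite (conv_joint x (mSw h n.+1) (mstep h n.+1) ind bf); congr (conv P _ _ x); apply/funext => y.
apply: eq_law_conv => // A mA; rewrite grid_step_law// (Sw_law 1%N h0 mA) mul1r//.
Qed.

Let a_ h n : R := \int[P]_w expR (- walk_max (grid_step X h) n 0 w).

Let mwalk h n : measurable_fun setT (fun w => expR (- walk_max (grid_step X h) n 0 w)).
Proof. by apply: mfun_expR; apply: measurable_funN; apply: measurable_walk_max. Qed.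

Let walk01 h n w : 0 <= expR (- walk_max (grid_step X h) n 0 w) <= 1.
Proof. by rewrite expR_ge0 expR_le1 oppr_le0 walk_max_ge0. Qed.

Let int01 (f : T -> R) : measurable_fun setT f -> (forall w, 0 <= f w <= 1) -> 0 <= \int[P]_w f w <= 1.
Proof.
move=> mf f01; rewrite Rintegral_ge0/=; last by move=> w _; case/andP: (f01 w).
apply: le_trans (ler_norm _) _; apply: Rintegral_le_bound => // w.
by case/andP: (f01 w) => ? ?; rewrite ger0_norm.
Qed.

(** [E_pospart] at time (i + 1) h, whose exponent is b = (i + 1) h c. The factor 1 / pi is moved
    into [w_]. *)
Let gE (h : R) i : 0 < h -> \int[P]_w expR (- Num.max (Sw h i.+1 w) 0) =
  1 - \int[mu]_(v in I) ((1 - expR (- (i.+1%:R * (h * y_ v)))) * w_ v).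
Proof.
move=> h0; have ih : 0 < i.+1%:R * h by rewrite mulr_gt0.
have [me [M eM]] := bdmeas_exp_max0 R.
rewrite (@eq_law_Rintegral _ _ _ P (Sw h i.+1) (X (i.+1%:R * h)) (fun x => expR (- Num.max x 0)) (mSw h i.+1) (mX _) (fun A mA => Sw_law i.+1 h0 mA) me (fun x => expR_ge0 _)).
have b0 : 0 < i.+1%:R * h * c by rewrite mulr_gt0.
have := @E_pospart R alpha rho _ a02 rho01 b0 th0I _ _ P _ (mX (i.+1%:R * h)) (fun v v0 => Xcos ih v0) (fun v v0 => Xsin ih v0).
have ie : P.-integrable setT (EFin \o (fun w => expR (- Num.max (X (i.+1%:R * h) w) 0))).
  apply: (@bounded_integrable _ _ _ P _ M) => [|w]; last exact: eM.
  exact: (measurableT_comp me).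
rewrite RintegralB//; last exact: finite_measure_integrable_cst.
rewrite Rintegral_probability1 => h1.
have -> : \int[mu]_(v in I) ((1 - expR (- (i.+1%:R * (h * y_ v)))) * w_ v) =
    pi^-1 * \int[mu]_(v in I) ((1 - expR (- (i.+1%:R * h * c * v `^ alpha))) * wk rho v).
  rewrite -LintegralZ//.
    apply: eq_Lintegral => v _; rewrite /w_ /y_.
    have -> : i.+1%:R * (h * (c * v `^ alpha)) = i.+1%:R * h * c * v `^ alpha by ring.
    by rewrite mulrCA.
  apply: (@le_Lint _ (wk rho)) => //; last exact: integrable_wk.
    by rewrite /wk; meas.
  move=> v /S v0; have w0 := wk_ge0 rho01 (ltW v0).
  have e1 : expR (- (i.+1%:R * h * c * v `^ alpha)) <= 1 by rewrite expR_le1 oppr_le0 mulr_ge0 ?powR_ge0// ltW.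
  have e2 := expR_ge0 (- (i.+1%:R * h * c * v `^ alpha)).
  rewrite normrM (ger0_norm w0) ler_piMl// ger0_norm; lra.
by rewrite -h1; ring.
Qed.

Let a_rec (h : R) n : 0 < h -> n.+1%:R * a_ h n.+1 = \sum_(i < n.+1)
  (1 - \int[mu]_(v in I) ((1 - expR (- (i.+1%:R * (h * y_ v)))) * w_ v)) * a_ h (n - i)%N.
Proof.
move=> h0; have lawS (m : nat) (A : set R) : measurable A -> P (grid_step X h m @^-1` A) = P (Sw h 1%N @^-1` A).
  by move=> mA; rewrite grid_step_law// (Sw_law 1%N h0 mA) mul1r.
rewrite /a_ (@spitzer_recurrence _ _ _ P (grid_step X h) (mstep h) (fun m j A mA => grid_step_indep m j h0 mA) (Sw h) (mSw h) (fun n f bf => conv_Sw n h0 bf) lawS).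
by apply: eq_bigr => i _; rewrite gE.
Qed.

Section fixed_time.
Variables (t : R) (M : T -> R).
Hypothesis t0 : 0 < t.
Hypothesis Mub : {ae P, forall w, (forall s : R, 0 <= s <= t -> X s w <= M w) /\
  (forall e : R, 0 < e -> exists2 s : R, 0 <= s <= t & M w - e < X s w)}.

(** The meshes are adapted to [t], and other times [s] are rounded down to the grid. For those, only
    monotonicity in [s] and the Laplace transform of the limit [phi] are used. *)
Let A_ N s : R := a_ (mesh t N) (Num.truncn (s / mesh t N)).
Let phi s : R := limn (A_ ^~ s).

Let A01 N s : 0 <= A_ N s <= 1.
Proof. by apply: int01 => //; exact: mwalk. Qed.

Let A_nonincr (s : R) : 0 <= s -> nonincreasing_seq (A_ ^~ s).
Proof.
move=> s0; apply/nonincreasing_seqP => N; apply: le_Rintegral => //.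
- by apply: (@bounded_integrable _ _ _ P _ 1) => // w; rewrite ger0_norm ?expR_ge0//; case/andP: (walk01 (mesh t N.+1) (Num.truncn (s / mesh t N.+1)) w).
- by apply: (@bounded_integrable _ _ _ P _ 1) => // w; rewrite ger0_norm ?expR_ge0//; case/andP: (walk01 (mesh t N) (Num.truncn (s / mesh t N)) w).
by move=> w _; rewrite ler_expR lerN2; exact: walk_max_refine.
Qed.

Let phi_cvg (s : R) : 0 <= s -> A_ N s @[N --> \oo] --> phi s.
Proof.
move=> s0; apply: nonincreasing_is_cvgn; first exact: A_nonincr.
by exists 0 => _ [N _ <-]; case/andP: (A01 N s).
Qed.

Let phi_dec (s u : R) : 0 < s -> s <= u -> phi u <= phi s.
Proof.
move=> s0 su; have u0 : 0 <= u by exact: le_trans (ltW s0) su.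
apply: (ler_cvg_to (phi_cvg u0) (phi_cvg (ltW s0))); apply: nearW => N.
apply: le_Rintegral => //.
- by apply: (@bounded_integrable _ _ _ P _ 1) => // w; rewrite ger0_norm ?expR_ge0//; case/andP: (walk01 (mesh t N) (Num.truncn (u / mesh t N)) w).
- by apply: (@bounded_integrable _ _ _ P _ 1) => // w; rewrite ger0_norm ?expR_ge0//; case/andP: (walk01 (mesh t N) (Num.truncn (s / mesh t N)) w).
move=> w _; rewrite ler_expR lerN2; apply: walk_max_mono; apply: le_truncn.
by rewrite ler_pM2r// invr_gt0 mesh_gt0.
Qed.

Let phi01 (s : R) : 0 < s -> 0 <= phi s <= 1.
Proof.
move=> s0; have h := phi_cvg (ltW s0); apply/andP; split.
  by apply: (ler_cvg_to (cvg_cst 0) h); apply: nearW => N; case/andP: (A01 N s).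
by apply: (@ler_cvg_to _ _ _ _ (A_ ^~ s) (fun=> 1 : R) _ _ h (cvg_cst _)); apply: nearW => N; case/andP: (A01 N s).
Qed.

(** [laplace_limit] with weight wk / pi and exponent c v^alpha; its value is recognised as [kQ] at q
    / c by [kQE]. *)
Let phi_laplace (q : R) : 0 < q -> mu.-integrable I (EFin \o (fun s => q * expR (- (q * s)) * phi s)) /\
  \int[mu]_(s in I) (q * expR (- (q * s)) * phi s) = kQ alpha rho (q / c).
Proof.
move=> q0; have qc : 0 < q / c by rewrite divr_gt0.
have m0 N := mesh_gt0 N t0.
have g01 N k : 0 <= 1 - \int[mu]_(v in I) ((1 - expR (- (k.+1%:R * (mesh t N * y_ v)))) * w_ v) <= 1.
  rewrite -gE//; apply: int01 => [|w]; last by rewrite expR_ge0 expR_le1 oppr_le0 le_max lexx orbT.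
  by apply: mfun_expR; apply: measurable_funN; exact: measurable_max0.
have a0 N : a_ (mesh t N) 0 = 1.
  rewrite /a_ /=; under eq_Rintegral do rewrite oppr0 expR0; exact: Rintegral_probability1.
have pi0 : 0 <= pi^-1 :> R by rewrite invr_ge0 pi_ge0.
have E v : 1 + y_ v / q = 1 + v `^ alpha / (q / c).
  by rewrite /y_ invf_div; ring.
have := @laplace_limit R (fun N n => a_ (mesh t N) n) (mesh t) w_ y_ phi.
have a01 N n : 0 <= a_ (mesh t N) n <= 1 by apply: int01 => //; exact: mwalk.
have wi : mu.-integrable I (EFin \o w_) by apply: LintZ => //; exact: integrable_wk.
have w0 (v : R) : 0 < v -> 0 <= w_ v by move=> v0; rewrite mulr_ge0// (wk_ge0 rho01 (ltW v0)).
have my : measurable_fun I y_ by rewrite /y_; meas.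
have y0 (v : R) : 0 < v -> 0 <= y_ v by move=> v0; rewrite mulr_ge0 ?powR_ge0// ltW.
have pc s : 0 < s -> a_ (mesh t N) (Num.truncn (s / mesh t N)) @[N --> \oo] --> phi s.
  by move=> s0; exact: (phi_cvg (ltW s0)).
move=> /(_ a01 a0 g01 (fun N n => a_rec n (m0 N)) m0 (mesh_cvg0 t) wi w0 my y0 pc q q0).
have ki := integrable_wk_ln1p a02 rho01 qc.
have kE v : I v -> pi^-1 * (wk rho v * ln (1 + v `^ alpha / (q / c))) = w_ v * ln (1 + y_ v / q).
  by move=> _; rewrite /w_ E mulrA.
case; first by apply: (eq_Lint mI kE); exact: LintZ.
move=> i ->; split => //; rewrite kQE//; congr (expR (- _)).
by rewrite -(eq_Lintegral kE) LintegralZ.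
Qed.

(** At the time [t] itself the grid maxima converge almost surely to [M], so [phi t] is the
    expectation sought. [M] is not assumed measurable, hence the sandwich argument at the end. *)
Lemma expectation_running_max :
  (\int[P]_w (expR (- M w))%:E = (mix alpha rho c t)%:E)%E.
Proof.
rewrite -(mix_unique a02 rho01 c0 phi_dec phi01 phi_laplace t0).
pose W N w := walk_max (grid_step X (mesh t N)) (Num.truncn (t / mesh t N)) 0 w.
pose G w := limn (fun N => expR (- W N w)).
have Gc w : expR (- W N w) @[N --> \oo] --> G w.
  apply: nonincreasing_is_cvgn.
    apply/nonincreasing_seqP => N; rewrite ler_expR lerN2; apply: walk_max_refine => //; exact: ltW.
  by exists 0 => _ [N _ <-]; exact: expR_ge0.
have mW N : measurable_fun setT (fun w => expR (- W N w)) by exact: mwalk.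
have G0 w : 0 <= G w.
  by apply: (ler_cvg_to (cvg_cst 0) (Gc w)); apply: nearW => N; exact: expR_ge0.
have c1i : P.-integrable setT (EFin \o (fun _ : T => 1 : R)) by exact: finite_measure_integrable_cst.
have W1 N w : setT w -> `|expR (- W N w)| <= 1.
  by move=> _; rewrite ger0_norm ?expR_ge0//; case/andP: (walk01 (mesh t N) (Num.truncn (t / mesh t N)) w).
have [Gi phiG] := @Rdominated_cvg R _ _ P setT (fun N w => expR (- W N w)) G (fun=> 1) measurableT mW
  (fun w _ => Gc w) c1i W1.
have -> : phi t = \int[P]_w G w by apply: (cvg_unique _ (phi_cvg (ltW t0)) phiG).
rewrite /Rintegral fineK; last exact: integrable_fin_num.
apply: ge0_ae_eq_integral_nonmeasurable => //.
  exact: integrable_mfun Gi.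
move: X0 Xcad Mub; apply: filterS3 => w w0 wc [ub app].
have h : expR (- W N w) @[N --> \oo] --> expR (- M w).
  apply: (continuous_cvg _ (@continuous_expR R _)); apply: cvgN.
  exact: walk_max_cvg.
exact: (cvg_unique _ h (Gc w)).
Qed.

End fixed_time.
End running_maximum.

Local Open Scope complex_scope.
Local Open Scope ring_scope.

(** * The mixture as the announced formula *)

Section sup_formula_mix.
Context {R : realType}.
Notation mu := (@lebesgue_measure R).
Variables (alpha rho k t xi : R).
Hypotheses (a02 : 0 < alpha <= 2) (rho01 : 0 < rho < 1) (k0 : 0 < k) (t0 : 0 < t) (xi0 : 0 < xi).
Hypothesis cos0 : 0 < cos ((2 * rho - 1) * (alpha * pi / 2)).

Let c := k `^ alpha * xi `^ alpha / cos ((2 * rho - 1) * (alpha * pi / 2)).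
Let c0 : 0 < c. Proof. by rewrite divr_gt0// mulr_gt0// powR_gt0. Qed.

Lemma sup_integrandE u : 0 < u -> mix_term alpha rho c t u = sup_integrand alpha rho k t xi u.
Proof.
move=> u0; rewrite /mix_term -sup_kernelE// /sup_integrand.
set IJ := I_term _ _ _ + J_term _ _; rewrite [in RHS]expRD [RHS]mulrA.
congr (_ * expR (- _)); rewrite /c; move: (cos _) (u `^ alpha) (k `^ alpha) (xi `^ alpha) => x y z w; ring.
Qed.

Lemma sup_formula_mix :
  sup_formula_converges alpha rho k t xi /\ mix alpha rho c t = sup_formula alpha rho k t xi.
Proof.
have E u : (`]0, +oo[%classic : set R) u -> mix_term alpha rho c t u = sup_integrand alpha rho k t xi u.
  by rewrite /= in_itv/= andbT => u0; exact: sup_integrandE.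
split; last by rewrite /mix /sup_formula (eq_Lintegral E).
split.
- by move=> u u0; exact: integrable_I.
- by move=> u u0; exact: integrable_J.
- by apply: (eq_Lint _ E); [exact: measurable_itv|exact: integrable_mix_term].
Qed.

End sup_formula_mix.

(** * Stable processes *)

Section stable_process.
Context d (T : measurableType d) (R : realType) (P : probability T R).
Variables (alpha rho k : R) (X : R -> {RV P >-> R}).
Hypothesis hX : strictly_stable alpha rho k X.

Let th : R := (2 * rho - 1) * (alpha * pi / 2).

(** For alpha > 1 the admissible range gives |2 rho - 1| alpha <= 2 - alpha < 1; for alpha <= 1 it
    suffices that |2 rho - 1| < 1. *)
Lemma stable_angle : `|th| < pi / 2.
Proof.
have [a02 /andP[r0 r1] h] := stable_range hX; have /andP[a0 a2] := a02.
have p0 := @pi_gt0 R.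
have -> : th = (2 * rho - 1) * alpha * (pi / 2) by rewrite /th; field.
rewrite normrM [X in _ * X]gtr0_norm ?divr_gt0// gtr_pMl ?divr_gt0//.
rewrite ltr_norml; have [a1|a1] := ltP 1 alpha; last by apply/andP; split; nra.
have /andP[h1 h2] := h a1.
have e : alpha^-1 * alpha = 1 by rewrite mulVf// gt_eqF.
by apply/andP; split; nra.
Qed.

Let cos_th : 0 < cos th.
Proof. by apply: cos_gt0_pihalf; have := stable_angle; rewrite ltr_norml. Qed.

(** Since 1 - i tan th = e^(- i th) / cos th, dividing by the cosine puts the characteristic
    exponent in the polar form on which the rotation acts. *)
Lemma stable_charfun_cos_sin s z : 0 < s -> 0 < z ->
  \int[P]_w cos (z * X s w) = expR (- (s * (k `^ alpha * z `^ alpha / cos th) * cos th)) *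
    cos (s * (k `^ alpha * z `^ alpha / cos th) * sin th) /\
  \int[P]_w sin (z * X s w) = expR (- (s * (k `^ alpha * z `^ alpha / cos th) * cos th)) *
    sin (s * (k `^ alpha * z `^ alpha / cos th) * sin th).
Proof.
move=> s0 z0; have H := stable_charfun hX z (ltW s0).
have cn : cos th != 0 by rewrite gt_eqF.
have gen (x y u v : R) : x != 0 -> - (u * (y * v / x) * x) = - (u * (y * v)) /\
    u * (y * v / x) * sin th = u * (y * v) * (sin th / x).
  by move=> x0; split; field.
have [g1 g2] := gen (cos th) (k `^ alpha) s (z `^ alpha) cn.
rewrite g1 g2 -/(tan th).
have e1 : \int[P]_w cos (z * X s w) = complex.Re (cexpectation P (fun w => cexp ('i%C * z%:C * (X s w)%:C))).
  transitivity (fine (\int[P]_w (complex.Re (cexp ('i%C * z%:C * (X s w)%:C)))%:E)%E); last by rewrite /cexpectation unlock.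
  congr fine; apply: eq_integral => w _ /=.
  by rewrite !(mul0r, mul1r, mulr0, add0r, addr0, subr0, oppr0) expR0 mul1r.
have e2 : \int[P]_w sin (z * X s w) = complex.Im (cexpectation P (fun w => cexp ('i%C * z%:C * (X s w)%:C))).
  transitivity (fine (\int[P]_w (complex.Im (cexp ('i%C * z%:C * (X s w)%:C)))%:E)%E); last by rewrite /cexpectation unlock.
  congr fine; apply: eq_integral => w _ /=.
  by rewrite !(mul0r, mul1r, mulr0, add0r, addr0, subr0, oppr0) expR0 mul1r.
rewrite e1 e2 H /stable_exponent z0 /stable_coef -/th /=.
rewrite !(mul0r, mul1r, mulr0, add0r, addr0, subr0, oppr0, sub0r, mulrN, mulNr, opprK, mulr1).
by split; rewrite [k `^ alpha * tan th * _]mulrAC [s * (_ * tan th)]mulrA.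
Qed.

Let mul_preimage (e : R) (A : set R) : measurable A -> measurable ((fun x : R => e * x) @^-1` A).
Proof.
move=> mA; rewrite -[X in measurable X]setTI.
have : measurable_fun setT (fun x : R => e * x) by exact: measurable_funM.
by apply.
Qed.

(** Stated for a factor [e] of either sign, to cover both xi X and - xi X; the Levy properties pass
    to the scaled process by taking preimages under the multiplication. *)
Lemma scaled_running_max (e rho1 c t : R) (M : T -> R) :
  let th1 := alpha * ((rho1 - 1 / 2) * pi) in
  0 < rho1 < 1 -> 0 < c -> `|th1| < pi / 2 -> 0 < t ->
  (forall s v : R, 0 < s -> 0 < v -> \int[P]_w cos (v * (e * X s w)) =
    expR (- (s * c * v `^ alpha * cos th1)) * cos (s * c * v `^ alpha * sin th1)) ->
  (forall s v : R, 0 < s -> 0 < v -> \int[P]_w sin (v * (e * X s w)) =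
    expR (- (s * c * v `^ alpha * cos th1)) * sin (s * c * v `^ alpha * sin th1)) ->
  (forall w, cadlag (fun s => X s w) -> (forall s : R, 0 <= s <= t -> e * X s w <= M w) /\
    (forall eps : R, 0 < eps -> exists2 s : R, 0 <= s <= t & M w - eps < e * X s w)) ->
  (\int[P]_w (expR (- M w))%:E = (mix alpha rho1 c t)%:E)%E.
Proof.
move=> th1 rho1I c0 th1I t0 hc hs hM.
have [a02 _ _] := stable_range hX; have L := stable_levy hX.
apply: (@expectation_running_max _ _ _ P (fun s w => e * X s w) alpha rho1 c a02 rho1I c0 th1I _ _ _ _ _ hc hs t M t0).
- by move=> s; apply: measurable_funM => //; exact: measurable_funP.
- by move: (levy_start L); apply: filterS => w ->; rewrite mulr0.
- move=> n s s0 sm A mA.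
  have hA := levy_independent L s0 sm (fun i => mul_preimage e (mA i)).
  have E (i : 'I_n) : (fun w => e * X (s i.+1) w - e * X (s i) w) @^-1` A i =
      (fun w => X (s i.+1) w - X (s i) w) @^-1` ((fun x : R => e * x) @^-1` A i).
    by apply/funext => w; rewrite /preimage/= mulrBr.
  rewrite (eq_bigcapr (fun (i : 'I_n) _ => E i)) hA.
  by apply: eq_bigr => i _; rewrite E.
- move=> s u s0 u0 A mA; have := levy_stationary L s0 u0 (mul_preimage e mA).
  by rewrite (_ : (fun w => e * X (s + u) w - e * X s w) = (fun w => e * (X (s + u) w - X s w)))//; apply/funext => w; rewrite mulrBr.
- move: (levy_cadlag L); apply: filterS => w [h1 h2]; split=> s s0.
    by apply: cvgM; [exact: cvg_cst|exact: h1].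
  by apply: is_cvgM; [exact: is_cvg_cst|exact: h2].
- by move: (levy_cadlag L); apply: filterS => w; exact: hM.
Qed.

Lemma running_sup_prop (w : T) t (xi : R) : 0 < t -> 0 < xi -> cadlag (fun s => X s w) ->
  (forall s : R, 0 <= s <= t -> xi * X s w <= xi * running_sup X t w) /\
  (forall eps : R, 0 < eps -> exists2 s : R, 0 <= s <= t & xi * running_sup X t w - eps < xi * X s w).
Proof.
move=> t0 xi0 hw; have [B hB] := cadlag_bounded hw (ltW t0).
have hs : has_sup [set X s w | s in `[0, t]].
  split; first by exists (X 0 w); exists 0 => //=; rewrite in_itv/= lexx ltW.
  by exists B => _ [s /= sI <-]; apply: hB; rewrite in_itv/= in sI.
split=> [s sI|eps eps0].
  by rewrite ler_pM2l//; apply: (sup_upper_bound hs); exists s => //=; rewrite in_itv.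
have [_ [s /= sI <-] h] := sup_adherent (divr_gt0 eps0 xi0) hs.
exists s; first by rewrite in_itv/= in sI.
have : xi * (running_sup X t w - eps / xi) < xi * X s w by rewrite ltr_pM2l.
by rewrite mulrBr mulrCA mulfV ?mulr1// gt_eqF.
Qed.

Lemma running_inf_prop (w : T) t (xi : R) : 0 < t -> 0 < xi -> cadlag (fun s => X s w) ->
  (forall s : R, 0 <= s <= t -> - xi * X s w <= - xi * running_inf X t w) /\
  (forall eps : R, 0 < eps -> exists2 s : R, 0 <= s <= t & - xi * running_inf X t w - eps < - xi * X s w).
Proof.
move=> t0 xi0 [c1 c2].
have hw : cadlag (fun s => - X s w).
  by split=> s s0; [apply: cvgN; exact: c1|apply: is_cvgN; exact: c2].
have [B hB] := cadlag_bounded hw (ltW t0).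
have hs : has_inf [set X s w | s in `[0, t]].
  split; first by exists (X 0 w); exists 0 => //=; rewrite in_itv/= lexx ltW.
  by exists (- B) => _ [s /= sI <-]; rewrite lerNl; apply: hB; rewrite in_itv/= in sI.
split=> [s sI|eps eps0].
  by rewrite !mulNr lerN2 ler_pM2l//; apply: (ge_inf hs.2); exists s => //=; rewrite in_itv.
have [_ [s /= sI <-] h] := inf_adherent (divr_gt0 eps0 xi0) hs.
exists s; first by rewrite in_itv/= in sI.
have : xi * X s w < xi * (running_inf X t w + eps / xi) by rewrite ltr_pM2l.
by rewrite mulrDr mulrCA mulfV ?mulr1 ?gt_eqF//; lra.
Qed.

End stable_process.

Theorem theorem2p1 (d : measure_display) (T : measurableType d) (R : realType)
    (P : probability T R) (alpha rho k : R) (X : R -> {RV P >-> R})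
    (hX : strictly_stable alpha rho k X) (t xi : R) (t0 : 0 < t) (xi0 : 0 < xi) :
  [/\ sup_formula_converges alpha rho k t xi,
      ('E_P[fun w => expR (- xi * running_sup X t w)] =
        (sup_formula alpha rho k t xi)%:E)%E,
      sup_formula_converges alpha (1 - rho) k t xi &
      ('E_P[fun w => expR (xi * running_inf X t w)] =
        (sup_formula alpha (1 - rho) k t xi)%:E)%E].
Proof.
have [a02 rho01 _] := stable_range hX; have k0 := stable_scale hX.
have rho01' : 0 < 1 - rho < 1 by case/andP: rho01 => ? ?; apply/andP; split; lra.
have := stable_angle hX; set th := (2 * rho - 1) * (alpha * pi / 2) => thI.
have cos_th : 0 < cos th by apply: cos_gt0_pihalf; move: thI; rewrite ltr_norml.
have thE : alpha * ((rho - 1 / 2) * pi) = th by rewrite /th; field.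
have thE' : alpha * ((1 - rho - 1 / 2) * pi) = - th by rewrite /th; field.
have thN : (2 * (1 - rho) - 1) * (alpha * pi / 2) = - th by rewrite /th; field.
pose c := k `^ alpha * xi `^ alpha / cos th.
have c0 : 0 < c by rewrite divr_gt0// mulr_gt0// powR_gt0.
have cE s v : 0 < v -> s * (k `^ alpha * (v * xi) `^ alpha / cos th) = s * c * v `^ alpha.
  by move=> v0; rewrite powRM ?(ltW v0) ?(ltW xi0)// /c; ring.
have [cv1 F1] := sup_formula_mix a02 rho01 k0 t0 xi0 cos_th.
have cos_thN : 0 < cos ((2 * (1 - rho) - 1) * (alpha * pi / 2)) by rewrite thN cosN.
have [cv2 F2] := sup_formula_mix a02 rho01' k0 t0 xi0 cos_thN.
split => //.
- rewrite -F1 unlock; under eq_integral do rewrite mulNr.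
  have h := @scaled_running_max _ _ _ _ _ _ _ _ hX xi rho c t (fun w => xi * running_sup X t w).
  move: h; cbv zeta; rewrite thE => h; apply: (h rho01 c0 thI t0); last by move=> w; exact: running_sup_prop.
  + move=> s v s0 v0; have [e _] := stable_charfun_cos_sin hX s0 (mulr_gt0 v0 xi0).
    by rewrite -(cE s v v0) -e; apply: eq_Rint => w _; rewrite mulrA.
  + move=> s v s0 v0; have [_ e] := stable_charfun_cos_sin hX s0 (mulr_gt0 v0 xi0).
    by rewrite -(cE s v v0) -e; apply: eq_Rint => w _; rewrite mulrA.
(* Here exp (xi inf X) = exp (- sup (- xi X)). Reflecting the process changes the sign of the sine
   transform, that is, th into - th, which is the angle of [1 - rho]; the constant [c] is unchanged
   because the cosine is even. *)
- rewrite -F2 unlock thN cosN; under eq_integral do rewrite -[xi * _]opprK -mulNr.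
  have h := @scaled_running_max _ _ _ _ _ _ _ _ hX (- xi) (1 - rho) c t (fun w => - xi * running_inf X t w).
  move: h; cbv zeta; rewrite thE' normrN => h; apply: (h rho01' c0 thI t0); last by move=> w; exact: running_inf_prop.
  + move=> s v s0 v0; have [e _] := stable_charfun_cos_sin hX s0 (mulr_gt0 v0 xi0).
    rewrite -(cE s v v0) cosN sinN mulrN cosN -e; apply: eq_Rint => w _.
    by rewrite mulNr mulrN cosN mulrA.
  + move=> s v s0 v0; have [_ e] := stable_charfun_cos_sin hX s0 (mulr_gt0 v0 xi0).
    rewrite -(cE s v v0) cosN sinN mulrN sinN mulrN -e -mulN1r -RintegralZl//.
      by apply: eq_Rint => w _; rewrite mulNr mulrN sinN mulrA mulN1r.
    apply: (@bounded_integrable _ _ _ P _ 1) => [|w]; last by rewrite ler_norml sin_geN1 sin_le1.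
    by apply: mfun_sin; apply: measurable_funM => //; exact: measurable_funP.
Qed.
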